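(* Let $(N,\langle\cdot,\cdot\rangle)$ be a Riemannian nilmanifold, i.e. a connected nilpotent Lie group $N$ endowed with a left-invariant Riemannian metric, and let $\mathfrak{n}$ be its Lie algebra with the induced inner product. Then $(N,\langle\cdot,\cdot\rangle)$ is cyclic if and only if $\mathfrak{n}$ is at most two-step nilpotent (i.e. $[\mathfrak{n},[\mathfrak{n},\mathfrak{n}]]=\{0\}$) and $J_{\mathfrak{z}}=\{J_Z : Z\in\mathfrak{z}\}$ is an Abelian subalgebra of $\mathfrak{so}(\mathfrak{a})$ (i.e. $[J_Z,J_{Z'}]=0$ for all $Z,Z'\in\mathfrak{z}$). Consequently, every cyclic Riemannian nilmanifold is naturally reductive.
   Context: Homogeneous presentations. Let $(M,g)$ be a connected homogeneous Riemannian manifold. A homogeneous presentation $M=G/H$ consists of a connected Lie group $G$ acting transitively and effectively on $M$ by isometries, with $H$ the isotropy subgroup at a point $p\in M$. Let $\mathfrak{g},\mathfrak{h}$ be the Lie algebras of $G,H$. A reductive decomposition is a vector space direct sum $\mathfrak{g}=\mathfrak{h}\oplus\mathfrak{m}$ with $\operatorname{Ad}(H)\mathfrak{m}\subset\mathfrak{m}$. Identifying $\mathfrak{m}$ with $T_pM$, the metric $g$ induces an $\operatorname{Ad}(H)$-invariant inner product $\langle\cdot,\cdot\rangle$ on $\mathfrak{m}$. For $X,Y\in\mathfrak{g}$, $[X,Y]_{\mathfrak{m}}$ denotes the projection of $[X,Y]$ onto $\mathfrak{m}$ along $\mathfrak{h}$. Cyclic. $(M,g)$ is called cyclic if it admits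 a homogeneous presentation $M=G/H$ and a reductive decomposition $\mathfrak{g}=\mathfrak{h}\oplus\mathfrak{m}$ such that $$\langle [X,Y]_{\mathfrak{m}},Z\rangle+\langle [Y,Z]_{\mathfrak{m}},X\rangle+\langle [Z,X]_{\mathfrak{m}},Y\rangle=0\quad\text{for all }X,Y,Z\in\mathfrak{m}.$$ (Note that for a nilmanifold $N$ the group $G$ need not be $N$ itself.) Naturally reductive. $(M,g)$ is called naturally reductive if it admits a homogeneous presentation $M=G/H$ and a reductive decomposition $\mathfrak{g}=\mathfrak{h}\oplus\mathfrak{m}$ such that $$\langle [X,Y]_{\mathfrak{m}},Z\rangle+\langle Y,[X,Z]_{\mathfrak{m}}\rangle=0\quad\text{for all }X,Y,Z\in\mathfrak{m}.$$ The $J$-map. Let $\mathfrak{n}$ be a Lie algebra with inner product $\langle\cdot,\cdot\rangle$ and $[\mathfrak{n},[\mathfrak{n},\mathfrak{n}]]=\{0\}$. Let $\mathfrak{z}$ be the center of $\mathfrak{n}$ and $\mathfrak{a}=\mathfrak{z}^{\perp}$ its orthogonal complement in $\mathfrak{n}$. Let $\mathfrak{so}(\mathfrak{a})$ be the Lie algebra of skew-symmetric endomorphisms of $(\mathfrak{a},\langle\cdot,\cdot\rangle|_{\mathfrak{a}})$ with the commutator bracket. The linear map $J:\mathfrak{z}\to\mathfrak{so}(\mathfrak{a})$, $Z\mapsto J_Z$, is defined by $\langle J_ZX,Y\rangle=\langle [X,Y],Z\rangle$ for $X,Y\in\mathfrak{a}$, $Z\in\mathfrak{z}$. *)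

(* Defs.v *)
From HB Require Import structures.
From mathcomp Require Import all_boot all_order all_algebra.
From mathcomp Require Import monoid.
From mathcomp Require Import all_classical all_reals all_analysis.
Set Implicit Arguments.
Unset Strict Implicit.
Unset Printing Implicit Defensive.
Import Order.TTheory GRing.Theory Num.Theory.
Import numFieldNormedType.Exports.
Local Open Scope classical_set_scope.
Local Open Scope ring_scope.

(* [Ck_on k U f]: all iterated directional derivatives of [f] of order at most
   [k] exist and are continuous at every point of [U].  Only meaningful for
   [U] open, which is the case in every use below. *)
Fixpoint Ck_on (R : realType) (V W : normedModType R) (k : nat) (U : set V)
    (f : V -> W) {struct k} : Prop :=
  (forall x, U x -> {for x, continuous f}) /\
  match k with
  | 0%N => True
  | j.+1 => (forall x v, U x -> derivable f x v) /\
            (forall v, Ck_on j U ('D_v f))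
  end.

Definition smooth_on (R : realType) (V W : normedModType R) (U : set V)
    (f : V -> W) : Prop :=
  forall k, Ck_on k U f.

(* [coord] and [point] are total functions, with junk values outside [dom] and
   [cod] respectively. *)
Record chart (R : realType) (n : nat) (M : topologicalType) := Chart {
  dom : set M;
  cod : set 'rV[R]_n;
  coord : M -> 'rV[R]_n;
  point : 'rV[R]_n -> M;
  dom_open : open dom;
  cod_open : open cod;
  coord_cod : forall p, dom p -> cod (coord p);
  point_dom : forall x, cod x -> dom (point x);
  coordK : forall p, dom p -> point (coord p) = p;
  pointK : forall x, cod x -> coord (point x) = x;
  coord_continuous : forall p, dom p -> {for p, continuous coord};
  point_continuous : forall x, cod x -> {for x, continuous point}
}.

(* The preferred chart [chart_at p] serves to represent the tangent space at
   [p] as ['rV[R]_n]: a tangent vector is given by its coordinates in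
   [chart_at p]. *)
HB.mixin Record Topological_isManifold (R : realType) (n : nat) M
    of Topological M := {
  atlas : set (chart R n M);
  chart_at : M -> chart R n M;
  chart_at_atlas : forall p, atlas (chart_at p);
  chart_at_dom : forall p, dom (chart_at p) p;
  atlas_compatible : forall c d, atlas c -> atlas d ->
    smooth_on [set x | cod c x /\ dom d (point c x)] (coord d \o point c);
  manifold_hausdorff : hausdorff_space M;
  manifold_second_countable : @second_countable M
}.

#[short(type="manifoldType")]
HB.structure Definition Manifold (R : realType) (n : nat) :=
  { M of Topological M & Topological_isManifold R n M }.

Definition smooth (R : realType) (n m : nat) (M : manifoldType R n)
    (P : manifoldType R m) (f : M -> P) : Prop :=
  continuous f /\
  forall (c : chart R n M) (d : chart R m P), atlas c -> atlas d ->
    smooth_on [set x | cod c x /\ dom d (f (point c x))]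
              (coord d \o f \o point c).

(* Smoothness for the product manifold structure on the source. *)
Definition smooth2 (R : realType) (n m k : nat) (M : manifoldType R n)
    (P : manifoldType R m) (Q : manifoldType R k) (f : M -> P -> Q) : Prop :=
  continuous (fun p : M * P => f p.1 p.2) /\
  forall (c : chart R n M) (d : chart R m P) (e : chart R k Q),
    atlas c -> atlas d -> atlas e ->
    smooth_on [set x : 'rV[R]_n * 'rV[R]_m |
                 [/\ cod c x.1, cod d x.2
                   & dom e (f (point c x.1) (point d x.2))]]
              (fun x : 'rV[R]_n * 'rV[R]_m =>
                 coord e (f (point c x.1) (point d x.2))).

Definition smooth_curve (R : realType) (n : nat) (M : manifoldType R n)
    (gamma : R^o -> M) : Prop :=
  continuous gamma /\
  forall c : chart R n M, atlas c ->
    smooth_on [set t | dom c (gamma t)] (coord c \o gamma).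

Definition velocity (R : realType) (n : nat) (M : manifoldType R n)
    (gamma : R^o -> M) (t : R^o) : 'rV[R]_n :=
  'D_(1 : R^o) (coord (chart_at (gamma t)) \o gamma) t.

Definition tangent_map (R : realType) (n m : nat) (M : manifoldType R n)
    (P : manifoldType R m) (f : M -> P) (p : M) (u : 'rV[R]_n) : 'rV[R]_m :=
  'D_u (coord (chart_at (f p)) \o f \o point (chart_at p))
       (coord (chart_at p) p).

(* [gram p] is the Gram matrix of the metric at [p] in the coordinates of
   [chart_at p]; smoothness is that of the coefficients of the metric in an
   arbitrary chart of the atlas. *)
Record riemannian (R : realType) (n : nat) (M : manifoldType R n) :=
    Riemannian {
  gram : M -> 'M[R]_n;
  gram_sym : forall p, (gram p)^T = gram p;
  gram_posdef : forall p (u : 'rV[R]_n), u != 0 ->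
    0 < (u *m gram p *m u^T) ord0 ord0;
  gram_smooth : forall (c : chart R n M) (u v : 'rV[R]_n), atlas c ->
    smooth_on (cod c) (fun x : 'rV[R]_n =>
      let phi := coord (chart_at (point c x)) \o point c in
      ('D_u phi x *m gram (point c x) *m ('D_v phi x)^T) ord0 ord0 : R^o)
}.

Definition inner (R : realType) (n : nat) (M : manifoldType R n)
    (g : riemannian M) (p : M) (u v : 'rV[R]_n) : R :=
  (u *m gram g p *m v^T) ord0 ord0.

Definition preserves_metric (R : realType) (n : nat) (M : manifoldType R n)
    (g : riemannian M) (f : M -> M) : Prop :=
  forall p u v,
    inner g (f p) (tangent_map f p u) (tangent_map f p v) = inner g p u v.

Definition isometry (R : realType) (n : nat) (M : manifoldType R n)
    (g : riemannian M) (f : M -> M) : Prop :=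
  [/\ bijective f, smooth f & preserves_metric g f].

HB.mixin Record isLieGroup (R : realType) (n : nat) G
    of Manifold R n G & Group G := {
  lie_mul_smooth : smooth2 (fun x y : G => (x * y)%g);
  lie_inv_smooth : smooth (fun x : G => (x^-1)%g)
}.

#[short(type="lieGroupType")]
HB.structure Definition LieGroup (R : realType) (n : nat) :=
  { G of Manifold R n G & Group G & isLieGroup R n G }.

(* Coordinate expression, in the chart at the identity, of the left-invariant
   vector field with value [X] at the identity. *)
Definition left_invariant_field (R : realType) (n : nat)
    (G : lieGroupType R n) (X x : 'rV[R]_n) : 'rV[R]_n :=
  let c := chart_at (1%g : G) in
  'D_X (fun y => coord c (point c x * point c y)%g) (coord c 1%g).

(* The Lie algebra of [G] is the tangent space ['rV[R]_n] at the identity, with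
   the bracket of left-invariant vector fields. *)
Definition lie_bracket (R : realType) (n : nat) (G : lieGroupType R n)
    (X Y : 'rV[R]_n) : 'rV[R]_n :=
  let x0 := coord (chart_at (1%g : G)) 1%g in
  'D_X (left_invariant_field G Y) x0 - 'D_Y (left_invariant_field G X) x0.

Definition Ad (R : realType) (n : nat) (G : lieGroupType R n) (a : G)
    (X : 'rV[R]_n) : 'rV[R]_n :=
  tangent_map (fun x : G => (a * x * a^-1)%g) 1%g X.

(* Lie algebra of a closed subgroup [H] of [G]: the initial velocities of the
   one-parameter subgroups of [G] contained in [H]. *)
Definition lie_algebra_of (R : realType) (n : nat) (G : lieGroupType R n)
    (H : set G) : set 'rV[R]_n :=
  [set X | exists theta : R^o -> G,
    [/\ smooth_curve theta,
        forall s t : R, theta (s + t) = (theta s * theta t)%g,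
        velocity theta 0 = X
      & forall t, H (theta t)]].

Definition left_invariant (R : realType) (n : nat) (G : lieGroupType R n)
    (g : riemannian G) : Prop :=
  forall a : G, preserves_metric g (fun x : G => (a * x)%g).

Fixpoint upper_central_series (G : groupType) (k : nat) : set G :=
  match k with
  | 0%N => [set 1%g]
  | j.+1 => [set x | forall y, upper_central_series j [~ x, y]%g]
  end.

Definition nilpotent_group (G : groupType) : Prop :=
  exists k, upper_central_series k = [set: G].

Record homogeneous_presentation (R : realType) (n k : nat)
    (M : manifoldType R n) (g : riemannian M) (G : lieGroupType R k)
    (act : G -> M -> M) : Prop := HomogeneousPresentation {
  presentation_connected : connected [set: G];
  presentation_act1 : forall p, act 1%g p = p;
  presentation_actM : forall a b p, act (a * b)%g p = act a (act b p);
  presentation_smooth : smooth2 act;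
  presentation_transitive : forall p q, exists a, act a p = q;
  presentation_effective : forall a, (forall p, act a p = p) -> a = 1%g;
  presentation_isometry : forall a, isometry g (act a)
}.

Definition isotropy (G M : Type) (act : G -> M -> M) (p : M) : set G :=
  [set a | act a p = p].

Definition reductive_decomposition (R : realType) (k : nat)
    (G : lieGroupType R k) (H : set G) (h m : {vspace 'rV[R]_k}) : Prop :=
  [/\ [set X | X \in h] = lie_algebra_of H,
      (h + m)%VS = fullv,
      directv (h + m)
    & forall a, H a -> forall X, X \in m -> Ad a X \in m].

(* The inner product on [m] obtained by transporting the metric at [p] along
   the identification of [m] with the tangent space of [M] at [p], that is
   along the differential at the identity of [a |-> act a p].  (Its values are
   coordinates in the chart at [act 1 p], which is [p].) *)
Definition induced_inner (R : realType) (n k : nat) (M : manifoldType R n)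
    (g : riemannian M) (G : lieGroupType R k) (act : G -> M -> M) (p : M)
    (X Y : 'rV[R]_k) : R :=
  let pi := tangent_map (act^~ p) (1%g : G) in
  inner g p (pi X) (pi Y).

(* [daddv_pi m h] is the projection onto [m] along [h]. *)
Definition bracket_proj (R : realType) (k : nat) (G : lieGroupType R k)
    (h m : {vspace 'rV[R]_k}) (X Y : 'rV[R]_k) : 'rV[R]_k :=
  daddv_pi m h (lie_bracket G X Y).

Definition cyclic_manifold (R : realType) (n : nat) (M : manifoldType R n)
    (g : riemannian M) : Prop :=
  exists (k : nat) (G : lieGroupType R k) (act : G -> M -> M) (p : M)
         (h m : {vspace 'rV[R]_k}),
    let ip := induced_inner g act p in
    let br := bracket_proj G h m in
    [/\ homogeneous_presentation g act,
        reductive_decomposition (isotropy act p) h m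
      & forall X Y Z, X \in m -> Y \in m -> Z \in m ->
          ip (br X Y) Z + ip (br Y Z) X + ip (br Z X) Y = 0].

Definition naturally_reductive (R : realType) (n : nat)
    (M : manifoldType R n) (g : riemannian M) : Prop :=
  exists (k : nat) (G : lieGroupType R k) (act : G -> M -> M) (p : M)
         (h m : {vspace 'rV[R]_k}),
    let ip := induced_inner g act p in
    let br := bracket_proj G h m in
    [/\ homogeneous_presentation g act,
        reductive_decomposition (isotropy act p) h m
      & forall X Y Z, X \in m -> Y \in m -> Z \in m ->
          ip (br X Y) Z + ip Y (br X Z) = 0].

Definition at_most_two_step (R : realType) (n : nat) (N : lieGroupType R n)
    : Prop :=
  forall X Y Z, lie_bracket N X (lie_bracket N Y Z) = 0.

Definition lie_center (R : realType) (n : nat) (N : lieGroupType R n)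
    : set 'rV[R]_n :=
  [set Z | forall X, lie_bracket N Z X = 0].

Definition center_orth (R : realType) (n : nat) (N : lieGroupType R n)
    (g : riemannian N) : set 'rV[R]_n :=
  [set X | forall Z, lie_center N Z -> inner g 1%g X Z = 0].

(* For [X] in [center_orth g], [J_map g Z X] is the unique vector [W] of
   [center_orth g] with <W, Y> = <[X, Y], Z> for all [Y] in [center_orth g]. *)
Definition J_map (R : realType) (n : nat) (N : lieGroupType R n)
    (g : riemannian N) (Z X : 'rV[R]_n) : 'rV[R]_n :=
  get [set W | center_orth g W /\ forall Y, center_orth g Y ->
                 inner g 1%g W Y = inner g 1%g (lie_bracket N X Y) Z].

Definition J_abelian (R : realType) (n : nat) (N : lieGroupType R n)
    (g : riemannian N) : Prop :=
  forall Z Z', lie_center N Z -> lie_center N Z' ->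
    forall X, center_orth g X ->
      J_map g Z (J_map g Z' X) - J_map g Z' (J_map g Z X) = 0.

(* Main.v *)
(* Let [G] act isometrically and transitively on [N].  In the left trivialisation of the tangent
   bundle, an element [X] of the Lie algebra of [G] has at the base point a value [K X] in [n] and a
   skew endomorphism [S_X] of [n], and [K [X, Y] = [K X, K Y] + S_X (K Y) - S_Y (K X)].  By a theorem
   of Wilson every [S_X] is a derivation of [n]: the derivatives of [S_X] along left-invariant fields
   form a representation of [n] on a space of skew endomorphisms, whose weights vanish because [n] is
   nilpotent, and a trace argument then kills the failure of [S_X] to be a derivation.  For [X] in
   [m] over [x] in [n], cyclicity says that the cyclic sum of [<[x, y], z> + 2 <S_x y, z>] vanishes;
   evaluated on the centre and on its orthogonal complement, it yields that [n] is two-step nilpotent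
   and that the [J_z] commute.

   Conversely, commuting [J_z] can be written [<[x, y], z> = sum_i c_i(z) <Q_i x, y>] with quarter
   turns [Q_i] on orthogonal subspaces.  The torus generated by the [Q_i] acts on [n], hence on [N],
   by isometric automorphisms, and [G] is the semidirect product of [N] with this torus; [h] is the
   Lie algebra of the torus and [m] the graph of [x |-> (k / 2) c(x)].  Then [<[X, Y]_m, Z>] equals
   [a + k (b + c)], where [a = <[x, y], z>] and [b], [c] are its cyclic permutations: [k = - 1 / 2]
   is the cyclic case and [k = 1] the naturally reductive one. *)
From HB Require Import structures.
Require Import Defs.
From mathcomp Require Import all_boot all_order all_algebra.
From mathcomp Require Import monoid.
From mathcomp Require Import all_classical all_reals all_analysis.
From mathcomp Require Import ring lra zify.
From mathcomp Require complex spectral.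
Import Defs.
Set Implicit Arguments.
Unset Strict Implicit.
Unset Printing Implicit Defensive.
Import Order.TTheory GRing.Theory Num.Theory.
Import numFieldNormedType.Exports.
Local Open Scope classical_set_scope.
Local Open Scope ring_scope.

(** * Smooth maps between finite-dimensional normed spaces *)

(** The group [G] is arbitrary, and no flow is ever integrated. The action is read in the left
    trivialisation through two increments, [kap] and [thet], and the identities between [K] and [S]
    come from differentiating their composition laws. That [K] is onto [n] is not formal: a bound
    from below on the rank of the orbit map needs second countability of [G] and Baire's theorem.
    Wilson's theorem is reduced to linear algebra by following [S_X] over a neighbourhood: the span
    of all its values is stable under differentiation, and the Koszul formula expresses the
    derivative by the value.

    In the converse an automorphism of [n] need not integrate to [N], which may have a fundamental
    group. The rotations do, because they fix the centre and the kernel of the exponential map is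
    central. This exponential is obtained from its inverse: for a two-step algebra the logarithm
    satisfies [D_Y L = Y + [L, Y] / 2], which is solved by taking primitives of closed forms
    twice. *)

Definition mklin (R : pzRingType) (V W : lmodType R) (f : V -> W)
    (H : linear f) : {linear V -> W} :=
  HB.pack f (GRing.isLinear.Build R V W *:%R f H).

(** A basis with continuous coordinate forms, kept as data. The instances for scalars, row vectors,
    matrices and products let one chain rule serve all the spaces that occur. *)
Class FinDim (R : realType) (V : normedModType R) := {
  fd_n : nat;
  fd_e : 'I_fd_n -> V;
  fd_c : 'I_fd_n -> {linear V -> R^o};
  fd_cont : forall i, continuous (fd_c i : V -> R^o);
  fd_eq : forall v, v = \sum_i (fd_c i v : R) *: fd_e i }.
Arguments fd_n {R} V {_}.
Arguments fd_c {R V _} i.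
Arguments fd_e {R V _} i.

#[global] Program Instance FinDim_Ro (R : realType) : FinDim (R^o : normedModType R) := {|
  fd_n := 1; fd_e := fun=> 1; fd_c := fun=> idfun |}.
Next Obligation. by move=> R i x. Qed.
Next Obligation. by move=> R v; rewrite big_ord1 /=; apply/esym/mulr1. Qed.

Lemma coord_is_linear (R : realType) n (i : 'I_n) :
  linear (fun v : 'rV[R]_n => (v ord0 i : R^o)).
Proof. by move=> a u v; rewrite !mxE. Qed.

#[global] Program Instance FinDim_rV (R : realType) n : FinDim ('rV[R]_n : normedModType R) := {|
  fd_n := n; fd_e := fun i => delta_mx ord0 i; fd_c := fun i => mklin (@coord_is_linear R n i) |}.
Next Obligation. by move=> R n i; exact: matrix_normedtype.coord_continuous. Qed.
Next Obligation. by move=> R n v; exact: row_sum_delta. Qed.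

Lemma lincomp_is_linear (R : realType) (V W X : lmodType R)
  (f : {linear V -> W}) (g : {linear W -> X}) : linear (fun v => g (f v)).
Proof. by move=> a u v; rewrite !linearP. Qed.

Lemma fst_is_linear (R : realType) (V W : lmodType R) : linear (@fst V W).
Proof. by []. Qed.
Lemma snd_is_linear (R : realType) (V W : lmodType R) : linear (@snd V W).
Proof. by []. Qed.

Section FinDim_prod.
Variables (R : realType) (V W : normedModType R) (FV : FinDim V) (FW : FinDim W).

Definition fdp_e (k : 'I_(fd_n V + fd_n W)) : V * W :=
  match fintype.split k with inl i => (fd_e i, 0) | inr j => (0, fd_e j) end.
Definition fdp_c (k : 'I_(fd_n V + fd_n W)) : {linear (V * W)%type -> R^o} :=
  match fintype.split k with
  | inl i => mklin (lincomp_is_linear (mklin (@fst_is_linear R V W)) (fd_c i))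
  | inr j => mklin (lincomp_is_linear (mklin (@snd_is_linear R V W)) (fd_c j)) end.

#[global] Program Instance FinDim_prod : FinDim ((V * W)%type : normedModType R) := {|
  fd_n := fd_n V + fd_n W; fd_e := fdp_e; fd_c := fdp_c |}.
Next Obligation.
move=> k x; rewrite /fdp_c; case: fintype.split => j /=.
- by apply: (@continuous_comp _ _ _ fst (fd_c j)); [exact: cvg_fst|exact: fd_cont].
- by apply: (@continuous_comp _ _ _ snd (fd_c j)); [exact: cvg_snd|exact: fd_cont].
Qed.
Next Obligation.
move=> v; rewrite big_split_ord /=.
under eq_bigr do rewrite /fdp_e /fdp_c (unsplitK (inl _)) /=.
under [X in _ + X]eq_bigr do rewrite /fdp_e /fdp_c (unsplitK (inr _)) /=.
case: v => v w /=; rewrite {1}(fd_eq v) {1}(fd_eq w).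
have -> : \sum_i fd_c i v *: (fd_e i, 0 : W) = (\sum_i fd_c i v *: fd_e i, 0).
  by elim/big_rec2: _ => // i a b _ ->; congr pair; rewrite /= scaler0 add0r.
have -> : \sum_i fd_c i w *: (0 : V, fd_e i) = (0, \sum_i fd_c i w *: fd_e i).
  by elim/big_rec2: _ => // i a b _ ->; congr pair; rewrite /= scaler0 add0r.
by congr pair; rewrite /= ?addr0 ?add0r.
Qed.
End FinDim_prod.

Lemma fd_linear_continuous (R : realType) (V W : normedModType R) {FV : FinDim V}
  (f : {linear V -> W}) : continuous f.
Proof.
have -> : (f : V -> W) = \sum_i (fun v => (fd_c i v : R) *: f (fd_e i)).
  apply/funext => v; rewrite {1}(fd_eq v) linear_sum fct_sumE.
  by apply: eq_bigr => i _; rewrite linearZ.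
elim/big_ind: _ => [|a b ca cb|i _] x; first exact: cst_continuous.
  by apply: continuousD; [exact: ca|exact: cb].
by apply: cvgZr_tmp; exact: fd_cont.
Qed.

(** * Directional derivatives and strict differentiability *)

Section directional.
Variables (R : realType) (V W : normedModType R).
Implicit Types (f : V -> W).

Lemma is_derive_line f (y w : V) (s : R) : derivable f (y + s *: w) w ->
  is_derive s (1 : R) (fun s : R => f (y + s *: w)) ('D_w f (y + s *: w)).
Proof.
move=> dfx.
have E : (fun h => h^-1 *: (f (y + (h *: (1 : R) + s) *: w) - f (y + s *: w))) =
         (fun h => h^-1 *: (f (h *: w + (y + s *: w)) - f (y + s *: w))).
  apply/funext => h; congr (_ *: (f _ - _)).
  by rewrite scalerDl [h *: 1]mulr1 addrCA.
by apply: DeriveDef; rewrite /derivable /derive /= E.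
Qed.

(** Differentiability along the single line [h |-> z + h v] suffices, since a multiple of [v] only
    rescales [h]. *)
Lemma is_derive_scale f (z v : V) (t : R) : derivable f z v ->
  is_derive z (t *: v) f (t *: 'D_v f z).
Proof.
move=> dfx; have /derivable1_diffP dphi := (derivable1P f z v).1 dfx.
pose phi := fun h : R => f (h *: v + z).
have dt : differentiable (fun h : R => h * t) 0 by [].
have d2 : differentiable (phi \o (fun h : R => h * t)) (0 : R).
  by apply: differentiable_comp => //=; rewrite mul0r.
have E : phi \o (fun h : R => h * t) = (fun h : R => f (h *: (t *: v) + z)).
  by apply/funext => h; rewrite /phi /= scalerA.
have dtv : derivable f z (t *: v).
  by apply/derivable1P/derivable1_diffP; rewrite -E.
apply: DeriveDef => //.
have DE u : 'D_u f z = 'D_1 (fun h : R => f (h *: u + z)) 0.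
  rewrite /derive; set a := (fun h => _); set b := (fun h => _).
  suff -> : a = b by []; apply/funext => h; rewrite /a /b /=.
  by rewrite [h *: 1]mulr1 addr0 scale0r add0r.
rewrite !DE -E deriveE // diff_comp //=; last by rewrite mul0r.
have -> : 'd (fun h : R => h * t) (0 : R) (1 : R) = t.
  rewrite -deriveE //.
  have -> : (fun h : R => h * t) = t *: (id : R -> R) by apply/funext => h; rewrite mulrC.
  by rewrite deriveZ //= derive_id [_ *: _]mulr1.
rewrite mul0r.
by rewrite -[t in LHS]mulr1 -/(t *: (1 : R)) linearZ /= -deriveE.
Qed.

Lemma derivable_lin (X : normedModType R) (L : {linear W -> X}) f x v :
  continuous L -> derivable f x v -> is_derive x v (fun y => L (f y)) (L ('D_v f x)).
Proof.
move=> cL df.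
have H : (fun h => h^-1 *: (L (f (h *: v + x)) - L (f x))) @ 0^' --> L ('D_v f x).
  have -> : (fun h => h^-1 *: (L (f (h *: v + x)) - L (f x))) =
    L \o (fun h => h^-1 *: (f (h *: v + x) - f x)).
    apply/funext => h /=.
    by rewrite [RHS]linearZ [in RHS]linearB.
  by apply: cvg_comp; [exact: df|exact: cL].
apply: DeriveDef; first by apply/cvg_ex; eexists; exact: H.
by apply: cvg_lim.
Qed.

End directional.

Section strict.
Variables (R : realType) (V : normedModType R).

(** Mean value theorem on the segment from [y] to [y + t v]: on it ['D_v f] stays within [e] of its
    value at [x]. The estimate is uniform in the base point [y], as strict differentiability
    demands. *)
Lemma strict_deriv (f : V -> R^o) x v : (\forall y \near x, derivable f y v) ->
  {for x, continuous ('D_v f)} -> forall e : R, 0 < e ->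
  exists2 d : R, 0 < d & forall y t, `|y - x| < d -> `|t| < d ->
  `|f (y + t *: v) - f y - t * 'D_v f x| <= e * `|t|.
Proof.
move=> df cf e e0.
have : \forall y \near x, derivable f y v /\ `|'D_v f x - 'D_v f y| < e.
  near=> y; split; first by near: y.
  by near: y; move/cvgrPdist_lt : cf; apply.
case/nbhs_normP => d0 /= d00 H.
have v1 : 0 < 1 + `|v| by rewrite ltr_wpDr.
exists (d0 / (1 + `|v|)); first by rewrite divr_gt0.
move=> y t yx td.
pose g (s : R) : R := f (y + s *: (t *: v)).
have inb (s : R) : s \in `[0, 1]%R -> derivable f (y + s *: (t *: v)) v /\
    `|'D_v f x - 'D_v f (y + s *: (t *: v))| < e.
  rewrite in_itv /= => /andP[s0 s1]; apply: H => /=.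
  rewrite opprD addrA (le_lt_trans (ler_normB _ _))// !normrZ (ger0_norm s0).
  rewrite distrC -(mulfVK (lt0r_neq0 v1) d0) mulrDr mulr1 ltr_leD //.
  rewrite mulrA ler_wpM2r //; apply: (@le_trans _ _ (1 * `|t|)).
    by rewrite ler_wpM2r.
  by rewrite mul1r ltW.
have dg (s : R) : s \in `[0, 1]%R -> is_derive s (1 : R) g (t * 'D_v f (y + s *: (t *: v))).
  move=> /inb[d1 _]; have [a b] := is_derive_scale t d1.
  by have := is_derive_line a; rewrite b.
pose dg' (s : R) : R := t * 'D_v f (y + s *: (t *: v)).
have M1 (s : R) : s \in `]0, 1[%R -> is_derive s (1 : R) g (dg' s).
  by move=> s01; apply: dg; move: s01; rewrite !in_itv /= => /andP[/ltW-> /ltW->].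
have M2 : {within `[0, 1], continuous g}.
  by apply: derivable_within_continuous => s /dg dgs; exact: ex_derive.
have [c c01] := MVT ltr01 M1 M2.
rewrite subr0 mulr1 /g scale1r scale0r addr0 => ->.
rewrite -mulrBr normrM mulrC ler_wpM2r // distrC ltW //.
by apply: (inb c _).2; move: c01; rewrite !in_itv /= => /andP[/ltW-> /ltW->].
Unshelve. all: by end_near. Qed.

End strict.

Section lincomb.
Variables (R : realType) (V W : normedModType R) (FV : FinDim V).
Definition lincomb (a : 'I_(fd_n V) -> W) (v : V) : W := \sum_i (fd_c i v : R) *: a i.
Lemma lincomb_is_linear a : linear (lincomb a).
Proof.
move=> k u v; rewrite /lincomb scaler_sumr -big_split; apply: eq_bigr => i _ /=.
by rewrite linearP scalerDl scalerA.
Qed.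
End lincomb.

(** The increment is compared with [df h] at every base point [y] near [x], not at [x] alone. This
    stronger form yields the Lipschitz bounds of the inverse function theorem and the symmetry of
    second derivatives. *)
Definition strictly_diff (R : realType) (V W : normedModType R) (f : V -> W)
  (df : V -> W) (x : V) := forall e : R, 0 < e ->
  exists2 d : R, 0 < d & forall y h, `|y - x| < d -> `|h| < d ->
    `|f (y + h) - f y - df h| <= e * `|h|.

Section C1.
Variables (R : realType) (V W : normedModType R) (FV : FinDim V) (FW : FinDim W).

Lemma fd_c_bound (U : normedModType R) (FU : FinDim U) : exists2 C : R, 0 < C &
  forall (i : 'I_(fd_n U)) (u : U), `|fd_c i u| <= C * `|u|.
Proof.
have H i : exists2 k, k > 0 & forall x : U, `|fd_c i x| <= k * `|x|.
  by apply: linear_lipschitz; exact: fd_cont.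
have [K HK] := choice (fun i => (ex2_ind (fun k a b => ex_intro (fun k => 0 < k /\
   forall x : U, `|fd_c i x| <= k * `|x|) k (conj a b)) (H i))).
exists (1 + \sum_i K i).
  by rewrite ltr_wpDr // sumr_ge0 // => i _; rewrite ltW // (HK i).1.
move=> i u; apply: le_trans ((HK i).2 u) _; rewrite ler_wpM2r //.
rewrite (bigD1 i) //= addrCA lerDl addr_ge0 // sumr_ge0 // => j _.
by rewrite ltW // (HK j).1.
Qed.

(** Change one coordinate at a time and apply [strict_deriv] to each move; the induction runs over
    the list of coordinates to be changed. *)
Lemma C1_strict_real (f : V -> R^o) x :
  (forall i : 'I_(fd_n V), \forall y \near x, derivable f y (fd_e i)) ->
  (forall i : 'I_(fd_n V), {for x, continuous ('D_(fd_e i) f)}) ->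
  strictly_diff f (lincomb (fun i => 'D_(fd_e i) f x)) x.
Proof.
move=> df cf; have [C C0 HC] := fd_c_bound FV.
suff H (r : seq 'I_(@fd_n _ V FV)) (e : R) : 0 < e -> exists2 d : R, 0 < d & forall y h,
    `|y - x| < d -> `|h| < d -> `|f (y + \sum_(i <- r) (fd_c i h : R) *: fd_e i) - f y
      - \sum_(i <- r) (fd_c i h : R) *: ('D_(fd_e i) f x : R^o)| <= e * `|h|.
  move=> e e0; have [d d0 Hd] := H (index_enum _) e e0; exists d => // y h yx hd.
  by rewrite {1}(fd_eq h); apply: Hd.
elim: r e => [|i r IH] e e0.
  exists 1 => // y h _ _; rewrite !big_nil addr0 subrr subr0 normr0 mulr_ge0 //.
  exact: ltW.
have e20 : 0 < e / 2 by rewrite divr_gt0.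
have [d1 d10 H1] := IH (e / 2) e20.
have ec : 0 < e / 2 / C by rewrite divr_gt0.
have [d2 d20 H2] := strict_deriv (df i) (cf i) ec.
(* [M] absorbs the displacement caused by the move along [fd_e i], so that the intermediate base
   point is still within [min d1 d2] of [x]. *)
pose M := 1 + C * (1 + `|fd_e i|).
have Cg : 0 <= C * (1 + `|fd_e i|) by rewrite mulr_ge0 ?(ltW C0) // addr_ge0.
have M0 : 0 < M by rewrite ltr_wpDr.
pose d := Order.min d1 d2 / M.
have d0 : 0 < d by rewrite divr_gt0 // lt_min d10.
have dM : d * M = Order.min d1 d2 by rewrite mulfVK // lt0r_neq0.
exists d => // y h yx hd.
rewrite !big_cons.
have ch : `|fd_c i h| <= C * `|h| := HC i h.
have dd : d <= Order.min d1 d2 by rewrite -dM ler_peMr ?(ltW d0) // lerDl.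
have cd : `|fd_c i h| < Order.min d1 d2.
  apply: le_lt_trans ch _; apply: (@lt_le_trans _ _ (C * d)); first by rewrite ltr_pM2l.
  rewrite -dM mulrC ler_wpM2l ?(ltW d0) // /M mulrDr mulr1 addrA -[leLHS]add0r.
  by rewrite addrAC lerD2r addr_ge0 // mulr_ge0 // ltW.
have yd : `|y + (fd_c i h : R) *: fd_e i - x| < Order.min d1 d2.
  rewrite addrAC (le_lt_trans (ler_normD _ _)) // normrZ -dM /M mulrDr mulr1.
  apply: ltr_leD => //; rewrite mulrDr mulr1 mulrDr -[leLHS]add0r lerD //.
    by rewrite mulr_ge0 // ltW.
  rewrite mulrA ler_wpM2r // (le_trans ch) // mulrC ler_wpM2r //; first exact: ltW.
  exact: ltW.
have A := H1 (y + (fd_c i h : R) *: fd_e i) h.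
have B := H2 y (fd_c i h).
rewrite addrA.
set S := \sum_(_ <- r) _ *: fd_e _; set T := \sum_(_ <- r) _.
have -> : f (y + (fd_c i h : R) *: fd_e i + S) - f y - ((fd_c i h : R) *: ('D_(fd_e i) f x : R^o) + T) =
  (f (y + (fd_c i h : R) *: fd_e i + S) - f (y + (fd_c i h : R) *: fd_e i) - T) +
  (f (y + (fd_c i h : R) *: fd_e i) - f y - (fd_c i h : R) * ('D_(fd_e i) f x)).
  by rewrite /GRing.scale /=; ring.
rewrite (le_trans (ler_normD _ _)) // (splitr e) mulrDl lerD //.
- apply: A; first by move: yd; rewrite lt_min => /andP[].
  by move: (lt_le_trans hd dd); rewrite lt_min => /andP[].
- apply: le_trans (B _ _) _.
  + by move: (lt_le_trans yx dd); rewrite lt_min => /andP[].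
  + by move: cd; rewrite lt_min => /andP[].
  + apply: (@le_trans _ _ (e / 2 / C * (C * `|h|))); first by rewrite ler_wpM2l // ltW.
    by rewrite mulrA mulfVK // lt0r_neq0.
Qed.

Lemma C1_strict (f : V -> W) x :
  (forall i : 'I_(fd_n V), \forall y \near x, derivable f y (fd_e i)) ->
  (forall i : 'I_(fd_n V), {for x, continuous ('D_(fd_e i) f)}) ->
  strictly_diff f (lincomb (fun i => 'D_(fd_e i) f x)) x.
Proof.
move=> df cf e e0.
pose g (j : 'I_(@fd_n _ W FW)) y : R^o := fd_c j (f y).
have gD j i : \forall y \near x, derivable (g j) y (fd_e i) /\
    'D_(fd_e i) (g j) y = fd_c j ('D_(fd_e i) f y).
  near=> y; have fy : derivable f y (fd_e i) by near: y; exact: df.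
  by have [] := derivable_lin (@fd_cont _ _ FW j) fy.
have gS j : strictly_diff (g j) (lincomb (fun i => 'D_(fd_e i) (g j) x)) x.
  apply: C1_strict_real => i; first by apply: filterS (gD j i) => y [].
  have Ex : 'D_(fd_e i) (g j) x = fd_c j ('D_(fd_e i) f x).
    by have /nbhs_singleton[] := gD j i.
  rewrite /prop_for /continuous_at Ex.
  apply: (@cvg_trans _ ((fun y => fd_c j ('D_(fd_e i) f y)) @ x)).
    by apply: near_eq_cvg; apply: filterS (gD j i) => y [_ ->].
  exact: (@continuous_comp _ _ _ ('D_(fd_e i) f) (fd_c j) x (cf i) (@fd_cont _ _ FW j _)).
pose N := \sum_(j < @fd_n _ W FW) `|fd_e j : W|.
have N0 : 0 < 1 + N by rewrite ltr_wpDr // sumr_ge0.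
have e'0 : 0 < e / (1 + N) by rewrite divr_gt0.
have [d1 H1] := choice (fun j => (ex2_ind (fun k a b => ex_intro (fun k => 0 < k /\ _) k (conj a b)) (gS j _ e'0))).
pose d := \big[Order.min/1]_j d1 j.
have d0 : 0 < d.
  by rewrite /d; elim/big_ind : _ => // [a b a0 b0|j _]; rewrite ?lt_min ?a0 ?b0 // (H1 j).1.
have dle j : d <= d1 j by rewrite /d; apply: bigmin_le.
exists d => // y h yx hd.
rewrite (fd_eq (_ - _ - _)).
apply: le_trans (ler_norm_sum _ _ _) _.
apply: (@le_trans _ _ (\sum_j e / (1 + N) * `|h| * `|fd_e (j : 'I_(fd_n W)) : W|)).
  apply: ler_sum => j _; rewrite normrZ ler_wpM2r //.
  have -> : (fd_c j (f (y + h) - f y - lincomb (fun i => 'D_(fd_e i) f x) h) : R^o) =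
    g j (y + h) - g j y - lincomb (fun i => 'D_(fd_e i) (g j) x) h.
    rewrite !linearB /lincomb linear_sum; congr (_ - _); apply: eq_bigr => i _.
    by rewrite linearZ; have /nbhs_singleton[_ ->] := gD j i.
  by apply: (H1 j).2; [exact: lt_le_trans (dle j)|exact: lt_le_trans hd (dle j)].
rewrite -mulr_sumr -/N [leLHS]mulrAC ler_wpM2r // mulrAC ler_pdivrMr //.
by rewrite ler_wpM2l ?(ltW e0) // lerDr.
Unshelve. all: by end_near. Qed.

Lemma strict_differentiable (f : V -> W) (a : 'I_(fd_n V) -> W) x : strictly_diff f (lincomb a) x ->
  differentiable f x /\ 'd f x = lincomb a :> (V -> W).
Proof.
move=> sf.
pose L := mklin (lincomb_is_linear a).
have cL : continuous L by exact: fd_linear_continuous.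
have E : f \o shift x = cst (f x) + L +o_ (0 : V) id.
  apply/eqaddoP => _/posnumP[e].
  have [d d0 H] := sf e%:num [gt0 of e%:num].
  apply/nbhs_normP; exists d; first exact: d0.
  move=> h /=; rewrite sub0r normrN => hd.
  have := H x h; rewrite subrr normr0 => /(_ d0 hd).
  rewrite (_ : _ - _ - _ = (f \o +%R^~ x - (cst (f x) + lincomb a)) h) //.
  by rewrite -[RHS]/(f (h + x) - (f x + lincomb a h)) [h + x]addrC opprD addrA.
have D := @diff_unique _ _ _ f L x cL E.
split; last by rewrite D.
by apply/diff_locallyP; rewrite D.
Qed.

End C1.

Lemma fd_inj (R : realType) (V : normedModType R) {FV : FinDim V} (v w : V) :
  (forall j, fd_c j v = fd_c j w) -> v = w.
Proof.
by move=> H; rewrite (fd_eq v) (fd_eq w); apply: eq_bigr => j _; rewrite H.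
Qed.

Lemma strict_diff_at (R : realType) (V W : normedModType R) {FV : FinDim V} {FW : FinDim W}
  (f : V -> W) x :
  (forall v, \forall y \near x, derivable f y v) ->
  (forall v, {for x, continuous ('D_v f)}) ->
  differentiable f x /\ strictly_diff f ('d f x) x.
Proof.
move=> df cf; have S := C1_strict FW (fun i : 'I_(@fd_n _ V FV) => df (fd_e i)) (fun i => cf (fd_e i)).
by have [D ->] := strict_differentiable S.
Qed.

Lemma derive_chain (R : realType) (U V W : normedModType R) (f : U -> V) (g : V -> W) x v :
  derivable f x v -> differentiable g (f x) ->
  is_derive x v (g \o f) ('d g (f x) ('D_v f x)).
Proof.
move=> df dg.
pose phi := fun h : R => f (h *: v + x).
have dphi : differentiable phi 0 by apply/derivable1_diffP; exact: (derivable1P f x v).1 df.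
have phi0 : phi 0 = f x by rewrite /phi scale0r add0r.
have dg' : differentiable g (phi 0) by rewrite phi0.
have dgf : differentiable (g \o phi) 0 by apply: differentiable_comp.
have DE (Z : normedModType R) (k : U -> Z) : 'D_v k x = 'D_1 (fun h : R => k (h *: v + x)) 0.
  rewrite /derive; set a := (fun h => _); set b := (fun h => _).
  suff -> : a = b by []; apply/funext => h; rewrite /a /b /=.
  by rewrite [h *: 1]mulr1 addr0 scale0r add0r.
apply: DeriveDef; first by apply/derivable1P/derivable1_diffP.
rewrite (DE _ (g \o f)) -[fun h : R => _]/(g \o phi) (deriveE _ dgf) (diff_comp dphi dg') /=.
by rewrite phi0 (DE _ f) -/phi (deriveE _ dphi).
Qed.

(** * Pointwise smoothness and its closure properties *)

Section Ck_at.
Variables (R : realType) (V : normedModType R).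

(** [Ck_on] only evaluates derivatives at the points of its set, so it splits into conditions at
    single points. A neighbourhood is then added, since the derivatives of a composition are
    computed nearby; in [smooth_at] one neighbourhood serves all orders [k]. *)
Definition Ck_at (W : normedModType R) k (f : V -> W) (x : V) := Ck_on k [set x] f.
Definition Ck_near (W : normedModType R) k (f : V -> W) (x : V) := \forall y \near x, Ck_at k f y.
Definition smooth_at (W : normedModType R) (f : V -> W) (x : V) := \forall y \near x, forall k, Ck_at k f y.

Lemma Ck_onP (W : normedModType R) k U (f : V -> W) : Ck_on k U f <-> forall x, U x -> Ck_at k f x.
Proof.
elim: k f => [|k IH] f; rewrite /Ck_at /=.
  split; first by move=> [H _] x Ux; split => // y ->; exact: H.
  by move=> H; split => // x Ux; apply: (H x Ux).1.
split.
  move=> [H1 [H2 H3]] x Ux; split; first by move=> y ->; exact: H1.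
  split; first by move=> y v ->; exact: H2.
  by move=> v; have /IH := H3 v; apply.
move=> H; split; first by move=> x Ux; apply: (H x Ux).1.
split; first by move=> x v Ux; apply: (H x Ux).2.1.
by move=> v; apply/IH => x Ux; apply: (H x Ux).2.2.
Qed.

Lemma Ck_at0 (W : normedModType R) (f : V -> W) (x : V) : Ck_at 0 f x <-> {for x, continuous f}.
Proof. by split => [[H _]|H]; [exact: H|split => // y ->]. Qed.

Lemma Ck_atS (W : normedModType R) k (f : V -> W) (x : V) : Ck_at k.+1 f x <->
  [/\ {for x, continuous f}, forall v, derivable f x v & forall v, Ck_at k ('D_v f) x].
Proof.
split => [[H1 [H2 H3]]|[H1 H2 H3]].
  by split => // [|v]; [exact: H1|exact: H2].
by split; [move=> y ->|split; [move=> y v ->; exact: H2|exact: H3]].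
Qed.

Lemma Ck_at_cont (W : normedModType R) k (f : V -> W) (x : V) : Ck_at k f x -> {for x, continuous f}.
Proof. by case: k => [/Ck_at0//|k /Ck_atS[]]. Qed.

Lemma near_near (P : V -> Prop) (x : V) : (\forall y \near x, P y) ->
  \forall y \near x, \forall z \near y, P z.
Proof. exact: nbhs_interior. Qed.

Lemma Ck_at_ext (W : normedModType R) k (f g : V -> W) (x : V) : (\forall y \near x, f y = g y) ->
  Ck_at k f x -> Ck_at k g x.
Proof.
have cext (f' g' : V -> W) : (\forall y \near x, f' y = g' y) ->
    {for x, continuous f'} -> {for x, continuous g'}.
  move=> fg cf; rewrite /prop_for /continuous_at -(nbhs_singleton fg).
  by apply: cvg_trans cf; apply: near_eq_cvg; apply: filterS fg => y ->.
elim: k f g => [|k IH] f g fg; first by move=> /Ck_at0 cf; apply/Ck_at0; exact: cext fg cf.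
move=> /Ck_atS[cf df Df]; apply/Ck_atS; split; first exact: cext fg cf.
  by move=> v; apply: near_eq_derivable (df v).
move=> v; apply: IH (Df v); apply: filterS (near_near fg) => y; exact: near_eq_derive.
Qed.

Lemma Ck_near_at (W : normedModType R) k (f : V -> W) (x : V) : Ck_near k f x -> Ck_at k f x.
Proof. exact: nbhs_singleton. Qed.

Lemma Ck_near_near (W : normedModType R) k (f : V -> W) (x : V) : Ck_near k f x ->
  \forall y \near x, Ck_near k f y.
Proof. exact: near_near. Qed.

Lemma Ck_near_D (W : normedModType R) k (f : V -> W) (x v : V) : Ck_near k.+1 f x -> Ck_near k ('D_v f) x.
Proof. by apply: filterS => y /Ck_atS[]. Qed.

Lemma Ck_near_derivable (W : normedModType R) k (f : V -> W) (x v : V) : Ck_near k.+1 f x -> derivable f x v.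
Proof. by move=> /Ck_near_at/Ck_atS[]. Qed.

Lemma Ck_nearS (W : normedModType R) k (f : V -> W) (x : V) : Ck_near k.+1 f x -> Ck_near k f x.
Proof.
have H k' (h : V -> W) y : Ck_at k'.+1 h y -> Ck_at k' h y.
  elim: k' h => [|k' IH] h; first by move=> /Ck_atS[? _ _]; apply/Ck_at0.
  by move=> /Ck_atS[a b c]; apply/Ck_atS; split => // v; apply: IH.
by apply: filterS => y; exact: H.
Qed.

(** The induction step of the regularity proofs below: exhibit the directional derivatives [g v] on
    a neighbourhood and prove that they are of class [k]. *)
Lemma Ck_nearSI (W : normedModType R) k (f : V -> W) (g : V -> V -> W) (x : V) :
  (\forall y \near x, {for y, continuous f} /\ (forall v, is_derive y v f (g v y)) /\
    (forall v, Ck_near k (g v) y)) -> Ck_near k.+1 f x.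
Proof.
move=> H; rewrite /Ck_near; near=> y.
have Hy : \forall z \near y, {for z, continuous f} /\ (forall v, is_derive z v f (g v z)) /\
    (forall v, Ck_near k (g v) z) by near: y; exact: near_near.
have [cf [df ng]] := nbhs_singleton Hy.
apply/Ck_atS; split => //.
move=> v; apply: Ck_at_ext (Ck_near_at (ng v)).
by apply: filterS Hy => z [_ [dz _]]; have [_ ->] := dz v.
Unshelve. all: by end_near. Qed.

Lemma smooth_atI (W : normedModType R) (f : V -> W) (x : V) :
  (\forall y \near x, forall k, Ck_near k f y) -> smooth_at f x.
Proof. by apply: filterS => y H k; apply: Ck_near_at. Qed.

Lemma smooth_at_near (W : normedModType R) (f : V -> W) (x : V) : smooth_at f x ->
  \forall y \near x, smooth_at f y.
Proof. exact: near_near. Qed.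

Lemma smooth_at_Ck_near (W : normedModType R) (f : V -> W) x k : smooth_at f x -> Ck_near k f x.
Proof. by apply: filterS => y. Qed.

Lemma smooth_at_ext (W : normedModType R) (f g : V -> W) (x : V) : (\forall y \near x, f y = g y) ->
  smooth_at f x -> smooth_at g x.
Proof.
by move=> fg; apply: filterS2 (near_near fg) => y fgy sf k; apply: Ck_at_ext (sf k).
Qed.

Lemma smooth_at_cont (W : normedModType R) (f : V -> W) (x : V) : smooth_at f x -> {for x, continuous f}.
Proof. by move=> /nbhs_singleton/(_ 0%N)/Ck_at_cont. Qed.

Lemma smooth_at_derivable (W : normedModType R) (f : V -> W) (x v : V) : smooth_at f x -> derivable f x v.
Proof. by move=> /(smooth_at_Ck_near 1%N)/Ck_near_derivable. Qed.

Lemma smooth_at_D (W : normedModType R) (f : V -> W) (x v : V) : smooth_at f x -> smooth_at ('D_v f) x.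
Proof. by apply: filterS => y H k; have /Ck_atS[] := H k.+1. Qed.

Lemma smooth_on_at (W : normedModType R) U (f : V -> W) : open U ->
  smooth_on U f <-> forall x, U x -> smooth_at f x.
Proof.
move=> oU; split => [H x Ux|H k].
  have := open_nbhs_nbhs (conj oU Ux); apply: filterS => y Uy k.
  by have /Ck_onP := H k; apply.
by apply/Ck_onP => x Ux; have /nbhs_singleton := H x Ux; exact.
Qed.

End Ck_at.
Arguments Ck_near_derivable {R V W k f x} v _.
Arguments smooth_at_derivable {R V W f x} v _.
Arguments smooth_at_D {R V W f x} v _.
Arguments Ck_near_D {R V W k f x} v _.

Lemma Ck_at_cst (R : realType) (V W : normedModType R) k (w : W) (x : V) : Ck_near k (fun=> w) x.
Proof.
apply: nearW => y; elim: k w => [|k IH] w; first by apply/Ck_at0; exact: cst_continuous.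
apply/Ck_atS; split => [||v]; [exact: cst_continuous|by []|].
have -> : 'D_v (fun=> w) = (fun=> 0 : W) :> (V -> W) by apply/funext => z; rewrite derive_cst.
exact: IH.
Qed.

Lemma smooth_at_cst (R : realType) (V W : normedModType R) (w : W) (x : V) : smooth_at (fun=> w) x.
Proof. by apply: smooth_atI; apply: nearW => y k; apply: Ck_at_cst. Qed.

Lemma Ck_near_lin (R : realType) (V W X : normedModType R) (L : {linear W -> X}) k (f : V -> W) x :
  continuous L -> Ck_near k f x -> Ck_near k (fun y => L (f y)) x.
Proof.
move=> cL; elim: k f x => [|k IH] f x.
  apply: filterS => y /Ck_at0 cf; apply/Ck_at0.
  by apply: (@continuous_comp _ _ _ f L) => //; exact: cL.
move=> nf; apply: (@Ck_nearSI _ _ _ _ _ (fun v y => L ('D_v f y))).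
apply: filterS (Ck_near_near nf) => y nfy; split; [|split].
- apply: (@continuous_comp _ _ _ f L); last exact: cL.
  exact: Ck_at_cont (Ck_near_at nfy).
- by move=> v; apply: derivable_lin => //; exact: Ck_near_derivable nfy.
- by move=> v; apply: IH; exact: Ck_near_D nfy.
Qed.

Lemma smooth_at_lin (R : realType) (V W X : normedModType R) {FW : FinDim W} (L : {linear W -> X}) (f : V -> W) x :
  smooth_at f x -> smooth_at (fun y => L (f y)) x.
Proof.
move=> sf; apply: smooth_atI; apply: filterS (smooth_at_near sf) => y sfy k.
by apply: Ck_near_lin; [exact: fd_linear_continuous|exact: smooth_at_Ck_near].
Qed.

Lemma smooth_at_id (R : realType) (V : normedModType R) (x : V) : smooth_at id x.
Proof.
apply: smooth_atI; apply: nearW => y [|k].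
  by apply: nearW => z; apply/Ck_at0.
apply: (@Ck_nearSI _ _ _ _ _ (fun v y => v)); apply: nearW => z; split; first exact: cvg_id.
by split=> v; [exact: is_derive_id|exact: Ck_at_cst].
Qed.

Lemma Ck_nearD (R : realType) (V W : normedModType R) k (f g : V -> W) x :
  Ck_near k f x -> Ck_near k g x -> Ck_near k (f + g) x.
Proof.
elim: k f g x => [|k IH] f g x nf ng.
  by apply: filterS2 nf ng => y /Ck_at0 cf /Ck_at0 cg; apply/Ck_at0; exact: continuousD.
apply: (@Ck_nearSI _ _ _ _ _ (fun v => 'D_v f + 'D_v g)).
apply: filterS2 (Ck_near_near nf) (Ck_near_near ng) => y nfy ngy; split; [|split].
- by apply: continuousD; [exact: Ck_at_cont (Ck_near_at nfy)|exact: Ck_at_cont (Ck_near_at ngy)].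
- move=> v; have := Ck_near_derivable v nfy; have := Ck_near_derivable v ngy.
  by move=> /derivableP b /derivableP a; exact: is_deriveD.
- by move=> v; apply: IH; exact: Ck_near_D.
Qed.

Lemma smooth_atD (R : realType) (V W : normedModType R) (f g : V -> W) x :
  smooth_at f x -> smooth_at g x -> smooth_at (fun y => f y + g y) x.
Proof.
move=> sf sg; apply: smooth_atI.
apply: filterS2 (smooth_at_near sf) (smooth_at_near sg) => y sfy sgy k.
by apply: (Ck_nearD (f:=f)); exact: smooth_at_Ck_near.
Qed.

Lemma smooth_at_sum (R : realType) (V W : normedModType R) (I : Type) (r : seq I) (P : pred I)
  (f : I -> V -> W) x :
  (forall i, smooth_at (f i) x) -> smooth_at (fun y => \sum_(i <- r | P i) f i y) x.
Proof.
move=> sf; have -> : (fun y => \sum_(i <- r | P i) f i y) = \sum_(i <- r | P i) f i.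
  by apply/funext => y; rewrite fct_sumE.
by elim/big_ind: _ => // [|a b]; [exact: smooth_at_cst|exact: smooth_atD].
Qed.

Lemma scaleo_is_derive (R : realType) (V W : normedModType R) (a : V -> R^o) (f : V -> W) x v :
  {for x, continuous a} -> derivable a x v -> derivable f x v ->
  is_derive x v (fun y => (a y : R) *: f y) (('D_v a x : R) *: f x + (a x : R) *: 'D_v f x).
Proof.
move=> ca da df.
have H : (fun h => h^-1 *: ((a (h *: v + x) : R) *: f (h *: v + x) - (a x : R) *: f x)) @ 0^' -->
    (('D_v a x : R) *: f x + (a x : R) *: 'D_v f x).
  have -> : (fun h => h^-1 *: ((a (h *: v + x) : R) *: f (h *: v + x) - (a x : R) *: f x)) =
    (fun h => (h^-1 *: (a (h *: v + x) - a x) : R) *: f (h *: v + x)) +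
    (fun h => (a x : R) *: (h^-1 *: (f (h *: v + x) - f x))).
    apply/funext => h; rewrite [RHS]/GRing.add /=.
    rewrite -[X in _ = X + _]/((h^-1 * (a (h *: v + x) - a x)) *: f (h *: v + x)) -scalerA.
    rewrite [a x *: (h^-1 *: _)]scalerA [a x * _]mulrC -scalerA -scalerDr; congr (_ *: _).
    by rewrite scalerBl scalerBr addrA subrK.
  apply: cvgD; last by apply: cvgZl_tmp; exact: df.
  apply: cvgZ; first exact: da.
  pose phi := fun h : R => f (h *: v + x).
  have : differentiable phi 0 by apply/derivable1_diffP; exact: (derivable1P f x v).1 df.
  move=> /differentiable_continuous; rewrite /prop_for /continuous_at /phi scale0r add0r.
  by move=> c; apply: cvg_trans c; apply: cvg_app; exact: cvg_within.
apply: DeriveDef; first by apply/cvg_ex; eexists; exact: H.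
exact: cvg_lim.
Qed.

Lemma Ck_nearZ (R : realType) (V W : normedModType R) k (a : V -> R^o) (f : V -> W) x :
  Ck_near k a x -> Ck_near k f x -> Ck_near k (fun y => (a y : R) *: f y) x.
Proof.
elim: k a f x => [|k IH] a f x na nf.
  by apply: filterS2 na nf => y /Ck_at0 cf /Ck_at0 cg; apply/Ck_at0; exact: continuousZ.
apply: (@Ck_nearSI _ _ _ _ _ (fun v => (fun y => ('D_v a y : R) *: f y) + (fun y => (a y : R) *: 'D_v f y))).
apply: filterS2 (Ck_near_near na) (Ck_near_near nf) => y nfy ngy.
have ca := Ck_at_cont (Ck_near_at nfy); have cf := Ck_at_cont (Ck_near_at ngy).
split; [|split].
- by apply: continuousZ.
- move=> v; apply: scaleo_is_derive => //; [exact: Ck_near_derivable nfy|exact: Ck_near_derivable ngy].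
- move=> v; apply: Ck_nearD; apply: IH; do ?[exact: Ck_near_D|exact: Ck_nearS].
Qed.

Lemma smooth_atZ (R : realType) (V W : normedModType R) (a : V -> R^o) (f : V -> W) x :
  smooth_at a x -> smooth_at f x -> smooth_at (fun y => (a y : R) *: f y) x.
Proof.
move=> sf sg; apply: smooth_atI.
apply: filterS2 (smooth_at_near sf) (smooth_at_near sg) => y sfy sgy k.
by apply: Ck_nearZ; exact: smooth_at_Ck_near.
Qed.

Lemma smooth_at_pair (R : realType) (V W X : normedModType R) {FW : FinDim W} {FX : FinDim X}
  (f : V -> W) (g : V -> X) x :
  smooth_at f x -> smooth_at g x -> smooth_at (fun y => (f y, g y)) x.
Proof.
have l1 : linear (fun w : W => (w, 0 : X)).
  by move=> a u w; congr pair; rewrite /= scaler0 addr0.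
have l2 : linear (fun z : X => (0 : W, z)).
  by move=> a u w; congr pair; rewrite /= scaler0 addr0.
move=> sf sg; have -> : (fun y => (f y, g y)) = (fun y => mklin l1 (f y) + mklin l2 (g y)).
  by apply/funext => y; congr pair; rewrite /= ?addr0 ?add0r.
by apply: smooth_atD; exact: smooth_at_lin.
Qed.

Section comp.
Context {R : realType} {U V W : normedModType R} {FV : FinDim V} {FW : FinDim W}.

Lemma smooth_at_strict (f : V -> W) x : smooth_at f x -> differentiable f x /\ strictly_diff f ('d f x) x.
Proof.
move=> sf; apply: strict_diff_at => v.
  by apply: filterS (smooth_at_near sf) => y; exact: smooth_at_derivable.
exact: smooth_at_cont (smooth_at_D v sf).
Qed.

Lemma smooth_at_diff (f : V -> W) x : smooth_at f x -> differentiable f x.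
Proof. by move=> /smooth_at_strict[]. Qed.

Lemma diff_lincomb (f : V -> W) x v : differentiable f x ->
  'd f x v = \sum_i (fd_c i v : R) *: 'D_(fd_e i) f x.
Proof.
move=> df; rewrite {1}(fd_eq v) linear_sum; apply: eq_bigr => i _.
by rewrite linearZ deriveE.
Qed.

Lemma smooth_at_chain (f : U -> V) (g : V -> W) x v : smooth_at f x -> smooth_at g (f x) ->
  is_derive x v (fun y => g (f y)) ('D_('D_v f x) g (f x)).
Proof.
move=> sf sg; have dg := smooth_at_diff sg; rewrite deriveE //.
by apply: derive_chain => //; exact: smooth_at_derivable.
Qed.

Lemma Ck_near_cont (X Y : normedModType R) k (f : X -> Y) x : Ck_near k f x -> {for x, continuous f}.
Proof. by move=> /Ck_near_at/Ck_at_cont. Qed.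

(** [g] is smooth but [f] only of order [k]: in this form the lemma bootstraps the regularity of the
    local inverse in [inverse_function]. The derivative is a sum of products of derivatives of [f]
    and of partial derivatives of [g] at [f y], all of order [k] again. *)
Lemma Ck_near_comp k (f : U -> V) (g : V -> W) x : Ck_near k f x -> smooth_at g (f x) ->
  Ck_near k (fun y => g (f y)) x.
Proof.
elim: k g x => [|k IH] g x sf sg.
  have gn : \forall y \near x, smooth_at g (f y) by exact: (Ck_near_cont sf (smooth_at_near sg)).
  apply: filterS2 (Ck_near_near sf) gn => y sfy sgy; apply/Ck_at0.
  by apply: (@continuous_comp _ _ _ f g); [exact: Ck_near_cont sfy|exact: smooth_at_cont].
have gn : \forall y \near x, smooth_at g (f y) by exact: (Ck_near_cont sf (smooth_at_near sg)).
apply: (@Ck_nearSI _ _ _ _ _ (fun v y => \sum_i (fd_c i ('D_v f y) : R) *: 'D_(fd_e i) g (f y))).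
apply: filterS2 (Ck_near_near sf) gn => y sfy sgy; split; [|split].
- by apply: (@continuous_comp _ _ _ f g); [exact: Ck_near_cont sfy|exact: smooth_at_cont].
- move=> v; rewrite -diff_lincomb; last exact: smooth_at_diff.
  by apply: derive_chain; [exact: Ck_near_derivable sfy|exact: smooth_at_diff].
- move=> v; have -> : (fun y => \sum_i (fd_c i ('D_v f y) : R) *: 'D_(fd_e i) g (f y)) =
    \sum_i (fun y => (fd_c i ('D_v f y) : R) *: 'D_(fd_e i) g (f y)).
    by apply/funext => z; rewrite fct_sumE.
  elim/big_ind: _ => [|a b|i _]; [exact: Ck_at_cst|exact: Ck_nearD|].
  apply: Ck_nearZ.
  + apply: Ck_near_lin; first exact: fd_cont.
    exact: Ck_near_D.
  + by apply: (IH ('D_(fd_e i) g)); [exact: Ck_nearS|exact: smooth_at_D].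
Qed.

Lemma smooth_at_comp (f : U -> V) (g : V -> W) x : smooth_at f x -> smooth_at g (f x) ->
  smooth_at (fun y => g (f y)) x.
Proof.
move=> sf sg; apply: smooth_atI.
have gn : \forall y \near x, smooth_at g (f y) by exact: (smooth_at_cont sf (smooth_at_near sg)).
by apply: filterS2 (smooth_at_near sf) gn => y a b k; apply: Ck_near_comp => //; exact: smooth_at_Ck_near.
Qed.

Lemma smooth_at_DD (f : V -> W) x a u v : smooth_at f x ->
  'D_(a *: u + v) f x = a *: 'D_u f x + 'D_v f x.
Proof. by move=> /smooth_at_diff df; rewrite !deriveE // linearP. Qed.

End comp.

Section bilinear.
Context {R : realType} {V W X Y : normedModType R} {FV : FinDim V} {FW : FinDim W}.
Variable B : V -> W -> X.
Hypothesis Bl : forall w, linear (B^~ w).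
Hypothesis Br : forall v, linear (B v).

Let bilin_sum (v : V) (w : W) : B v w = \sum_i (fd_c i v : R) *: mklin (Br (fd_e i)) w.
Proof.
rewrite -[LHS]/(mklin (Bl w) v) {1}(fd_eq v) linear_sum; apply: eq_bigr => i _.
by rewrite linearZ.
Qed.

Lemma smooth_at_bilin (f : Y -> V) (g : Y -> W) x :
  smooth_at f x -> smooth_at g x -> smooth_at (fun y => B (f y) (g y)) x.
Proof.
move=> sf sg.
have -> : (fun y => B (f y) (g y)) = (fun y => \sum_i (fd_c i (f y) : R) *: mklin (Br (fd_e i)) (g y)).
  by apply/funext => y; exact: bilin_sum.
apply: smooth_at_sum => i; apply: (@smooth_atZ _ _ _ (fun y => fd_c i (f y))).
  exact: smooth_at_lin.
exact: smooth_at_lin.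
Qed.

Lemma is_derive_bilin (f : Y -> V) (g : Y -> W) x v : smooth_at f x -> smooth_at g x ->
  is_derive x v (fun y => B (f y) (g y)) (B ('D_v f x) (g x) + B (f x) ('D_v g x)).
Proof.
move=> sf sg.
have -> : (fun y => B (f y) (g y)) = \sum_i (fun y => (fd_c i (f y) : R) *: mklin (Br (fd_e i)) (g y)).
  by apply/funext => y; rewrite fct_sumE; exact: bilin_sum.
rewrite !bilin_sum -big_split; apply: is_derive_sum => i.
have L1 := derivable_lin (@fd_cont _ _ FV i) (smooth_at_derivable v sf).
have L2 := derivable_lin (@fd_linear_continuous _ _ _ _ (mklin (Br (fd_e i)))) (smooth_at_derivable v sg).
have c1 : smooth_at (fun y => fd_c i (f y)) x by exact: smooth_at_lin.
have [d1 e1] := L1; have [d2 e2] := L2.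
rewrite -{1}e1 -{1}e2.
exact: scaleo_is_derive (smooth_at_cont c1) d1 d2.
Qed.

End bilinear.

Section real_valued.
Variables (R : realType) (V : normedModType R).
Implicit Types f g : V -> R^o.

Lemma smooth_atM f g x : smooth_at f x -> smooth_at g x -> smooth_at (fun y => f y * g y : R^o) x.
Proof. exact: (@smooth_atZ R V (R^o)). Qed.

Lemma smooth_at_prod (I : Type) (r : seq I) (P : pred I) (f : I -> V -> R^o) x :
  (forall i, smooth_at (f i) x) -> smooth_at (fun y => \prod_(i <- r | P i) f i y : R^o) x.
Proof.
move=> sf; elim: r => [|i r IH].
  by under eq_fun do rewrite big_nil; exact: smooth_at_cst.
under eq_fun do rewrite big_cons; case: (P i) => //; exact: smooth_atM.
Qed.

Lemma smooth_at_inv_id (x : R^o) : x != 0 -> smooth_at (fun y : R^o => y^-1 : R^o) x.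
Proof.
move=> x0.
have nz (z : R^o) : z != 0 -> \forall y \near z, y != 0.
  by move=> z0; apply: (@open_nbhs_nbhs _ z [set y : R^o | y != 0]); split => //; exact: open_neq.
have cinv (y : R^o) : y != 0 -> {for y, continuous (fun y : R^o => y^-1 : R^o)}.
  by move=> y0; exact: inv_continuous.
apply: smooth_atI; apply: filterS (nz _ x0) => y y0 k.
elim: k y y0 => [|k IH] y y0.
  by apply: filterS (nz _ y0) => z z0; apply/Ck_at0; exact: cinv.
apply: (@Ck_nearSI R (R^o) (R^o) k _ (fun v y => (- (y^-1 * y^-1) * v : R^o))).
apply: filterS (nz _ y0) => z z0; split; [|split].
- exact: cinv.
- move=> v; have /= D : is_derive z v (id : R^o -> R^o) v by exact: is_derive_id.
  have := @deriveV R (R^o) id z v z0 (@ex_derive _ _ _ _ _ _ _ D).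
  rewrite derive_val => E; apply: DeriveDef; last first.
    by rewrite E /GRing.scale /= expr2 invfM.
  exact: derivableV.
- move=> v; have -> : (fun y : R^o => - (y^-1 * y^-1) * v : R^o) =
    (fun y : R^o => ((-1) * v : R) *: ((y^-1 : R) *: (y^-1 : R^o)) : R^o).
    by apply/funext => t; rewrite /GRing.scale /=; ring.
  apply: (@Ck_nearZ _ _ _ _ (fun=> (-1) * v)); first exact: Ck_at_cst.
  by apply: (@Ck_nearZ _ _ _ _ (fun y : R^o => y^-1)); exact: IH.
Qed.

Lemma smooth_at_inv f x : f x != 0 -> smooth_at f x -> smooth_at (fun y => (f y)^-1 : R^o) x.
Proof. by move=> f0 sf; apply: (@smooth_at_comp _ _ _ _ _ _ f (fun y : R^o => y^-1 : R^o) _ sf); exact: smooth_at_inv_id. Qed.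

Lemma derive_comp1 (h : R -> R) (dh : R) (v : R) (x : R) : is_derive x (1 : R) h dh -> is_derive x v h (v * dh).
Proof.
move=> [dd de]; have := is_derive_scale v dd; rewrite [v *: 1]mulr1 de.
by [].
Qed.

(** Both functions together, since each is up to sign the derivative of the other. *)
Lemma smooth_at_cos_sin (x : R^o) : smooth_at (fun t : R^o => cos t : R^o) x /\ smooth_at (fun t : R^o => sin t : R^o) x.
Proof.
suff H k (y : R^o) : Ck_near k (fun t : R^o => cos t : R^o) y /\ Ck_near k (fun t : R^o => sin t : R^o) y.
  by split; apply: smooth_atI; apply: filterE => y k; have [] := H k y.
elim: k y => [|k IH] y.
  by split; apply: filterE => z; apply/Ck_at0; [exact: continuous_cos|exact: continuous_sin].
split.
- apply: (@Ck_nearSI R (R^o) (R^o) k _ (fun v y => (v * - sin y : R^o))); apply: filterE => z.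
  split; [exact: continuous_cos|split => v].
    by apply: derive_comp1.
  have -> : (fun t : R^o => v * - sin t : R^o) = (fun t : R^o => (- v : R) *: (sin t : R^o)).
    by apply/funext => t; rewrite /GRing.scale /= mulrN mulNr.
  by apply: (@Ck_nearZ _ _ _ _ (fun=> - v)); [exact: Ck_at_cst|exact: (IH z).2].
- apply: (@Ck_nearSI R (R^o) (R^o) k _ (fun v y => (v * cos y : R^o))); apply: filterE => z.
  split; [exact: continuous_sin|split => v].
    by apply: derive_comp1.
  by apply: (@Ck_nearZ _ _ _ _ (fun=> v)); [exact: Ck_at_cst|exact: (IH z).1].
Qed.

End real_valued.

Section rowvec.
Variables (R : realType) (V : normedModType R).

Lemma smooth_at_rowP n (f : V -> 'rV[R]_n) x :
  smooth_at f x <-> forall j, smooth_at (fun y => f y ord0 j : R^o) x.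
Proof.
split => [sf j|sf]; first exact: (@smooth_at_lin _ _ _ _ _ (mklin (@coord_is_linear R n j))).
have -> : f = (fun y => \sum_j (f y ord0 j : R) *: delta_mx ord0 j).
  by apply/funext => y; exact: row_sum_delta.
by apply: smooth_at_sum => j; apply: (@smooth_atZ _ _ _ (fun y => f y ord0 j)); [exact: sf|exact: smooth_at_cst].
Qed.

Lemma smooth_at_det n (M : V -> 'M[R]_n) x : (forall i j, smooth_at (fun y => M y i j : R^o) x) ->
  smooth_at (fun y => \det (M y) : R^o) x.
Proof.
move=> sM; apply: smooth_at_sum => s.
by apply: smooth_atM; [exact: smooth_at_cst|exact: smooth_at_prod].
Qed.

Lemma smooth_at_invmx n (M : V -> 'M[R]_n) x : (forall i j, smooth_at (fun y => M y i j : R^o) x) ->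
  M x \in unitmx -> (\forall y \near x, M y \in unitmx) /\
  forall i j, smooth_at (fun y => invmx (M y) i j : R^o) x.
Proof.
move=> sM Mx; have sd := smooth_at_det sM.
have ud : \forall y \near x, M y \in unitmx.
  have nz : \det (M x) != 0 by rewrite -unitfE -unitmxE.
  have oz : open [set t : R^o | t != 0] by exact: open_neq.
  have : \forall y \near x, \det (M y) != 0 by exact: (smooth_at_cont sd (open_nbhs_nbhs (conj oz nz))).
  by apply: filterS => y; rewrite unitmxE unitfE.
split => // i j.
(* Cramer's formula reduces the inverse to determinants; it is used where the determinant does not
   vanish, hence near [x]. *)
apply: (@smooth_at_ext _ _ _ (fun y => (\det (M y))^-1 * \adj (M y) i j : R^o)).
  by apply: filterS ud => y uy; rewrite /invmx uy [RHS]mxE.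
apply: smooth_atM; first by apply: smooth_at_inv => //; rewrite -unitfE -unitmxE.
have -> : (fun y => \adj (M y) i j : R^o) = (fun y => (-1) ^+ (j + i) * \det (row' j (col' i (M y))) : R^o).
  by apply/funext => y; rewrite mxE.
apply: smooth_atM; first exact: smooth_at_cst.
apply: smooth_at_det => a b.
have -> : (fun y => row' j (col' i (M y)) a b : R^o) = (fun y => M y (lift j a) (lift i b)).
  by apply/funext => y; rewrite !mxE.
exact: sM.
Qed.

End rowvec.

(** * Symmetry of second derivatives, functions with zero derivative *)

Section schwarz.
Context {R : realType} {V : normedModType R} {FV : FinDim V}.

(** The second difference over the parallelogram spanned by [s u] and [s v] is symmetric in [u] and
    [v]. By the mean value theorem in the direction [u] it is [s] times an increment of ['D_u f]
    along [s v], which strict differentiability of ['D_u f] evaluates. *)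
Lemma schwarz_aux (f : V -> R^o) x u v : smooth_at f x -> forall e : R, 0 < e ->
  exists2 d : R, 0 < d & forall s : R, 0 < s -> s < d ->
    `|f (x + s *: u + s *: v) - f (x + s *: u) - f (x + s *: v) + f x
      - s * s * 'D_v ('D_u f) x| <= s * s * (e * `|v|).
Proof.
move=> sf e e0.
have [dD sD] := smooth_at_strict (smooth_at_D u sf).
have [d1 d10 H1] := sD e e0.
have [d2 /= d20 H2] := (@nbhs_normP _ _ x _).1 (smooth_at_near sf).
pose M := 1 + `|u| + `|v|.
have M0 : 0 < M by rewrite /M -addrA ltr_wpDr // addr_ge0.
pose d := Order.min d1 d2 / M.
have d0 : 0 < d by rewrite divr_gt0 // lt_min d10.
have dM : d * M = Order.min d1 d2 by rewrite mulfVK // lt0r_neq0.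
exists d => // s s0 sd.
have sM : s * `|u| + s * `|v| < Order.min d1 d2.
  rewrite -mulrDr -dM; apply: (@le_lt_trans _ _ (s * M)); last by rewrite ltr_pM2r.
  by rewrite ler_wpM2l ?(ltW s0) // /M -addrA lerDr.
have inb (r : R) (t : R) : 0 <= r -> r <= 1 -> 0 <= t -> t <= 1 ->
    `|(x + r *: (s *: u) + t *: (s *: v)) - x| < Order.min d1 d2.
  move=> r0 r1 t0 t1; apply: le_lt_trans sM.
  rewrite addrAC [x + _]addrC addrK (le_trans (ler_normD _ _)) // !normrZ.
  rewrite !ger0_norm ?(ltW s0) //.
  by rewrite lerD // ler_piMl // mulr_ge0 // ltW.
pose g (r : R) : R := f (x + s *: v + r *: (s *: u)) - f (x + r *: (s *: u)).
pose dg (r : R) : R := s * 'D_u f (x + s *: v + r *: (s *: u)) - s * 'D_u f (x + r *: (s *: u)).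
have dd y : `|y - x| < Order.min d1 d2 -> forall w, derivable f y w.
  by rewrite lt_min => /andP[_ h] w; apply: smooth_at_derivable; apply: H2; rewrite /= distrC.
have Dg (r : R) : r \in `[0, 1]%R -> is_derive r (1 : R) g (dg r).
  rewrite in_itv /= => /andP[r0 r1].
  have A := inb r 1 r0 r1 ler01 (lexx _); have B := inb r 0 r0 r1 (lexx _) ler01.
  rewrite scale1r [x + _ + _]addrAC in A; rewrite scale0r addr0 in B.
  have [A1 A2] := is_derive_scale s (dd _ A u).
  have [B1 B2] := is_derive_scale s (dd _ B u).
  have LA := is_derive_line A1; have LB := is_derive_line B1.
  by have := is_deriveB LA LB; rewrite A2 B2.
have M1 (r : R) : r \in `]0, 1[%R -> is_derive r (1 : R) g (dg r).
  by move=> s01; apply: Dg; move: s01; rewrite !in_itv /= => /andP[/ltW-> /ltW->].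
have M2 : {within `[0, 1], continuous g}.
  by apply: derivable_within_continuous => r /Dg dgs; exact: ex_derive.
have [c] := MVT ltr01 M1 M2; rewrite in_itv /= => /andP[/ltW c0 /ltW c1].
rewrite subr0 mulr1 /g /dg scale1r scale0r !addr0 => E.
have -> : f (x + s *: u + s *: v) - f (x + s *: u) - f (x + s *: v) + f x =
   f (x + s *: v + s *: u) - f (x + s *: u) - (f (x + s *: v) - f x).
  by rewrite (addrAC x) opprB addrA addrAC [LHS]addrAC -!addrA; congr (_ + _); ring.
rewrite E -mulrBr -mulrA -mulrBr normrM (ger0_norm (ltW s0)) -[leRHS]mulrA ler_wpM2l ?(ltW s0) //.
have B := inb c 0 c0 c1 (lexx _) ler01; rewrite scale0r addr0 in B.
have := H1 (x + c *: (s *: u)) (s *: v).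
have L : 'd ('D_u f) x (s *: v) = s * 'D_v ('D_u f) x by rewrite [LHS]linearZ -deriveE.
rewrite L -(addrAC x (s *: v)) => K.
apply: le_trans (K _ _) _.
- by move: B; rewrite lt_min => /andP[].
- have := inb 0 1 (lexx _) ler01 ler01 (lexx _).
  by rewrite scale0r addr0 scale1r addrAC subrr add0r lt_min => /andP[].
- by rewrite normrZ (ger0_norm (ltW s0)) mulrCA.
Qed.

Lemma schwarz_real (f : V -> R^o) x u v : smooth_at f x -> 'D_v ('D_u f) x = 'D_u ('D_v f) x.
Proof.
move=> sf; apply/eqP; rewrite -subr_eq0 -normr_le0; apply/ler_addgt0Pr => e e0.
rewrite add0r; pose N := `|u| + `|v| + 1.
have N0 : 0 < N by rewrite ltr_wpDl // addr_ge0.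
have e1 : 0 < e / N by rewrite divr_gt0.
have [d1 d10 H1] := schwarz_aux u v sf e1.
have [d2 d20 H2] := schwarz_aux v u sf e1.
pose s := Order.min d1 d2 / 2.
have s0 : 0 < s by rewrite divr_gt0 // lt_min d10.
have sm : s < Order.min d1 d2 by rewrite ltr_pdivrMr // ltr_pMr ?ltr1n // lt_min d10.
move: (sm); rewrite lt_min => /andP[sd1 sd2].
have {}H1 := H1 s s0 sd1; have {}H2 := H2 s s0 sd2.
have ss : 0 < s * s by rewrite mulr_gt0.
rewrite -(ler_pM2l ss) -[X in X * `|_|]ger0_norm ?(ltW ss) // -normrM.
have -> : s * s * ('D_v ('D_u f) x - 'D_u ('D_v f) x) =
  (f (x + s *: v + s *: u) - f (x + s *: v) - f (x + s *: u) + f x - s * s * 'D_u ('D_v f) x) -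
  (f (x + s *: u + s *: v) - f (x + s *: u) - f (x + s *: v) + f x - s * s * 'D_v ('D_u f) x).
  rewrite (addrAC x (s *: v)).
  move: (f _) (f _) (f _) (f _) ('D_v _ _) ('D_u _ _) => a1 a2 a3 a4 a5 a6.
  by rewrite /GRing.regular in a1 a2 a3 a4 a5 a6 *; ring.
apply: le_trans (ler_normB _ _) _; apply: le_trans (lerD H2 H1) _.
rewrite -mulrDr -mulrDr ler_wpM2l ?(ltW ss) // mulrAC ler_pdivrMr // ler_wpM2l ?(ltW e0) //.
by rewrite /N lerDl.
Qed.

Lemma schwarz (W : normedModType R) {FW : FinDim W} (f : V -> W) x u v :
  smooth_at f x -> 'D_v ('D_u f) x = 'D_u ('D_v f) x.
Proof.
move=> sf; apply: fd_inj => j.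
have cD (w : V) (h : V -> W) y : smooth_at h y -> 'D_w (fun z => fd_c j (h z)) y = fd_c j ('D_w h y).
  by move=> sh; have [] := derivable_lin (@fd_cont _ _ FW j) (smooth_at_derivable w sh).
have cDn (w : V) : \forall y \near x, fd_c j ('D_w f y) = 'D_w (fun z => fd_c j (f z)) y.
  by apply: filterS (smooth_at_near sf) => y sy; rewrite cD.
rewrite -!cD; try exact: smooth_at_D.
rewrite (near_eq_derive _ (cDn u)) (near_eq_derive _ (cDn v)).
by apply: schwarz_real; exact: smooth_at_lin.
Qed.

Lemma zero_derive_const (W : normedModType R) {FW : FinDim W} (f : V -> W) x (r : R) :
  (forall y, `|y - x| < r -> forall v, is_derive y v f 0) ->
  forall y, `|y - x| < r -> f y = f x.
Proof.
move=> H y yr; apply: fd_inj => j.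
pose g (t : R) : R := fd_c j (f (x + t *: (y - x))).
have Dg (t : R) : t \in `[0, 1]%R -> is_derive t (1 : R) g 0.
  rewrite in_itv /= => /andP[t0 t1].
  have inb : `|x + t *: (y - x) - x| < r.
    rewrite addrAC subrr add0r normrZ ger0_norm //; apply: le_lt_trans yr.
    by rewrite ler_piMl.
  have [d e] := H _ inb (y - x).
  have L := is_derive_line d; rewrite e in L.
  have [d1 e1] := L.
  by have := derivable_lin (@fd_cont _ _ FW j) d1; rewrite e1 linear0.
have M1 (t : R) : t \in `]0, 1[%R -> is_derive t (1 : R) g (cst 0 t).
  by move=> s01; apply: Dg; move: s01; rewrite !in_itv /= => /andP[/ltW-> /ltW->].
have M2 : {within `[0, 1], continuous g}.
  by apply: derivable_within_continuous => t /Dg dgs; exact: ex_derive.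
have [c _] := MVT ltr01 M1 M2.
rewrite mul0r /g scale1r scale0r addr0 [x + _]addrC subrK => /eqP.
by rewrite subr_eq0 => /eqP.
Qed.

Lemma zero_derive_near (W : normedModType R) {FW : FinDim W} (f : V -> W) x :
  (\forall y \near x, forall v, is_derive y v f 0) -> \forall y \near x, f y = f x.
Proof.
case/nbhs_normP => r /= r0 H; apply/nbhs_normP; exists r => // y /= yr.
apply: (@zero_derive_const _ _ _ _ r); last by rewrite distrC.
by move=> z zr v; apply: H; rewrite /= distrC.
Qed.

End schwarz.

(** Completeness of row vectors, for the fixed point theorem and for Baire's theorem. *)
HB.instance Definition _ (R : realType) n :=
  Uniform_isComplete.Build 'rV[R]_n (@cauchy_cvg ('rV[R]_n)).

Section jac.
Context {R : realType} {n m : nat}.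

(** Vectors are rows, so this is the transpose of the usual Jacobian matrix, and composition
    multiplies matrices from left to right. *)
Definition jac (f : 'rV[R]_n -> 'rV[R]_m) (x : 'rV[R]_n) : 'M[R]_(n, m) :=
  \matrix_(i, j) ('D_(delta_mx ord0 i) f x) ord0 j.

Lemma jacE (f : 'rV[R]_n -> 'rV[R]_m) x v : smooth_at f x -> 'D_v f x = v *m jac f x.
Proof.
move=> sf; have df : differentiable f x by exact: smooth_at_diff.
rewrite deriveE // [v in LHS]row_sum_delta linear_sum; apply/rowP => j.
rewrite summxE mxE; apply: eq_bigr => i _.
by rewrite linearZ mxE -deriveE // !mxE.
Qed.

Lemma smooth_at_jac (f : 'rV[R]_n -> 'rV[R]_m) x i j : smooth_at f x ->
  smooth_at (fun y => jac f y i j : R^o) x.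
Proof.
move=> sf; have -> : (fun y => jac f y i j : R^o) = (fun y => 'D_(delta_mx ord0 i) f y ord0 j).
  by apply/funext => y; rewrite mxE.
by have /smooth_at_rowP := smooth_at_D (delta_mx ord0 i) sf.
Qed.

End jac.

Lemma mulmx_bound (R : realType) n m (B : 'M[R]_(n, m)) : exists2 b : R, 0 < b &
  forall v : 'rV[R]_n, `|v *m B| <= b * `|v|.
Proof.
have l : linear (mulmxr B : 'rV[R]_n -> 'rV[R]_m) by move=> a u v; rewrite linearP.
have [b b0 Hb] := @linear_lipschitz _ _ _ (mklin l) (@fd_linear_continuous _ _ _ _ (mklin l)).
by exists b.
Qed.

Lemma lipschitz_continuous (R : realType) (V W : normedModType R) (g : V -> W) x (r C : R) :
  0 < r -> 0 <= C -> (forall z, `|z - x| < r -> `|g z - g x| <= C * `|z - x|) ->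
  {for x, continuous g}.
Proof.
move=> r0 C0 H; apply/cvgrPdist_le => e e0.
have C1 : 0 < C + 1 by rewrite ltr_wpDl.
have e1 : 0 < e / (C + 1) by rewrite divr_gt0.
near=> z.
have zr : `|z - x| < r by rewrite distrC; near: z; exact: cvgr_dist_lt.
have ze : `|z - x| <= e / (C + 1) by rewrite distrC; near: z; exact: cvgr_dist_le.
rewrite distrC; apply: le_trans (H _ zr) _; rewrite ler_pdivlMr // in ze.
by apply: le_trans ze; rewrite mulrC ler_wpM2l // lerDl.
Unshelve. all: by end_near. Qed.

Lemma near_comp (R : realType) (V W : normedModType R) (f : V -> W) x (P : W -> Prop) :
  {for x, continuous f} -> nbhs (f x) P -> \forall y \near x, P (f y).
Proof. by move=> cf; apply: cf. Qed.

(** * The inverse function theorem *)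

Section inverse.
Variables (R : realType) (n : nat) (f : 'rV[R]_n -> 'rV[R]_n) (x0 : 'rV[R]_n).
Hypothesis sf : smooth_at f x0.
Hypothesis jf : jac f x0 \in unitmx.

Let A := jac f x0.
Let B := invmx A.

(** As [A *m B] is the identity, the map [x |-> x - f x *m B] has strict derivative zero at [x0],
    hence contracts by one half near [x0]. *)
Let local_bounds : exists b r : R, [/\ 0 < b, 0 < r,
  forall x y : 'rV[R]_n, `|x - x0| <= r -> `|y - x0| <= r ->
    `|(y - x) - (f y - f x) *m B| <= 2^-1 * `|y - x| &
  forall v : 'rV[R]_n, `|v *m B| <= b * `|v|].
Proof.
have [b b0 Hb] := mulmx_bound B.
have [df sd] := smooth_at_strict sf.
have e0 : 0 < (2 * b)^-1 by rewrite invr_gt0 mulr_gt0.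
have [d d0 Hd] := sd _ e0.
(* Two points within [d / 4] of [x0] differ by at most [d / 2], below the radius [d] required of the
   increment. *)
exists b, (d / 4); split => //; first by rewrite divr_gt0.
have d4 : d / 4 < d by rewrite ltr_pdivrMr // ltr_pMr // ltr1n.
move=> x y xr yr.
have -> : (y - x) - (f y - f x) *m B = - ((f (x + (y - x)) - f x - (y - x) *m A) *m B).
  by rewrite [x + _]addrC subrK [in RHS]mulmxBl -[_ *m A *m B]mulmxA mulmxV // mulmx1 opprB.
rewrite normrN; apply: le_trans (Hb _) _.
have h : `|y - x| < d.
  have -> : y - x = (y - x0) - (x - x0) by rewrite opprB addrA subrK.
  apply: le_lt_trans (ler_normB _ _) _; apply: le_lt_trans (lerD yr xr) _.
  by rewrite -mulrDr gtr_pMr //; lra.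
have := Hd x (y - x) (le_lt_trans xr d4) h.
rewrite -deriveE // jacE // => K.
rewrite mulrC -ler_pdivlMr //; apply: le_trans K _.
by rewrite invfM mulrAC.
Qed.

(** Newton's iteration with the fixed slope [B] has a fixed point in a closed ball, which defines
    [g]. The contraction makes [g] Lipschitz with constant [2 b], and its derivative is then found
    from strict differentiability. *)
Lemma inverse_function : exists g : 'rV[R]_n -> 'rV[R]_n,
  [/\ g (f x0) = x0, smooth_at g (f x0), \forall y \near f x0, f (g y) = y &
      \forall x \near x0, g (f x) = x].
Proof.
have [b [r [b0 r0 K Hb]]] := local_bounds.
have Lip x y : `|x - x0| <= r -> `|y - x0| <= r -> `|y - x| <= 2 * b * `|f y - f x|.
  move=> xr yr; have := K x y xr yr; have := Hb (f y - f x).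
  have := ler_normD ((y - x) - (f y - f x) *m B) ((f y - f x) *m B); rewrite subrK; lra.
(* For [y] this close to [f x0] the iteration moves [x0] by at most [r / 2], and the contraction
   adds at most [r / 2]: the ball of radius [r] is preserved. *)
pose rho := r / (2 * b).
have rho0 : 0 < rho by rewrite divr_gt0 // mulr_gt0.
have x0r : `|x0 - x0| <= r by rewrite subrr normr0 ltW.
have ex y : `|y - f x0| < rho -> exists x, `|x - x0| <= r /\ f x = y.
  move=> yr; pose T x := x - (f x - y) *m B.
  pose U := [set x : 'rV[R]_n | `|x - x0| <= r].
  have TU : {homo T : x / U x >-> U x}.
    move=> x Ux; rewrite /U /T /=.
    have -> : x - (f x - y) *m B - x0 = (x - x0 - (f x - f x0) *m B) - (f x0 - y) *m B.
      rewrite [in RHS]mulmxBl [in LHS]mulmxBl [in RHS]mulmxBl.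
      by move: (_ *m _) (_ *m _) (_ *m _) => p q s; apply/rowP => i; rewrite !mxE; ring.
    apply: le_trans (ler_normB _ _) _.
    have := K x0 x x0r Ux; have := Hb (f x0 - y); rewrite distrC in yr.
    have : b * `|f x0 - y| <= r / 2.
      by rewrite mulrC -ler_pdivlMr // -mulrA -invfM ltW.
    have : `|x - x0| <= r := Ux.
    lra.
  pose T' : {fun U >-> U} := HB.pack T (isFun.Build _ _ U U T TU).
  have [|||p Up pT] := @banach_fixed_point R _ U T'.
  - have q0 : 0 <= (2^-1 : R) by rewrite invr_ge0.
    exists (NngNum q0); split => /=; first by rewrite invf_lt1 ?ltr1n.
    move=> [x z] [/= Ux Uz]; rewrite /T.
    have -> : x - (f x - y) *m B - (z - (f z - y) *m B) = (x - z) - (f x - f z) *m B.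
      rewrite !mulmxBl; move: (f x *m B) (f z *m B) (y *m B) => p q s.
      by apply/rowP => i; rewrite !mxE; ring.
    exact: K.
  - have -> : U = (fun x => `|x - x0|) @^-1` [set t | t <= r] by [].
    apply: closed_comp; last exact: closed_le.
    move=> x _; apply: (@cvg_norm _ _ _ (nbhs x) _ (fun x => x - x0)).
    by apply: cvgB; [exact: cvg_id|exact: cvg_cst].
  - by exists x0.
  exists p; split => //; apply/eqP; rewrite -subr_eq0; apply/eqP.
  have : (f p - y) *m B = 0.
    have E : p = p - (f p - y) *m B := pT.
    have : p - (f p - y) *m B = p - 0 by rewrite subr0 -E.
    by move=> /addrI /oppr_inj.
  by move=> /(congr1 (mulmx^~ A)); rewrite -mulmxA mulVmx // mulmx1 mul0mx.
have [g gP] : exists g : 'rV[R]_n -> 'rV[R]_n, forall y, `|y - f x0| < rho -> `|g y - x0| <= r /\ f (g y) = y.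
  by exists (fun y => get [set x | `|x - x0| <= r /\ f x = y]) => y /ex; exact: getPex.
have fx0 : `|f x0 - f x0| < rho by rewrite subrr normr0.
have gu x : `|x - x0| <= r -> `|f x - f x0| < rho -> g (f x) = x.
  move=> xr fr; have [gr fg] := gP _ fr.
  by apply/eqP; rewrite -subr_eq0 -normr_le0; have := Lip x (g (f x)) xr gr; rewrite fg subrr normr0 mulr0.
have g0 : g (f x0) = x0 by apply: gu.
have Lg y z : `|y - f x0| < rho -> `|z - f x0| < rho -> `|g z - g y| <= 2 * b * `|z - y|.
  by move=> /gP[gy fy] /gP[gz fz]; have := Lip _ _ gy gz; rewrite fy fz.
have gc (y : 'rV[R]_n) : `|y - f x0| < rho -> {for y, continuous g}.
  move=> yr; apply: (@lipschitz_continuous _ _ _ g y (rho - `|y - f x0|) (2 * b)).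
  - by rewrite subr_gt0.
  - by rewrite ltW // mulr_gt0.
  move=> z zy; apply: Lg => //.
  have := ler_normD (z - y) (y - f x0); rewrite addrA subrK; lra.
have ball_rho : \forall y \near f x0, `|y - f x0| < rho.
  by near=> y; rewrite distrC; near: y; exact: cvgr_dist_lt.
pose admissible x := smooth_at f x /\ jac f x \in unitmx.
have admissiblen : \forall x \near x0, admissible x.
  have [ju _] := smooth_at_invmx (fun i j => smooth_at_jac i j sf) jf.
  exact: filterS2 (smooth_at_near sf) ju.
pose W y := `|y - f x0| < rho /\ admissible (g y).
have WN : \forall y \near f x0, W y.
  have : \forall y \near f x0, admissible (g y).
    have h2 : nbhs (g (f x0)) admissible by rewrite g0.
    exact: (near_comp (gc _ fx0) h2).
  exact: filterS2 ball_rho.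
have Dg y w : W y -> is_derive y w g (w *m invmx (jac f (g y))).
  move=> [yr [sfy ju]]; have [c c0 Hc] := mulmx_bound (invmx (jac f (g y))).
  have [_ sd] := smooth_at_strict sfy.
  have H : (fun t => t^-1 *: (g (t *: w + y) - g y)) @ 0^' --> w *m invmx (jac f (g y)).
    apply/cvgrPdist_le => e e0.
    (* The error of the difference quotient is at most [c * (e / M) * 2 b (|w| + 1)], which is [e]
       for this [M]. *)
    pose M := c * (2 * b * (`|w| + 1)).
    have M0 : 0 < M by rewrite !mulr_gt0 // ltr_wpDl.
    have e1 : 0 < e / M by rewrite divr_gt0.
    have [d d0 Hd] := sd _ e1.
    have r1 : 0 < (rho - `|y - f x0|) / (`|w| + 1) by rewrite divr_gt0 ?subr_gt0 // ltr_wpDl.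
    have r2 : 0 < d / (2 * b * (`|w| + 1)) by rewrite divr_gt0 // !mulr_gt0 // ltr_wpDl.
    have w1 : 0 < `|w| + 1 by rewrite ltr_wpDl.
    near=> t.
    have t0 : t != 0 by near: t; exact: nbhs_dnbhs_neq.
    have t1 : `|t| < (rho - `|y - f x0|) / (`|w| + 1) by near: t; exact: dnbhs0_lt.
    have t2 : `|t| < d / (2 * b * (`|w| + 1)) by near: t; exact: dnbhs0_lt.
    have ty : `|t *: w + y - f x0| < rho.
      rewrite ltr_pdivlMr // in t1; rewrite -addrA; have := ler_normD (t *: w) (y - f x0).
      by rewrite normrZ; have : 0 <= `|t| by []; rewrite mulrDr mulr1 in t1; lra.
    have [gt ft] := gP _ ty; have [gy fy] := gP _ yr.
    have := Lg _ _ yr ty; rewrite addrK normrZ => hL.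
    have hd : `|g (t *: w + y) - g y| < d.
      apply: le_lt_trans hL _; rewrite ltr_pdivlMr in t2; last by rewrite !mulr_gt0.
      have E2 : `|t| * (2 * b * (`|w| + 1)) = 2 * b * (`|t| * (`|w| + 1)) by ring.
      rewrite E2 in t2; apply: le_lt_trans t2; rewrite ler_wpM2l ?mulr_ge0 ?(ltW b0) //.
      by rewrite ler_wpM2l // lerDl.
    have gg : `|g y - g y| < d by rewrite subrr normr0.
    have := Hd (g y) (g (t *: w + y) - g y) gg hd; rewrite [g y + _]addrC subrK ft fy addrK -deriveE; last exact: smooth_at_diff.
    rewrite jacE // => K1.
    have E : w *m invmx (jac f (g y)) - t^-1 *: (g (t *: w + y) - g y) =
       t^-1 *: ((t *: w - (g (t *: w + y) - g y) *m jac f (g y)) *m invmx (jac f (g y))).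
      by rewrite [in RHS]mulmxBl -(mulmxA (g (t *: w + y) - g y)) mulmxV // mulmx1 -scalemxAl [RHS]scalerBr scalerA mulVf // scale1r.
    rewrite E normrZ normfV -ler_pdivlMl ?invr_gt0 ?normr_gt0 // invrK.
    apply: le_trans (Hc _) _; rewrite mulrC -ler_pdivlMr //.
    apply: le_trans K1 _; apply: (@le_trans _ _ (e / M * (2 * b * (`|t| * (`|w| + 1))))).
      rewrite ler_wpM2l ?(ltW e1) //; apply: le_trans hL _; rewrite ler_wpM2l ?mulr_ge0 ?(ltW b0) //.
      by rewrite ler_wpM2l // lerDl.
    have -> : e / M * (2 * b * (`|t| * (`|w| + 1))) = `|t| * e * ((2 * b * (`|w| + 1)) / M) by ring.
    have -> // : 2 * b * (`|w| + 1) / M = c^-1.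
    by rewrite /M invfM [LHS]mulrCA divff ?mulr1 // gt_eqF // !mulr_gt0.
  by apply: DeriveDef; [apply/cvg_ex; eexists; exact: H|exact: cvg_lim].
exists g; split => //.
- apply: smooth_atI; apply: filterS (near_near WN) => y Wy k.
  elim: k y Wy => [|k IH] y Wy.
    by apply: filterS Wy => z [zr _]; apply/Ck_at0; exact: gc.
  (* Bootstrap: the derivative of [g] is a smooth function of [g] itself, so order [k] of [g] gives
     order [k.+1]. *)
  apply: (@Ck_nearSI _ _ _ _ _ (fun w z => w *m invmx (jac f (g z)))).
  apply: filterS (near_near Wy) => z Wz; have [zr [sz jz]] := nbhs_singleton Wz.
  split; first exact: gc.
  split; first by move=> v; apply: Dg.
  move=> v; apply: (@Ck_near_comp _ _ _ _ _ _ k g (fun x => v *m invmx (jac f x))); first exact: IH.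
  apply/smooth_at_rowP => j.
  have -> : (fun y0 => (v *m invmx (jac f y0)) ord0 j : R^o) =
     (fun y0 => \sum_i ((v ord0 i : R) *: (invmx (jac f y0) i j : R^o))).
    by apply/funext => t; rewrite mxE.
  apply: smooth_at_sum => i; apply: (@smooth_atZ _ _ _ (fun=> v ord0 i)); first exact: smooth_at_cst.
  by have [_] := smooth_at_invmx (fun i j => smooth_at_jac i j sz) jz.
- by apply: filterS ball_rho => y /gP[].
- near=> x; apply: gu.
    by rewrite distrC; near: x; exact: cvgr_dist_le.
  by near: x; exact: (smooth_at_cont sf ball_rho).
Unshelve. all: by end_near. Qed.

End inverse.

Lemma smooth_at_affine (R : realType) (V : normedModType R) (a v : V) (t : R^o) :
  smooth_at (fun t : R^o => a + (t : R) *: v) t /\ 'D_(1 : R^o) (fun t : R^o => a + (t : R) *: v) t = v.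
Proof.
split.
  apply: smooth_atD; first exact: smooth_at_cst.
  by apply: (@smooth_atZ _ _ _ (id : R^o -> R^o)); [exact: smooth_at_id|exact: smooth_at_cst].
have dI : derivable (id : V -> V) (a + t *: v) v by exact: derivable_id.
by have [_] := is_derive_line dI; rewrite derive_id.
Qed.

Definition dot (R : pzRingType) n (u v : 'rV[R]_n) : R := (u *m v^T) ord0 ord0.

Lemma dotE (R : pzRingType) n (u v : 'rV[R]_n) : dot u v = \sum_i u ord0 i * v ord0 i.
Proof. by rewrite /dot mxE; apply: eq_bigr => i _; rewrite mxE. Qed.

Lemma dot_linear_r (R : realType) n (u : 'rV[R]_n) : linear (fun v => dot u v : R^o).
Proof. by move=> a v w; rewrite /dot linearP mulmxDr -scalemxAr !mxE. Qed.
Lemma dot_linear_l (R : realType) n (v : 'rV[R]_n) : linear (fun u => dot u v : R^o).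
Proof. by move=> a u w; rewrite /dot mulmxDl -scalemxAl !mxE. Qed.

Lemma dotZl (R : comPzRingType) n a (u v : 'rV[R]_n) : dot (a *: u) v = a * dot u v.
Proof. by rewrite /dot -scalemxAl mxE. Qed.
Lemma dotZr (R : comPzRingType) n a (u v : 'rV[R]_n) : dot u (a *: v) = a * dot u v.
Proof. by rewrite /dot linearZ -scalemxAr mxE. Qed.
Lemma dotDl (R : pzRingType) n (u w v : 'rV[R]_n) : dot (u + w) v = dot u v + dot w v.
Proof. by rewrite /dot mulmxDl mxE. Qed.
Lemma dotDr (R : pzRingType) n (u w v : 'rV[R]_n) : dot v (u + w) = dot v u + dot v w.
Proof. by rewrite /dot linearD mulmxDr mxE. Qed.
Lemma dotC (R : comPzRingType) n (u v : 'rV[R]_n) : dot u v = dot v u.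
Proof. by rewrite !dotE; apply: eq_bigr => i _; rewrite mulrC. Qed.

Lemma smooth_at_dot (R : realType) (V : normedModType R) n (f g : V -> 'rV[R]_n) x :
  smooth_at f x -> smooth_at g x -> smooth_at (fun y => dot (f y) (g y) : R^o) x.
Proof.
move=> sf sg; exact: (@smooth_at_bilin R _ _ _ V (FinDim_rV R n) (FinDim_rV R n) (fun u v => dot u v : R^o)
    (@dot_linear_l R n) (@dot_linear_r R n) f g x sf sg).
Qed.

Lemma is_derive_dot (R : realType) (V : normedModType R) n (f g : V -> 'rV[R]_n) x v :
  smooth_at f x -> smooth_at g x ->
  is_derive x v (fun y => dot (f y) (g y) : R^o) (dot ('D_v f x) (g x) + dot (f x) ('D_v g x)).
Proof.
move=> sf sg; exact: (@is_derive_bilin R _ _ _ V (FinDim_rV R n) (FinDim_rV R n) (fun u v => dot u v : R^o)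
    (@dot_linear_l R n) (@dot_linear_r R n) f g x v sf sg).
Qed.

(** * The Poincare lemma for one-forms *)

Section poincare.
Variables (R : realType) (n : nat) (w : 'rV[R]_n -> 'rV[R]_n) (x0 : 'rV[R]_n).
Hypothesis sw : smooth_at w x0.
Hypothesis wclosed : \forall x \near x0, forall u v, dot ('D_v w x) u = dot ('D_u w x) v.

Local Notation mu := (@lebesgue_measure R).

Let f x : R^o := \int[mu]_(s in `[0, 1]%classic) dot (w (x0 + s *: (x - x0))) (x - x0).

(** Uniform bounds on [w] and its derivatives, to dominate the integrand when differentiating under
    the integral. *)
Let local_ball : exists r M : R, [/\ 0 < r, 0 <= M &
  forall x, `|x - x0| < r -> [/\ smooth_at w x,
    forall u v, dot ('D_v w x) u = dot ('D_u w x) v &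
    forall u v, `|dot ('D_u w x) v| <= M * `|u| * `|v| /\ `|dot (w x) v| <= M * `|v|]].
Proof.
pose M := 1 + `|w x0| + \sum_i `|'D_(delta_mx ord0 i) w x0|.
have sw1 : \forall x \near x0, `|w x| <= M /\ forall i : 'I_n, `|'D_(delta_mx ord0 i) w x| <= M.
  near=> x; split.
    have : `|w x0 - w x| <= 1.
      by near: x; have /cvgrPdist_le := smooth_at_cont sw; apply.
    have := ler_normB (w x0) (w x0 - w x); rewrite opprB addrC subrK.
    have : 0 <= \sum_i `|'D_(delta_mx ord0 i) w x0| by apply: sumr_ge0.
    by rewrite /M; move: (\sum_i _) (`|w x0 - w x|) (`|w x|) (`|w x0|) => *; lra.
  near: x; apply: filter_forall => i; near=> x.
  have : `|'D_(delta_mx ord0 i) w x0 - 'D_(delta_mx ord0 i) w x| <= 1.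
    by near: x; have /cvgrPdist_le := smooth_at_cont (smooth_at_D (delta_mx ord0 i) sw); apply.
  have := ler_normB ('D_(delta_mx ord0 i) w x0) ('D_(delta_mx ord0 i) w x0 - 'D_(delta_mx ord0 i) w x).
  rewrite opprB addrC subrK.
  have : `|'D_(delta_mx ord0 i) w x0| <= \sum_i `|'D_(delta_mx ord0 i) w x0|.
    by rewrite (bigD1 i) //= lerDl sumr_ge0.
  have : 0 <= `|w x0| by [].
  rewrite /M; move: (`|'D_(delta_mx ord0 i) w x0 - 'D_(delta_mx ord0 i) w x|) (`|'D_(delta_mx ord0 i) w x|) (`|'D_(delta_mx ord0 i) w x0|) (\sum_i _) (`|w x0|) => *.
  lra.
have M0 : 0 <= M by rewrite /M !addr_ge0 // sumr_ge0.
have [r /= r0 H] := (@nbhs_normP _ _ x0 _).1 (filterI (filterI (smooth_at_near sw) wclosed) sw1).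
have dotb (u v : 'rV[R]_n) : `|dot u v| <= n%:R * `|u| * `|v|.
  rewrite dotE; apply: le_trans (ler_norm_sum _ _ _) _.
  apply: (@le_trans _ _ (\sum_(i < n) `|u| * `|v|)).
    apply: ler_sum => i _; rewrite normrM.
    have nb (y : 'rV[R]_n) : `|y ord0 i| <= `|y|.
      rewrite [leRHS]/Num.Def.normr /= mx_normrE.
      exact: (@le_bigmax _ _ _ _ (fun ij : 'I_1 * 'I_n => `|y ij.1 ij.2|) (ord0, i)).
    by apply: ler_pM.
  by rewrite sumr_const card_ord -[X in X <= _]mulr_natl mulrA.
exists r, (n%:R * (n%:R * M + M)); split => //.
  by rewrite mulr_ge0 // addr_ge0 // mulr_ge0.
move=> x xr; have [[sx cx] [b1 b2]] : (smooth_at w x /\ forall u v, dot ('D_v w x) u = dot ('D_u w x) v) /\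
   (`|w x| <= M /\ forall i : 'I_n, `|'D_(delta_mx ord0 i) w x| <= M).
  by apply: H; rewrite /= distrC.
split => // u v; split; apply: le_trans (dotb _ _) _.
  rewrite ler_wpM2r // -mulrA ler_wpM2l // jacE //.
  have -> : u *m jac w x = \sum_i u ord0 i *: 'D_(delta_mx ord0 i) w x.
    apply/rowP => j; rewrite summxE mxE; apply: eq_bigr => i _; by rewrite !mxE.
  apply: le_trans (ler_norm_sum _ _ _) _.
  apply: (@le_trans _ _ (\sum_(i < n) `|u| * M)).
    apply: ler_sum => i _; rewrite normrZ; apply: ler_pM => //.
    rewrite [leRHS]/Num.Def.normr /= mx_normrE.
    exact: (@le_bigmax _ _ _ _ (fun ij : 'I_1 * 'I_n => `|u ij.1 ij.2|) (ord0, i)).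
  rewrite sumr_const card_ord -[X in X <= _]mulr_natl.
  have : 0 <= M * `|u| by rewrite mulr_ge0.
  have -> : n%:R * (`|u| * M) = n%:R * M * `|u| by ring.
  by move=> hh; rewrite mulrDl lerDl.
rewrite ler_wpM2r // ler_wpM2l //.
by apply: le_trans b1 _; rewrite lerDr mulr_ge0.
Unshelve. all: by end_near. Qed.

(** The candidate is the integral of [w] over the segment from [x0] to [x]. By closedness the
    derivative of the integrand in the direction [v] equals the derivative in [s] of
    [s * <w(x0 + s (x - x0)), v>], and the fundamental theorem of calculus gives [<w x, v>]. *)
Lemma poincare : exists F : 'rV[R]_n -> R^o, [/\ F x0 = 0, smooth_at F x0 &
  \forall x \near x0, forall v, is_derive x v F (dot (w x) v)].
Proof.
have [r [M [r0 M0 H]]] := local_ball.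
exists f.
have f0 : f x0 = 0.
  rewrite /f subrr; under eq_Rintegral do rewrite /dot trmx0 mulmx0 mxE.
  by rewrite Rintegral_cst //= mul0r.
have Df x v : `|x - x0| < r -> is_derive x v f (dot (w x) v).
  move=> xr.
  pose h (t : R^o) := (x - x0) + (t : R) *: v.
  pose y t s := x0 + s *: h t.
  pose G (t s : R) : R := dot (w (y t s)) (h t).
  pose dG (t s : R) : R := s * dot ('D_v w (y t s)) (h t) + dot (w (y t s)) v.
  pose d := (r - `|x - x0|) / (`|v| + 1).
  have v1 : 0 < `|v| + 1 by rewrite ltr_wpDl.
  have d0 : 0 < d by rewrite divr_gt0 // subr_gt0.
  have hr t : `|t| < d -> `|h t| < r.
    rewrite ltr_pdivlMr // => td; rewrite /h.
    have := ler_normD (x - x0) (t *: v); rewrite normrZ.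
    by have : 0 <= `|t| by []; rewrite mulrDr mulr1 in td; lra.
  have yr t s : `|t| < d -> 0 <= s -> s <= 1 -> `|y t s - x0| < r.
    move=> td s0 s1; rewrite /y addrAC subrr add0r normrZ ger0_norm //.
    by apply: le_lt_trans (hr t td); rewrite ler_piMl.
  have DG t s : `|t| < d -> 0 <= s -> s <= 1 -> is_derive t (1 : R) (G ^~ s) (dG t s).
    move=> td s0 s1; have [sy _ _] := H _ (yr t s td s0 s1).
    have [sh dh] := smooth_at_affine (x - x0) v t.
    have yE : (y ^~ s : R^o -> 'rV[R]_n) = (fun t : R^o => (x0 + s *: (x - x0)) + (t : R) *: (s *: v)).
      apply/funext => z; rewrite /y /h scalerDr addrA; congr (_ + _).
      by rewrite !scalerA mulrC.
    have [sY dY] := smooth_at_affine (x0 + s *: (x - x0)) (s *: v) t.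
    rewrite -yE in sY dY.
    have [dc ec] := @smooth_at_chain _ _ _ _ _ _ _ w t (1 : R^o) sY sy.
    have swy : smooth_at (fun t : R^o => w (y t s)) t by exact: (smooth_at_comp sY sy).
    have := @is_derive_dot R R^o n _ _ t 1 swy sh.
    rewrite ec dh dY => D; rewrite /dG.
    have -> : s * dot ('D_v w (y t s)) (h t) = dot ('D_(s *: v) w (y t s)) (h t).
      by rewrite !jacE // -scalemxAl dotZl.
    exact: D.
  have cG t : `|t| < d -> {within `[0, 1], continuous (G t)}.
    move=> td; apply: derivable_within_continuous => s; rewrite in_itv /= => /andP[s0 s1].
    have [sy _ _] := H _ (yr t s td s0 s1).
    have [sY _] := smooth_at_affine x0 (h t) s.
    have swy : smooth_at (fun s : R^o => w (y t s)) s by exact: (smooth_at_comp sY sy).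
    have sG : smooth_at (G t : R^o -> R^o) s by apply: smooth_at_dot => //; exact: smooth_at_cst.
    exact: smooth_at_derivable sG.
  have iG t : t \in `](- d), d[%R -> mu.-integrable `[0, 1]%classic (EFin \o G t).
    rewrite in_itv /= => tt; apply: continuous_compact_integrable; first exact: segment_compact.
    by apply: cG; rewrite ltr_norml.
  have I0 : `](- d), d[%classic (0 : R) by rewrite /= in_itv /= oppr_lt0 d0.
  have K := @cvg_differentiation_under_integral R _ _ mu G `[0, 1]%classic _ 0 (- d) d I0 _ _ (fun=> M * `|v| * r + M * `|v|).
  have KK : h^-1 *: (f (h *: v + x) - f x) @[h --> 0^'] --> dot (w x) v.
    have EF (t : R) : f (t *: v + x) = \int[mu]_(s in `[0, 1]%classic) G t s.
      by rewrite /f /G /y /h [t *: v + x]addrC addrAC.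
    have EF0 : f x = \int[mu]_(s in `[0, 1]%classic) G 0 s.
      by rewrite -EF scale0r add0r.
    have -> : (fun t : R => t^-1 *: (f (t *: v + x) - f x)) =
      (fun t : R => t^-1 *: ((\int[mu]_(s in `[0, 1]%classic) G (t + 0) s) - \int[mu]_(s in `[0, 1]%classic) G 0 s)).
      by apply/funext => t; rewrite EF EF0 addr0.
    have d1G t s : t \in `](- d), d[%R -> s \in `[0, 1]%R -> is_derive t (1 : R) (G^~ s) (dG t s).
      rewrite !in_itv /= => tt /andP[s0 s1]; apply: DG => //.
      by rewrite ltr_norml.
    have P1 : partial1of2 G 0 = (fun s => 'D_1 (G^~ s) 0) by apply/funext => s; rewrite partial1of2E.
    have R1 : \int[mu]_(s in `[0, 1]%classic) partial1of2 G 0 s = dot (w x) v.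
      have E1 : {in `[0, 1]%classic, partial1of2 G 0 =1 dG 0}.
        move=> s; rewrite inE /= => s01; rewrite partial1of2E.
        by have [_] := d1G 0 s I0 s01.
      have -> : \int[mu]_(s in `[0, 1]%classic) partial1of2 G 0 s = \int[mu]_(s in `[0, 1]%classic) dG 0 s.
        by apply: eq_Rintegral => s sI; exact: E1.
      pose P (s : R) : R := s * dot (w (y 0 s)) v.
      have DP (s : R) : s \in `[0, 1]%R -> is_derive s (1 : R) P (dG 0 s).
        rewrite in_itv /= => /andP[s0 s1].
        have z0 : `|0 : R| < d by rewrite normr0.
        have [sy cy _] := H _ (yr 0 s z0 s0 s1).
        have [sY dY] := smooth_at_affine x0 (h 0) s.
        have [dc ec] := @smooth_at_chain _ _ _ _ _ _ _ w s (1 : R^o) sY sy.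
        have swy : smooth_at (fun s : R^o => w (y 0 s)) s by exact: (smooth_at_comp sY sy).
        have [da ea] := @is_derive_dot R R^o n _ (fun=> v) s 1 swy (smooth_at_cst _ _).
        have dI : derivable (id : R^o -> R^o) s 1 by exact: derivable_id.
        have := @scaleo_is_derive R R^o R^o id (fun s => dot (w (y 0 s)) v) s 1 (@cvg_id _ _) dI da.
        rewrite ea derive_id ec dY derive_cst (_ : dot _ 0 = 0) ?addr0; last by rewrite /dot trmx0 mulmx0 mxE.
        rewrite cy /dG [in X in is_derive _ _ _ X](_ : (1 : R) *: dot (w (y 0 s)) v = dot (w (y 0 s)) v); last exact: mul1r.
        by rewrite addrC.
      have cdG : {within `[0, 1], continuous (dG 0)}.
        apply: derivable_within_continuous => s; rewrite in_itv /= => /andP[s0 s1].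
        have z0 : `|0 : R| < d by rewrite normr0.
        have [sy cy _] := H _ (yr 0 s z0 s0 s1).
        have [sY _] := smooth_at_affine x0 (h 0) s.
        have s1y : smooth_at (fun s : R^o => w (y 0 s)) s by exact: (smooth_at_comp sY sy).
        have s2y : smooth_at (fun s : R^o => 'D_v w (y 0 s)) s by exact: (smooth_at_comp sY (smooth_at_D v sy)).
        have sB g u : smooth_at (g : R^o -> 'rV[R]_n) s -> smooth_at (fun s : R^o => dot (g s) u : R^o) s.
          by move=> sg; apply: smooth_at_dot => //; exact: smooth_at_cst.
        have : smooth_at (dG 0 : R^o -> R^o) s.
          apply: smooth_atD; last exact: sB.
          apply: smooth_atM; first exact: smooth_at_id.
          exact: sB.
        exact: smooth_at_derivable.
      have cP : {within `[0, 1], continuous P}.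
        by apply: derivable_within_continuous => s /DP [].
      have F2 := @continuous_FTC2 R (dG 0) P 0 1 ltr01 cdG.
      rewrite /Rintegral F2.
      - have -> : P 0 = 0 by rewrite /P mul0r.
        have -> : P 1 = dot (w x) v.
          by rewrite /P mul1r /y /h scale0r addr0 scale1r [x0 + _]addrC subrK.
        by rewrite /= subr0.
      - have [_ c0 c1] := (continuous_within_itvP P ltr01).1 cP.
        split; [|exact: c0|exact: c1] => s s01.
        exact: (@ex_derive _ _ _ _ _ _ _ (DP s (subset_itv_oo_cc s01))).
      - move=> s s01; rewrite derive1E.
        exact: (@derive_val _ _ _ _ _ _ _ (DP s (subset_itv_oo_cc s01))).
    rewrite -R1; apply: K => //.
    - by move=> t s tI sI; have [] := d1G t s tI sI.
    - by rewrite addr_ge0 // !mulr_ge0 // ltW.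
    - apply: continuous_compact_integrable; first exact: segment_compact.
      by apply: continuous_subspaceT; exact: cst_continuous.
    - move=> t s tI sI; rewrite partial1of2E; have [_ ->] := d1G t s tI sI.
      move: tI sI; rewrite /= !in_itv /= => tt /andP[s0 s1].
      have td : `|t| < d by rewrite ltr_norml.
      have [_ _ /(_ v (h t))[b1 _]] := H _ (yr t s td s0 s1).
      have [_ _ /(_ v v)[_ b2]] := H _ (yr t s td s0 s1).
      rewrite /dG; apply: le_trans (ler_normD _ _) _; apply: lerD => //.
      rewrite normrM ger0_norm //; apply: le_trans (_ : 1 * (M * `|v| * `|h t|) <= _).
        by apply: ler_pM.
      by rewrite mul1r ler_wpM2l ?mulr_ge0 // ltW // hr.
  by apply: DeriveDef; [apply/cvg_ex; eexists; exact: KK|exact: cvg_lim].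
have Dfn : \forall x \near x0, `|x - x0| < r.
  by apply/nbhs_normP; exists r => // x /=; rewrite distrC.
split => //; last by apply: filterS Dfn => x xr v; exact: Df.
have sdot v x : smooth_at w x -> smooth_at (fun y => dot (w y) v : R^o) x.
  by move=> sx; apply: smooth_at_dot => //; exact: smooth_at_cst.
apply: smooth_atI; apply: filterS (near_near Dfn) => x xn k.
(* Directional derivatives alone do not give continuity; here they are themselves continuous, so [f]
   is differentiable. *)
have cf : \forall y \near x, {for y, continuous f}.
  apply: filterS (near_near xn) => y yn.
  have [sy _ _] := H _ (nbhs_singleton yn).
  have [d _] : differentiable f y /\ strictly_diff f ('d f y) y.
    apply: strict_diff_at => v; first by apply: filterS yn => z zr; have [] := Df z v zr.
    apply: smooth_at_cont; apply: smooth_at_ext (sdot v y sy).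
    by apply: filterS yn => z zr; have [_ ->] := Df z v zr.
  exact: differentiable_continuous.
case: k => [|k]; first by apply: filterS cf => z cz; apply/Ck_at0.
apply: (@Ck_nearSI _ _ _ _ _ (fun v y => dot (w y) v : R^o)).
apply: filterS2 cf xn => y cy yr; split => //; split => v; first exact: Df.
by have [sy _ _] := H _ yr; apply: smooth_at_Ck_near; exact: sdot.
Qed.

End poincare.

(** * Manifolds and plots *)

Section charts.
Context {R : realType} {n : nat} {M : topologicalType}.

Lemma cod_near (c : chart R n M) (x : 'rV[R]_n) : cod c x -> \forall y \near x, cod c y.
Proof. by move=> cx; apply: open_nbhs_nbhs; split => //; exact: cod_open. Qed.

Lemma transition_open (c d : chart R n M) : open [set x | cod c x /\ dom d (point c x)].
Proof.
rewrite openE => x [cx dx]; rewrite /interior.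
have n1 : \forall y \near x, cod c y by exact: (cod_near cx).
have n2 : \forall y \near x, dom d (point c y).
  by apply: (point_continuous cx); exact: (open_nbhs_nbhs (conj (dom_open d) dx)).
exact: filterS2 n1 n2.
Qed.

Lemma dom_near (c : chart R n M) (T : topologicalType) (f : T -> M) t :
  {for t, continuous f} -> dom c (f t) -> \forall s \near t, dom c (f s).
Proof. by move=> cf dc; apply: cf; exact: (open_nbhs_nbhs (conj (dom_open c) dc)). Qed.

End charts.

Section plots.
Context {R : realType} {V : normedModType R} {n : nat} {M : manifoldType R n}.
Implicit Types (f : V -> M) (x : V).

(* Maps between manifolds are only differentiated after composition with plots, so that the chain
   rule is always that of normed spaces. *)
Definition plot_at f x := (\forall y \near x, {for y, continuous f}) /\
  forall c : chart R n M, atlas c -> dom c (f x) -> smooth_at (coord c \o f) x.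

Lemma transition_smooth (c d : chart R n M) (x : 'rV[R]_n) : atlas c -> atlas d -> cod c x -> dom d (point c x) ->
  smooth_at (coord d \o point c) x.
Proof.
move=> ac ad cx dx; have oU : open [set x | cod c x /\ dom d (point c x)] by exact: transition_open.
have := atlas_compatible c d ac ad.
by move/(smooth_on_at _ oU); apply.
Qed.

(** One chart around [f x] is enough, the transition maps being smooth. *)
Lemma plot_atI (c : chart R n M) f x : atlas c -> dom c (f x) -> (\forall y \near x, {for y, continuous f}) ->
  smooth_at (coord c \o f) x -> plot_at f x.
Proof.
move=> ac dc cf sc; split => // d ad dd.
apply: (@smooth_at_ext _ _ _ ((coord d \o point c) \o (coord c \o f))).
  by apply: filterS (dom_near (nbhs_singleton cf) dc) => y dy /=; rewrite coordK.
apply: (smooth_at_comp sc); apply: transition_smooth => //; first exact: coord_cod.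
by rewrite /= coordK.
Qed.

Lemma plot_at_near f x : plot_at f x -> \forall y \near x, plot_at f y.
Proof.
move=> [cf sf]; pose c := chart_at (f x).
have dc : dom c (f x) := chart_at_dom _.
have sc := sf c (chart_at_atlas _) dc.
apply: filterS3 (near_near cf) (smooth_at_near sc) (dom_near (nbhs_singleton cf) dc) => y cy sy dy.
exact: (plot_atI (chart_at_atlas (f x))).
Qed.

Lemma plot_at_cont f x : plot_at f x -> {for x, continuous f}.
Proof. by move=> [/nbhs_singleton]. Qed.

Lemma plot_at_ext f g x : (\forall y \near x, f y = g y) -> plot_at f x -> plot_at g x.
Proof.
move=> fg [cf sf]; split.
  apply: filterS2 (near_near fg) cf => y fgy cy.
  rewrite /prop_for /continuous_at -(nbhs_singleton fgy).
  by apply: cvg_trans cy; apply: near_eq_cvg; apply: filterS fgy => z ->.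
move=> c ac; rewrite -(nbhs_singleton fg) => dc.
by apply: smooth_at_ext (sf c ac dc); apply: filterS fg => y /= ->.
Qed.

Lemma plot_at_cst (p : M) x : plot_at (fun=> p) x.
Proof.
split; first by apply: filterE => y; exact: cst_continuous.
by move=> c _ _; exact: smooth_at_cst.
Qed.

Lemma plot_at_coord (c : chart R n M) f x : atlas c -> dom c (f x) -> plot_at f x -> smooth_at (fun y => coord c (f y)) x.
Proof. by move=> ac dc [_ /(_ c ac dc)]. Qed.

End plots.

Lemma plot_at_point (R : realType) n (M : manifoldType R n) (c : chart R n M) x :
  atlas c -> cod c x -> plot_at (point c) x.
Proof.
move=> ac cx; apply: (plot_atI ac); first exact: point_dom.
  have : \forall y \near x, cod c y by exact: (cod_near cx).
  by apply: filterS => y cy; exact: point_continuous.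
apply: (@smooth_at_ext _ _ _ id); last exact: smooth_at_id.
have : \forall y \near x, cod c y by exact: (cod_near cx).
by apply: filterS => y cy /=; rewrite pointK.
Qed.

Lemma plot_at_comp (R : realType) (U V : normedModType R) {FV : FinDim V} n (M : manifoldType R n)
  (g : U -> V) (f : V -> M) x : smooth_at g x -> plot_at f (g x) -> plot_at (fun y => f (g y)) x.
Proof.
move=> sg pf; have := plot_at_near pf => pfn; split.
  have gn : \forall y \near x, plot_at f (g y) by exact: (smooth_at_cont sg pfn).
  apply: filterS2 (smooth_at_near sg) gn => y sy py.
  by apply: (@continuous_comp _ _ _ g f); [exact: smooth_at_cont|exact: plot_at_cont].
move=> c ac dc; exact: (smooth_at_comp sg (pf.2 c ac dc)).
Qed.

Section smooth_maps.
Context {R : realType} {V : normedModType R} {n m k : nat}.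
Context {M : manifoldType R n} {P : manifoldType R m} {Q : manifoldType R k}.

Lemma smooth_plot (F : M -> P) (f : V -> M) x : smooth F -> plot_at f x -> plot_at (fun y => F (f y)) x.
Proof.
move=> [cF sF] pf; pose c := chart_at (f x); pose d := chart_at (F (f x)).
have dc : dom c (f x) := chart_at_dom _; have dd : dom d (F (f x)) := chart_at_dom _.
have sc := pf.2 c (chart_at_atlas _) dc.
have cc := plot_at_cont pf.
apply: (@plot_atI _ _ _ _ d) => //; first exact: chart_at_atlas.
  by apply: filterS pf.1 => y cy; apply: (@continuous_comp _ _ _ f F) => //; exact: cF.
apply: (@smooth_at_ext _ _ _ (fun y => (coord d \o F \o point c) (coord c (f y)))).
  by apply: filterS (dom_near cc dc) => y dy /=; rewrite coordK.
apply: (smooth_at_comp sc).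
have oU : open [set x | cod c x /\ dom d (F (point c x))].
  rewrite openE => y [cy dy]; rewrite /interior.
  have n1 : \forall z \near y, cod c z by exact: (cod_near cy).
  have n2 : \forall z \near y, dom d (F (point c z)).
    apply: (@dom_near _ _ _ _ _ (fun z => F (point c z))) => //.
    by apply: (@continuous_comp _ _ _ (point c) F); [exact: point_continuous|exact: cF].
  exact: filterS2 n1 n2.
have := sF c d (chart_at_atlas _) (chart_at_atlas _).
move/(smooth_on_at _ oU); apply; split; first exact: coord_cod.
by rewrite coordK.
Qed.

Lemma smooth2_plot (F : M -> P -> Q) (f : V -> M) (g : V -> P) x : smooth2 F ->
  plot_at f x -> plot_at g x -> plot_at (fun y => F (f y) (g y)) x.
Proof.
move=> [cF sF] pf pg.
pose c := chart_at (f x); pose d := chart_at (g x); pose e := chart_at (F (f x) (g x)).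
have dc : dom c (f x) := chart_at_dom _; have dd : dom d (g x) := chart_at_dom _.
have de : dom e (F (f x) (g x)) := chart_at_dom _.
have sc := pf.2 c (chart_at_atlas _) dc; have sd := pg.2 d (chart_at_atlas _) dd.
have cfg y : {for y, continuous f} -> {for y, continuous g} -> {for y, continuous (fun z => F (f z) (g z))}.
  move=> c1 c2; apply: (@continuous_comp _ _ _ (fun z => (f z, g z)) (fun p => F p.1 p.2)); last exact: cF.
  by apply: cvg_pair; [exact: c1|exact: c2].
apply: (@plot_atI _ _ _ _ e) => //; first exact: chart_at_atlas.
  by apply: filterS2 pf.1 pg.1 => y; exact: cfg.
have oU : open [set x : 'rV[R]_n * 'rV[R]_m | [/\ cod c x.1, cod d x.2 & dom e (F (point c x.1) (point d x.2))]].
  rewrite openE => y [cy dy ey]; rewrite /interior.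
  have c1 : {for y, continuous (fun z : 'rV[R]_n * 'rV[R]_m => point c z.1)}.
    by apply: (@continuous_comp _ _ _ fst (point c)); [exact: cvg_fst|exact: point_continuous].
  have c2 : {for y, continuous (fun z : 'rV[R]_n * 'rV[R]_m => point d z.2)}.
    by apply: (@continuous_comp _ _ _ snd (point d)); [exact: cvg_snd|exact: point_continuous].
  have n1 : \forall z \near y, cod c z.1.
    by apply: (@cvg_fst _ _ (nbhs y.1) (nbhs y.2) _); exact: (cod_near cy).
  have n2 : \forall z \near y, cod d z.2.
    by apply: (@cvg_snd _ _ (nbhs y.1) (nbhs y.2) _); exact: (cod_near dy).
  have n3 : \forall z \near y, dom e (F (point c z.1) (point d z.2)).
    apply: (@dom_near _ _ _ _ _ (fun z : 'rV[R]_n * 'rV[R]_m => F (point c z.1) (point d z.2))) => //.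
    apply: (@continuous_comp _ _ _ (fun z : 'rV[R]_n * 'rV[R]_m => (point c z.1, point d z.2)) (fun p => F p.1 p.2)); last exact: cF.
    by apply: cvg_pair; [exact: c1|exact: c2].
  by apply: filterS3 n1 n2 n3 => z.
have H : smooth_at (fun z : 'rV[R]_n * 'rV[R]_m => coord e (F (point c z.1) (point d z.2))) (coord c (f x), coord d (g x)).
  have := sF c d e (chart_at_atlas _) (chart_at_atlas _) (chart_at_atlas _).
  move/(smooth_on_at _ oU); apply; split => /=; try exact: coord_cod.
  by rewrite !coordK.
have K : smooth_at (fun y => coord e (F (point c (coord c (f y))) (point d (coord d (g y))))) x.
  by exact: (smooth_at_comp (smooth_at_pair sc sd) H).
apply: smooth_at_ext K.
apply: filterS2 (dom_near (plot_at_cont pf) dc) (dom_near (plot_at_cont pg) dd) => y d1 d2 /=.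
by rewrite !coordK.
Qed.

(** Smoothness in the sense of charts is recovered from plots by testing on the inverses of the
    charts. *)
Lemma plots_smooth (F : M -> P) :
  (forall (c : chart R n M) x, atlas c -> cod c x -> plot_at (fun y => F (point c y)) x) -> smooth F.
Proof.
move=> H; have cF : continuous F.
  move=> p; pose c := chart_at p; have dp : dom c p := chart_at_dom p.
  have := plot_at_cont (H c _ (chart_at_atlas p) (coord_cod dp)) => cf.
  have : {for p, continuous (fun q => F (point c (coord c q)))}.
    by apply: (@continuous_comp _ _ _ (coord c) (fun y => F (point c y))); [exact: coord_continuous|exact: cf].
  rewrite /prop_for /continuous_at coordK // => h; apply: cvg_trans h.
  apply: near_eq_cvg; have := open_nbhs_nbhs (conj (dom_open c) dp).
  by apply: filterS => q dq; rewrite coordK.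
split => // c d ac ad.
have oU : open [set x | cod c x /\ dom d (F (point c x))].
  rewrite openE => y [cy dy]; rewrite /interior.
  have n1 : \forall z \near y, cod c z by exact: (cod_near cy).
  have n2 : \forall z \near y, dom d (F (point c z)).
    apply: (@dom_near _ _ _ _ _ (fun z => F (point c z))) => //.
    by apply: (@continuous_comp _ _ _ (point c) F); [exact: point_continuous|exact: cF].
  exact: filterS2 n1 n2.
apply/(smooth_on_at _ oU) => x [cx dx].
exact: (H c x ac cx).2.
Qed.

Lemma plots_smooth2 (F : M -> P -> Q) :
  (forall (c : chart R n M) (d : chart R m P) (z : 'rV[R]_n * 'rV[R]_m), atlas c -> atlas d -> cod c z.1 -> cod d z.2 ->
    plot_at (fun y : 'rV[R]_n * 'rV[R]_m => F (point c y.1) (point d y.2)) z) -> smooth2 F.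
Proof.
move=> H; have cF : continuous (fun p : M * P => F p.1 p.2).
  move=> [p q]; pose c := chart_at p; have dp : dom c p := chart_at_dom p.
  pose d := chart_at q; have dq : dom d q := chart_at_dom q.
  have cf := plot_at_cont (H c d (coord c p, coord d q) (chart_at_atlas p) (chart_at_atlas q) (coord_cod dp) (coord_cod dq)).
  have : {for (p, q), continuous (fun z : M * P => F (point c (coord c z.1)) (point d (coord d z.2)))}.
    apply: (@continuous_comp _ _ _ (fun z : M * P => (coord c z.1, coord d z.2)) (fun y => F (point c y.1) (point d y.2))); last exact: cf.
    have c1 : {for (p, q), continuous (fun z : M * P => coord c z.1)}.
      by apply: (@continuous_comp _ _ _ fst (coord c)); [exact: cvg_fst|exact: coord_continuous].
    have c2 : {for (p, q), continuous (fun z : M * P => coord d z.2)}.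
      by apply: (@continuous_comp _ _ _ snd (coord d)); [exact: cvg_snd|exact: coord_continuous].
    exact: (cvg_pair c1 c2).
  rewrite /prop_for /continuous_at /= !coordK // => h; apply: cvg_trans h.
  apply: near_eq_cvg.
  exists (dom c, dom d) => /=; first by split; [exact: (open_nbhs_nbhs (conj (dom_open c) dp))|exact: (open_nbhs_nbhs (conj (dom_open d) dq))].
  by move=> [a b] /= [da db]; rewrite !coordK.
split => // c d e ac ad ae.
have oU : open [set x : 'rV[R]_n * 'rV[R]_m | [/\ cod c x.1, cod d x.2 & dom e (F (point c x.1) (point d x.2))]].
  rewrite openE => y [cy dy ey]; rewrite /interior.
  have n1 : \forall z \near y, cod c z.1.
    by apply: (@cvg_fst _ _ (nbhs y.1) (nbhs y.2) _); exact: (cod_near cy).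
  have n2 : \forall z \near y, cod d z.2.
    by apply: (@cvg_snd _ _ (nbhs y.1) (nbhs y.2) _); exact: (cod_near dy).
  have n3 : \forall z \near y, dom e (F (point c z.1) (point d z.2)).
    apply: (@dom_near _ _ _ _ _ (fun z : 'rV[R]_n * 'rV[R]_m => F (point c z.1) (point d z.2))) => //.
    exact: plot_at_cont (H c d y ac ad cy dy).
  by apply: filterS3 n1 n2 n3 => z.
apply/(smooth_on_at _ oU) => x [cx dx ex].
exact: (H c d x ac ad cx dx).2.
Qed.

End smooth_maps.

Definition vel (R : realType) (V : normedModType R) n (M : manifoldType R n) (f : V -> M) x v : 'rV[R]_n :=
  'D_v (fun y => coord (chart_at (f x)) (f y)) x.

Section velocity.
Context {R : realType} {V : normedModType R} {n m : nat}.
Context {M : manifoldType R n} {P : manifoldType R m}.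

(** The chain rule through the chart at [f x]: differentials can henceforth be computed along any
    plot with the right velocity. *)
Lemma tangent_map_vel (F : M -> P) (f : V -> M) x v : smooth F -> plot_at f x ->
  tangent_map F (f x) (vel f x v) = vel (fun y => F (f y)) x v.
Proof.
move=> sF pf; rewrite /tangent_map /vel; set c := chart_at (f x); set d := chart_at (F (f x)).
have dc : dom c (f x) := chart_at_dom _; have dd : dom d (F (f x)) := chart_at_dom _.
have sc := plot_at_coord (chart_at_atlas _) dc pf.
have pF : plot_at (fun y => F (point c y)) (coord c (f x)).
  by apply: smooth_plot => //; apply: plot_at_point (chart_at_atlas _) (coord_cod dc).
have sd : smooth_at (fun y => coord d (F (point c y))) (coord c (f x)).
  by apply: (plot_at_coord (chart_at_atlas _)) pF => /=; rewrite coordK.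
have [_ E] := smooth_at_chain v sc sd.
rewrite -[coord d \o _ \o _]/(fun y => coord d (F (point c y))) -E.
apply: near_eq_derive; apply: filterS (dom_near (plot_at_cont pf) dc) => y dy.
by rewrite coordK.
Qed.

End velocity.

Section partial.
Context {R : realType} {V W X : normedModType R}.

Lemma derive_p1 (f : V * W -> X) x y v : 'D_v (fun x => f (x, y)) x = 'D_(v, 0) f (x, y).
Proof.
rewrite /derive; set a := (fun h => _); set b := (fun h => _).
suff -> : a = b by []; apply/funext => h; rewrite /a /b /=.
by congr (_ *: (f _ - _)); congr pair; rewrite /= scaler0 add0r.
Qed.

Lemma derive_p2 (f : V * W -> X) x y w : 'D_w (fun y => f (x, y)) y = 'D_(0, w) f (x, y).
Proof.
rewrite /derive; set a := (fun h => _); set b := (fun h => _).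
suff -> : a = b by []; apply/funext => h; rewrite /a /b /=.
by congr (_ *: (f _ - _)); congr pair; rewrite /= scaler0 add0r.
Qed.

Lemma smooth_at_pair1 {FV : FinDim V} {FW : FinDim W} (x : V) (y : W) : smooth_at (fun x : V => (x, y)) x.
Proof. by apply: smooth_at_pair; [exact: smooth_at_id|exact: smooth_at_cst]. Qed.

Lemma smooth_at_pair2 {FV : FinDim V} {FW : FinDim W} (x : V) (y : W) : smooth_at (fun y : W => (x, y)) y.
Proof. by apply: smooth_at_pair; [exact: smooth_at_cst|exact: smooth_at_id]. Qed.

Lemma smooth_at_p1 {FV : FinDim V} {FW : FinDim W} {FX : FinDim X} (f : V * W -> X) x y :
  smooth_at f (x, y) -> smooth_at (fun x => f (x, y)) x.
Proof. by move=> sf; exact: (smooth_at_comp (smooth_at_pair1 x y) sf). Qed.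

Lemma smooth_at_p2 {FV : FinDim V} {FW : FinDim W} {FX : FinDim X} (f : V * W -> X) x y :
  smooth_at f (x, y) -> smooth_at (fun y => f (x, y)) y.
Proof. by move=> sf; exact: (smooth_at_comp (smooth_at_pair2 x y) sf). Qed.

Lemma smooth_at_fst {FV : FinDim V} {FW : FinDim W} (z : V * W) : smooth_at fst z.
Proof. exact: (@smooth_at_lin _ _ _ _ _ (mklin (@fst_is_linear R V W)) id z (smooth_at_id z)). Qed.

Lemma smooth_at_snd {FV : FinDim V} {FW : FinDim W} (z : V * W) : smooth_at snd z.
Proof. exact: (@smooth_at_lin _ _ _ _ _ (mklin (@snd_is_linear R V W)) id z (smooth_at_id z)). Qed.

(** The direction [L y] varies with the point: one term comes from varying the direction, the other
    from varying the base point. Derivatives along left-invariant fields are differentiated in this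
    way. *)
Lemma derive_along {FV : FinDim V} {FX : FinDim X} (L : W -> V) (g : W -> V) (F : V -> X) x w :
  smooth_at L x -> smooth_at g x -> smooth_at F (g x) ->
  smooth_at (fun y => 'D_(L y) F (g y)) x /\
  'D_w (fun y => 'D_(L y) F (g y)) x = 'D_('D_w L x) F (g x) + 'D_('D_w g x) ('D_(L x) F) (g x).
Proof.
move=> sL sg sF.
have gn : \forall y \near x, smooth_at F (g y) by exact: (smooth_at_cont sg (smooth_at_near sF)).
have E : \forall y \near x, \sum_i (fd_c i (L y) : R) *: 'D_(fd_e i) F (g y) = 'D_(L y) F (g y).
  by apply: filterS gn => y sy; rewrite deriveE ?diff_lincomb //; exact: smooth_at_diff.
have s1 i : smooth_at (fun y => fd_c i (L y) : R^o) x by exact: smooth_at_lin.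
have s2 i : smooth_at (fun y => 'D_(fd_e i) F (g y)) x by exact: (smooth_at_comp sg (smooth_at_D (fd_e i) sF)).
split.
  by apply: smooth_at_ext E _; apply: smooth_at_sum => i; exact: smooth_atZ.
rewrite -(near_eq_derive _ E).
have -> : (fun y => \sum_i (fd_c i (L y) : R) *: 'D_(fd_e i) F (g y)) =
   \sum_i (fun y => (fd_c i (L y) : R) *: 'D_(fd_e i) F (g y)) by apply/funext => y; rewrite fct_sumE.
have D i : is_derive x w (fun y => (fd_c i (L y) : R) *: 'D_(fd_e i) F (g y))
    ((fd_c i ('D_w L x) : R) *: 'D_(fd_e i) F (g x) + (fd_c i (L x) : R) *: 'D_('D_w g x) ('D_(fd_e i) F) (g x)).
  have [d1 e1] := derivable_lin (@fd_cont _ _ FV i) (smooth_at_derivable w sL).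
  have [d2 e2] := smooth_at_chain w sg (smooth_at_D (fd_e i) sF).
  by have := scaleo_is_derive (smooth_at_cont (s1 i)) d1 d2; rewrite e1 e2.
have [_ ->] := is_derive_sum D.
rewrite big_split /=; congr (_ + _).
  by rewrite [RHS]deriveE ?diff_lincomb //; exact: smooth_at_diff.
have E2 : \forall z \near g x, \sum_i (fd_c i (L x) : R) *: 'D_(fd_e i) F z = 'D_(L x) F z.
  by apply: filterS (smooth_at_near sF) => z sz; rewrite deriveE ?diff_lincomb //; exact: smooth_at_diff.
rewrite -(near_eq_derive _ E2).
have -> : (fun z => \sum_i (fd_c i (L x) : R) *: 'D_(fd_e i) F z) =
   \sum_i (fun z => (fd_c i (L x) : R) *: 'D_(fd_e i) F z) by apply/funext => z; rewrite fct_sumE.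
have D' i : is_derive (g x) ('D_w g x) (fun z => (fd_c i (L x) : R) *: 'D_(fd_e i) F z)
    ((fd_c i (L x) : R) *: 'D_('D_w g x) ('D_(fd_e i) F) (g x)).
  exact: is_deriveZ (derivableP (smooth_at_derivable _ (smooth_at_D _ sF))).
by have [_ ->] := is_derive_sum D'.
Qed.

End partial.

(** * Lie groups in the chart at the identity *)

Notation lchart N := (chart_at (1%g : N)).
Notation lco N := (coord (lchart N)).
Notation lpt N := (point (lchart N)).
Notation le0 N := (coord (lchart N) (1%g : N)).

Lemma addr_cancel (V : zmodType) (a b c : V) : a + b - (c + b) = - c + a.
Proof. by rewrite opprD addrACA subrr addr0 addrC. Qed.

Lemma addr_reorder (V : zmodType) (a b c d : V) : a - b - (c - d) = a - b - c + d.
Proof. by rewrite opprB addrA addrAC. Qed.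

Lemma smooth_atB (R : realType) (V W : normedModType R) (f g : V -> W) x :
  smooth_at f x -> smooth_at g x -> smooth_at (fun y => f y - g y) x.
Proof.
move=> sf sg; apply: smooth_atD => //.
have : smooth_at (fun y => (fun=> -1 : R^o) y *: g y) x by apply: smooth_atZ => //; exact: smooth_at_cst.
by apply: smooth_at_ext; apply: filterE => y; rewrite scaleN1r.
Qed.

Lemma jacobi_sum (R : realType) (n : nat) (a b c d e f : 'rV[R]_n) :
  -1 *: (a - b - c + d) + (d - e - f + a) = c - f - e + b.
Proof. by apply/rowP => i; rewrite !mxE; ring. Qed.

Lemma smooth_at_chainE (R : realType) (U V W : normedModType R) {FV : FinDim V} {FW : FinDim W}
  (f : U -> V) (g : V -> W) x v : smooth_at f x -> smooth_at g (f x) ->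
  'D_v (fun y => g (f y)) x = 'D_('D_v f x) g (f x).
Proof. by move=> sf sg; have [] := smooth_at_chain v sf sg. Qed.

Lemma derive_pair (R : realType) (U V W : normedModType R) {FV : FinDim V} {FW : FinDim W}
  (f : U -> V) (g : U -> W) x v : smooth_at f x -> smooth_at g x ->
  'D_v (fun y => (f y, g y)) x = ('D_v f x, 'D_v g x).
Proof.
move=> sf sg; have sp : smooth_at (fun y => (f y, g y)) x by exact: smooth_at_pair.
rewrite [LHS]surjective_pairing; congr pair.
  have c1 : continuous (mklin (@fst_is_linear R V W)) by move=> z; exact: cvg_fst.
  by have [_ <-] := derivable_lin c1 (smooth_at_derivable v sp).
have c2 : continuous (mklin (@snd_is_linear R V W)) by move=> z; exact: cvg_snd.
by have [_ <-] := derivable_lin c2 (smooth_at_derivable v sp).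
Qed.

Lemma derive_split (R : realType) (V W X : normedModType R) {FV : FinDim V} {FW : FinDim W} {FX : FinDim X}
  (F : V * W -> X) z v w : smooth_at F z -> 'D_(v, w) F z = 'D_(v, 0) F z + 'D_(0, w) F z.
Proof.
move=> sF; have -> : (v, w) = 1 *: (v, 0) + (0, w) :> V * W.
  by rewrite scale1r; congr pair; rewrite /= ?addr0 ?add0r.
by rewrite smooth_at_DD // scale1r.
Qed.

(* Unification would otherwise unfold these limits. *)
#[local] Opaque derive.
#[local] Opaque lie_bracket.

Section local.
Context {R : realType} {n : nat} {N : lieGroupType R n}.
Local Notation co := (lco N).
Local Notation pt := (lpt N).
Local Notation e0 := (le0 N).
Local Notation c := (lchart N).
Implicit Types (u v w X Y Z : 'rV[R]_n).

Lemma dom1 : dom c 1%g. Proof. exact: chart_at_dom. Qed.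
Lemma cod1 : cod c e0. Proof. exact/coord_cod/dom1. Qed.
Lemma pt1 : pt e0 = 1%g. Proof. exact/coordK/dom1. Qed.

Lemma plot_mul (V : normedModType R) (f g : V -> N) x :
  plot_at f x -> plot_at g x -> plot_at (fun y => f y * g y)%g x.
Proof. by apply: smooth2_plot; exact: lie_mul_smooth. Qed.

Lemma plot_inv (V : normedModType R) (f : V -> N) x : plot_at f x -> plot_at (fun y => (f y)^-1)%g x.
Proof. by apply: smooth_plot; exact: lie_inv_smooth. Qed.

Lemma plot_pt u : cod c u -> plot_at pt u.
Proof. by apply: plot_at_point; exact: chart_at_atlas. Qed.

Lemma plot_pt_comp (V : normedModType R) (f : V -> 'rV[R]_n) x : smooth_at f x -> cod c (f x) ->
  plot_at (fun y => pt (f y)) x.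
Proof. by move=> sf cf; apply: (plot_at_comp sf); exact: plot_pt. Qed.

Lemma plot_co (V : normedModType R) (f : V -> N) x : plot_at f x -> dom c (f x) ->
  smooth_at (fun y => co (f y)) x.
Proof. by move=> pf df; apply: plot_at_coord => //; exact: chart_at_atlas. Qed.

(* The velocity of [f] when [f x = 1]; meaningless otherwise. *)
Definition evel (V : normedModType R) (f : V -> N) (x v : V) : 'rV[R]_n := 'D_v (fun y => co (f y)) x.

Lemma evel_vel (V : normedModType R) (f : V -> N) (x v : V) : f x = 1%g -> vel f x v = evel f x v.
Proof. by rewrite /vel => ->. Qed.

Lemma evel_ext (V : normedModType R) (f g : V -> N) (x v : V) : (\forall y \near x, f y = g y) ->
  evel f x v = evel g x v.
Proof. by move=> fg; apply: near_eq_derive; apply: filterS fg => y ->. Qed.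

Lemma smooth1 (V : normedModType R) (f : V -> N) (x : V) : plot_at f x -> f x = 1%g ->
  smooth_at (fun y => co (f y)) x.
Proof. by move=> pf fx; apply: plot_co => //; rewrite fx; exact: dom1. Qed.

Lemma evel_comp (U V : normedModType R) {FV : FinDim V} (g : U -> V) (f : V -> N) (x v : U) :
  smooth_at g x -> plot_at f (g x) -> f (g x) = 1%g ->
  evel (fun y => f (g y)) x v = evel f (g x) ('D_v g x).
Proof. by move=> sg pf f1; apply: (smooth_at_chainE v sg); exact: smooth1. Qed.

Lemma evel_cst (V : normedModType R) (p : N) (x v : V) : evel (fun=> p) x v = 0.
Proof. by rewrite /evel derive_cst. Qed.

Definition mu (z : 'rV[R]_n * 'rV[R]_n) := co (pt z.1 * pt z.2)%g.

Lemma smooth_mu u v : cod c u -> cod c v -> dom c (pt u * pt v)%g -> smooth_at mu (u, v).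
Proof.
move=> cu cv d; apply: plot_co => //; apply: plot_mul.
  by apply: plot_pt_comp => //; exact: smooth_at_fst.
by apply: plot_pt_comp => //; exact: smooth_at_snd.
Qed.

Lemma smooth_mu0 u : cod c u -> smooth_at mu (u, e0).
Proof. by move=> cu; apply: smooth_mu => //; rewrite ?pt1 ?mulg1; [exact: cod1|exact: point_dom]. Qed.

Lemma smooth_mu0l u : cod c u -> smooth_at mu (e0, u).
Proof. by move=> cu; apply: smooth_mu => //; rewrite ?pt1 ?mul1g; [exact: cod1|exact: point_dom]. Qed.

Lemma mu0 u : cod c u -> mu (u, e0) = u.
Proof. by move=> cu; rewrite /mu /= pt1 mulg1 pointK. Qed.

Lemma mu0l u : cod c u -> mu (e0, u) = u.
Proof. by move=> cu; rewrite /mu /= pt1 mul1g pointK. Qed.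

Lemma cod_near1 : \forall u \near e0, cod c u.
Proof. exact: cod_near cod1. Qed.

Lemma D_mu1 u X : cod c u -> 'D_(X, 0) mu (u, e0) = X.
Proof.
move=> cu; rewrite -derive_p1; have /near_eq_derive -> : \forall y \near u, mu (y, e0) = y.
  by apply: filterS (cod_near cu) => y; exact: mu0.
exact: derive_id.
Qed.

Lemma D_mu2 u X : cod c u -> 'D_(0, X) mu (e0, u) = X.
Proof.
move=> cu; rewrite -derive_p2; have /near_eq_derive -> : \forall y \near u, mu (e0, y) = y.
  by apply: filterS (cod_near cu) => y; exact: mu0l.
exact: derive_id.
Qed.

Lemma evel_mul (V : normedModType R) (f g : V -> N) (x v : V) : plot_at f x -> plot_at g x ->
  f x = 1%g -> g x = 1%g -> evel (fun y => f y * g y)%g x v = evel f x v + evel g x v.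
Proof.
move=> pf pg f1 g1; have sf := smooth1 pf f1; have sg := smooth1 pg g1.
have E : \forall y \near x, mu (co (f y), co (g y)) = co (f y * g y)%g.
  have d1 : dom c (f x) by rewrite f1; exact: dom1.
  have d2 : dom c (g x) by rewrite g1; exact: dom1.
  apply: filterS2 (dom_near (plot_at_cont pf) d1) (dom_near (plot_at_cont pg) d2) => y a b.
  by rewrite /mu /= !coordK.
rewrite /evel -(near_eq_derive v E).
have sm : smooth_at mu (co (f x), co (g x)) by rewrite f1 g1; apply: smooth_mu0; exact: cod1.
have sp : smooth_at (fun y => (co (f y), co (g y))) x by exact: smooth_at_pair.
rewrite (smooth_at_chainE v sp sm) derive_pair // f1 g1 derive_split; last by apply: smooth_mu0; exact: cod1.
by rewrite D_mu1 ?D_mu2 //; exact: cod1.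
Qed.

Lemma evel_inv (V : normedModType R) (f : V -> N) (x v : V) : plot_at f x -> f x = 1%g ->
  evel (fun y => (f y)^-1)%g x v = - evel f x v.
Proof.
move=> pf f1; apply/eqP; rewrite -addr_eq0 addrC -evel_mul //; last 2 first.
- exact: plot_inv.
- by rewrite f1 invg1.
by under eq_fun do rewrite mulgV; rewrite evel_cst.
Qed.

Lemma evel_linear (V : normedModType R) {FV : FinDim V} (f : V -> N) (x : V) a (v w : V) : plot_at f x -> f x = 1%g ->
  evel f x (a *: v + w) = a *: evel f x v + evel f x w.
Proof. by move=> pf f1; apply: smooth_at_DD; exact: smooth1. Qed.

Lemma conj_smooth (a : N) : smooth (fun x : N => a * x * a^-1)%g.
Proof.
apply: plots_smooth => d x ad dx.
apply: plot_mul; last exact: plot_at_cst.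
by apply: plot_mul; [exact: plot_at_cst|exact: plot_at_point].
Qed.

Lemma evel_conj (V : normedModType R) (a : N) (f : V -> N) (x v : V) : plot_at f x -> f x = 1%g ->
  evel (fun y => a * f y * a^-1)%g x v = Ad a (evel f x v).
Proof.
move=> pf f1; have E := tangent_map_vel v (conj_smooth a) pf.
have E1 : vel (fun y => a * f y * a^-1)%g x v = evel (fun y => a * f y * a^-1)%g x v.
  by apply: evel_vel; rewrite f1 mulg1 mulgV.
by rewrite -E1 -E (evel_vel v f1) f1.
Qed.

Lemma evel_pt X : evel pt e0 X = X.
Proof.
rewrite /evel; have /near_eq_derive -> : \forall y \near e0, co (pt y) = y.
  by apply: filterS cod_near1 => y cy; rewrite pointK.
exact: derive_id.
Qed.

Lemma AdE (a : N) X : Ad a X = evel (fun y => a * pt y * a^-1)%g e0 X.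
Proof. by rewrite evel_conj ?evel_pt ?pt1 //; apply: plot_pt; exact: cod1. Qed.

Lemma Ad_linear (a : N) r X Y : Ad a (r *: X + Y) = r *: Ad a X + Ad a Y.
Proof.
rewrite !AdE evel_linear // ?pt1 ?mulg1 ?mulgV //.
apply: plot_mul; last exact: plot_at_cst.
by apply: plot_mul; [exact: plot_at_cst|exact: plot_pt cod1].
Qed.

Definition lfield X u := 'D_(0, X) mu (u, e0).

Lemma left_invariant_fieldE X u : left_invariant_field N X u = lfield X u.
Proof. by rewrite /lfield -derive_p2. Qed.

Lemma smooth_lfield X u : cod c u -> smooth_at (lfield X) u.
Proof.
by move=> cu; apply: (@smooth_at_p1 _ _ _ _ _ _ _ ('D_(0, X) mu)); apply: smooth_at_D; exact: smooth_mu0.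
Qed.

Lemma lfield0 X : lfield X e0 = X.
Proof. by apply: D_mu2; exact: cod1. Qed.

(** The mixed second order term of the group law at the identity. Its symmetric part depends on the
    chart; its antisymmetrisation is the bracket. *)
Definition lb X Y := 'D_(X, 0) ('D_(0, Y) mu) (e0, e0).

Lemma D_lfield X Y : 'D_X (lfield Y) e0 = lb X Y.
Proof. by rewrite /lb -derive_p1. Qed.

Lemma lie_bracketE X Y : lie_bracket N X Y = lb X Y - lb Y X.
Proof.
have E Z : left_invariant_field N Z = lfield Z by apply/funext => u; exact: left_invariant_fieldE.
by rewrite -(D_lfield X Y) -(D_lfield Y X) -!E.
Qed.

Let s00 : smooth_at mu (e0, e0).
Proof. by apply: smooth_mu0; exact: cod1. Qed.

Lemma lb_linear_l Y a X X' : lb (a *: X + X') Y = a *: lb X Y + lb X' Y.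
Proof.
rewrite /lb -smooth_at_DD; last exact: smooth_at_D.
by congr ('D_(_) _ _); congr pair; rewrite /= ?scaler0 ?addr0.
Qed.

Lemma lb_linear_r Y a X X' : lb Y (a *: X + X') = a *: lb Y X + lb Y X'.
Proof.
have C Z : lb Y Z = 'D_(0, Z) ('D_(Y, 0) mu) (e0, e0) by exact: schwarz.
rewrite !C.
rewrite -smooth_at_DD; last exact: smooth_at_D.
by congr ('D_(_) _ _); congr pair; rewrite /= ?scaler0 ?addr0.
Qed.

Lemma bracketC X Y : lie_bracket N X Y = - lie_bracket N Y X.
Proof. by rewrite !lie_bracketE opprB. Qed.

Lemma bracket_linear_l Y a X X' :
  lie_bracket N (a *: X + X') Y = a *: lie_bracket N X Y + lie_bracket N X' Y.
Proof.
rewrite !lie_bracketE lb_linear_l lb_linear_r scalerBr.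
move: (lb X Y) (lb Y X) (lb X' Y) (lb Y X') => ? ? ? ?.
by apply/rowP => i; rewrite !mxE; ring.
Qed.

Lemma bracket_linear_r Y a X X' :
  lie_bracket N Y (a *: X + X') = a *: lie_bracket N Y X + lie_bracket N Y X'.
Proof. by rewrite bracketC bracket_linear_l opprD -scalerN [lie_bracket N Y X]bracketC [lie_bracket N Y X']bracketC. Qed.

Definition lder (W : normedModType R) X (F : 'rV[R]_n -> W) u := 'D_(lfield X u) F u.

Section lder.
Context {W : normedModType R} {FW : FinDim W}.
Implicit Types F : 'rV[R]_n -> W.

Lemma smooth_lder X F u : cod c u -> smooth_at F u -> smooth_at (lder X F) u.
Proof.
move=> cu sF; have [+ _] := derive_along 0 (smooth_lfield X cu) (smooth_at_id u) sF.
by [].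
Qed.

Lemma dom_mul_near u : cod c u -> \forall v \near e0, dom c (pt u * pt v)%g /\ cod c v.
Proof.
move=> cu; have p1 : plot_at (fun v => pt u * pt v)%g e0.
  by apply: plot_mul; [exact: plot_at_cst|exact: plot_pt cod1].
have d1 : dom c (pt u * pt e0)%g by rewrite pt1 mulg1; exact: point_dom.
exact: filterS2 (dom_near (plot_at_cont p1) d1) cod_near1.
Qed.

(** Left invariance of the operator [lder X], a consequence of associativity [(u v) y = u (v y)]. *)
Lemma lder_mu_aux X F u v : cod c u -> cod c v -> dom c (pt u * pt v)%g -> smooth_at F (mu (u, v)) ->
  lder X F (mu (u, v)) = lder X (fun v => F (mu (u, v))) v.
Proof.
move=> cu cv d sF; have sm := smooth_mu cu cv d.
have s2 : smooth_at (fun v => mu (u, v)) v by exact: smooth_at_p2.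
rewrite /lder (smooth_at_chainE _ s2 sF); congr ('D_(_) _ _).
have cm : cod c (mu (u, v)) by exact: coord_cod.
rewrite /lfield -!derive_p2.
have E : \forall y \near e0, mu (u, mu (v, y)) = mu (mu (u, v), y).
  apply: filterS (dom_mul_near cv) => y [dy _].
  by rewrite /mu /= !coordK // mulgA.
rewrite -(near_eq_derive _ E).
have s3 : smooth_at (fun y => mu (v, y)) e0 by apply: smooth_at_p2; exact: smooth_mu0.
have s4 : smooth_at (fun y => mu (u, y)) (mu (v, e0)) by rewrite mu0.
by rewrite (smooth_at_chainE _ s3 s4) mu0.
Qed.

Lemma lder_mu X F u : cod c u -> smooth_at F u ->
  \forall v \near e0, lder X F (mu (u, v)) = lder X (fun v => F (mu (u, v))) v.
Proof.
move=> cu sF; have s2 : smooth_at (fun v => mu (u, v)) e0 by apply: smooth_at_p2; exact: smooth_mu0.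
have sn : \forall v \near e0, smooth_at F (mu (u, v)).
  by apply: (near_comp (smooth_at_cont s2)); rewrite mu0 //; exact: (smooth_at_near sF).
by apply: filterS2 (dom_mul_near cu) sn => v [d cv] sv; exact: lder_mu_aux.
Qed.

Lemma lder_e0 X F : lder X F e0 = 'D_X F e0.
Proof. by rewrite /lder lfield0. Qed.

Lemma lderE X F u : cod c u -> smooth_at F u -> lder X F u = 'D_X (fun v => F (mu (u, v))) e0.
Proof.
move=> cu sF; rewrite -lder_e0 -(nbhs_singleton (lder_mu X cu sF)) mu0 //.
Qed.

(** Translated to the identity, both sides become derivatives of [v |-> F (u v)] at [e0]; the second
    derivatives cancel by symmetry and the [lb] terms leave the bracket. *)
Lemma lder_comm X Y F u : cod c u -> smooth_at F u ->
  lder X (lder Y F) u - lder Y (lder X F) u = lder (lie_bracket N X Y) F u.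
Proof.
move=> cu sF.
have s2 : smooth_at (fun v => mu (u, v)) e0 by apply: smooth_at_p2; exact: smooth_mu0.
have sF' : smooth_at F (mu (u, e0)) by rewrite mu0.
have sP : smooth_at (fun v => F (mu (u, v))) e0 by exact: (smooth_at_comp s2 sF').
have H A B : lder A (lder B F) u = 'D_(lb A B) (fun v => F (mu (u, v))) e0
    + 'D_A ('D_B (fun v => F (mu (u, v)))) e0.
  rewrite lderE //; last exact: smooth_lder.
  rewrite (near_eq_derive _ (lder_mu B cu sF)) /lder.
  have [_ ->] := derive_along A (smooth_lfield B cod1) (smooth_at_id e0) sP.
  by rewrite D_lfield lfield0 derive_id.
rewrite (H X Y) (H Y X) (schwarz X Y sP) lderE // lie_bracketE addrC [lb X Y - _]addrC -[- lb Y X]scaleN1r.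
rewrite (smooth_at_DD _ _ _ sP) scaleN1r addrC.
exact: addr_cancel.
Qed.

End lder.

Lemma lder_id X : lder X id e0 = X.
Proof. by rewrite lder_e0 derive_id. Qed.

Lemma lder_inj (X Y : 'rV[R]_n) : (forall F : 'rV[R]_n -> 'rV[R]_n, smooth_at F e0 -> lder X F e0 = lder Y F e0) -> X = Y.
Proof. by move=> H; have := H id (smooth_at_id _); rewrite !lder_id. Qed.

Lemma lderB (W : normedModType R) X (F G : 'rV[R]_n -> W) u : smooth_at F u -> smooth_at G u ->
  lder X (fun y => F y - G y) u = lder X F u - lder X G u.
Proof. by move=> sF sG; rewrite /lder deriveB //; exact: smooth_at_derivable. Qed.

Lemma lder_ext (W : normedModType R) X (F G : 'rV[R]_n -> W) u : (\forall y \near u, F y = G y) ->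
  lder X F u = lder X G u.
Proof. exact: near_eq_derive. Qed.

#[local] Opaque lder.

(** For commutators of operators the identity is formal; [lder_inj] transfers it back to vectors. *)
Lemma bracket_jacobi X Y Z : lie_bracket N X (lie_bracket N Y Z) =
  lie_bracket N (lie_bracket N X Y) Z + lie_bracket N Y (lie_bracket N X Z).
Proof.
apply: lder_inj => F sF.
have sl A (G : 'rV[R]_n -> 'rV[R]_n) : smooth_at G e0 -> smooth_at (lder A G) e0 by move=> sG; exact: (smooth_lder A cod1 sG).
have L A B C : lder (lie_bracket N A (lie_bracket N B C)) F e0 =
  lder A (lder B (lder C F)) e0 - lder A (lder C (lder B F)) e0
   - lder B (lder C (lder A F)) e0 + lder C (lder B (lder A F)) e0.
  rewrite -lder_comm //; last exact: cod1.
  have -> : lder A (lder (lie_bracket N B C) F) e0 = lder A (fun y => lder B (lder C F) y - lder C (lder B F) y) e0.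
    by apply: lder_ext; apply: filterS2 cod_near1 (smooth_at_near sF) => y cy sy; rewrite lder_comm.
  have -> := lderB A (sl B _ (sl C _ sF)) (sl C _ (sl B _ sF)).
  have <- := lder_comm B C cod1 (sl A F sF).
  exact: addr_reorder.
have lin a A B (G : 'rV[R]_n -> 'rV[R]_n) : smooth_at G e0 -> lder (a *: A + B) G e0 = a *: lder A G e0 + lder B G e0.
  by move=> sG; rewrite !lder_e0 smooth_at_DD.
have -> : lie_bracket N (lie_bracket N X Y) Z = -1 *: lie_bracket N Z (lie_bracket N X Y).
  by rewrite scaleN1r -bracketC.
apply: etrans (L X Y Z) _; apply: esym; apply: etrans (lin (-1) _ _ _ sF) _.
apply: etrans (congr2 (fun a b => -1 *: a + b) (L Z X Y) (L Y X Z)) _.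
exact: jacobi_sum.
Qed.

Lemma smooth_Ad Z : smooth_at (fun v => Ad (pt v) Z) e0.
Proof.
pose q (z : 'rV[R]_n * 'rV[R]_n) := co (pt z.1 * pt z.2 * (pt z.1)^-1)%g.
have sq : smooth_at q (e0, e0).
  have p1 : plot_at (fun z : 'rV[R]_n * 'rV[R]_n => pt z.1) (e0, e0).
    by apply: plot_pt_comp; [exact: smooth_at_fst|exact: cod1].
  have p2 : plot_at (fun z : 'rV[R]_n * 'rV[R]_n => pt z.2) (e0, e0).
    by apply: plot_pt_comp; [exact: smooth_at_snd|exact: cod1].
  apply: smooth1; last by rewrite /= pt1 mulg1 mulgV.
  by apply: plot_mul; [exact: plot_mul|exact: plot_inv].
have -> : (fun v => Ad (pt v) Z) = (fun v => 'D_(0, Z) q (v, e0)).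
  by apply/funext => v; rewrite AdE -derive_p2.
by apply: (@smooth_at_p1 _ _ _ _ _ _ _ ('D_(0, Z) q)); exact: smooth_at_D.
Qed.

(** Differentiate [(v y v^-1) v = v y] in [y] at the identity, then in [v]. The left side gives the
    wanted derivative plus [lb Z Y], the right side gives [lb Y Z]. *)
Lemma derive_Ad Y Z : 'D_Y (fun v => Ad (pt v) Z) e0 = lie_bracket N Y Z.
Proof.
pose q (z : 'rV[R]_n * 'rV[R]_n) := co (pt z.1 * pt z.2 * (pt z.1)^-1)%g.
have E : \forall v \near e0, 'D_(Ad (pt v) Z, 0) mu (e0, v) = 'D_(0, Z) mu (v, e0).
  apply: filterS cod_near1 => v cv.
  have p1 : plot_at (fun y => pt v * pt y * (pt v)^-1)%g e0.
    apply: plot_mul; last exact: plot_at_cst.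
    by apply: plot_mul; [exact: plot_at_cst|exact: plot_pt cod1].
  have f1 : (pt v * pt e0 * (pt v)^-1 = 1)%g by rewrite pt1 mulg1 mulgV.
  have d1 : dom c (pt v * pt e0 * (pt v)^-1)%g by rewrite f1; exact: dom1.
  have E1 : \forall y \near e0, mu (q (v, y), v) = mu (v, y).
    apply: filterS (dom_near (plot_at_cont p1) d1) => y dy.
    by rewrite /mu /q /= coordK // mulgVK.
  rewrite -derive_p2 -(near_eq_derive _ E1) -derive_p1.
  have s1 : smooth_at (fun y => q (v, y)) e0 by exact: (smooth1 p1 f1).
  have e1 : q (v, e0) = e0 by rewrite /q /= f1.
  have s2 : smooth_at (fun x => mu (x, v)) (q (v, e0)).
    by rewrite e1; apply: smooth_at_p1; exact: smooth_mu0l.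
  by rewrite (smooth_at_chainE _ s1 s2) e1 AdE.
have sA : smooth_at (fun v => (Ad (pt v) Z, 0 : 'rV[R]_n)) e0.
  by apply: smooth_at_pair; [exact: smooth_Ad|exact: smooth_at_cst].
have [_] := derive_along Y sA (smooth_at_pair2 e0 e0) s00.
rewrite (near_eq_derive _ E) derive_pair; [|exact: smooth_Ad|exact: smooth_at_cst].
rewrite derive_cst D_mu1; last exact: cod1.
rewrite (derive_pair Y (smooth_at_cst _ _) (smooth_at_id _)) derive_cst derive_id pt1.
have -> : Ad (1%g : N) Z = Z.
  by rewrite AdE; under [fun y => (1 * pt y * 1^-1)%g]eq_fun do rewrite mul1g invg1 mulg1; exact: evel_pt.
rewrite (schwarz (Z, 0) _ s00) -/(lb Z Y) lie_bracketE.
have -> : 'D_Y (fun v => 'D_(0, Z) mu (v, e0)) e0 = lb Y Z by exact: D_lfield.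
by move=> ->; rewrite addrK.
Qed.

End local.

(** * Upper central series of the group and of its Lie algebra *)

Fixpoint ad_killed (R : realType) n (N : lieGroupType R n) (j : nat) (X : 'rV[R]_n) : Prop :=
  match j with
  | 0%N => X = 0
  | i.+1 => forall Y, ad_killed N i (lie_bracket N Y X)
  end.

(** Intermediate between group and algebra: [Ad a X - X] is the velocity of commutators in the
    group, and its derivative in [a] at the identity is a bracket. *)
Fixpoint Ad_killed (R : realType) n (N : lieGroupType R n) (j : nat) (X : 'rV[R]_n) : Prop :=
  match j with
  | 0%N => X = 0
  | i.+1 => forall a : N, Ad_killed N i (Ad a X - X)
  end.

Section nilpotent.
Context {R : realType} {n : nat} {N : lieGroupType R n}.
Local Notation pt := (lpt N).
Local Notation e0 := (le0 N).

Lemma derive_linB (L : 'rV[R]_n -> 'rV[R]_n) (f : 'rV[R]_n -> 'rV[R]_n) (x v : 'rV[R]_n) : linear L ->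
  smooth_at f x -> smooth_at (fun y => L (f y) - f y) x /\
  'D_v (fun y => L (f y) - f y) x = L ('D_v f x) - 'D_v f x.
Proof.
move=> lL sf; have cL : continuous (mklin lL) by exact: fd_linear_continuous.
have sL : smooth_at (fun y => mklin lL (f y)) x by exact: smooth_at_lin.
split; first by apply: smooth_atB.
have [_ E] := derivable_lin cL (smooth_at_derivable v sf).
have -> := deriveB (smooth_at_derivable v sL) (smooth_at_derivable v sf).
by rewrite E.
Qed.

Lemma Ad_killed_derive j (f : 'rV[R]_n -> 'rV[R]_n) (x v : 'rV[R]_n) : smooth_at f x ->
  (\forall y \near x, Ad_killed N j (f y)) -> Ad_killed N j ('D_v f x).
Proof.
elim: j f => [|j IH] f sf kf /=.
  have /near_eq_derive -> : \forall y \near x, f y = (fun=> 0) y by [].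
  by rewrite derive_cst.
move=> a; have lA : linear (Ad a : 'rV[R]_n -> 'rV[R]_n) by move=> r U V; exact: Ad_linear.
have [s1 <-] := derive_linB v lA sf.
by apply: IH => //; apply: filterS kf => y /(_ a).
Qed.

Lemma Ad_killed_ad j X : Ad_killed N j X -> ad_killed N j X.
Proof.
elim: j X => // j IH X kX Y; apply: IH.
have -> : lie_bracket N Y X = 'D_Y (fun v => Ad (pt v) X - X) e0.
  rewrite deriveB ?derive_cst ?subr0 ?derive_Ad //; exact: smooth_at_derivable (smooth_Ad _).
apply: Ad_killed_derive; last by apply: filterE.
by apply: smooth_atB; [exact: smooth_Ad|exact: smooth_at_cst].
Qed.

(** If [f] lies in one term of the series, its commutators with [a^-1] lie in the previous one, and
    their velocity is [Ad a X - X] where [X] is that of [f]. *)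
Lemma upper_central_killed (V : normedModType R) j (f : V -> N) (x v : V) : plot_at f x -> f x = 1%g ->
  (\forall y \near x, upper_central_series j (f y)) -> Ad_killed N j (evel f x v).
Proof.
elim: j f => [|j IH] f pf f1 uf.
  by rewrite /= (evel_ext (g := fun=> 1%g)) ?evel_cst.
move=> a /=.
have p1 : plot_at (fun y => a * f y * a^-1)%g x.
  by apply: plot_mul; [apply: plot_mul => //; exact: plot_at_cst|exact: plot_at_cst].
have e1 : (a * f x * a^-1 = 1)%g by rewrite f1 mulg1 mulgV.
have p2 := plot_inv pf.
have e2 : ((f x)^-1 = 1)%g by rewrite f1 invg1.
have -> : Ad a (evel f x v) - evel f x v = evel (fun y => [~ f y, a^-1])%g x v.
  rewrite -evel_conj // addrC -evel_inv // -evel_mul //.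
  by apply: evel_ext; apply: filterE => y; rewrite commgEl conjgE invgK !mulgA.
apply: IH.
- apply: (plot_at_ext (f := fun y => (f y)^-1 * (a * f y * a^-1))%g); last exact: plot_mul.
  by apply: filterE => y; rewrite commgEl conjgE invgK !mulgA.
- by rewrite f1 comm1g.
- by apply: filterS uf => y /(_ a^-1)%g.
Qed.

Lemma nilpotent_killed : nilpotent_group N -> exists k, forall X, ad_killed N k X.
Proof.
move=> [k E]; exists k => X; apply: Ad_killed_ad; rewrite -[X](evel_pt (N := N)).
apply: upper_central_killed; [exact: plot_pt cod1|exact: pt1|].
by apply: filterE => y; rewrite E.
Qed.

End nilpotent.

Arguments mu {R n} N z.
Arguments lfield {R n} N X u.
Arguments lb {R n} N X Y.
Arguments lder {R n} N {W} X F u.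
Arguments bracket_linear_l {R n} N Y a X X'.
Arguments bracket_linear_r {R n} N Y a X X'.

Section bracket_lin.
Context {R : realType} {n : nat} {N : lieGroupType R n}.
Implicit Types X Y : 'rV[R]_n.

Lemma bracketDl X X' Y : lie_bracket N (X + X') Y = lie_bracket N X Y + lie_bracket N X' Y.
Proof. by have := bracket_linear_l N Y 1 X X'; rewrite !scale1r. Qed.

Lemma bracketDr X Y Y' : lie_bracket N X (Y + Y') = lie_bracket N X Y + lie_bracket N X Y'.
Proof. by have := bracket_linear_r N X 1 Y Y'; rewrite !scale1r. Qed.

Lemma bracket0l Y : lie_bracket N 0 Y = 0.
Proof. by apply: (addrI (lie_bracket N 0 Y)); rewrite -bracketDl !addr0. Qed.

Lemma bracket0r Y : lie_bracket N Y 0 = 0.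
Proof. by rewrite bracketC bracket0l oppr0. Qed.

Lemma bracketZl a X Y : lie_bracket N (a *: X) Y = a *: lie_bracket N X Y.
Proof. by have := bracket_linear_l N Y a X 0; rewrite bracket0l !addr0. Qed.

Lemma bracketZr a X Y : lie_bracket N X (a *: Y) = a *: lie_bracket N X Y.
Proof. by have := bracket_linear_r N X a Y 0; rewrite bracket0r !addr0. Qed.

Lemma bracketNr X Y : lie_bracket N X (- Y) = - lie_bracket N X Y.
Proof. by rewrite -scaleN1r bracketZr scaleN1r. Qed.

Lemma bracketNl X Y : lie_bracket N (- X) Y = - lie_bracket N X Y.
Proof. by rewrite -scaleN1r bracketZl scaleN1r. Qed.

End bracket_lin.

Lemma smooth_derive_AdV (R : realType) n (N : lieGroupType R n) Z :
  smooth_at (fun v => Ad (lpt N v)^-1%g Z) (le0 N) /\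
  forall Y, 'D_Y (fun v => Ad (lpt N v)^-1%g Z) (le0 N) = lie_bracket N Z Y.
Proof.
have pp := plot_pt (@cod1 R n N).
have pI := plot_inv pp.
have i1 : ((lpt N (le0 N))^-1 = 1)%g by rewrite pt1 invg1.
have sI : smooth_at (fun v => lco N (lpt N v)^-1%g) (le0 N) by exact: smooth1.
have sA : smooth_at (fun v => Ad (lpt N v) Z) (lco N (lpt N (le0 N))^-1%g).
  by rewrite i1; exact: smooth_Ad.
have d1 : dom (lchart N) ((lpt N (le0 N))^-1)%g by rewrite i1; exact: dom1.
have E : \forall v \near le0 N, Ad (lpt N (lco N (lpt N v)^-1%g)) Z = Ad (lpt N v)^-1%g Z.
  by apply: filterS (dom_near (plot_at_cont pI) d1) => v dv; rewrite coordK.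
split; first by apply: smooth_at_ext E _; exact: (smooth_at_comp sI sA).
move=> Y; rewrite -(near_eq_derive _ E) (smooth_at_chainE _ sI sA).
have -> : 'D_Y (fun v => lco N (lpt N v)^-1%g) (le0 N) = - Y by rewrite -/(evel _ _ _) evel_inv ?evel_pt ?pt1.
by rewrite i1 derive_Ad bracketNl -bracketC.
Qed.

Lemma lderD (R : realType) n (N : lieGroupType R n) (W : normedModType R) X (F H : 'rV[R]_n -> W) u :
  smooth_at F u -> smooth_at H u -> lder N X (fun y => F y + H y) u = lder N X F u + lder N X H u.
Proof. by move=> sF sH; exact: deriveD (smooth_at_derivable _ sF) (smooth_at_derivable _ sH). Qed.

Lemma lder_lin (R : realType) n (N : lieGroupType R n) (W W' : normedModType R) {FW : FinDim W}
  (L : {linear W -> W'}) X (F : 'rV[R]_n -> W) u :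
  smooth_at F u -> lder N X (fun y => L (F y)) u = L (lder N X F u).
Proof.
move=> sF; have cL : continuous L by exact: fd_linear_continuous.
by have [_] := derivable_lin cL (smooth_at_derivable (lfield N X u) sF).
Qed.

#[local] Opaque lder.

(** * Infinitesimal transformation groups *)

Lemma derive_lincomb (R : realType) (V W : normedModType R) (f g : V -> W) a x v :
  smooth_at f x -> smooth_at g x -> 'D_v (fun y => a *: f y + g y) x = a *: 'D_v f x + 'D_v g x.
Proof.
move=> /(smooth_at_derivable v) df /(smooth_at_derivable v) dg.
have dZ : derivable (fun y => a *: f y) x v by exact: derivableZ.
apply: etrans (deriveD dZ dg) _; congr (_ + _); exact: (deriveZ a df).
Qed.

Lemma koszul_sum (R : realType) n (a b c d l l' s : 'rV[R]_n) :
  a + b + l - (- c - d + l') = a + c + s -> l - l' = s - b - d.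
Proof.
move=> /rowP E; apply/rowP => i; have := E i; rewrite !mxE.
by move: (a _ _) (b _ _) (c _ _) (d _ _) (l _ _) (l' _ _) (s _ _) => *; lra.
Qed.

Lemma koszul_rearrange (R : realType) n (b : 'rV[R]_n -> 'rV[R]_n -> 'rV[R]_n)
  (bD : forall x x' y, b (x + x') y = b x y + b x' y) (bC : forall x y, b x y = - b y x)
  (bJ : forall x y z, b x (b y z) = b (b x y) z + b y (b x z)) k y y' s s' t l l' :
  b (b k y + s) y' + l - (b (b k y' + s') y + l') = b k (b y y') + t ->
  l - l' = t - b s y' - b y s'.
Proof. by rewrite bJ !bD (bC (b k y') y) (bC s' y); exact: koszul_sum. Qed.

Lemma bracket_sum (R : realType) n (l l' s s' : 'rV[R]_n) : s + l - (s' + l') = l - l' + s - s'.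
Proof. by apply/rowP => i; rewrite !mxE; ring. Qed.

Section action.
Context {R : realType} {k n : nat} {G : lieGroupType R k} {N : lieGroupType R n}.
Variables (act : G -> N -> N) (p : N).
Hypothesis act1 : forall x, act 1%g x = x.
Hypothesis actM : forall a b x, act (a * b)%g x = act a (act b x).
Hypothesis act_smooth : smooth2 act.
Local Notation co := (lco N).
Local Notation pt := (lpt N).
Local Notation e0 := (le0 N).
Local Notation gpt := (lpt G).
Local Notation g0 := (le0 G).
Local Notation c := (lchart N).
Local Notation gc := (lchart G).
Implicit Types (u v w Y : 'rV[R]_n) (z X : 'rV[R]_k).

Definition base w : N := (p * pt w)%g.
(* The value of [act a] at [base w] and its increments from there, brought back by left translations. *)
Definition kap (a : G) w : N := ((base w)^-1 * act a (base w))%g.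
Definition thet (a : G) w v : N := ((act a (base w))^-1 * act a (base w * pt v))%g.

Lemma kap1 w : kap 1%g w = 1%g. Proof. by rewrite /kap act1 mulVg. Qed.
Lemma thet1 w v : thet 1%g w v = pt v. Proof. by rewrite /thet !act1 mulKg. Qed.
Lemma thet0 a w : thet a w e0 = 1%g. Proof. by rewrite /thet pt1 mulg1 mulVg. Qed.

Lemma base_mu w v : cod c w -> dom c (pt w * pt v)%g -> base (mu N (w, v)) = (base w * pt v)%g.
Proof. by move=> cw d; rewrite /base /mu /= coordK // mulgA. Qed.

Lemma kap_mu a w v : cod c w -> dom c (pt w * pt v)%g ->
  kap a (mu N (w, v)) = (((pt v)^-1 * kap a w * (pt v)^-1^-1) * ((pt v)^-1 * thet a w v))%g.
Proof. by move=> cw d; rewrite /kap base_mu // /thet invgK invgM -!mulgA !mulVKg. Qed.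

(** The composition law of the increments. [thet] takes its last argument in the chart at the
    identity, where [co] is a junk value outside the domain; the second alternative records that
    case. *)
Lemma kapM a b w : kap (a * b)%g w = (kap a w * thet a w (co (kap b w)))%g \/ ~ dom c (kap b w).
Proof.
have [d|] := EM (dom c (kap b w)); last by right.
by left; rewrite /thet coordK // /kap mulVKg -mulgA mulVKg actM.
Qed.

Lemma plot_base (V : normedModType R) (f : V -> 'rV[R]_n) x : smooth_at f x -> cod c (f x) ->
  plot_at (fun y => base (f y)) x.
Proof. by move=> sf cf; apply: plot_mul; [exact: plot_at_cst|exact: plot_pt_comp]. Qed.

Lemma plot_act (V : normedModType R) (f : V -> G) (h : V -> N) x : plot_at f x -> plot_at h x ->
  plot_at (fun y => act (f y) (h y)) x.
Proof. exact: smooth2_plot. Qed.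

Lemma plot_kap (V : normedModType R) (f : V -> G) (h : V -> 'rV[R]_n) x : plot_at f x ->
  smooth_at h x -> cod c (h x) -> plot_at (fun y => kap (f y) (h y)) x.
Proof.
move=> pf sh ch; have pb := plot_base sh ch.
by apply: plot_mul; [exact: plot_inv|exact: plot_act].
Qed.

Lemma plot_thet (V : normedModType R) (f : V -> G) (h j : V -> 'rV[R]_n) x : plot_at f x ->
  smooth_at h x -> cod c (h x) -> smooth_at j x -> cod c (j x) -> plot_at (fun y => thet (f y) (h y) (j y)) x.
Proof.
move=> pf sh ch sj cj; have pb := plot_base sh ch; have pj := plot_pt_comp sj cj.
by apply: plot_mul; [apply: plot_inv; exact: plot_act|apply: plot_act => //; exact: plot_mul].
Qed.

Definition kmap (y : 'rV[R]_k * 'rV[R]_n) := co (kap (gpt y.1) y.2).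
Definition tmap (y : ('rV[R]_k * 'rV[R]_n) * 'rV[R]_n) := co (thet (gpt y.1.1) y.1.2 y.2).

Lemma smooth_kmap w : cod c w -> smooth_at kmap (g0, w).
Proof.
move=> cw; apply: smooth1; last by rewrite /= pt1 kap1.
apply: plot_kap; [|exact: smooth_at_snd|exact: cw].
by apply: plot_pt_comp; [exact: smooth_at_fst|exact: cod1].
Qed.

Lemma smooth_tmap y : cod gc y.1.1 -> cod c y.1.2 -> cod c y.2 -> dom c (thet (gpt y.1.1) y.1.2 y.2) ->
  smooth_at tmap y.
Proof.
move=> c1 c2 c3 d; apply: plot_co; last exact: d.
have s1 : smooth_at (fun y : ('rV[R]_k * 'rV[R]_n) * 'rV[R]_n => y.1.1) y.
  exact: (smooth_at_comp (smooth_at_fst y) (smooth_at_fst y.1)).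
have s2 : smooth_at (fun y : ('rV[R]_k * 'rV[R]_n) * 'rV[R]_n => y.1.2) y.
  exact: (smooth_at_comp (smooth_at_fst y) (smooth_at_snd y.1)).
apply: plot_thet => //; last exact: smooth_at_snd.
exact: plot_pt_comp.
Qed.

Lemma smooth_tmap0 z w : cod gc z -> cod c w -> smooth_at tmap ((z, w), e0).
Proof. by move=> cz cw; apply: smooth_tmap => //=; [exact: cod1|rewrite thet0; exact: dom1]. Qed.

(* In the left trivialisation, [Kf X] is the fundamental vector field of [X] and [Af Y (a, w)] the
   differential of [act a] applied to [Y]. *)
Definition Kf X w : 'rV[R]_n := 'D_(X, 0) kmap (g0, w).
Definition Af Y (y : 'rV[R]_k * 'rV[R]_n) : 'rV[R]_n := 'D_(0, Y) tmap (y, e0).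
(** The derivative at the identity of the differentials [Af]: it is the endomorphism [S_X] at the
    point [base w], applied to [Y]. *)
Definition Sf X Y w : 'rV[R]_n := 'D_(X, 0) (Af Y) (g0, w).

Lemma KfE X w : Kf X w = evel (fun z => kap (gpt z) w) g0 X.
Proof. by rewrite /Kf -derive_p1. Qed.

Lemma Kf_kmap X w : Kf X w = 'D_X (fun z => kmap (z, w)) g0.
Proof. by rewrite /Kf -derive_p1. Qed.

Lemma AfE Y z w : Af Y (z, w) = evel (fun v => thet (gpt z) w v) e0 Y.
Proof. by rewrite /Af -derive_p2. Qed.

Lemma SfE X Y w : Sf X Y w = 'D_X (fun z => Af Y (z, w)) g0.
Proof. by rewrite /Sf -derive_p1. Qed.

Lemma smooth_Kf X w : cod c w -> smooth_at (Kf X) w.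
Proof.
by move=> cw; apply: (@smooth_at_p2 _ _ _ _ _ _ _ ('D_(X, 0) kmap)); apply: smooth_at_D; exact: smooth_kmap.
Qed.

Lemma smooth_Af Y z w : cod gc z -> cod c w -> smooth_at (Af Y) (z, w).
Proof.
by move=> cz cw; apply: (@smooth_at_p1 _ _ _ _ _ _ _ ('D_(0, Y) tmap)); apply: smooth_at_D; exact: smooth_tmap0.
Qed.

Lemma smooth_Sf X Y w : cod c w -> smooth_at (Sf X Y) w.
Proof.
move=> cw; apply: (@smooth_at_p2 _ _ _ _ _ _ _ ('D_(X, 0) (Af Y))); apply: smooth_at_D.
by apply: smooth_Af => //; exact: cod1.
Qed.

Lemma Kf_linear w : cod c w -> linear (Kf^~ w).
Proof.
move=> cw a X X'; rewrite /Kf -smooth_at_DD; last exact: smooth_kmap.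
by congr ('D_(_) _ _); congr pair; rewrite /= scaler0 addr0.
Qed.

Lemma Af_linear z w : cod gc z -> cod c w -> linear (fun Y => Af Y (z, w)).
Proof.
move=> cz cw a Y Y'; rewrite /Af -smooth_at_DD; last exact: smooth_tmap0.
by congr ('D_(_) _ _); congr pair; rewrite /= scaler0 addr0.
Qed.

Lemma Sf_linear_r X w : cod c w -> linear (fun Y => Sf X Y w).
Proof.
move=> cw a Y Y'; rewrite !SfE.
have s B : smooth_at (fun z => Af B (z, w)) g0.
  by apply: smooth_at_p1; apply: smooth_Af => //; exact: cod1.
have E : \forall z \near g0, a *: Af Y (z, w) + Af Y' (z, w) = Af (a *: Y + Y') (z, w).
  by apply: filterS (cod_near1 (N := G)) => z cz; rewrite Af_linear.
apply: etrans (esym (near_eq_derive _ E)) _.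
exact: derive_lincomb.
Qed.

Lemma Af1 Y w : cod c w -> Af Y (g0, w) = Y.
Proof.
move=> cw; rewrite AfE -[RHS](evel_pt (N := N)).
by apply: evel_ext; apply: filterE => v; rewrite pt1 thet1.
Qed.

(* [kap a (w v) = v^-1 kap a w v * v^-1 thet a w v]; differentiate in [a], then in [v]. *)
Lemma lder_Kf X Y w : cod c w -> lder N Y (Kf X) w = lie_bracket N (Kf X w) Y + Sf X Y w.
Proof.
move=> cw; rewrite lderE //; last exact: smooth_Kf.
pose r (y : 'rV[R]_k * 'rV[R]_n) := co ((pt y.2)^-1 * thet (gpt y.1) w y.2)%g.
have pr v : cod c v -> plot_at (fun y : 'rV[R]_k * 'rV[R]_n => (pt y.2)^-1 * thet (gpt y.1) w y.2)%g (g0, v).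
  move=> cv; apply: plot_mul; first by apply: plot_inv; apply: plot_pt_comp; [exact: smooth_at_snd|].
  apply: plot_thet => //; [|exact: smooth_at_cst|exact: smooth_at_snd].
  by apply: plot_pt_comp; [exact: smooth_at_fst|exact: cod1].
have sr v : cod c v -> smooth_at r (g0, v).
  by move=> cv; apply: smooth1; [exact: pr|rewrite /= pt1 thet1 mulVg].
have E : \forall v \near e0, Ad (pt v)^-1%g (Kf X w) + 'D_(X, 0) r (g0, v) = Kf X (mu N (w, v)).
  apply: filterS (dom_mul_near cw) => v [d cv].
  have cm : cod c (mu N (w, v)) by exact: coord_cod.
  have pg : plot_at gpt g0 by exact: plot_pt cod1.
  have pk : plot_at (fun z => kap (gpt z) w) g0 by apply: plot_kap => //; exact: smooth_at_cst.
  have k1 : kap (gpt g0) w = 1%g by rewrite pt1 kap1.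
  have p1 : plot_at (fun z => (pt v)^-1 * kap (gpt z) w * (pt v)^-1^-1)%g g0.
    by apply: plot_mul; [apply: plot_mul => //|]; exact: plot_at_cst.
  have p2 : plot_at (fun z => (pt v)^-1 * thet (gpt z) w v)%g g0.
    by apply: plot_mul; [exact: plot_at_cst|apply: plot_thet => //; exact: smooth_at_cst].
  rewrite !KfE -(evel_conj (pt v)^-1%g X pk k1) -derive_p1.
  have -> : 'D_X (fun z => r (z, v)) g0 = evel (fun z => (pt v)^-1 * thet (gpt z) w v)%g g0 X by [].
  rewrite -evel_mul //; last 2 first.
  - by rewrite k1 mulg1 mulgV.
  - by rewrite pt1 thet1 mulVg.
  by apply: evel_ext; apply: filterE => z; rewrite kap_mu.
rewrite -(near_eq_derive _ E).
have sAd : smooth_at (fun v => Ad (pt v)^-1%g (Kf X w)) e0 by exact: (smooth_derive_AdV N (Kf X w)).1.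
have sD : smooth_at (fun v => 'D_(X, 0) r (g0, v)) e0.
  by apply: (@smooth_at_p2 _ _ _ _ _ _ _ ('D_(X, 0) r)); apply: smooth_at_D; apply: sr; exact: cod1.
have -> := deriveD (smooth_at_derivable Y sAd) (smooth_at_derivable Y sD).
apply: f_equal2; first exact: (smooth_derive_AdV N (Kf X w)).2.
(* Schwarz exchanges the derivatives in the group variable and in [v]; at [v = e0] the inner one is
   then [Af Y - Y]. *)
rewrite (derive_p2 ('D_(X, 0) r)) (schwarz _ _ (sr _ cod1)) -derive_p1 SfE.
have sA : smooth_at (fun z => Af Y (z, w)) g0.
  by apply: smooth_at_p1; apply: smooth_Af => //; exact: cod1.
have E2 : \forall z \near g0, Af Y (z, w) - Y = 'D_(0, Y) r (z, e0).
  apply: filterS (cod_near1 (N := G)) => z cz.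
  have p2 : plot_at (fun v => thet (gpt z) w v) e0.
    apply: plot_thet => //; [exact: plot_at_cst|exact: smooth_at_cst|exact: smooth_at_id|exact: cod1].
  have p1 : plot_at (fun v => (pt v)^-1)%g e0 by apply: plot_inv; exact: plot_pt cod1.
  rewrite -derive_p2 AfE.
  have -> : 'D_Y (fun v => r (z, v)) e0 = evel (fun v => (pt v)^-1 * thet (gpt z) w v)%g e0 Y by [].
  have i1 : ((pt e0)^-1 = 1)%g by rewrite pt1 invg1.
  have pe : plot_at pt e0 by exact: plot_pt cod1.
  by rewrite (evel_mul Y p1 p2 i1 (thet0 _ _)) (evel_inv Y pe pt1) evel_pt addrC.
rewrite -(near_eq_derive _ E2).
have -> := deriveB (smooth_at_derivable X sA) (smooth_at_derivable X (smooth_at_cst Y g0)).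
by rewrite derive_cst subr0.
Qed.

(** Differentiating the composition law in the right factor expresses the differential of the orbit
    map at [y] by its value [Kf B e0] at the identity. Both the bracket formula and the constancy of
    the rank rest on this. *)
Lemma kmap_lfield : \forall y \near g0, forall B, 'D_(0, Af (Kf B e0) (y, e0)) (mu N) (kmap (y, e0), e0) =
  'D_(lfield G B y) (fun z => kmap (z, e0)) y.
Proof.
pose f z := kmap (z, e0).
have f0 : f g0 = e0 by rewrite /f /kmap /= pt1 kap1.
have sf : smooth_at f g0 by apply: smooth_at_p1; exact: smooth_kmap cod1.
have Df A : 'D_A f g0 = Kf A e0 by rewrite /Kf -derive_p1.
have pk : plot_at (fun z => kap (gpt z) e0) g0.
  apply: plot_kap; [exact: plot_pt cod1|exact: smooth_at_cst|exact: cod1].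
have dk : dom c (kap (gpt g0) e0) by rewrite pt1 kap1; exact: dom1.
have nd : \forall z \near g0, dom c (kap (gpt z) e0) := dom_near (plot_at_cont pk) dk.
  apply: filterS3 (cod_near1 (N := G)) (nd) (smooth_at_near sf) => y cy dy sfy B.
  have sm : smooth_at (fun z => mu G (y, z)) g0 by apply: smooth_at_p2; exact: smooth_mu0.
  have sfy' : smooth_at f (mu G (y, g0)) by rewrite mu0.
  have := smooth_at_chainE B sm sfy'; rewrite mu0 // derive_p2 => <-.
  have E2 : \forall z \near g0, mu N (f y, tmap ((y, e0), f z)) = f (mu G (y, z)).
    have pth : plot_at (fun z => thet (gpt y) e0 (f z)) g0.
      apply: plot_thet => //; [exact: plot_at_cst|exact: smooth_at_cst|exact: cod1|].
      by rewrite f0; exact: cod1.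
    have dth : dom c (thet (gpt y) e0 (f g0)) by rewrite f0 thet0; exact: dom1.
    apply: filterS3 (dom_mul_near cy) (nd) (dom_near (plot_at_cont pth) dth) => z [dz _] kz tz.
    rewrite /f /kmap /mu /tmap /= !coordK //.
    by case: (kapM (gpt y) (gpt z) e0) => [->|//].
  rewrite -(near_eq_derive _ E2).
  have st : smooth_at (fun v => tmap ((y, e0), v)) (f g0).
    by rewrite f0; apply: smooth_at_p2; apply: smooth_tmap0 => //; exact: cod1.
  have t0 : tmap ((y, e0), f g0) = e0 by rewrite f0 /tmap /= thet0.
  have s1 : smooth_at (fun z => tmap ((y, e0), f z)) g0 by exact: (smooth_at_comp sf st).
  have cf : cod c (f y) by exact: coord_cod.
  have s2 : smooth_at (fun v => mu N (f y, v)) (tmap ((y, e0), f g0)).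
    by rewrite t0; apply: smooth_at_p2; exact: smooth_mu0.
  rewrite (smooth_at_chainE _ s1 s2) (smooth_at_chainE _ sf st) t0 f0 Df.
  by rewrite -derive_p2 /Af -derive_p2.
Qed.

(* Differentiate [kap (b c) = kap b * thet b (kap c)] in [c], then in [b], and antisymmetrise. *)
Lemma Kf_bracket X X' : Kf (lie_bracket G X X') e0 =
  lie_bracket N (Kf X e0) (Kf X' e0) + Sf X (Kf X' e0) e0 - Sf X' (Kf X e0) e0.
Proof.
pose f z := kmap (z, e0).
have f0 : f g0 = e0 by rewrite /f /kmap /= pt1 kap1.
have sf : smooth_at f g0 by apply: smooth_at_p1; exact: smooth_kmap cod1.
have Df A : 'D_A f g0 = Kf A e0 by rewrite /Kf -derive_p1.
have E A B : 'D_(lb G A B) f g0 + 'D_A ('D_B f) g0 = Sf A (Kf B e0) e0 + lb N (Kf A e0) (Kf B e0).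
  have [_ H1] := derive_along A (smooth_lfield (N := G) B cod1) (smooth_at_id g0) sf.
  rewrite D_lfield lfield0 derive_id in H1; apply: etrans (esym H1) _ => {H1}.
  have E1 : \forall y \near g0, 'D_(0, Af (Kf B e0) (y, e0)) (mu N) (f y, e0) = 'D_(lfield G B y) f y.
    by apply: filterS kmap_lfield => y /(_ B).
  rewrite -(near_eq_derive _ E1).
  have sA : smooth_at (fun y => Af (Kf B e0) (y, e0)) g0.
    by apply: smooth_at_p1; apply: smooth_Af; exact: cod1.
  have sL : smooth_at (fun y => (0 : 'rV[R]_n, Af (Kf B e0) (y, e0))) g0.
    by apply: smooth_at_pair => //; exact: smooth_at_cst.
  have sg : smooth_at (fun y => (f y, e0)) g0 by apply: smooth_at_pair => //; exact: smooth_at_cst.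
  have smf : smooth_at (mu N) (f g0, e0) by rewrite f0; exact: smooth_mu0 cod1.
  have [_ ->] := derive_along A sL sg smf.
  rewrite (derive_pair _ (smooth_at_cst _ _) sA) (derive_pair _ sf (smooth_at_cst _ _)) !derive_cst.
  rewrite f0 -SfE D_mu2; last exact: cod1.
  by rewrite Df Af1 //; exact: cod1.
have Kl := Kf_linear cod1.
rewrite -[LHS]Df lie_bracketE -[- lb G X' X]scaleN1r addrC smooth_at_DD // scaleN1r.
have sw : 'D_X ('D_X' f) g0 = 'D_X' ('D_X f) g0 by exact: schwarz.
have E' := etrans (f_equal2 +%R erefl sw) (E X' X).
apply: etrans (esym (addr_cancel _ _ _)) (etrans (congr2 (fun a b => a - b) (E X X') E') _).
rewrite lie_bracketE; exact: bracket_sum.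
Qed.

(* Apply [lder_comm] to [Kf X] and insert [lder_Kf]. *)
Lemma lder_Sf X Y Y' w : cod c w -> lder N Y (Sf X Y') w - lder N Y' (Sf X Y) w =
  Sf X (lie_bracket N Y Y') w - lie_bracket N (Sf X Y w) Y' - lie_bracket N Y (Sf X Y' w).
Proof.
move=> cw; have sK := smooth_Kf X cw.
have H A B : lder N A (lder N B (Kf X)) w = lie_bracket N (lie_bracket N (Kf X w) A + Sf X A w) B + lder N A (Sf X B) w.
  have E0 : \forall u \near w, lder N B (Kf X) u = lie_bracket N (Kf X u) B + Sf X B u.
    by apply: filterS (cod_near cw) => u cu; rewrite lder_Kf.
  apply: etrans (lder_ext A E0) _.
  have l : linear (fun U => lie_bracket N U B) by move=> r U U'; exact: bracket_linear_l.
  have sB : smooth_at (fun u => mklin l (Kf X u)) w by exact: smooth_at_lin.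
  apply: etrans (lderD N A sB (smooth_Sf X B cw)) _; apply: f_equal2; last by [].
  have e1 : lder N A (fun u => mklin l (Kf X u)) w = mklin l (lder N A (Kf X) w) by exact: lder_lin.
  by apply: etrans e1 _; rewrite lder_Kf.
have E : lder N Y (lder N Y' (Kf X)) w - lder N Y' (lder N Y (Kf X)) w = lder N (lie_bracket N Y Y') (Kf X) w.
  exact: lder_comm.
have E' := etrans (esym (f_equal2 (fun a b => a - b) (H Y Y') (H Y' Y))) (etrans E (lder_Kf X _ cw)).
exact: (koszul_rearrange bracketDl bracketC bracket_jacobi E').
Qed.

End action.

#[local] Opaque Af Kf Sf.

(** * Skew endomorphisms of a nilpotent Lie algebra *)

Section eigenpair.
Import complex.
Variable R : realType.

(** [c1] and [c2] are the real and imaginary parts of a common complex eigenvector, with eigenvalue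
    [al + i be] for the matrix in question. *)
Lemma real_eigenpair d (I : finType) (A : I -> 'M[R]_d) : (0 < d)%N ->
  (forall i j, A i *m A j = A j *m A i) ->
  exists c1 c2 : 'rV[R]_d, ~ (c1 = 0 /\ c2 = 0) /\
    forall i, exists al be, c1 *m A i = al *: c1 - be *: c2 /\ c2 *m A i = be *: c1 + al *: c2.
Proof.
move=> d0 AC.
pose toC (x : R) : R[i] := (x +i* 0)%C.
have [|v v0 /allP sv] := @spectral.common_eigenvector R[i] d [seq map_mx toC (A i) | i <- enum I] d0.
  move=> _ _ /mapP[i _ ->] /mapP[j _ ->]; rewrite /comm_mx.
  have M X Y : map_mx toC X *m map_mx toC Y = map_mx toC (X *m Y).
    apply/matrixP => k l; rewrite !mxE.
    rewrite (_ : toC (\sum_j0 _) = \sum_j0 toC (X k j0 * Y j0 l)); last first.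
      by rewrite (big_morph toC (id1 := 0) (op1 := +%R)) // => x y; rewrite /toC; apply/eqP; rewrite eq_complex /= addr0 !eqxx.
    by apply: eq_bigr => m _; rewrite !mxE; apply/eqP; rewrite eq_complex /=; apply/andP; split; apply/eqP; ring.
  by rewrite !M AC.
pose c1 := map_mx (@Re R) v; pose c2 := map_mx (@Im R) v.
exists c1, c2; split.
  move=> [/rowP h1 /rowP h2]; move/eqP: v0; apply; apply/rowP => i.
  by apply/eqP; rewrite eq_complex; have := h1 i; have := h2 i; rewrite !mxE => -> -> /=; rewrite eqxx.
move=> i; have /sv : map_mx toC (A i) \in [seq map_mx toC (A i) | i <- enum I].
  by apply/mapP; exists i => //; rewrite mem_enum.
move=> /sub_rVP[[al be] E]; exists al, be.
have re (s : 'I_d -> R[i]) : Re (\sum_j s j) = \sum_j Re (s j).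
  by rewrite (big_morph (@Re R) (id1 := 0) (op1 := +%R)) // => -[? ?] [? ?].
have im (s : 'I_d -> R[i]) : Im (\sum_j s j) = \sum_j Im (s j).
  by rewrite (big_morph (@Im R) (id1 := 0) (op1 := +%R)) // => -[? ?] [? ?].
split; apply/rowP => j.
  have := congr1 (fun M : 'rV_d => Re (M ord0 j)) E; rewrite !mxE re.
  under eq_bigr do rewrite !mxE /toC.
  case Evj: (v ord0 j) => [p q] /= => <-.
  by apply: eq_bigr => k _; rewrite !mxE; case: (v ord0 k) => x y /=; ring.
have := congr1 (fun M : 'rV_d => Im (M ord0 j)) E; rewrite !mxE im.
under eq_bigr do rewrite !mxE /toC.
case Evj: (v ord0 j) => [p q] /= ; rewrite [_ + be * _]addrC => <-.
by apply: eq_bigr => k _; rewrite !mxE; case: (v ord0 k) => x y /=; ring.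
Qed.

End eigenpair.

(** Induction on the size. A rank factorisation [M = C *m B] gives [\tr M = \tr (B *m C)], where
    [B *m C] is again nilpotent and of size [\rank M]; at full rank, nilpotency leaves only the zero
    vector. *)
Lemma nilpotent_trace (R : fieldType) m K (M : 'M[R]_m) :
  (forall x : 'rV_m, iter K (mulmxr M) x = 0) -> \tr M = 0.
Proof.
elim/ltn_ind: m K M => m IH K M nM.
have [r_eq|r_lt] := ltnP (\rank M) m; last first.
  have fM : row_free M by rewrite -row_leq_rank.
  have x0 (x : 'rV[R]_m) : x = 0.
    apply/eqP; elim: K nM => [/(_ x)/= -> //|K IHK nM]; apply: IHK => y.
    by apply: (row_free_inj fM); rewrite mul0mx; exact: (nM y).
  suff -> : M = 0 by rewrite mxtrace0.
  by apply/row_matrixP => i; rewrite row0; exact: x0.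
rewrite -{1}(mulmx_base M) mxtrace_mulC.
apply: (IH _ r_eq K.+1) => x.
have E k (y : 'rV_(\rank M)) : iter k.+1 (mulmxr (row_base M *m col_base M)) y =
    iter k (mulmxr M) (y *m row_base M) *m col_base M.
  elim: k => [|k IHk]; first by rewrite /= mulmxA.
  by rewrite iterS IHk /= mulmxA -(mulmxA _ (col_base M)) mulmx_base.
by rewrite E nM mul0mx.
Qed.

Lemma dot_eq0 (R : realType) n (u : 'rV[R]_n) : dot u u = 0 -> u = 0.
Proof.
rewrite dotE => /eqP; rewrite psumr_eq0 => [/allP h|i _]; last exact: sqr_ge0.
by apply/rowP => i; rewrite mxE; apply/eqP; have := h i (mem_index_enum i); rewrite mulf_eq0 orbb.
Qed.

Lemma dot_ge0 (R : realType) n (u : 'rV[R]_n) : 0 <= dot u u.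
Proof. by rewrite dotE sumr_ge0 // => i _; exact: sqr_ge0. Qed.

Lemma dot_inj (R : realType) n (u v : 'rV[R]_n) : (forall w, dot u w = dot v w) -> u = v.
Proof.
move=> h; apply/eqP; rewrite -subr_eq0; apply/eqP; apply: dot_eq0.
by rewrite -[- v]scaleN1r dotDl dotZl h mulN1r subrr.
Qed.

Lemma eq_mx_row (R : realType) m n (A B : 'M[R]_(m, n)) : (forall x : 'rV_m, x *m A = x *m B) -> A = B.
Proof. by move=> h; apply/row_matrixP => i; rewrite !rowE h. Qed.

Section rowalg.
Context {R : realType} {n : nat}.
Implicit Types (A B S : 'M[R]_n) (u v x y z : 'rV[R]_n).
Local Notation e i := (delta_mx ord0 i : 'rV[R]_n).

Lemma dotNl u v : dot (- u) v = - dot u v. Proof. by rewrite -scaleN1r dotZl mulN1r. Qed.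
Lemma dotNr u v : dot u (- v) = - dot u v. Proof. by rewrite -scaleN1r dotZr mulN1r. Qed.
Lemma dot0l u : dot 0 u = 0. Proof. by rewrite -(scale0r 0) dotZl mul0r. Qed.
Lemma dot_suml (I : Type) (r : seq I) (P : pred I) (F : I -> 'rV[R]_n) v :
  dot (\sum_(i <- r | P i) F i) v = \sum_(i <- r | P i) dot (F i) v.
Proof. by rewrite (big_morph (fun u => dot u v) (id1 := 0) (op1 := +%R)) ?dot0l // => a b; exact: dotDl. Qed.
Lemma dot_sumr (I : Type) (r : seq I) (P : pred I) (F : I -> 'rV[R]_n) v :
  dot v (\sum_(i <- r | P i) F i) = \sum_(i <- r | P i) dot v (F i).
Proof. by rewrite dotC dot_suml; apply: eq_bigr => i _; rewrite dotC. Qed.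

Lemma dot_mx A u v : dot (u *m A) v = dot u (v *m A^T).
Proof. by rewrite /dot trmx_mul trmxK mulmxA. Qed.

Lemma dot_skew S u v : S^T = - S -> dot (u *m S) v = - dot u (v *m S).
Proof. by move=> sS; rewrite dot_mx sS mulmxN dotNr. Qed.

Lemma skew_dot0 S u : S^T = - S -> dot (u *m S) u = 0.
Proof. by move=> sS; have := dot_skew u u sS; rewrite (dotC u); lra. Qed.

Lemma dot_delta u i : dot u (e i) = u ord0 i.
Proof.
rewrite dotE (bigD1 i) //= big1 ?mxE ?eqxx ?mulr1 ?addr0 // => j ji.
by rewrite mxE (negbTE ji) mulr0.
Qed.

Lemma trace_dot A : \tr A = \sum_i dot (e i *m A) (e i).
Proof. by apply: eq_bigr => i _; rewrite dot_delta -rowE mxE. Qed.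

Lemma trace_dot2 A B : \sum_i dot (e i *m A) (e i *m B) = \tr (A *m B^T).
Proof. by rewrite trace_dot; apply: eq_bigr => i _; rewrite mulmxA [in RHS]dot_mx trmxK. Qed.

Lemma trace_skew S : S^T = - S -> \tr S = 0.
Proof. by move=> sS; have := mxtrace_tr S; rewrite sS linearN /=; lra. Qed.

Lemma sum_delta u : \sum_i u ord0 i *: e i = u.
Proof. by rewrite -row_sum_delta. Qed.

(** The trilinear form [<y D_x, z>] is symmetric in [x, y] and skew in [y, z], hence zero: the
    argument for the uniqueness of the Levi-Civita connection. *)
Lemma koszul_unique (D : 'rV[R]_n -> 'M[R]_n) : (forall x, (D x)^T = - D x) ->
  (forall x y, y *m D x = x *m D y) -> forall x, D x = 0.
Proof.
move=> sk sy x; apply: eq_mx_row => y; rewrite mulmx0; apply: dot_inj => z; rewrite dot0l.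
have a1 := dot_skew y z (sk x); have a2 := dot_skew z x (sk y); have a3 := dot_skew x y (sk z).
rewrite (sy x z) in a1; rewrite (sy y x) in a2; rewrite (sy z y) in a3.
rewrite (dotC y) in a1; rewrite (dotC z) in a2; rewrite (dotC x) in a3.
by move: a1 a2 a3; set P := dot (y *m D x) z; set Q := dot (x *m D z) y; set W := dot (z *m D y) x; lra.
Qed.

End rowalg.

Section lie.
Context {R : realType} {n : nat} {br : 'rV[R]_n -> 'rV[R]_n -> 'rV[R]_n}.
Hypothesis brl : forall y, linear (br^~ y).
Hypothesis brC : forall x y, br x y = - br y x.
Implicit Types (A B S D : 'M[R]_n) (u v x y z : 'rV[R]_n).
Local Notation e i := (delta_mx ord0 i : 'rV[R]_n).

Lemma brr x : linear (br x).
Proof. by move=> a y z; rewrite brC brl opprD -scalerN -!(brC x). Qed.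

Definition ad x : 'M[R]_n := lin1_mx (mklin (brr x)).

Lemma adE x y : y *m ad x = br x y. Proof. by rewrite mul_rV_lin1. Qed.

Lemma ad_linear : linear ad.
Proof. by move=> a x y; apply: eq_mx_row => z; rewrite mulmxDr -scalemxAr !adE brl. Qed.

Definition ad_lin := mklin ad_linear.

Fixpoint killed (k : nat) x : Prop :=
  match k with 0%N => x = 0 | j.+1 => forall y, killed j (br y x) end.

Lemma killedDZ k a x y : killed k x -> killed k y -> killed k (a *: x + y).
Proof.
elim: k x y => [|k IH] x y /=; first by move=> -> ->; rewrite scaler0 addr0.
by move=> hx hy z; rewrite brr; exact: IH.
Qed.

Lemma killed0 k : killed k 0.
Proof. by elim: k => //= k IH y; have := brr y (-1) 0 0; rewrite scaler0 addr0 scaleN1r addNr => ->. Qed.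

Lemma killedZ k a x : killed k x -> killed k (a *: x).
Proof. by move=> h; rewrite -[_ *: _]addr0; apply: killedDZ => //; exact: killed0. Qed.
Lemma killedN k x : killed k x -> killed k (- x).
Proof. by rewrite -scaleN1r; exact: killedZ. Qed.
Lemma killedD k x y : killed k x -> killed k y -> killed k (x + y).
Proof. by rewrite -{2}[x]scale1r; exact: killedDZ. Qed.
Lemma killedB k x y : killed k x -> killed k y -> killed k (x - y).
Proof. by move=> hx /killedN; exact: killedD. Qed.

Lemma killedS k x : killed k x -> killed k.+1 x.
Proof. by elim: k x => [x -> y|k IH x hx y]; [exact: killed0 1%N y|exact: IH]. Qed.

Lemma killed_le k l x : (k <= l)%N -> killed k x -> killed l x.
Proof. by move=> /subnK <- h; elim: (l - k)%N => //= m IH; exact: (killedS IH). Qed.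

Lemma killed_br k x y : killed k.+1 x -> killed k (br x y).
Proof. by move=> h; rewrite brC; apply: killedN; exact: h. Qed.

Hypothesis nil : exists K, forall x, killed K x.

(** Such an endomorphism strictly descends the upper central series, hence is nilpotent. *)
Lemma lowering_trace A : (forall k x, killed k.+1 x -> killed k (x *m A)) -> \tr A = 0.
Proof.
move=> low; have [K nK] := nil; apply: (@nilpotent_trace _ _ K) => x.
have H k y : killed k y -> iter k (mulmxr A) y = 0.
  elim: k y => [//|k IH] y hy; rewrite iterSr; apply: IH; exact: low.
exact: H.
Qed.

Definition isder A := forall x y, br x y *m A = br (x *m A) y + br x (y *m A).

Lemma der_killed A : isder A -> forall k x, killed k x -> killed k (x *m A).
Proof.
move=> dA; elim=> [x ->|k IH x hx y] /=; first by rewrite mul0mx.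
have -> : br y (x *m A) = br y x *m A - br (y *m A) x by rewrite dA addrC addKr.
by apply: killedB; [apply: IH; exact: hx|exact: hx].
Qed.

Lemma tr_ad x : \tr (ad x) = 0.
Proof. by apply: lowering_trace => k y h; rewrite adE; exact: h. Qed.

Lemma tr_ad_der x A : isder A -> \tr (ad x *m A) = 0.
Proof. by move=> dA; apply: lowering_trace => k y h; rewrite mulmxA adE; apply: der_killed => //; exact: h. Qed.

Lemma ad_der x A : isder A -> ad x *m A = ad (x *m A) + A *m ad x.
Proof. by move=> dA; apply: eq_mx_row => y; rewrite mulmxDr !mulmxA !adE dA. Qed.

(** It is alternating in [x] and the vector it acts on ([der_defect_alt]), so that it can be the
    torsion of a family [D] of skew endomorphisms. *)
Definition der_defect S x := ad x *m S - ad (x *m S) - S *m ad x.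

Lemma der_defectE S x y : y *m der_defect S x = br x y *m S - br (x *m S) y - br x (y *m S).
Proof. by rewrite /der_defect !mulmxBr !mulmxA !adE. Qed.

Lemma der_defect_alt S x y : y *m der_defect S x = - (x *m der_defect S y).
Proof.
rewrite !der_defectE (brC y x) (brC (y *m S)) (brC y (x *m S)) mulNmx.
move: (br x y *m S) (br (x *m S) y) (br x (y *m S)) => a b c.
by apply/rowP => i; rewrite !mxE; ring.
Qed.

(* The second order part of the argument: if all [D x] are derivations, the squared norm of
   the torsion [der_defect S] is a sum of traces of nilpotent endomorphisms. *)
Lemma torsion_free S (D : 'rV[R]_n -> 'M[R]_n) : S^T = - S ->
  (forall x, (D x)^T = - D x) -> (forall x, isder (D x)) ->
  (forall x y, y *m D x - x *m D y = y *m der_defect S x) -> forall x, der_defect S x = 0.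
Proof.
move=> sS sD dD DT.
have trT x : \tr (der_defect S x) = 0.
  rewrite /der_defect !linearB /= tr_ad mxtrace_mulC subr0.
  by rewrite subrr.
(* Since each [D x] is skew, the vanishing trace of the torsion at [m] says that this sum is
   orthogonal to [m]. *)
have D0 : \sum_i e i *m D (e i) = 0.
  apply: dot_inj => m; rewrite dot0l dot_suml.
  have := trT m; rewrite trace_dot.
  under eq_bigr do rewrite -DT dotDl dotNl.
  rewrite big_split /= -trace_dot trace_skew // add0r sumrN => /eqP; rewrite oppr_eq0 => /eqP E.
  apply/eqP; rewrite -oppr_eq0 -sumrN; apply/eqP; rewrite -[RHS]E; apply: eq_bigr => i _.
  by rewrite dot_skew // opprK dotC.
(* One term of the torsion gives the trace of a nilpotent product of [ad] with a derivation, two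
   others cancel by cyclicity of the trace. The rest is linear in [x *m D x], so the sum over the
   frame vanishes by [D0]. *)
have trTD x : \tr (der_defect S x *m D x) = - \tr (S *m ad (x *m D x)).
  rewrite /der_defect !mulmxBl !linearB /= (tr_ad_der _ (dD x)) subr0 -[S *m ad x *m D x]mulmxA.
  rewrite (ad_der x (dD x)) mulmxDr linearD /= -mulmxA mxtrace_mulC -mulmxA.
  have -> : \tr (S *m (D x *m ad x)) = \tr (S *m D x *m ad x) by rewrite mulmxA.
  by rewrite opprD addrCA subrr addr0.
have sum0 : \sum_i \tr (der_defect S (e i) *m D (e i)) = 0.
  under eq_bigr do rewrite trTD.
  rewrite sumrN -linear_sum /= -mulmx_sumr -(linear_sum ad_lin) D0 /= [ad 0](linear0 ad_lin).
  by rewrite mulmx0 linear0 oppr0.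
(* Pairing the torsion with [D] gives zero by [sum0]. As the torsion is alternating, pairing it with
   the antisymmetrisation of [D], which is the torsion itself, gives zero too. *)
have H : \sum_i \sum_j dot (e j *m der_defect S (e i)) (e j *m der_defect S (e i)) = 0.
  have P : \sum_i \sum_j dot (e j *m der_defect S (e i)) (e j *m D (e i)) = 0.
    under eq_bigr do rewrite trace_dot2 sD mulmxN linearN /=.
    by rewrite sumrN sum0 oppr0.
  under eq_bigr do under eq_bigr do rewrite -{2}DT dotDr dotNr.
  under eq_bigr do rewrite big_split /= sumrN.
  rewrite big_split /= P add0r sumrN exchange_big /=.
  rewrite -[RHS]P -sumrN; apply: eq_bigr => i _; rewrite -sumrN; apply: eq_bigr => j _.
  by rewrite der_defect_alt dotNl opprK.
move=> x; apply: eq_mx_row => y; rewrite mulmx0.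
have T0 i j : e j *m der_defect S (e i) = 0.
  apply: dot_eq0; apply/eqP; move/eqP: H.
  rewrite psumr_eq0 => [/allP/(_ i (mem_index_enum _))|k _]; last by apply: sumr_ge0 => l _; exact: dot_ge0.
  by rewrite /= psumr_eq0 => [/allP/(_ j (mem_index_enum _))|k _]; last exact: dot_ge0.
have T1 i z : z *m der_defect S (e i) = 0.
  rewrite -(sum_delta z) mulmx_suml big1 // => j _.
  by rewrite -scalemxAl T0 scaler0.
rewrite der_defect_alt -(sum_delta x) mulmx_suml big1 ?oppr0 // => i _.
by rewrite -scalemxAl der_defect_alt T1 oppr0 scaler0.
Qed.

Lemma der_defect0_der S : (forall x, der_defect S x = 0) -> isder S.
Proof.
move=> T0 x y; have := der_defectE S x y; rewrite T0 mulmx0 => /esym/eqP.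
by rewrite subr_eq0 subr_eq => /eqP ->; rewrite addrC.
Qed.

End lie.

(** * Representations on skew endomorphisms and Wilson's theorem *)

Section wilson.
Context {R : realType} {n : nat} {br : 'rV[R]_n -> 'rV[R]_n -> 'rV[R]_n}.
Hypothesis brl : forall y, linear (br^~ y).
Hypothesis brC : forall x y, br x y = - br y x.
Hypothesis nil : exists K, forall x, killed (br := br) K x.
Variable Phi : 'rV[R]_n -> 'M[R]_n -> 'M[R]_n.
Hypothesis Phi_r : forall x, linear (Phi x).
Hypothesis Phi_l : forall S, linear (Phi^~ S).
Implicit Types (A B S D T : 'M[R]_n) (u v w x y z : 'rV[R]_n) (U V : {vspace 'M[R]_n}).
Local Notation e i := (delta_mx ord0 i : 'rV[R]_n).
Local Notation T := (der_defect brl brC).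
Local Notation killed := (killed (br := br)).
Local Notation ad := (ad brl brC).

(* The skew parts [Sf X] of the fundamental vector fields span such a space, [Phi x] being their
   derivative along the left-invariant field [x]: it is determined by the failure of [S] to be a
   derivation and has no curvature. *)
Definition admissible U := forall S, S \in U ->
  [/\ S^T = - S, forall x, Phi x S \in U,
      forall x y, y *m Phi x S - x *m Phi y S = y *m T S x
    & forall x y, Phi y (Phi x S) - Phi x (Phi y S) = Phi (br x y) S].

Lemma Phi0 x : Phi x 0 = 0.
Proof. by have := Phi_r x (-1) 0 0; rewrite scaler0 addr0 scaleN1r addNr. Qed.

Lemma admissible_sub U V : admissible U -> (V <= U)%VS -> (forall S x, S \in V -> Phi x S \in V) -> admissible V.
Proof.
move=> gU sVU iV S SV; have [h1 h2 h3 h4] := gU S (subvP sVU S SV).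
by split=> // x; exact: iV.
Qed.

(** If second derivatives vanish, each [Phi z S] has zero [der_defect] and so is a derivation;
    [torsion_free] then removes the torsion of [S], and [Phi x S] has the symmetries of
    [koszul_unique]. *)
Lemma admissible_torsion_free U : admissible U -> (forall S x y, S \in U -> Phi y (Phi x S) = 0) ->
  forall S x, S \in U -> Phi x S = 0.
Proof.
move=> gU H S x SU; have [sS hP hT _] := gU S SU.
have sk z : (Phi z S)^T = - Phi z S by have [] := gU _ (hP z).
have T0 y : T S y = 0.
  apply: (@torsion_free R n br brl brC nil S (Phi^~ S) sS sk _ hT y) => z; apply: (@der_defect0_der _ _ _ brl brC) => y'.
  apply: eq_mx_row => w; have [_ _ <- _] := gU _ (hP z).
  by rewrite !H // !mulmx0 subr0.
move: x; apply: koszul_unique => // x y.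
by apply/eqP; rewrite -subr_eq0 hT T0 mulmx0.
Qed.

Definition vecU U (c : 'rV[R]_(\dim U)) : 'M[R]_n := \sum_i c ord0 i *: (vbasis U)`_i.
(** The matrix of [Phi x] on [U] in the basis [vbasis U], acting on rows; by [matU_comm] these
    matrices turn brackets into commutators. *)
Definition matU U x : 'M[R]_(\dim U) := \matrix_(i, j) vector.coord (vbasis U) j (Phi x (vbasis U)`_i).

Lemma vbasis_in U (i : 'I_(\dim U)) : (vbasis U)`_i \in U.
Proof. by apply: vbasis_mem; apply: mem_nth; rewrite size_tuple. Qed.

Lemma vecU_in U c : vecU (U := U) c \in U.
Proof. by apply: rpred_sum => i _; apply: rpredZ; exact: vbasis_in. Qed.

Lemma vecU_inj U : injective (@vecU U).
Proof.
move=> c d E; apply/rowP => i.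
have F (a : 'rV[R]_(\dim U)) : vector.coord (vbasis U) i (vecU a) = a ord0 i.
  by apply: coord_sum_free; exact: basis_free (vbasisP U).
by rewrite -!F E.
Qed.

Lemma vecU_surj U S : S \in U -> exists c, S = vecU (U := U) c.
Proof.
move=> SU; exists (\row_i vector.coord (vbasis U) i S); rewrite {1}(coord_vbasis SU).
by apply: eq_bigr => i _; rewrite mxE.
Qed.

Lemma matUE U x c : admissible U -> Phi x (vecU c) = vecU (c *m matU U x).
Proof.
move=> gU; rewrite /vecU -[Phi x]/(mklin (Phi_r x) : _ -> _) linear_sum /=.
have E (i : 'I_(\dim U)) : Phi x (vbasis U)`_i = \sum_j vector.coord (vbasis U) j (Phi x (vbasis U)`_i) *: (vbasis U)`_j.
  by apply: coord_vbasis; have [_ + _ _] := gU _ (vbasis_in i); exact.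
under eq_bigr => i _.
  have -> : Phi x (c ord0 i *: (vbasis U)`_i) = c ord0 i *: Phi x (vbasis U)`_i.
    by have := Phi_r x (c ord0 i) (vbasis U)`_i 0; rewrite Phi0 !addr0.
  rewrite E scaler_sumr.
  over.
rewrite exchange_big; apply: eq_bigr => j _ /=.
by rewrite mxE scaler_suml; apply: eq_bigr => i _; rewrite scalerA !mxE.
Qed.

Lemma matU_comm U x y : admissible U -> matU U x *m matU U y - matU U y *m matU U x = matU U (br x y).
Proof.
move=> gU; apply: eq_mx_row => c; apply: vecU_inj.
have [_ _ _] := gU _ (vecU_in c); move=> /(_ x y).
rewrite !matUE // => <-; rewrite mulmxBr !mulmxA /vecU -sumrB.
by apply: eq_bigr => i _; rewrite !mxE scalerBl.
Qed.

Definition trivial_on U := forall S x, S \in U -> Phi x S = 0.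

Lemma vspace_lt U V : (V <= U)%VS -> (exists2 S, S \in U & S \notin V) -> (\dim V < \dim U)%N.
Proof.
move=> sVU [S SU nSV]; rewrite ltn_neqAle dimvS // andbT; apply: contra nSV => /eqP E.
by have /eqP -> : V == U by rewrite eqEdim sVU E leqnn.
Qed.

(** If [Phi z] were not onto, its image and its kernel in [U] would be smaller admissible spaces, on
    which [Phi] vanishes. Since [Phi z] commutes with every [Phi x], all [Phi y (Phi x A)] would
    vanish, and [admissible_torsion_free] would make [U] trivial. *)
Lemma schur U z : admissible U -> (forall V, admissible V -> (\dim V < \dim U)%N -> trivial_on V) -> ~ trivial_on U ->
  (exists2 S, S \in U & Phi z S <> 0) -> (forall w S, S \in U -> Phi (br w z) S = 0) ->
  forall S, S \in U -> exists2 S', S' \in U & Phi z S' = S.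
Proof.
move=> gU IH nU [S0 S0U nS0] cz S SU.
pose L := linfun (mklin (Phi_r z)) : 'End('M[R]_n).
have LE A : L A = Phi z A by rewrite lfunE.
have comm x A : A \in U -> Phi z (Phi x A) = Phi x (Phi z A).
  by move=> AU; have [_ _ _ /(_ x z)] := gU A AU; rewrite cz // => /eqP; rewrite subr_eq0 => /eqP.
pose V1 := (L @: U)%VS.
have sV1 : (V1 <= U)%VS.
  by apply/subvP => _ /memv_imgP[A AU ->]; rewrite LE; have [_ + _ _] := gU A AU; exact.
have [/eqP E|ne] := boolP (V1 == U).
  by move: SU; rewrite -{1}E => /memv_imgP[S' S'U ->]; exists S'; rewrite ?LE.
exfalso; apply: nU.
have g1 : admissible V1.
  apply: (admissible_sub gU sV1) => _ x /memv_imgP[A AU ->]; rewrite LE -comm // -LE.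
  by apply: memv_img; have [_ + _ _] := gU A AU; exact.
have t1 : trivial_on V1.
  by apply: IH => //; rewrite ltn_neqAle dimvS // andbT; apply: contra ne => /eqP d1; rewrite eqEdim sV1 d1 /=.
pose V2 := (U :&: lker L)%VS.
have g2 : admissible V2.
  apply: (admissible_sub gU (capvSl _ _)) => A x; rewrite !memv_cap !memv_ker !LE => /andP[AU /eqP A0].
  have [_ -> _ _] := gU A AU; rewrite comm // A0 Phi0 eqxx //.
have t2 : trivial_on V2.
  apply: IH => //; apply: vspace_lt; first exact: capvSl.
  by exists S0 => //; rewrite memv_cap memv_ker LE S0U /=; apply/eqP.
apply: admissible_torsion_free => // A x y AU; apply: t2; rewrite memv_cap memv_ker LE.
have [_ -> _ _] := gU A AU; rewrite comm // t1 ?eqxx // -LE; exact: memv_img.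
Qed.

(* A chain [z, [w, z], [w', [w, z]], ...] on which [Phi] does not vanish stops by nilpotency. *)
Lemma last_nontrivial U k (P : 'rV[R]_n -> Prop) z : (forall w z, P z -> P (br w z)) -> P z -> killed k z ->
  (exists2 S, S \in U & Phi z S <> 0) -> exists z', [/\ P z', exists2 S, S \in U & Phi z' S <> 0
    & forall w S, S \in U -> Phi (br w z') S = 0].
Proof.
move=> hP; elim: k z => [|k IH] z Pz kz [S SU nS].
  by exfalso; apply: nS; rewrite kz; have := Phi_l S (-1) 0 0; rewrite scaler0 addr0 scaleN1r addNr.
have [[w [S' [S'U nS']]]|h] := EM (exists w S, S \in U /\ Phi (br w z) S <> 0).
  by apply: (IH (br w z)); [exact: hP|exact: kz|exists S'].
exists z; split => //; first by exists S.
by move=> w S' S'U; apply: contrapT => n0; apply: h; exists w, S'.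
Qed.

(** Otherwise the last nontrivial [z] of a chain of brackets acts invertibly by [schur] and commutes
    with everything. As [z] is itself a bracket, the identity is a commutator times a matrix
    commuting with both factors, and its trace [\dim U] is zero. *)
Lemma commuting U : admissible U -> (forall V, admissible V -> (\dim V < \dim U)%N -> trivial_on V) -> ~ trivial_on U ->
  forall x y S, S \in U -> Phi (br x y) S = 0.
Proof.
move=> gU IH nU x y S SU; apply: contrapT => n0.
have [K nK] := nil.
have [z [[a [b zab]] nz cz]] : exists z, [/\ exists a b, z = br a b, exists2 S, S \in U & Phi z S <> 0
    & forall w S, S \in U -> Phi (br w z) S = 0].
  apply: (@last_nontrivial U K (fun z => exists a b, z = br a b) (br x y)) => //.
  - by move=> w z _; exists w, z.
  - by exists x, y.
  - by exists S.
have surj := schur gU IH nU nz cz.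
have fM : matU U z \in unitmx.
  rewrite -row_full_unit; apply/row_fullP.
  have pick (i : 'I_(\dim U)) : exists c : 'rV[R]_(\dim U), c *m matU U z = delta_mx ord0 i.
    have [S' S'U E] := surj _ (vecU_in (delta_mx ord0 i)).
    have [c Ec] := vecU_surj S'U; exists c; apply: vecU_inj.
    by rewrite -matUE // -Ec.
  have [f Hf] := choice pick; exists (\matrix_i f i).
  by apply/row_matrixP => i; rewrite row_mul rowK Hf row1.
have MC w : matU U w *m matU U z = matU U z *m matU U w.
  apply/eqP; rewrite -subr_eq0 matU_comm //; apply/eqP; apply: eq_mx_row => c; apply: vecU_inj.
  by rewrite -matUE // cz ?vecU_in // mulmx0 /vecU big1 // => i _; rewrite mxE scale0r.
have MVC w : matU U w *m invmx (matU U z) = invmx (matU U z) *m matU U w.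
  by rewrite -[LHS]mul1mx -(mulVmx fM) -!mulmxA (mulmxA (matU U z)) -MC -!mulmxA mulmxV // mulmx1.
have tr1 : \tr (1%:M : 'M[R]_(\dim U)) = 0.
  rewrite -(mulmxV fM) {1}zab -matU_comm // mulmxBl linearB /=.
  by rewrite -[X in \tr X - _]mulmxA mxtrace_mulC -mulmxA -MVC mulmxA subrr.
have d0 : \dim U = 0%N by apply/eqP; move: tr1; rewrite mxtrace1 => /eqP; rewrite pnatr_eq0.
apply: nU => A w AU; have /eqP U0 : U == 0%VS by rewrite -dimv_eq0 d0.
by move: AU; rewrite U0 memv0 => /eqP ->; exact: Phi0.
Qed.

End wilson.

Section wilson2.
Context {R : realType} {n : nat} {br : 'rV[R]_n -> 'rV[R]_n -> 'rV[R]_n}.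
Hypothesis brl : forall y, linear (br^~ y).
Hypothesis brC : forall x y, br x y = - br y x.
Hypothesis nil : exists K, forall x, killed (br := br) K x.
Variable Phi : 'rV[R]_n -> 'M[R]_n -> 'M[R]_n.
Hypothesis Phi_r : forall x, linear (Phi x).
Hypothesis Phi_l : forall S, linear (Phi^~ S).
Implicit Types (A B S D : 'M[R]_n) (u v w x y z : 'rV[R]_n) (U V : {vspace 'M[R]_n}).
Local Notation e i := (delta_mx ord0 i : 'rV[R]_n).
Local Notation T := (der_defect brl brC).
Local Notation killed := (killed (br := br)).
Local Notation ad := (ad brl brC).
Local Notation admissible := (admissible brl brC Phi).
Local Notation trivial_on := (trivial_on Phi).

(** The commuting endomorphisms [Phi y] of [U] have a common complex eigenvector [A + i B]; its
    weight is linear in [y] and is represented by the vectors [a] and [b]. *)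
Lemma eigenpair_on U : admissible U -> ~ trivial_on U -> (forall x y S, S \in U -> Phi (br x y) S = 0) ->
  exists A B (a b : 'rV[R]_n), [/\ A \in U, B \in U, ~ (A = 0 /\ B = 0),
    forall y, Phi y A = dot y a *: A - dot y b *: B & forall y, Phi y B = dot y b *: A + dot y a *: B].
Proof.
move=> gU nU cU.
have dU : (0 < \dim U)%N.
  rewrite lt0n; apply/negP => /eqP d0; apply: nU => S x SU.
  have /eqP U0 : U == 0%VS by rewrite -dimv_eq0 d0.
  by move: SU; rewrite U0 memv0 => /eqP ->; exact: (Phi0 Phi_r).
have comm i j : matU Phi U (e i) *m matU Phi U (e j) = matU Phi U (e j) *m matU Phi U (e i).
  apply/eqP; rewrite -subr_eq0 (matU_comm Phi_r) //; apply/eqP; apply: eq_mx_row => c; apply: vecU_inj.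
  by rewrite -(matUE Phi_r) // cU ?vecU_in // mulmx0 /vecU big1 // => k _; rewrite mxE scale0r.
have [c1 [c2 [nz H]]] := real_eigenpair dU comm.
have [al Hal] := choice H; have [be Hbe] := choice Hal.
pose A := vecU c1; pose B := vecU c2.
have vecD (a : R) (c d : 'rV[R]_(\dim U)) : vecU (a *: c + d) = a *: vecU c + vecU d.
  by rewrite /vecU scaler_sumr -big_split; apply: eq_bigr => k _; rewrite !mxE scalerDl scalerA.
have vec0 : vecU (0 : 'rV[R]_(\dim U)) = 0 by rewrite /vecU big1 // => k _; rewrite mxE scale0r.
pose a := \row_i al i; pose b := \row_i be i.
have EA i : Phi (e i) A = al i *: A - be i *: B.
  rewrite /A (matUE Phi_r) // (Hbe i).1 vecD -[- (be i *: c2)]scaleNr -[_ *: c2]addr0 vecD vec0 addr0.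
  by rewrite scaleNr.
have EB i : Phi (e i) B = be i *: A + al i *: B.
  by rewrite /B (matUE Phi_r) // (Hbe i).2 vecD -[_ *: c2]addr0 vecD vec0 addr0.
have sumE S y : Phi y S = \sum_i y ord0 i *: Phi (e i) S.
  rewrite -{1}(sum_delta y) -[Phi _ S]/(mklin (Phi_l S) _) linear_sum /=.
  apply: eq_bigr => i _; have := Phi_l S (y ord0 i) (e i) 0.
  by have := Phi_l S (-1) 0 0; rewrite scaler0 addr0 scaleN1r addNr => ->; rewrite !addr0.
exists A, B, a, b; split; rewrite ?vecU_in //.
- by move=> [A0 B0]; apply: nz; split; apply: vecU_inj; rewrite ?vec0.
- move=> y; rewrite sumE !dotE !scaler_suml -sumrB; apply: eq_bigr => i _.
  by rewrite EA !mxE scalerBr !scalerA.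
move=> y; rewrite sumE !dotE !scaler_suml -big_split /=; apply: eq_bigr => i _.
by rewrite EB !mxE scalerDr !scalerA.
Qed.

Lemma weight_eq0 A B p q : ~ (A = 0 /\ B = 0) -> p *: A - q *: B = 0 -> q *: A + p *: B = 0 -> p = 0 /\ q = 0.
Proof.
move=> nz E1 E2.
have H : (p * p + q * q) *: A = 0 /\ (p * p + q * q) *: B = 0.
  split.
    transitivity (p *: (p *: A - q *: B) + q *: (q *: A + p *: B)); last by rewrite E1 E2 !scaler0 addr0.
    by apply/matrixP => i j; rewrite !mxE; ring.
  transitivity (p *: (q *: A + p *: B) - q *: (p *: A - q *: B)); last by rewrite E1 E2 !scaler0 subr0.
  by apply/matrixP => i j; rewrite !mxE; ring.
have [E|ne] := eqVneq (p * p + q * q) 0; first by split; nra.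
by case: nz; have [/eqP h1 /eqP h2] := H; rewrite !scaler_eq0 (negbTE ne) /= in h1 h2; split; apply/eqP.
Qed.

(* No nonzero weight: [schur] makes [Phi x] invertible for the first nontrivial [x] of the upper
   central series, and the trace of [A A^T + B B^T] over an eigenpair turns out to be nonpositive. *)
Lemma wilson_step U : admissible U -> (forall V, admissible V -> (\dim V < \dim U)%N -> trivial_on V) -> trivial_on U.
Proof.
move=> gU IH; apply: contrapT => nU.
have cU := commuting nil Phi_r Phi_l gU IH nU.
have [x [j [kx nx kj]]] : exists x j, [/\ killed j.+1 x, exists2 S, S \in U & Phi x S <> 0
    & forall y S, killed j y -> S \in U -> Phi y S = 0].
  have [K nK] := nil.
  have [x [S [SU nS]]] : exists x S, S \in U /\ Phi x S <> 0.
    apply: contrapT => h; apply: nU => S x SU; apply: contrapT => n0; apply: h; by exists x, S.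
  have : exists2 x, killed K x & exists2 S, S \in U & Phi x S <> 0 by exists x => //; exists S.
  elim: K {nK} => [[y y0 [S' _]]|K IHK [y ky [S' S'U nS']]].
    by case; rewrite y0; have := Phi_l S' (-1) 0 0; rewrite scaler0 addr0 scaleN1r addNr.
  have [h|h] := EM (exists2 x, killed K x & exists2 S, S \in U & Phi x S <> 0); first exact: IHK.
  exists y, K; split => //; first by exists S'.
  by move=> y' S'' ky' S''U; apply: contrapT => n0; apply: h; exists y' => //; exists S''.
have surj := schur nil Phi_r gU IH nU nx (fun w S => @cU w x S).
have TE S y z : S \in U -> y *m Phi z S - z *m Phi y S = br z y *m S - br (z *m S) y - br z (y *m S).
  by move=> SU; have [_ _ -> _] := gU S SU; rewrite der_defectE.
have sk S u v : S \in U -> dot (u *m S) v = - dot u (v *m S).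
  by move=> SU; have [sS _ _ _] := gU S SU; exact: dot_skew.
(* [U] annihilates the [j]-th centre. Writing [S] as [Phi x S'] repeatedly lowers the central term
   containing [z *m S] down to the [i]-th, where skewness and the induction hypothesis give
   [<z S, z S> = 0]. *)
have zS i : (i <= j)%N -> forall z S, killed i z -> S \in U -> z *m S = 0.
  elim: i => [_ z S -> _|i IHi ij z S kz SU]; first by rewrite mul0mx.
  have IHi' := IHi (ltnW ij).
  have rel S' : S' \in U -> z *m Phi x S' = - br x (z *m S') + br z (x *m S').
    move=> S'U; have := TE S' x z S'U.
    have -> : Phi z S' = 0 by apply: kj => //; exact: killed_le ij kz.
    have -> : br z x *m S' = 0 by apply: IHi' => //; exact: killed_br.
    rewrite mulmx0 !sub0r => /eqP; rewrite eqr_oppLR opprB opprK => /eqP ->.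
    by rewrite (brC (z *m S')) addrC.
  have [K nK] := nil.
  have H m : forall S', S' \in U -> killed (i + (K - m)) (z *m S').
    elim: m => [|m IHm] S' S'U; first by have := nK (z *m S'); apply: killed_le => //; rewrite subn0 leq_addl.
    have [mK|Km] := ltnP m K; last first.
      by have := IHm _ S'U; rewrite (eqP (_ : K - m == 0)%N) ?subn_eq0 // (eqP (_ : K - m.+1 == 0)%N) // subn_eq0 ltnW.
    have [S'' S''U <-] := surj _ S'U; rewrite rel //; apply: killedD => //.
      by apply: killedN => //; have := IHm _ S''U; rewrite -(subnSK mK) addnS; apply.
    by have := killed_br brl brC (x *m S'') kz; apply: killed_le => //; rewrite leq_addr.
  have kzS : killed i (z *m S) by have := H K S SU; rewrite subnn addn0.
  by apply: dot_eq0; rewrite sk // (IHi' _ _ kzS SU) dotC dot0l oppr0.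
have {}zS z S : killed j z -> S \in U -> z *m S = 0 by exact: zS.
have [A [B [a [b [AU BU nz PA PB]]]]] := eigenpair_on gU nU cU.
have w0 y : (forall S, S \in U -> Phi y S = 0) -> dot y a = 0 /\ dot y b = 0.
  by move=> h; apply: (weight_eq0 nz); rewrite -?PA -?PB h.
pose p := dot x a; pose q := dot x b; pose d := p * p + q * q.
have d0 : d != 0.
  apply/eqP => dE; have [S SU nS] := nx.
  have p0 : p = 0 by rewrite /d in dE; nra.
  have q0 : q = 0 by rewrite /d in dE; nra.
  have inj S' : S' \in U -> Phi x S' = 0 -> S' = 0.
    (* a surjective endomorphism of a finite dimensional space is injective *)
    move=> S'U E; pose L := linfun (mklin (Phi_r x)) : 'End('M[R]_n).
    have LE C : L C = Phi x C by rewrite lfunE.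
    have sU : (L @: U)%VS = U.
      apply/vspaceP => C; apply/idP/idP.
        by move=> /memv_imgP[D DU ->]; rewrite LE; have [_ + _ _] := gU D DU; exact.
      by move=> CU; have [D DU <-] := surj _ CU; rewrite -LE; exact: memv_img.
    have /eqP := limg_ker_dim L U; rewrite sU -[X in _ == X]add0n eqn_add2r dimv_eq0 => /eqP K0.
    have : S' \in (U :&: lker L)%VS by rewrite memv_cap memv_ker LE S'U E eqxx.
    by rewrite K0 memv0 => /eqP.
  apply: nz; split; apply: inj => //; rewrite ?PA ?PB -/p -/q p0 q0 !scale0r ?subr0 ?addr0 //.
(* [T1 + i T2] is [A + i B] divided by its weight [p + i q] at [x], hence a preimage of it under
   [Phi x]. *)
pose T1 := d^-1 *: (p *: A + q *: B); pose T2 := d^-1 *: (p *: B - q *: A).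
have T1U : T1 \in U by rewrite rpredZ // rpredD ?rpredZ.
have T2U : T2 \in U by rewrite rpredZ // rpredB ?rpredZ.
have PZ y r S S' : Phi y (r *: S + S') = r *: Phi y S + Phi y S' by exact: Phi_r.
have Plin y r s S S' : Phi y (d^-1 *: (r *: S + s *: S')) = d^-1 *: (r *: Phi y S + s *: Phi y S').
  rewrite -[d^-1 *: _]addr0 PZ (Phi0 Phi_r) addr0; congr (_ *: _).
  by rewrite PZ -[s *: S']addr0 PZ (Phi0 Phi_r) addr0.
have PT1 y : Phi y T1 = dot y a *: T1 - dot y b *: T2.
  by rewrite /T1 Plin PA PB /T2; apply/matrixP => k l; rewrite !mxE; ring.
have PT2 y : Phi y T2 = dot y b *: T1 + dot y a *: T2.
  by rewrite /T2 -scaleNr Plin PA PB /T1; apply/matrixP => k l; rewrite !mxE; ring.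
have ET1 : Phi x T1 = A.
  rewrite /T1 Plin PA PB -/p -/q.
  have -> : p *: (p *: A - q *: B) + q *: (q *: A + p *: B) = d *: A.
    by apply/matrixP => k l; rewrite !mxE /d; ring.
  by rewrite scalerA mulVf // scale1r.
have ET2 : Phi x T2 = B.
  rewrite /T2 -scaleNr Plin PA PB -/p -/q.
  have -> : p *: (q *: A + p *: B) + - q *: (p *: A - q *: B) = d *: B.
    by apply/matrixP => k l; rewrite !mxE /d; ring.
  by rewrite scalerA mulVf // scale1r.
pose w1 := x *m T1; pose w2 := x *m T2.
(* [[x, y] *m S] vanishes by [zS] and [[x, y S]] lies in the [j]-th centre, so the torsion formula
   simplifies modulo that centre. *)
have rel S y : S \in U -> killed j (y *m Phi x S - (x *m Phi y S - br (x *m S) y)).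
  move=> SU; have := TE S y x SU.
  have -> : br x y *m S = 0 by apply: zS => //; exact: killed_br.
  move=> E; have -> : y *m Phi x S - (x *m Phi y S - br (x *m S) y) = - br x (y *m S).
    by rewrite opprB addrCA E sub0r addNKr.
  by apply: killedN => //; exact: killed_br.
have rA y : killed j (y *m A - (dot y a *: w1 - dot y b *: w2 - br w1 y)).
  have E : x *m Phi y T1 = dot y a *: w1 - dot y b *: w2 by rewrite PT1 mulmxBr !scalemxAr.
  by have := rel T1 y T1U; rewrite ET1 E.
have rB y : killed j (y *m B - (dot y b *: w1 + dot y a *: w2 - br w2 y)).
  have E : x *m Phi y T2 = dot y b *: w1 + dot y a *: w2 by rewrite PT2 mulmxDr !scalemxAr.
  by have := rel T2 y T2U; rewrite ET2 E.
have br0 u y : dot (br u y) a = 0 /\ dot (br u y) b = 0 by apply: w0 => S SU; exact: cU.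
have kil0 y : killed j y -> dot y a = 0 /\ dot y b = 0 by move=> ky; apply: w0 => S SU; exact: kj.
(* On brackets with [w], [C] agrees with [- ad w] modulo the [j]-th centre, which [C] annihilates:
   [ad w *m C] is nilpotent. *)
have tr0 C w : C \in U -> (forall y, killed j (br w y *m C + br w (br w y))) -> \tr (ad w *m C) = 0.
  move=> CU hC; have [K nK] := nil; apply: (@nilpotent_trace _ _ K.+1) => y.
  have H m : forall y, killed (j + m) y -> iter m.+1 (mulmxr (ad w *m C)) y = 0.
    elim: m => [|m IHm] z kz.
      by rewrite /= mulmxA adE zS //; move: kz; rewrite addn0 => kz; exact: (killedS brl brC kz w).
    rewrite iterSr; apply: IHm; rewrite /= mulmxA adE.
    have -> : br w z *m C = (br w z *m C + br w (br w z)) - br w (br w z) by rewrite addrK.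
    apply: killedB => //; first by have := hC z; apply: killed_le => //; rewrite leq_addr.
    by rewrite addnS in kz; apply: killedS => //; exact: (killedS brl brC (kz w) w).
  by apply: H; have := nK y; apply: killed_le => //; rewrite leq_addl.
have trA : \tr (ad w1 *m A) = 0.
  apply: tr0 => // y; have := rA (br w1 y); have [-> ->] := br0 w1 y.
  by rewrite !scale0r subr0 sub0r opprK.
have trB : \tr (ad w2 *m B) = 0.
  apply: tr0 => // y; have := rB (br w2 y); have [-> ->] := br0 w2 y.
  by rewrite !scale0r addr0 sub0r opprK.
have norm C y v : C \in U -> killed j (y *m C - v) -> dot (y *m C) (y *m C) = dot v (y *m C).
  move=> CU k; apply/eqP; rewrite -subr_eq0 -dotNl -dotDl dotC sk // (zS _ _ k CU) dotC dot0l oppr0 eqxx //.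
have sumd C u v : C \in U -> \sum_i dot (e i) u * dot v (e i *m C) = dot v (u *m C).
  move=> CU; rewrite -{2}(sum_delta u) mulmx_suml dot_sumr; apply: eq_bigr => i _.
  by rewrite -scalemxAl dotZr (dotC _ u) dot_delta.
have sumt C w : C \in U -> \sum_i dot (br w (e i)) (e i *m C) = - \tr (ad w *m C).
  move=> CU; have [sC _ _ _] := gU C CU; under eq_bigr do rewrite -adE.
  by rewrite trace_dot2 sC mulmxN linearN.
have NA : \sum_i dot (e i *m A) (e i *m A) = dot w1 (a *m A) - dot w2 (b *m A).
  under eq_bigr do rewrite (norm _ _ _ AU (rA _)) !dotDl !dotNl !dotZl.
  by rewrite !big_split /= !sumrN !sumd // sumt // trA !oppr0 addr0.
have NB : \sum_i dot (e i *m B) (e i *m B) = dot w1 (b *m B) + dot w2 (a *m B).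
  under eq_bigr do rewrite (norm _ _ _ BU (rB _)) !dotDl !dotNl !dotZl.
  by rewrite !big_split /= !sumrN !sumd // sumt // trB !oppr0 addr0.
(* The weight vectors [a] and [b] are orthogonal to all brackets and to the [j]-th centre, so only
   the terms in [w1] and [w2] survive. *)
have val v u C (r s : R) w : C \in U -> killed j (v *m C - (r *: w1 + s *: w2 - br w v)) ->
   (u = a \/ u = b) -> dot v (u *m C) = - (r * dot w1 u + s * dot w2 u).
  move=> CU k hu; rewrite dotC sk // dotC; congr (- _).
  have k0 : dot (v *m C - (r *: w1 + s *: w2 - br w v)) u = 0 by case: hu => ->; have [] := kil0 _ k.
  have b0 : dot (br w v) u = 0 by case: hu => ->; have [] := br0 w v.
  by move: k0; rewrite dotDl dotNl !dotDl dotNl !dotZl b0; lra.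
have := val w1 a A _ _ _ AU (eq_ind _ (fun z => killed j (w1 *m A - (_ + z - _))) (rA w1) _ (esym (scaleNr _ _))) (or_introl erefl).
have := val w2 b A _ _ _ AU (eq_ind _ (fun z => killed j (w2 *m A - (_ + z - _))) (rA w2) _ (esym (scaleNr _ _))) (or_intror erefl).
have := val w1 b B _ _ _ BU (rB w1) (or_intror erefl).
have := val w2 a B _ _ _ BU (rB w2) (or_introl erefl).
set a1 := dot w1 a; set a2 := dot w2 a; set b1 := dot w1 b; set b2 := dot w2 b => e1 e2 e3 e4.
have tot : \sum_i dot (e i *m A) (e i *m A) + \sum_i dot (e i *m B) (e i *m B) <= 0.
  (* The four values combine to minus a sum of two squares, while the left side is the sum of the
     squared norms of [A] and [B]. *)
  rewrite NA NB e1 e2 e3 e4 (_ : _ + _ = - ((a1 + b2) ^+ 2 + (b1 - a2) ^+ 2)); last by ring.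
  by rewrite oppr_le0 addr_ge0 // sqr_ge0.
have zero C : C \in U -> \sum_i dot (e i *m C) (e i *m C) = 0 -> C = 0.
  move=> CU /eqP; rewrite psumr_eq0 => [/allP h|i _]; last exact: dot_ge0.
  apply/row_matrixP => i; rewrite row0 rowE; apply: dot_eq0; apply/eqP; exact: (h i (mem_index_enum i)).
have gA : 0 <= \sum_i dot (e i *m A) (e i *m A) by apply: sumr_ge0 => i _; exact: dot_ge0.
have gB : 0 <= \sum_i dot (e i *m B) (e i *m B) by apply: sumr_ge0 => i _; exact: dot_ge0.
by apply: nz; split; apply: zero => //; lra.
Qed.

Theorem wilson U : admissible U -> trivial_on U.
Proof.
have [d] := ubnP (\dim U); elim: d U => // d IH U dU gU.
apply: wilson_step => // V gV dV; apply: IH => //; exact: leq_trans dV dU.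
Qed.

End wilson2.

(** * Isometric actions on nilmanifolds *)

Section orthonormal.
Variable R : realType.

(** Gram-Schmidt in matrix form: while fewer than [n] rows are found, [G *m M^T] has a nonzero left
    kernel, and a normalised kernel vector is the next row. *)
Lemma orthonormal_frame n (G : 'M[R]_n) : G^T = G ->
  (forall u : 'rV[R]_n, u != 0 -> 0 < (u *m G *m u^T) ord0 ord0) ->
  exists2 P : 'M[R]_n, P \in unitmx & P *m G *m P^T = 1%:M.
Proof.
move=> sG pG.
have H r : (r <= n)%N -> exists M : 'M[R]_(r, n), M *m G *m M^T = 1%:M.
  elim: r => [_|r IH rn]; first by exists 0; apply/matrixP => -[].
  have [M EM] := IH (ltnW rn).
  have k0 : kermx (G *m M^T) != 0.
    rewrite -mxrank_eq0 mxrank_ker subn_eq0 -ltnNge.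
    exact: leq_ltn_trans (rank_leq_col _) rn.
  have [i ri] : exists i, row i (kermx (G *m M^T)) != 0.
    apply: contrapT => h; move/eqP: k0; apply; apply/row_matrixP => i; rewrite row0.
    by apply/eqP; apply: contrapT => /negP n0; apply: h; exists i.
  pose u := row i (kermx (G *m M^T)).
  have uM : u *m G *m M^T = 0 by rewrite -mulmxA /u -row_mul mulmx_ker row0.
  have cu := pG u ri; pose c := Num.sqrt ((u *m G *m u^T) ord0 ord0).
  have c0 : c != 0 by rewrite sqrtr_eq0 -ltNge.
  have E1 : (c^-1 *: u) *m G *m (c^-1 *: u)^T = 1%:M.
    rewrite linearZ /= -!scalemxAl -scalemxAr scalerA [u *m G *m _]mx11_scalar.
    rewrite -[X in X%:M](sqr_sqrtr (ltW cu)) -/c scale_scalar_mx expr2; congr (_ %:M).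
    by field.
  have E2 : (c^-1 *: u) *m G *m M^T = 0 by rewrite -!scalemxAl uM scaler0.
  have E3 : M *m G *m (c^-1 *: u)^T = 0.
    by apply: trmx_inj; rewrite trmx0 trmx_mul trmxK trmx_mul sG mulmxA E2.
  pose M' : 'M[R]_(1 + r, n) := col_mx (c^-1 *: u) M.
  have EM' : M' *m G *m M'^T = 1%:M.
    by rewrite /M' tr_col_mx mul_col_mx mul_col_row E1 E2 E3 EM -scalar_mx_block.
  by exists M'.
have [P EP] := H n (leqnn n); exists P => //.
by rewrite -mulmxA in EP; have [] := mulmx1_unit EP.
Qed.

End orthonormal.

Section span.
Variables (R : fieldType) (V : vectType R).

(** The span of a predicate, given by its induction principle. A family in [E] is enlarged until it
    generates; the dimension bounds the number of steps. *)
Lemma span_exists (E : V -> Prop) : exists U : {vspace V}, (forall v, E v -> v \in U) /\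
  forall Q : V -> Prop, Q 0 -> (forall a u v, Q u -> Q v -> Q (a *: u + v)) -> (forall v, E v -> Q v) ->
    forall v, v \in U -> Q v.
Proof.
have H k : exists2 X : seq V, (forall v, v \in X -> E v) &
    (forall v, E v -> v \in <<X>>%VS) \/ (k <= \dim <<X>>)%N.
  elim: k => [|k [X XE [h|h]]]; first by exists [::] => //; right.
    by exists X => //; left.
  have [hX|/existsNP[v /not_implyP[Ev /negP nv]]] := EM (forall v, E v -> v \in <<X>>%VS).
    by exists X => //; left.
  exists (v :: X); first by move=> w; rewrite inE => /orP[/eqP ->|/XE].
  right; apply: leq_ltn_trans h _; rewrite ltn_neqAle dimvS ?span_cons ?addvSr // andbT.
  apply: contra nv => /eqP d.
  have /eqP -> : <<X>>%VS == (<[v]> + <<X>>)%VS by rewrite eqEdim addvSr /= -d.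
  by rewrite memv_add0 // || apply: (subvP (addvSl _ _)); exact: memv_line.
have [X XE [h|h]] := H (dim V).+1; last first.
  by exfalso; have := leq_trans h (dimvS (subvf _)); rewrite dimvf ltnn.
exists <<X>>%VS; split => // Q Q0 QD QE v vX.
have := coord_span (X := in_tuple X) vX => ->.
apply: (big_ind Q) => // [u w Qu Qw|i _]; first by rewrite -[u]scale1r; exact: QD.
rewrite -[_ *: _]addr0; apply: QD => //; apply: QE; apply: XE; exact: mem_nth.
Qed.

End span.

Section koszul.
Context {R : realType} {n : nat} {br : 'rV[R]_n -> 'rV[R]_n -> 'rV[R]_n}.
Hypothesis brl : forall y, linear (br^~ y).
Hypothesis brC : forall x y, br x y = - br y x.
Implicit Types (S : 'M[R]_n) (x y : 'rV[R]_n).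
Local Notation e i := (delta_mx ord0 i : 'rV[R]_n).
Local Notation T := (der_defect brl brC).

(** The Koszul formula, which recovers a skew family [D] from its torsion. It makes the derivative
    of [S] a bilinear function [Phi] of the direction and of [S] itself. *)
Definition koszul x S : 'M[R]_n := \matrix_(j, k)
  (2^-1 * (dot (e j *m T S x) (e k) - dot (e k *m T S (e j)) x + dot (x *m T S (e k)) (e j))).

Lemma der_defect_linear_r S : linear (T S).
Proof.
move=> a x y; rewrite /der_defect mulmxDl -scalemxAl !(ad_linear brl brC) mulmxDr mulmxDl -scalemxAl -scalemxAr.
move: (_ *m S) (_ *m S) (ad _ _ (_ *m S)) (ad _ _ (_ *m S)) (S *m _) (S *m _) => *.
by apply/matrixP => i j; rewrite !mxE; ring.
Qed.

Lemma der_defect_linear_l x : linear (T^~ x).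
Proof.
move=> a S S'; rewrite /der_defect !mulmxDr !mulmxDl -!scalemxAl -!scalemxAr (ad_linear brl brC).
move: (_ *m S) (_ *m S') (ad _ _ (_ *m S)) (ad _ _ (_ *m S')) (S *m _) (S' *m _) => *.
by apply/matrixP => i j; rewrite !mxE; ring.
Qed.

Lemma koszul_linear_r x : linear (koszul x).
Proof.
move=> a S S'; apply/matrixP => j k; rewrite !mxE !der_defect_linear_l.
move: (T S x) (T S' x) (T S (e j)) (T S' (e j)) (T S (e k)) (T S' (e k)) => *.
by rewrite !mulmxDr -!scalemxAr !dotDl !dotZl; ring.
Qed.

Lemma koszul_linear_l S : linear (koszul^~ S).
Proof.
move=> a x x'; apply/matrixP => j k; rewrite !mxE !der_defect_linear_r.
move: (T S x) (T S x') (T S (e j)) (T S (e k)) => *.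
by rewrite !mulmxDr !mulmxDl -!scalemxAr -!scalemxAl !dotDl !dotDr !dotZl !dotZr; ring.
Qed.

Lemma koszulE S (D : 'rV[R]_n -> 'M[R]_n) : (forall x, (D x)^T = - D x) ->
  (forall x y, y *m D x - x *m D y = y *m T S x) -> forall x, D x = koszul x S.
Proof.
move=> sk DT x; apply/matrixP => j k; rewrite mxE -!DT !dotDl !dotNl.
have -> : D x j k = dot (e j *m D x) (e k) by rewrite dot_delta -rowE mxE.
have := dot_skew (e k) (e j) (sk x); rewrite (dotC (e k)).
have := dot_skew x (e k) (sk (e j)); rewrite (dotC x).
have := dot_skew x (e j) (sk (e k)); rewrite (dotC x).
move: (dot _ _) (dot _ _) (dot _ _) (dot _ _) (dot _ _) (dot _ _) => *; lra.
Qed.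

End koszul.

#[global] Program Instance FinDim_mx (R : realType) m n : FinDim ('M[R]_(m, n) : normedModType R) := {|
  fd_n := #|{: 'I_m * 'I_n}|;
  fd_e := fun k => delta_mx (enum_val k).1 (enum_val k).2;
  fd_c := fun k => mklin (_ : linear (fun M : 'M[R]_(m, n) => (M (enum_val k).1 (enum_val k).2 : R^o))) |}.
Next Obligation. by move=> R m n k a u v; rewrite !mxE. Qed.
Next Obligation. by move=> R m n k; exact: matrix_normedtype.coord_continuous. Qed.
Next Obligation.
move=> R m n v; rewrite {1}[v]matrix_sum_delta pair_bigA /=.
by rewrite -(big_enum_val (fun p => v p.1 p.2 *: delta_mx p.1 p.2)).
Qed.

Section inner.
Context {R : realType} {n : nat} {N : lieGroupType R n} (g : riemannian N).
Implicit Types (u v w : 'rV[R]_n).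
Local Notation ip := (inner g 1%g).

Lemma inner_dot (p : N) u v : inner g p u v = dot (u *m gram g p) v.
Proof. by []. Qed.

Lemma innerC (p : N) u v : inner g p u v = inner g p v u.
Proof. by rewrite !inner_dot dot_mx gram_sym dotC. Qed.

Lemma innerDZl (p : N) a u v w : inner g p (a *: u + v) w = a * inner g p u w + inner g p v w.
Proof. by rewrite !inner_dot mulmxDl -scalemxAl dotDl dotZl. Qed.

Lemma inner_eq0 (p : N) u : inner g p u u = 0 -> u = 0.
Proof.
move=> E; apply/eqP; apply: contrapT => /negP n0.
by have := gram_posdef g p n0; rewrite -/(inner g p u u) E ltxx.
Qed.

Lemma is_derive_inner (V : normedModType R) (p : N) (f h : V -> 'rV[R]_n) (x v : V) :
  smooth_at f x -> smooth_at h x ->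
  is_derive x v (fun y => inner g p (f y) (h y) : R^o) (inner g p ('D_v f x) (h x) + inner g p (f x) ('D_v h x)).
Proof.
move=> sf sh; have l : linear (fun u : 'rV[R]_n => u *m gram g p) by move=> a u u'; rewrite mulmxDl -scalemxAl.
have sG : smooth_at (fun y => mklin l (f y)) x by exact: smooth_at_lin.
have cl : continuous (mklin l) by exact: fd_linear_continuous.
have [_ e] := derivable_lin cl (smooth_at_derivable v sf).
by have := is_derive_dot v sG sh; rewrite e.
Qed.

Hypothesis gl : left_invariant g.

Lemma lmul_smooth (a : N) : smooth (fun x : N => a * x)%g.
Proof.
by apply: plots_smooth => d x ad dx; apply: plot_mul; [exact: plot_at_cst|exact: plot_at_point].
Qed.

(** Left invariance moves velocities to the identity, where the metric is one fixed inner
    product. *)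
Lemma inner_vel (V : normedModType R) (f : V -> N) x (v w : V) : plot_at f x ->
  inner g (f x) (vel f x v) (vel f x w) =
  ip (evel (fun y => (f x)^-1 * f y)%g x v) (evel (fun y => (f x)^-1 * f y)%g x w).
Proof.
move=> pf; pose h y := ((f x)^-1 * f y)%g.
have ph : plot_at h x by apply: plot_mul => //; exact: plot_at_cst.
have h1 : h x = 1%g by rewrite /h mulVg.
have E (u : V) : vel f x u = tangent_map (fun y : N => f x * y)%g (h x) (vel h x u).
  have E0 : (fun y => f x * h y)%g = f by apply/funext => y; rewrite /h mulVKg.
  by have := tangent_map_vel u (lmul_smooth (f x)) ph; rewrite E0 => ->.
have -> : ip (evel h x v) (evel h x w) = inner g (h x) (vel h x v) (vel h x w).
  by rewrite h1 !(evel_vel _ h1).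
by rewrite -(gl (f x) (h x)) -!E h1 mulg1.
Qed.

End inner.

Lemma conj_linear (R : realType) n (b : 'rV[R]_n -> 'rV[R]_n -> 'rV[R]_n) (P Q : 'M[R]_n) y :
  (forall y, linear (b^~ y)) -> linear (fun x => b (x *m P) (y *m P) *m Q).
Proof. by move=> bl a x x'; rewrite mulmxDl -scalemxAl bl mulmxDl -scalemxAl. Qed.

Lemma sub3_mul (R : realType) n (a b c : 'rV[R]_n) (Q : 'M[R]_n) :
  (a - b - c) *m Q = a *m Q - b *m Q - c *m Q.
Proof. by rewrite !mulmxBl. Qed.

Section isometric_action.
Context {R : realType} {k n : nat} {G : lieGroupType R k} {N : lieGroupType R n} {g : riemannian N}.
Variables (act : G -> N -> N) (p : N).
Hypothesis gl : left_invariant g.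
Hypothesis act1 : forall x, act 1%g x = x.
Hypothesis actM : forall a b x, act (a * b)%g x = act a (act b x).
Hypothesis act_smooth : smooth2 act.
Hypothesis act_isom : forall a, isometry g (act a).
Hypothesis N_nil : nilpotent_group N.
Local Notation co := (lco N).
Local Notation pt := (lpt N).
Local Notation e0 := (le0 N).
Local Notation gpt := (lpt G).
Local Notation g0 := (le0 G).
Local Notation c := (lchart N).
Local Notation gc := (lchart G).
Local Notation ip := (inner g (1%g : N)).
Local Notation Af := (Af act p).
Local Notation Sf := (Sf act p).
Implicit Types (u v w Y : 'rV[R]_n) (z X : 'rV[R]_k).

Lemma Af_orth Y Y' z w : cod gc z -> cod c w -> ip (Af Y (z, w)) (Af Y' (z, w)) = ip Y Y'.
Proof.
move=> cz cw; pose a := gpt z; pose f v := (base p w * pt v)%g.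
have pf : plot_at f e0 by apply: plot_mul; [exact: plot_at_cst|exact: plot_pt cod1].
have f0 : f e0 = base p w by rewrite /f pt1 mulg1.
have pa : plot_at (fun v => act a (f v)) e0 by apply: plot_act => //; exact: plot_at_cst.
have E1 B : evel (fun v => (f e0)^-1 * f v)%g e0 B = B.
  rewrite -[RHS](evel_pt (N := N)); apply: evel_ext; apply: filterE => v.
  by rewrite f0 /f mulKg.
have E2 B : evel (fun v => (act a (f e0))^-1 * act a (f v))%g e0 B = Af B (z, w).
  by rewrite AfE f0.
have [_ sm pm] := act_isom a.
have := inner_vel gl Y Y' pf; rewrite !E1 => <-.
have := inner_vel gl Y Y' pa; rewrite !E2 => <-.
by rewrite -(pm (f e0)) !(tangent_map_vel _ sm pf).
Qed.

Lemma Sf_skew X Y Y' w : cod c w -> ip (Sf X Y w) Y' = - ip Y (Sf X Y' w).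
Proof.
move=> cw; have sA B : smooth_at (fun z => Af B (z, w)) g0.
  by apply: smooth_at_p1; apply: smooth_Af => //; exact: cod1.
have [_ E] := is_derive_inner g 1%g X (sA Y) (sA Y').
have E0 : \forall z \near g0, ip (Af Y (z, w)) (Af Y' (z, w)) = (fun=> ip Y Y' : R^o) z.
  by apply: filterS (cod_near1 (N := G)) => z cz; exact: Af_orth.
have A1 B : Af B (g0, w) = B by exact: Af1.
have E' : 'D_X (fun z => ip (Af Y (z, w)) (Af Y' (z, w)) : R^o) g0 = 0.
  by apply: etrans (near_eq_derive X E0) _; exact: derive_cst.
have H : ip (Sf X Y w) Y' + ip Y (Sf X Y' w) = 0.
  apply: etrans (etrans (esym E) E'); apply: f_equal2.
    by apply: f_equal2; [exact: SfE|exact: esym (A1 Y')].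
  by apply: f_equal2; [exact: esym (A1 Y)|exact: SfE].
by apply/eqP; rewrite -addr_eq0 H.
Qed.

Definition Sm X w : 'M[R]_n := lin1_mx (fun Y => Sf X Y w).

Lemma SmE X w Y : cod c w -> Y *m Sm X w = Sf X Y w.
Proof.
move=> cw; have l : linear (fun Y => Sf X Y w) by exact: Sf_linear_r.
by rewrite /Sm -[fun _ => _]/(mklin l : _ -> _) mul_rV_lin1.
Qed.

Lemma smooth_Sm X w : cod c w -> smooth_at (Sm X) w.
Proof.
move=> cw; have l (i : 'I_n) : linear (fun v : 'rV[R]_n => delta_mx i ord0 *m v : 'M[R]_n).
  by move=> a u v; rewrite mulmxDr -scalemxAr.
apply: (@smooth_at_ext _ _ _ (fun u => \sum_i mklin (l i) (Sf X (delta_mx ord0 i) u))).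
  apply: filterS (cod_near cw) => u cu; apply: eq_mx_row => y; rewrite -{2}(sum_delta y) mulmx_suml mulmx_sumr.
  apply: eq_bigr => i _; rewrite -scalemxAl SmE //= mulmxA -colE.
  by rewrite [col i y]mx11_scalar mul_scalar_mx !mxE.
by apply: smooth_at_sum => i; apply: smooth_at_lin; exact: smooth_Sf.
Qed.

(** All points and all elements of the Lie algebra are treated at once, so that the span [U] of all
    values of [S] is stable under differentiation. [koszulE] identifies the derivatives with [Phi],
    [wilson] makes them vanish, and the torsion of [S X w], its failure to be a derivation, vanishes
    with them. *)
Theorem isometric_derivation X w Y Z : cod c w ->
  Sf X (lie_bracket N Y Z) w = lie_bracket N (Sf X Y w) Z + lie_bracket N Y (Sf X Z w).
Proof.
have [P uP EP] := orthonormal_frame (gram_sym g 1%g) (gram_posdef g 1%g).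
(* In the orthonormal frame [P] the inner product becomes [dot], as in the algebraic part. *)
pose br (x y : 'rV[R]_n) := lie_bracket N (x *m P) (y *m P) *m invmx P.
have brl y : linear (br^~ y).
  by apply: conj_linear => z a x x'; exact: bracket_linear_l.
have brC x y : br x y = - br y x by rewrite /br bracketC mulNmx.
have nil : exists K, forall x, killed (br := br) K x.
  have [K HK] := nilpotent_killed N_nil; exists K => x.
  have H j y : ad_killed N j (y *m P) -> killed (br := br) j y.
    elim: j y => [|j IH] y /=; first by move=> E; rewrite -(mulmxK uP y) E mul0mx.
    by move=> h z; apply: IH; rewrite /br mulmxKV.
  exact: H.
have GE : gram g 1%g = invmx P *m (invmx P)^T.
  rewrite -[LHS](mulKmx uP) -[X in _ *m X](mulmxK (_ : P^T \in unitmx)) ?unitmx_tr //.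
  by rewrite EP mul1mx trmx_inv.
have ipE u v : ip u v = dot (u *m invmx P) (v *m invmx P).
  by rewrite inner_dot GE mulmxA dot_mx trmxK.
pose S X w := P *m Sm X w *m invmx P.
have SE A u x : cod c u -> x *m S A u = Sf A (x *m P) u *m invmx P.
  by move=> cu; rewrite /S !mulmxA SmE.
have Ssk A u : cod c u -> (S A u)^T = - S A u.
  move=> cu; apply: eq_mx_row => x; apply: dot_inj => y.
  rewrite mulmxN dotNl dot_mx trmxK -[x in LHS](mulmxK uP) -[y in RHS](mulmxK uP).
  by rewrite !SE // -!ipE Sf_skew // opprK.
pose conjP (M : 'M[R]_n) := P *m M *m invmx P.
have lP : linear conjP by move=> a M M'; rewrite /conjP mulmxDr mulmxDl -scalemxAr -scalemxAl.
have sS A u : cod c u -> smooth_at (S A) u.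
  by move=> cu; exact: (smooth_at_lin (mklin lP) (smooth_Sm A cu)).
pose T := der_defect brl brC; pose Phi := koszul brl brC.
pose D A x u := lder N (x *m P) (S A) u.
have Drow A x y u : cod c u -> y *m D A x u = lder N (x *m P) (Sf A (y *m P)) u *m invmx P.
  move=> cu; have l1 : linear (fun M : 'M[R]_n => y *m M) by move=> a M M'; rewrite mulmxDr -scalemxAr.
  have l2 : linear (fun v : 'rV[R]_n => v *m invmx P) by move=> a v v'; rewrite mulmxDl -scalemxAl.
  have e1 : lder N (x *m P) (fun v => mklin l1 (S A v)) u = mklin l1 (lder N (x *m P) (S A) u).
    by apply: lder_lin; exact: sS.
  have e2 : lder N (x *m P) (fun v => mklin l2 (Sf A (y *m P) v)) u = mklin l2 (lder N (x *m P) (Sf A (y *m P)) u).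
    by apply: lder_lin; exact: smooth_Sf.
  apply: etrans (esym e1) _; apply: etrans _ e2; apply: lder_ext.
  by apply: filterS (cod_near cu) => v cv; exact: SE.
have Dsk A x u : cod c u -> (D A x u)^T = - D A x u.
  move=> cu; have l1 : linear (fun M : 'M[R]_n => M^T) by move=> a M M'; rewrite linearP.
  have e1 : lder N (x *m P) (fun v => mklin l1 (S A v)) u = mklin l1 (lder N (x *m P) (S A) u).
    by apply: lder_lin; exact: sS.
  have l2 : linear (fun M : 'M[R]_n => - M) by move=> a M M'; rewrite opprD scalerN.
  have e2 : lder N (x *m P) (fun v => mklin l2 (S A v)) u = mklin l2 (lder N (x *m P) (S A) u).
    by apply: lder_lin; exact: sS.
  apply: etrans (esym e1) _; apply: etrans _ e2; apply: lder_ext.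
  by apply: filterS (cod_near cu) => v cv; exact: Ssk.
have DT A u x y : cod c u -> y *m D A x u - x *m D A y u = y *m T (S A u) x.
  move=> cu; rewrite !Drow // -mulmxBl lder_Sf // der_defectE !SE //.
  have q1 : br x y *m P = lie_bracket N (x *m P) (y *m P) by rewrite /br mulmxKV.
  have q2 v : br (v *m invmx P) y = lie_bracket N v (y *m P) *m invmx P by rewrite /br mulmxKV.
  have q3 v : br x (v *m invmx P) = lie_bracket N (x *m P) v *m invmx P by rewrite /br mulmxKV.
  apply: etrans (sub3_mul _ _ _ _) _.
  by apply: f_equal2; [apply: f_equal2; [rewrite q1|rewrite q2]|rewrite q3].
have DPhi A u x : cod c u -> D A x u = Phi x (S A u).
  move=> cu; apply: (koszulE (brl := brl) (brC := brC) (D := fun x => D A x u)); first by move=> y; exact: Dsk.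
  by move=> y z; exact: DT.
have Phi_r x : linear (Phi x) by exact: koszul_linear_r.
have Phi_l M : linear (Phi^~ M) by exact: koszul_linear_l.
have [U [EU QU]] := span_exists (fun M : 'M[R]_n => exists A u, cod c u /\ M = S A u).
(* The linear map [L] below vanishes exactly on [U] and commutes with differentiation, while
   [L (S A v)] is zero for all [v] near [u]. *)
have DU A u x : cod c u -> D A x u \in U.
  move=> cu; pose L := (\1 - projv U)%VF : 'End('M[R]_n).
  have LE M : (M \in U) = (L M == 0).
    rewrite /L add_lfunE opp_lfunE id_lfunE subr_eq0 eq_sym.
    by apply/idP/eqP => [/projv_id|<-]; last exact: memv_proj.
  have lL : linear (fun M : 'M[R]_n => L M : 'M[R]_n) by move=> a M M'; rewrite linearP.
  have e1 : lder N (x *m P) (fun v => mklin lL (S A v)) u = mklin lL (lder N (x *m P) (S A) u).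
    by apply: lder_lin; exact: sS.
  rewrite LE; apply/eqP; apply: etrans (esym e1) _.
  apply: (etrans (y := lder N (x *m P) (fun=> 0 : 'M[R]_n) u)); last exact: derive_cst.
  apply: lder_ext; apply: filterS (cod_near cu) => v cv; apply/eqP; rewrite /= -LE.
  by apply: EU; exists A, v.
have gU : admissible brl brC Phi U.
  move=> M MU; split.
  - apply: (QU (fun M => M^T = - M)) => //; first by rewrite trmx0 oppr0.
      by move=> a M1 M2 h1 h2; rewrite linearP /= h1 h2 opprD scalerN.
    by move=> _ [A [u [cu ->]]]; exact: Ssk.
  - move=> x; apply: (QU (fun M => Phi x M \in U)) => //.
    + by rewrite (Phi0 Phi_r) mem0v.
    + by move=> a M1 M2 h1 h2; rewrite Phi_r memvD ?memvZ.
    + by move=> _ [A [u [cu ->]]]; rewrite -DPhi //; exact: DU.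
  - move=> x y; apply: (QU (fun M => y *m Phi x M - x *m Phi y M = y *m T M x)) => //.
    + by rewrite !(Phi0 Phi_r) /T der_defectE !mulmx0 /br !mul0mx bracket0l bracket0r !mul0mx !subr0.
    + move=> a M1 M2; have -> : T (a *: M1 + M2) x = a *: T M1 x + T M2 x by exact: der_defect_linear_l.
      move: (T M1 x) (T M2 x) => t1 t2 h1 h2; rewrite !Phi_r !mulmxDr -!scalemxAr -h1 -h2.
      move: (y *m _) (y *m _) (x *m _) (x *m _) => *; apply/rowP => i; rewrite !mxE; ring.
    + by move=> _ [A [u [cu ->]]]; rewrite -!DPhi // DT.
  - move=> x y; apply: (QU (fun M => Phi y (Phi x M) - Phi x (Phi y M) = Phi (br x y) M)) => //.
    + by rewrite !(Phi0 Phi_r) subr0.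
    + move=> a M1 M2 h1 h2; rewrite !Phi_r -h1 -h2.
      move: (Phi _ _) (Phi _ _) (Phi _ _) (Phi _ _) => *; apply/matrixP => i j; rewrite !mxE; ring.
    + move=> _ [A [u [cu ->]]].
      have H x1 y1 : lder N (x1 *m P) (lder N (y1 *m P) (S A)) u = Phi y1 (Phi x1 (S A u)).
        rewrite -(DPhi A u x1 cu); have e1 : lder N (x1 *m P) (fun v => mklin (Phi_r y1) (S A v)) u = mklin (Phi_r y1) (lder N (x1 *m P) (S A) u).
          by apply: lder_lin; exact: sS.
        apply: etrans _ e1.
        by apply: lder_ext; apply: filterS (cod_near cu) => v cv; exact: DPhi.
      have : lder N (x *m P) (lder N (y *m P) (S A)) u - lder N (y *m P) (lder N (x *m P) (S A)) u =
        lder N (lie_bracket N (x *m P) (y *m P)) (S A) u by apply: lder_comm => //; exact: sS.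
      rewrite !H => ->; rewrite -(DPhi A u (br x y) cu) /D /br mulmxKV //.
move=> cw; have SU : S X w \in U by apply: EU; exists X, w.
have W x := wilson nil Phi_r Phi_l gU x SU.
have d : isder (br := br) (S X w).
  apply: (@der_defect0_der _ _ _ brl brC) => x; apply: eq_mx_row => y; rewrite mulmx0.
  by have [_ _ <- _] := gU _ SU; rewrite !W !mulmx0 subr0.
have brP a b : br (a *m invmx P) (b *m invmx P) = lie_bracket N a b *m invmx P by rewrite /br !mulmxKV.
have SP a : a *m invmx P *m S X w = Sf X a w *m invmx P.
  by apply: etrans (SE X w _ cw) _; rewrite mulmxKV.
have E : Sf X (lie_bracket N Y Z) w *m invmx P =
    (lie_bracket N (Sf X Y w) Z + lie_bracket N Y (Sf X Z w)) *m invmx P.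
  apply: etrans (esym (SP _)) _; rewrite -brP; apply: etrans (d _ _) _; rewrite !SP !brP.
  exact: esym (mulmxDl _ _ _).
have : injective (fun v : 'rV[R]_n => v *m invmx P) by exact: can_inj (mulmxKV uP).
by apply.
Qed.

End isometric_action.

(** * Transitive actions *)

Lemma segment_const (R : realType) (V W : normedModType R) {FW : FinDim W} (f : V -> W) y w :
  (forall s : R, `|s| < 2 -> derivable f (y + s *: w) w /\ 'D_w f (y + s *: w) = 0) -> f (y + w) = f y.
Proof.
move=> H; have D (s : R^o) : `|s - 0| < 2 -> forall v : R^o, is_derive s v (fun s : R^o => f (y + (s : R) *: w)) 0.
  rewrite subr0 => s2 v; have [dP P0] := H s s2.
  have [d1 e1] := is_derive_line dP.
  have K1 : is_derive s (v *: (1 : R^o)) (fun s : R^o => f (y + (s : R) *: w)) (v *: 'D_w f (y + s *: w)).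
    by rewrite -e1; exact: is_derive_scale.
  by rewrite P0 scaler0 in K1; rewrite -[v]mulr1.
have one : `|(1 : R^o) - 0| < 2 by rewrite subr0 normr1 ltr1n.
have E : f (y + (1 : R^o) *: w) = f (y + (0 : R^o) *: w).
  exact: (zero_derive_const (f := fun s : R^o => f (y + (s : R) *: w)) D one).
by move: E; rewrite scale1r scale0r addr0.
Qed.

(* Constant rank: after composing with the local inverse of [F A + id B], the map [F] depends only
   on the coordinates seen by [A], so its local image meets each line along [ker A] at most once. *)
Lemma constant_rank_image (R : realType) k n (F : 'rV[R]_k -> 'rV[R]_n) z0 (Q : 'rV[R]_n -> Prop) :
  smooth_at F z0 -> (\forall z \near z0, (\rank (jac F z) <= \rank (jac F z0))%N) ->
  (\rank (jac F z0) < n)%N -> (\forall y \near F z0, Q y) ->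
  exists (C : set 'rV[R]_n) (u : 'rV[R]_n), [/\ compact C, (forall c, C c -> Q c), u != 0,
    (forall c (t : R), C c -> C (c + t *: u) -> t = 0) & \forall z \near z0, C (F z)].
Proof.
move=> sF rF rn nQ; set K := jac F z0; set r := \rank K in rn *.
have rk : (r <= k)%N by exact: rank_leq_row.
(* In the bases adapted to [K] the sum [K *m A + B] is [col_ebase K], hence invertible, and it is
   the Jacobian of [Psi] at [z0]. *)
pose A : 'M[R]_(n, k) := invmx (row_ebase K) *m pid_mx r.
pose B : 'M[R]_k := col_ebase K *m copid_mx r.
pose pi : 'M[R]_k := pid_mx r.
have Api : A *m pi = A by rewrite /A /pi -mulmxA pid_mx_id.
have Bpi : B *m pi = 0 by rewrite /B /pi -mulmxA mul_copid_mx_pid // mulmx0.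
have lA : linear (fun v : 'rV[R]_n => v *m A) by move=> a v w; rewrite mulmxDl -scalemxAl.
have lB : linear (fun v : 'rV[R]_k => v *m B) by move=> a v w; rewrite mulmxDl -scalemxAl.
have lp : linear (fun v : 'rV[R]_k => v *m pi) by move=> a v w; rewrite mulmxDl -scalemxAl.
have cA : continuous (mklin lA) by exact: fd_linear_continuous.
have cB : continuous (mklin lB) by exact: fd_linear_continuous.
have cp : continuous (mklin lp) by exact: fd_linear_continuous.
pose Psi z : 'rV[R]_k := mklin lA (F z) + mklin lB z.
have sPsi : smooth_at Psi z0.
  have s1 : smooth_at (fun z => mklin lA (F z)) z0 by exact: smooth_at_lin.
  have s2 : smooth_at (fun z => mklin lB z) z0 by exact: (smooth_at_lin _ (smooth_at_id z0)).
  exact: smooth_atD.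
have jPsi : jac Psi z0 \in unitmx.
  have -> : jac Psi z0 = col_ebase K.
    apply: eq_mx_row => v; rewrite -jacE //.
    have dF := smooth_at_derivable v sF; have dI := smooth_at_derivable v (smooth_at_id z0).
    have [d1 e1] := derivable_lin cA dF; have [d2 e2] := derivable_lin cB dI.
    rewrite (deriveD d1 d2) e1 e2 /= derive_id jacE // -/K -[in v *m K](mulmx_ebase K) -/r.
    rewrite /A /B -!mulmxA (mulmxA (row_ebase K)) mulmxV ?row_ebase_unit // mul1mx pid_mx_id; last exact: ltnW.
    by rewrite -mulmxDr -mulmxDr /copid_mx addrC subrK mulmx1.
  exact: col_ebase_unit.
have [g [g0 sg gK Kg]] := inverse_function sPsi jPsi.
set y0 := Psi z0 in g0 sg gK.
pose P y := F (g y).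
have sFg : smooth_at F (g y0) by rewrite g0.
have sP : smooth_at P y0 by exact: (smooth_at_comp sg sFg).
have gc := smooth_at_cont sg.
have nrel : \forall y \near y0, P y *m A = y *m pi.
  apply: filterS gK => y E; have E' : P y *m A + g y *m B = y by [].
  by rewrite -[y in RHS]E' mulmxDl -(mulmxA (P y)) -(mulmxA (g y)) Api Bpi mulmx0 addr0.
have nr : \forall y \near y0, (\rank (jac F (g y)) <= r)%N.
  have h : \forall z \near g y0, (\rank (jac F z) <= r)%N by rewrite g0.
  exact: (near_comp gc h).
have nsF : \forall y \near y0, smooth_at F (g y).
  exact: (near_comp gc (smooth_at_near sFg)).
have nPQ : \forall y \near y0, Q (P y).
  have h : \forall y \near P y0, Q y by rewrite /P g0.
  exact: (near_comp (smooth_at_cont sP) h).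
(* From [P y *m A = y *m pi] the Jacobian [J] of [P] satisfies [J *m A = pi], of rank [r]; as [J]
   itself has rank at most [r], its kernel is that of [pi]. *)
have Dz : \forall y \near y0, smooth_at P y /\ forall v, v *m pi = 0 -> 'D_v P y = 0.
  have n1 := near_near nrel; have n2 := smooth_at_near sg; have n3 := smooth_at_near sP.
  apply: filterS3 (filterI n1 n2) (filterI nr nsF) n3 => y [rel sgy] [ry sFy] sPy; split => // v v0.
  have JA : jac P y *m A = pi.
    apply: eq_mx_row => w; rewrite mulmxA -jacE //.
    have [_ e1] := derivable_lin cA (smooth_at_derivable w sPy).
    have [_ e2] := derivable_lin cp (smooth_at_derivable w (smooth_at_id y)).
    apply: etrans (esym e1) _; apply: etrans (near_eq_derive _ _) _; first exact: rel.
    by apply: etrans e2 _; rewrite derive_id.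
  have rJ : (\rank (jac P y) <= r)%N.
    have -> : jac P y = jac g y *m jac F (g y).
      apply: eq_mx_row => w; rewrite mulmxA -(jacE w sPy) -(jacE w sgy) -(jacE _ sFy).
      exact: smooth_at_chainE.
    exact: leq_trans (mxrankM_maxr _ _) ry.
  rewrite jacE //; apply/eqP; rewrite -sub_kermx; apply: (@submx_trans _ _ _ _ _ _ (kermx pi)).
    by rewrite sub_kermx v0.
  have sK : (kermx (jac P y) <= kermx pi)%MS.
    by rewrite sub_kermx -JA mulmxA mulmx_ker mul0mx.
  have [_ /esym] := mxrank_leqif_eq sK; rewrite !mxrank_ker rank_pid_mx // => E.
  have : (kermx (jac P y) == kermx pi)%MS.
    rewrite E eqn_leq; apply/andP; split; last by apply: leq_sub2l.
    by have := mxrankS sK; rewrite !mxrank_ker rank_pid_mx.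
  by move=> /eqmxP ->.
have nall : \forall y \near y0, Q (P y) /\ ((smooth_at P y /\ forall v, v *m pi = 0 -> 'D_v P y = 0) /\ P y *m A = y *m pi).
  exact: filterI nPQ (filterI Dz nrel).
move: nall => /nbhs_normP[rho /= rho0 Hrho].
(* The line through two points of the ball, followed for [|s| < 2], stays within [5 e] of [y0]. *)
pose e := rho / 6; have e0 : 0 < e by rewrite divr_gt0.
have e6 : e * 6 = rho by rewrite /e divfK.
pose cb := closed_ball y0 e.
have cbE y : cb y <-> `|y - y0| <= e by rewrite /cb closed_ballE // /closed_ball_ /= distrC.
have Hcb y : `|y - y0| < rho -> Q (P y) /\ ((smooth_at P y /\ forall v, v *m pi = 0 -> 'D_v P y = 0) /\ P y *m A = y *m pi).
  by move=> h; apply: Hrho; rewrite /= distrC.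
have small y : cb y -> `|y - y0| < rho by move=> /cbE h; lra.
have det y y' : cb y -> cb y' -> y *m pi = y' *m pi -> P y = P y'.
  move=> cy cy' E; pose w := y' - y.
  have w0 : w *m pi = 0 by rewrite mulmxBl E subrr.
  have nw : `|w| <= 2 * e.
    move/cbE: cy; move/cbE: cy' => h1 h2.
    have -> : w = (y' - y0) - (y - y0) by rewrite /w opprB addrA subrK.
    by apply: le_trans (ler_normB _ _) _; lra.
  have : P (y + w) = P y; last by rewrite /w addrC subrK.
  apply: segment_const => s s2.
  have inb : `|y + s *: w - y0| < rho.
    rewrite addrAC; apply: le_lt_trans (ler_normD _ _) _; rewrite normrZ.
    move/cbE: cy => h1; have : `|s| * `|w| <= 2 * (2 * e) by apply: ler_pM => //; exact: ltW.
    by move: (`|s| * `|w|) (`|y - y0|) h1 => *; lra.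
  have [_ [[sPs DPs] _]] := Hcb _ inb.
  by split; [exact: smooth_at_derivable|exact: DPs].
have ker0 : kermx A != 0.
  rewrite -mxrank_eq0 mxrank_ker subn_eq0 -ltnNge; apply: leq_ltn_trans (rn).
  have rpid : \rank (pid_mx r : 'M[R]_(n, k)) = r by rewrite rank_pid_mx //; exact: ltnW rn.
  by rewrite -[leqRHS]rpid; exact: mxrankM_maxr.
have [i ri] : exists i, row i (kermx A) != 0.
  apply: contrapT => h; move/eqP: ker0; apply; apply/row_matrixP => i; rewrite row0.
  by apply/eqP; apply: contrapT => /negP n0; apply: h; exists i.
(* Moving along a kernel vector of [A] does not change [P y *m A], which is [y *m pi], and by [det]
   this determines [P y]. *)
exists (P @` cb), (row i (kermx A)); split => //.
- apply: continuous_compact; last first.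
    apply: bounded_closed_compact; last exact: closed_ball_closed.
    exists (`|y0| + e); split => [|M hM y /cbE h]; first exact: num_real.
    apply: le_trans (ltW hM); rewrite -[y](subrK y0) addrC; apply: le_trans (ler_normD _ _) _.
    by rewrite lerD2l.
  apply: continuous_in_subspaceT => y /set_mem /small h.
  by have [_ [[sPy _] _]] := Hcb _ h; exact: smooth_at_cont.
- by move=> _ [y /small h <-]; have [] := Hcb _ h.
- move=> _ t [y cy <-] [y' cy' E].
  have [_ [_ r1]] := Hcb _ (small _ cy); have [_ [_ r2]] := Hcb _ (small _ cy').
  have : y *m pi = y' *m pi.
    by rewrite -r1 -r2 E mulmxDl -scalemxAl -row_mul mulmx_ker row0 scaler0 addr0.
  move=> /(det _ _ cy cy') E'; move: E; rewrite -E' => /esym/eqP.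
  by rewrite -subr_eq0 addrAC subrr add0r scaler_eq0 (negbTE ri) orbF => /eqP.
have nc : \forall z \near z0, cb (Psi z).
  have h : \forall y \near Psi z0, cb y.
    by apply/nbhs_normP; exists e => // y /= h; apply/cbE; rewrite distrC ltW.
  exact: (near_comp (smooth_at_cont sPsi) h).
by apply: filterS2 Kg nc => z Ez cz; exists (Psi z) => //; rewrite /P Ez.
Qed.

Lemma countable_dense (T : topologicalType) (x0 : T) : @second_countable T -> exists f : nat -> T,
  forall (O : set T) (x : T), nbhs x O -> exists i, O (f i).
Proof.
move=> [B /countable_injP[h ih] [oB bB]].
pose admissible i x := exists U, [/\ B U, h U = i & U x].
exists (fun i => if pselect (exists x, admissible i x) is left e then projT1 (cid e) else x0).
move=> O x /bB[U [BU Ux] UO]; exists (h U); apply: UO.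
case: pselect => [e|]; last by case; exists x, U.
have [V [BV hV Vx]] := projT2 (cid e).
have VU : V = U by apply: ih; rewrite ?inE.
by rewrite VU in Vx.
Qed.

Lemma baire_cover (R : realType) n (E : nat -> set 'rV[R]_n) (O : set 'rV[R]_n) : open O -> O !=set0 ->
  (forall i, closed (E i)) -> (forall i (x : 'rV[R]_n), ~ nbhs x (E i)) -> exists2 x, O x & forall i, ~ E i x.
Proof.
move=> oO O0 cE eE.
have H i : open (~` E i) /\ dense (~` E i).
  split; first exact: closed_openC.
  move=> U [x Ux] oU; apply: contrapT => h; apply: (eE i x); apply: (@filterS _ _ _ U).
    by move=> y Uy; apply: contrapT => nE; apply: h; exists y.
  exact: open_nbhs_nbhs.
by have [x [Ox h]] := Baire H O0 oO; exists x => // i; exact: h.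
Qed.

Lemma norm_gt_near (R : realType) (V : normedModType R) (x c : V) r :
  r < `|x - c| -> \forall y \near x, r < `|y - c|.
Proof.
move=> h; apply/nbhs_normP; exists (`|x - c| - r); first by rewrite /= subr_gt0.
by move=> y /= xy; have := ler_distD y x c; lra.
Qed.

Lemma open_norm_lt (R : realType) (V : normedModType R) (c : V) r : open [set x : V | `|x - c| < r].
Proof.
rewrite openE => x /= hx; rewrite /interior; apply/nbhs_normP; exists (r - `|x - c|).
  by rewrite /= subr_gt0.
by move=> y /= xy; have := ler_distD x y c; rewrite (distrC y x); lra.
Qed.

Section lmat.
Context {R : realType} {n : nat} (N : lieGroupType R n).
Local Notation e0 := (le0 N).

Definition lmat z := jac (fun y => mu N (z, y)) e0.

Lemma lmatE z Y : cod (lchart N) z -> Y *m lmat z = lfield N Y z.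
Proof.
move=> cz; rewrite -jacE; first by rewrite derive_p2.
by apply: smooth_at_p2; exact: smooth_mu0.
Qed.

Lemma smooth_lmat i j : smooth_at (fun z => lmat z i j : R^o) e0.
Proof.
apply: (@smooth_at_ext _ _ _ (fun z => lfield N (delta_mx ord0 i) z ord0 j : R^o)).
  by apply: filterS (cod_near1 (N := N)) => z cz; rewrite -lmatE // -rowE mxE.
by apply: (smooth_at_rowP _ _).1 => //; exact: smooth_lfield cod1.
Qed.

Lemma lmat1 : lmat e0 = 1%:M.
Proof. by apply: eq_mx_row => Y; rewrite lmatE ?mulmx1; [exact: lfield0|exact: cod1]. Qed.

Lemma lmat_unit : \forall z \near e0, lmat z \in unitmx.
Proof. by have [] := smooth_at_invmx smooth_lmat (_ : lmat e0 \in unitmx); rewrite ?lmat1 ?unitmx1. Qed.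

End lmat.

Section transitive.
Context {R : realType} {k n : nat} {G : lieGroupType R k} {N : lieGroupType R n}.
Variables (act : G -> N -> N) (p : N).
Hypothesis act1 : forall x, act 1%g x = x.
Hypothesis actM : forall a b x, act (a * b)%g x = act a (act b x).
Hypothesis act_smooth : smooth2 act.
Hypothesis act_tr : forall x y, exists a, act a x = y.
Local Notation co := (lco N).
Local Notation pt := (lpt N).
Local Notation e0 := (le0 N).
Local Notation gpt := (lpt G).
Local Notation g0 := (le0 G).
Local Notation c := (lchart N).
Local Notation gc := (lchart G).
Local Notation Kf := (Kf act p).

Let F z := kmap act p (z, e0).

Lemma F0 : F g0 = e0. Proof. by rewrite /F /kmap /= pt1 kap1. Qed.

Lemma smooth_F : smooth_at F g0.
Proof. by apply: smooth_at_p1; apply: smooth_kmap => //; exact: cod1. Qed.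

(** [kmap_lfield] factors the Jacobian at [z], up to the invertible frame of left-invariant fields,
    through the Jacobian at the identity. *)
Lemma rank_F : \forall z \near g0, (\rank (jac F z) <= \rank (jac F g0))%N.
Proof.
pose L := lmat G; have LE := @lmatE _ _ G; have uL := lmat_unit G.
have kl := kmap_lfield p act1 actM act_smooth.
have nF : \forall z \near g0, cod c (F z).
  by apply: (near_comp (smooth_at_cont smooth_F)); rewrite F0; exact: cod_near1.
apply: filterS3 (filterI uL (cod_near1 (N := G))) (kl) (filterI nF (smooth_at_near smooth_F)) => z [uz cz] H [cF sFz].
pose Q := lin1_mx (fun v : 'rV[R]_n => 'D_(0, Af act p v (z, e0)) (mu N) (F z, e0)).
have lQ : linear (fun v : 'rV[R]_n => 'D_(0, Af act p v (z, e0)) (mu N) (F z, e0)).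
  move=> a v v'; rewrite (Af_linear p act_smooth cz cod1).
  have s0 : smooth_at (mu N) (F z, e0) by exact: smooth_mu0.
  move: (Af _ _ v _) (Af _ _ v' _) => x y.
  have -> : (0, a *: x + y) = a *: (0, x) + (0, y) :> 'rV[R]_n * 'rV[R]_n.
    by congr pair; rewrite /= scaler0 addr0.
  exact: smooth_at_DD.
have E : L z *m jac F z = jac F g0 *m Q.
  apply: eq_mx_row => Y; rewrite mulmxA LE // -jacE // -H mulmxA -jacE; last exact: smooth_F.
  rewrite /Q -[fun v => _]/(mklin lQ : _ -> _) mul_rV_lin1 /=.
  by rewrite (Kf_kmap act p Y e0).
have -> : jac F z = invmx (L z) *m (jac F g0 *m Q) by rewrite -E mulKmx.
by apply: leq_trans (mxrankM_maxr _ _) _; exact: mxrankM_maxl.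
Qed.

(* Otherwise the orbit map has locally constant rank below [n], and by second countability [N] is a
   countable union of compact sets with empty interior, against Baire. *)
Theorem transitive_surjective Y : exists X, Kf X e0 = Y.
Proof.
suff fK : row_full (jac F g0).
  have /submxP[X EX] := submx_full (m1 := 1) Y fK.
  by exists X; rewrite Kf_kmap EX jacE //; exact: smooth_F.
rewrite -col_leq_rank leqNgt; apply/negP => rn.
have nQ : \forall y \near F g0, cod c y by rewrite F0; exact: cod_near1.
have [C [u [cC CQ u0 Cu CF]]] := constant_rank_image smooth_F rank_F rn nQ.
have [b Hb] := countable_dense (1%g : G) (@manifold_second_countable _ _ G).
have cact a : continuous (act a).
  move=> x; apply: (@continuous_comp _ _ _ (fun y : N => (a, y)) (fun q : G * N => act q.1 q.2)).
    by apply: cvg_pair; [exact: cvg_cst|exact: cvg_id].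
  exact: act_smooth.1.
have cmul (a : N) : continuous (fun x : N => a * x)%g.
  move=> x; apply: (@continuous_comp _ _ _ (fun y : N => (a, y)) (fun q : N * N => q.1 * q.2)%g).
    by apply: cvg_pair; [exact: cvg_cst|exact: cvg_id].
  exact: (@lie_mul_smooth _ _ N).1.
have cmulG (a : G) : continuous (fun x : G => a * x)%g.
  move=> x; apply: (@continuous_comp _ _ _ (fun y : G => (a, y)) (fun q : G * G => q.1 * q.2)%g).
    by apply: cvg_pair; [exact: cvg_cst|exact: cvg_id].
  exact: (@lie_mul_smooth _ _ G).1.
have cinvG : continuous (fun x : G => x^-1)%g := (@lie_inv_smooth _ _ G).1.
(* The translates of the local image [C] by the dense sequence [b] cover [N]. *)
pose h i (y : 'rV[R]_n) : N := act (b i) (p * pt y)%g.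
have ch i y : cod c y -> {for y, continuous (h i)}.
  move=> cy; apply: (@continuous_comp _ _ _ (fun y => p * pt y)%g (act (b i))); last exact: cact.
  by apply: (@continuous_comp _ _ _ pt (fun x => p * x)%g); [exact: point_continuous|exact: cmul].
have hinj i y y' : cod c y -> cod c y' -> h i y = h i y' -> y = y'.
  move=> cy cy' E; have := congr1 (act (b i)^-1%g) E; rewrite /h -!actM mulVg !act1 => /mulgI E'.
  by rewrite -(pointK cy) E' pointK.
have cover x : exists i y, C y /\ x = h i y.
  have [a <-] := act_tr p x.
  have nW : \forall z \near (1%g : G), exists2 y, C y & act z p = (p * pt y)%g.
    have cG : {for (1%g : G), continuous (lco G)} by exact: coord_continuous dom1.
    have nC : \forall z \near (1%g : G), C (F (lco G z)) by exact: (cG _ CF).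
    have nd : \forall z \near (1%g : G), dom gc z.
      by apply: open_nbhs_nbhs; split; [exact: dom_open|exact: dom1].
    have nk : \forall z \near (1%g : G), dom c (kap act p z e0).
      have ck : {for (1%g : G), continuous (fun z => kap act p z e0)}.
        apply: (@continuous_comp _ _ _ (fun z => act z (base p e0)) (fun x => (base p e0)^-1 * x)%g); last exact: cmul.
        apply: (@continuous_comp _ _ _ (fun z : G => (z, base p e0)) (fun q : G * N => act q.1 q.2)).
          by apply: cvg_pair; [exact: cvg_id|exact: cvg_cst].
        exact: act_smooth.1.
      by apply: (dom_near ck); rewrite kap1 //; exact: dom1.
    apply: filterS3 nC (nd) (nk) => z Cz dz kz; exists (F (lco G z)) => //.
    by rewrite /F /kmap /= (coordK dz) coordK // /kap /base pt1 mulg1 mulVKg.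
  have n2 : \forall z \near a, exists2 y, C y & act (z^-1 * a)%g p = (p * pt y)%g.
    have cz : {for a, continuous (fun z : G => z^-1 * a)%g}.
      apply: (@continuous_comp _ _ _ (fun z : G => (z^-1, a)%g) (fun q : G * G => q.1 * q.2)%g).
        by apply: cvg_pair; [exact: cinvG|exact: cvg_cst].
      exact: (@lie_mul_smooth _ _ G).1.
    have nW' : \forall z \near (a^-1 * a)%g, exists2 y, C y & act z p = (p * pt y)%g by rewrite mulVg.
    exact: (cz _ nW').
  have [i [y Cy E]] := Hb _ _ n2.
  by exists i, y; split => //; rewrite /h -E -actM mulVKg.
have [rho /= rho0 Hrho] : exists2 rho : R, 0 < rho & forall y, `|y - e0| <= rho -> cod c y.
  have /nbhs_normP[d /= d0 H] : \forall y \near e0, cod c y by exact: cod_near1.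
  exists (d / 2); first by rewrite divr_gt0.
  by move=> y hy; apply: H; rewrite /= distrC; apply: le_lt_trans hy _; rewrite ltr_pdivrMr // ltr_pMr // ltr1n.
pose E i : set 'rV[R]_n := [set x | `|x - e0| <= rho /\ (h i @` C) (pt x)].
have hC i : closed (h i @` C).
  apply: compact_closed; first exact: manifold_hausdorff.
  by apply: continuous_compact => //; apply: continuous_in_subspaceT => y /set_mem /CQ cy; exact: ch.
have cE i : closed (E i).
  rewrite -[E i]setCK; apply: open_closedC; rewrite openE => x nx; rewrite /interior.
  have [le|gt] := boolP (`|x - e0| <= rho); last first.
    rewrite -ltNge in gt; have H := norm_gt_near gt.
    by apply: filterS H => y ye [+ _]; rewrite leNgt ye.
  have nT : ~ (h i @` C) (pt x) by move=> H; apply: nx.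
  have oT : open (~` (h i @` C)) by exact: closed_openC.
  have : \forall y \near x, (~` (h i @` C)) (pt y).
    by apply: (point_continuous (Hrho _ le)); exact: open_nbhs_nbhs.
  by apply: filterS => y ny [_ /ny].
(* A neighbourhood of [x] inside [E i] would contain the image of a short segment [y + t u], whereas
   [C] meets that line only in [y]. *)
have eE i (x : 'rV[R]_n) : ~ nbhs x (E i).
  move=> nE; have [le [y Cy hy]] := nbhs_singleton nE.
  have cx := Hrho _ le; have cy := CQ _ Cy.
  pose l (t : R^o) := y + (t : R) *: u.
  have cl : {for (0 : R^o), continuous l} by exact: smooth_at_cont (smooth_at_affine y u 0).1.
  have l0 : l 0 = y by rewrite /l scale0r addr0.
  have cc : {for (0 : R^o), continuous (fun t => co (h i (l t)))}.
    apply: (@continuous_comp _ _ _ (fun t => h i (l t)) co).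
      by apply: (@continuous_comp _ _ _ l (h i)) => //; rewrite l0; exact: ch.
    by rewrite l0 hy; apply: coord_continuous; exact: point_dom.
  have n1 : \forall t \near (0 : R^o), E i (co (h i (l t))).
    by apply: cc; rewrite l0 hy pointK.
  have n2 : \forall t \near (0 : R^o), cod c (l t) by apply: cl; rewrite l0; exact: cod_near.
  have n3 : \forall t \near (0 : R^o), dom c (h i (l t)).
    have chl : {for (0 : R^o), continuous (fun t => h i (l t))}.
      by apply: (@continuous_comp _ _ _ l (h i)) => //; rewrite l0; exact: ch.
    by apply: (dom_near chl); rewrite l0 hy; exact: point_dom.
  have n4 : \forall t \near (0 : R^o), t = 0.
    apply: filterS3 n1 (n2) (n3) => t [_ [y' Cy' Ey']] clt dht.
    rewrite (coordK dht) in Ey'; have := hinj _ _ _ (CQ _ Cy') clt Ey' => E'.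
    by apply: (Cu y) => //; rewrite -/(l t) -E'.
  move: n4 => /nbhs_normP[d /= d0 H].
  have := H (d / 2); rewrite /= sub0r normrN gtr0_norm ?divr_gt0 // => H'.
  have d2 : d / 2 = 0 by apply: H'; rewrite ltr_pdivrMr // ltr_pMr // ltr1n.
  by move: d0; rewrite -[d](divfK (_ : 2 != 0)) // d2 mul0r ltxx.
have oB : open [set x : 'rV[R]_n | `|x - e0| < rho] by exact: open_norm_lt.
have nB : [set x : 'rV[R]_n | `|x - e0| < rho] !=set0 by exists e0; rewrite /= subrr normr0.
have [x hx nx] := baire_cover oB nB cE eE.
have [i [y [Cy Ey]]] := cover (pt x).
by apply: (nx i); split; [exact: ltW|exists y].
Qed.

End transitive.

(** * Cyclic presentations *)

Section orthogonal_projection.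
Context {R : realType} {n : nat} {ip : 'rV[R]_n -> 'rV[R]_n -> R}.
Hypothesis ipC : forall u v, ip u v = ip v u.
Hypothesis ipL : forall a u v w, ip (a *: u + v) w = a * ip u w + ip v w.
Hypothesis ip_eq0 : forall u, ip u u = 0 -> u = 0.
Implicit Types u v w : 'rV[R]_n.

Lemma ip0l v : ip 0 v = 0.
Proof. by have := ipL 1 0 0 v; rewrite scale1r addr0 mul1r => /eqP; rewrite addrC -subr_eq subrr eq_sym => /eqP. Qed.

Lemma ipDl u v w : ip (u + v) w = ip u w + ip v w.
Proof. by have := ipL 1 u v w; rewrite scale1r mul1r. Qed.

Lemma ipZl a u w : ip (a *: u) w = a * ip u w.
Proof. by have := ipL a u 0 w; rewrite addr0 ip0l addr0. Qed.

Lemma ipNl u w : ip (- u) w = - ip u w.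
Proof. by rewrite -scaleN1r ipZl mulN1r. Qed.

Lemma ipBl u v w : ip (u - v) w = ip u w - ip v w.
Proof. by rewrite ipDl ipNl. Qed.

Lemma ip0r v : ip v 0 = 0. Proof. by rewrite ipC ip0l. Qed.
Lemma ipDr u v w : ip w (u + v) = ip w u + ip w v. Proof. by rewrite ipC ipDl !(ipC w). Qed.
Lemma ipZr a u w : ip w (a *: u) = a * ip w u. Proof. by rewrite ipC ipZl (ipC w). Qed.
Lemma ipNr u w : ip w (- u) = - ip w u. Proof. by rewrite ipC ipNl (ipC w). Qed.
Lemma ipBr u v w : ip w (u - v) = ip w u - ip w v. Proof. by rewrite ipDr ipNr. Qed.

Lemma ip_skew_sum b u v w x z : ip v z = - ip x w -> ip (b + u - v) z = ip b z + ip u z + ip w x.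
Proof. by move=> E; rewrite ipBl ipDl E opprK (ipC x). Qed.

Lemma ip_suml (I : Type) (r : seq I) (F : I -> 'rV[R]_n) w :
  ip (\sum_(i <- r) F i) w = \sum_(i <- r) ip (F i) w.
Proof. by elim: r => [|i r IH]; rewrite ?big_nil ?ip0l // !big_cons ipDl IH. Qed.

(** The subspace is given as a predicate; the Gram matrix of a basis of its span is invertible
    because the form is definite. *)
Lemma orth_projection (P : 'rV[R]_n -> Prop) : P 0 -> (forall a u v, P u -> P v -> P (a *: u + v)) ->
  forall x, exists2 u, P u & forall w, P w -> ip (x - u) w = 0.
Proof.
move=> P0 PL x; have [U [PU UP]] := span_exists P; have {}UP := UP P P0 PL (fun v h => h).
pose b := vbasis U; pose d := \dim U.
pose M : 'M[R]_d := \matrix_(i, j) ip b`_i b`_j.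
pose comb (c : 'rV[R]_d) : 'rV[R]_n := \sum_i c ord0 i *: b`_i.
have combU c : comb c \in U.
  by apply: memv_suml => i _; apply: memvZ; apply: vbasis_mem; apply: mem_nth; rewrite size_tuple.
have cM c (j : 'I_d) : (c *m M) ord0 j = ip (comb c) b`_j.
  by rewrite ip_suml mxE; apply: eq_bigr => i _; rewrite ipZl mxE.
have orthU w c : (forall j : 'I_d, ip w b`_j = ip (comb c) b`_j) -> forall y, y \in U -> ip (w - comb c) y = 0.
  move=> H y yU; rewrite ipC (coord_vbasis yU) ip_suml big1 // => j _.
  by rewrite ipZl ipC ipBl H subrr mulr0.
have uM : M \in unitmx.
  rewrite -row_free_unit -kermx_eq0; apply/eqP/row_matrixP => i; rewrite row0; set c := row i _.
  have c0 : c *m M = 0 by rewrite /c -row_mul mulmx_ker row0.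
  have v0 : comb c = 0.
    have := orthU 0 c; rewrite sub0r => h; apply: ip_eq0; apply/eqP; rewrite -oppr_eq0 -ipNl h // => j.
    by rewrite ip0l -cM c0 mxE.
  apply/rowP => j; rewrite [RHS]mxE.
  have E : vector.coord b j (comb c) = c ord0 j by apply: coord_sum_free; exact: basis_free (vbasisP U).
  by apply: etrans (esym E) _; rewrite v0 linear0.
pose r : 'rV[R]_d := \row_j ip x b`_j; exists (comb (r *m invmx M)); first exact: UP.
by move=> w Pw; apply: orthU; [move=> j; rewrite -cM mulmxKV // mxE|exact: PU].
Qed.

End orthogonal_projection.

(** * Algebraic consequences of cyclicity *)

Section cyclic_algebra.
Context {R : realType} {n : nat} {ip : 'rV[R]_n -> 'rV[R]_n -> R} {br phi : 'rV[R]_n -> 'rV[R]_n -> 'rV[R]_n}.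
Hypothesis ipC : forall u v, ip u v = ip v u.
Hypothesis ipL : forall a u v w, ip (a *: u + v) w = a * ip u w + ip v w.
Hypothesis ip_eq0 : forall u, ip u u = 0 -> u = 0.
Hypothesis brl : forall y, linear (br^~ y).
Hypothesis brC : forall x y, br x y = - br y x.
Hypothesis jacobi : forall x y z, br x (br y z) = br (br x y) z + br y (br x z).
Hypothesis nil : exists K, forall x, killed (br := br) K x.
Hypothesis phi_linear : forall x, linear (phi x).
Hypothesis phi_skew : forall x y z, ip (phi x y) z = - ip y (phi x z).
Hypothesis phi_der : forall x y z, phi x (br y z) = br (phi x y) z + br y (phi x z).
Hypothesis cyc : forall x y z, ip (br x y) z + ip (br y z) x + ip (br z x) y +
  2 * (ip (phi x y) z + ip (phi y z) x + ip (phi z x) y) = 0.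
Implicit Types (u v w x y z : 'rV[R]_n).
Local Notation killed := (killed (br := br)).

Definition cen z := forall x, br z x = 0.
Definition orth x := forall z, cen z -> ip x z = 0.

Let ipD := ipDl ipL.

Lemma brDl x y z : br (x + y) z = br x z + br y z.
Proof. by have := brl z 1 x y; rewrite !scale1r. Qed.

Lemma br0l z : br 0 z = 0.
Proof. by have := brDl 0 0 z; rewrite addr0 => /eqP; rewrite -subr_eq subrr eq_sym => /eqP. Qed.

Lemma brNl x z : br (- x) z = - br x z.
Proof. by apply/eqP; rewrite -addr_eq0 -brDl addNr br0l. Qed.

Lemma cenr z x : cen z -> br x z = 0. Proof. by move=> cz; rewrite brC cz oppr0. Qed.

Lemma cenL a z z' : cen z -> cen z' -> cen (a *: z + z').
Proof. by move=> cz cz' x; rewrite brl cz cz' scaler0 addr0. Qed.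

Lemma cen0 : cen 0. Proof. by move=> x; exact: br0l. Qed.

Lemma brBl x y z : br (x - y) z = br x z - br y z.
Proof. by rewrite brDl brNl. Qed.

Lemma brBr x y z : br z (x - y) = br z x - br z y.
Proof. by rewrite brC brBl opprB (brC z x) (brC z y) opprK addrC. Qed.

Lemma split_cen x : exists2 z, cen z & orth (x - z).
Proof. exact: (orth_projection ipC ipL ip_eq0 cen0 cenL). Qed.

Lemma phiB x y z : phi x (y - z) = phi x y - phi x z.
Proof. by have := phi_linear x (-1) z y; rewrite !scaleN1r ![- _ + _]addrC. Qed.

Lemma phi_cen x z : cen z -> cen (phi x z).
Proof.
move=> cz y; have := phi_der x z y; rewrite !cz addr0.
by have := phiB x 0 0; rewrite !subrr => -> <-.
Qed.

Lemma phi_orth x y : orth y -> orth (phi x y).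
Proof. by move=> oy z cz; rewrite phi_skew oy ?oppr0 //; exact: phi_cen. Qed.

(* For central [z], [<[x, W], z> = 2 <x, v>] with [v = phi z (W - W_z)]; as [W] is a bracket in the
   second centre, [[v, W] = 0], so [v = 0]. *)
Lemma second_center_bracket A B : killed 2 (br A B) -> cen (br A B).
Proof.
set W := br A B => kW.
have c1 y : cen (br y W) by move=> x; rewrite brC; have /= := kW y x; move=> ->; rewrite oppr0.
have c1' y : cen (br W y) by move=> x; rewrite (brC W) brNl c1 oppr0.
have commW A' B' : br W (br A' B') = 0 by rewrite jacobi (c1' A') (cenr _ (c1' B')) addr0.
have [Wz cWz oW] := split_cen W.
suff H x z : cen z -> ip (br x W) z = 0.
  by move=> x; rewrite brC (ip_eq0 (H x _ (c1 x))) oppr0.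
move=> cz; pose v := phi z (W - Wz).
have ov : orth v by exact: phi_orth.
(* Cyclicity at [y], [W], [z]. The central component [Wz] of [W] contributes nothing, by cyclicity
   at [y], [Wz], [z]. *)
have E0 y : orth y -> ip (br y W) z = 2 * ip y v.
  move=> oy; have := cyc y W z; rewrite (cenr _ cz) cz !(ip0l ipL) !addr0.
  have e1 : ip (phi y W) z = ip (phi y Wz) z.
    by apply/eqP; rewrite -subr_eq0 -(ipBl ipL) -phiB (phi_orth y oW).
  have e2 : ip (phi W z) y = 0 by rewrite ipC oy //; exact: phi_cen.
  have e3 : ip (phi z y) W = - ip y v.
    by rewrite phi_skew /v phiB (ipBr ipC ipL) (oy (phi z Wz)) ?subr0 //; exact: phi_cen.
  have e4 : ip (phi y Wz) z = 0.
    have := cyc y Wz z; rewrite (cenr _ cz) cz (cenr _ cWz) !(ip0l ipL) !addr0 add0r.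
    have -> : ip (phi Wz z) y = 0 by rewrite ipC oy //; exact: phi_cen.
    have -> : ip (phi z y) Wz = 0 by rewrite phi_skew (oy (phi z Wz)) ?oppr0 //; exact: phi_cen.
    by rewrite !addr0 => /eqP; rewrite mulf_eq0 pnatr_eq0 => /eqP.
  by rewrite e1 e2 e3 e4; lra.
have E y : ip (br y W) z = 2 * ip y v.
  have [yz cy oy] := split_cen y; have := E0 _ oy.
  by rewrite brBl cy subr0 (ipBl ipL) [ip yz v]ipC ov // subr0.
have v0 : v = 0.
  have := E v; have -> : br v W = 0.
    rewrite /v phiB brBl (phi_cen z cWz) subr0 /W phi_der brDl.
    by rewrite !(brC _ W) !commW oppr0 addr0.
  rewrite (ip0l ipL) => /esym/eqP; rewrite mulf_eq0 pnatr_eq0 /= => /eqP; exact: ip_eq0.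
by rewrite E v0 (ip0r ipC ipL) mulr0.
Qed.

(** [second_center_bracket], applied to iterated brackets, lowers by one the central term containing
    all brackets; the descent starts from nilpotency and ends in the centre. *)
Lemma two_step x y z : br x (br y z) = 0.
Proof.
have step k A B : killed k.+2 (br A B) -> killed k.+1 (br A B).
  elim: k A B => [|k IH] A B; last by move=> h w; apply: IH; exact: h.
  by move=> /second_center_bracket c w; exact: cenr.
have [K hK] := nil.
have H k : (k <= K)%N -> forall A B, killed (K - k).+1 (br A B).
  elim: k => [_ A B|k IH kK A B]; first by rewrite subn0; apply: (killedS brl brC).
  by apply: step; rewrite -subSn // subSS; apply: IH; exact: ltnW.
by have := H K (leqnn _) y z; rewrite subnn /= => h; exact: h.
Qed.

Lemma cen_br x y : cen (br x y).
Proof. by move=> z; rewrite brC two_step oppr0. Qed.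

(** In other words [J_z = - 2 phi z] on the complement of the centre: commutation of the [J_z]
    becomes that of the [phi z]. *)
Lemma phi_bracket x y z : cen z -> orth x -> orth y -> ip (br x y) z = - 2 * ip (phi z x) y.
Proof.
move=> cz ox oy; have := cyc x y z; rewrite (cenr _ cz) cz !(ip0l ipL) !addr0.
have -> : ip (phi x y) z = 0 by exact: phi_orth.
have -> : ip (phi y z) x = 0 by rewrite ipC ox //; exact: phi_cen.
by rewrite !add0r; lra.
Qed.

(** Expand the derivation [phi z] on [[x, y]] and apply [phi_bracket] for [z']. *)
Lemma phi_comm z z' x y : cen z -> cen z' -> orth x -> orth y ->
  ip (br x y) (phi z z') = - 2 * (ip (phi z (phi z' x)) y - ip (phi z' (phi z x)) y).
Proof.
move=> cz cz' ox oy; have E : ip (phi z (br x y)) z' = - ip (br x y) (phi z z') by exact: phi_skew.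
rewrite phi_der ipD (phi_bracket cz') // in E; last exact: phi_orth.
rewrite (phi_bracket cz') // in E; last exact: phi_orth.
rewrite (phi_skew z (phi z' x)); lra.
Qed.

Lemma phi_antisym z z' x y : cen z -> cen z' -> ip (br x y) (phi z z') = - ip (br x y) (phi z' z).
Proof.
move=> cz cz'; have [xz cx ox] := split_cen x; have [yz cy oy] := split_cen y.
have -> : br x y = br (x - xz) (y - yz) by rewrite brBl cx subr0 brBr (cenr _ cy) subr0.
by rewrite !phi_comm //; lra.
Qed.

(** With [w = [x, y]] and [v = phi z w] central, cyclicity at [z], [w], [v] has no bracket terms,
    and by skewness and [phi_antisym] each of the three remaining terms equals [<v, v>]. *)
Lemma phi_center_bracket z x y : cen z -> phi z (br x y) = 0.
Proof.
move=> cz; pose Q w := forall z z', cen z -> cen z' -> ip w (phi z z') = - ip w (phi z' z).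
have Qbr A B : Q (br A B) by move=> *; exact: phi_antisym.
set w := br x y; set v := phi z w.
have Qv : Q v by move=> a b ca cb; rewrite /v phi_der !ipD !(phi_antisym _ _ ca cb) opprD.
have cw : cen w by exact: cen_br.
have cv : cen v by exact: phi_cen.
apply: ip_eq0; rewrite -/v.
have := cyc z w v; rewrite !(cz, cw, cv) !(ip0l ipL) !add0r -/v.
have e1 : ip (phi w v) z = ip v v.
  by rewrite phi_skew (Qv _ _ cw cz) opprK.
have e2 : ip (phi v z) w = ip v v.
  by rewrite ipC (Qbr _ _ _ _ cv cz) -[in RHS]/(phi z w) phi_skew ipC.
by rewrite e1 e2; lra.
Qed.

Lemma phi_commute z z' x y : cen z -> cen z' -> orth x -> orth y ->
  ip (phi z (phi z' x)) y = ip (phi z' (phi z x)) y.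
Proof.
move=> cz cz' ox oy; have := phi_skew z (br x y) z'.
by rewrite phi_center_bracket // (ip0l ipL) phi_comm //; lra.
Qed.

Lemma J_exists z x : cen z -> orth x ->
  exists w, orth w /\ forall y, orth y -> ip w y = ip (br x y) z.
Proof.
move=> cz ox; exists (- 2 *: phi z x); split => [z' cz'|y oy]; rewrite (ipZl ipL).
  by rewrite phi_orth ?mulr0.
by rewrite (phi_bracket cz).
Qed.

Lemma J_commute (J : 'rV[R]_n -> 'rV[R]_n -> 'rV[R]_n) :
  (forall z x, cen z -> orth x -> orth (J z x) /\ forall y, orth y -> ip (J z x) y = ip (br x y) z) ->
  forall z z', cen z -> cen z' -> forall x, orth x -> J z (J z' x) - J z' (J z x) = 0.
Proof.
move=> HJ; have oB u v : orth u -> orth v -> orth (u - v).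
  by move=> ou ov z cz; rewrite (ipBl ipL) ou // ov // subr0.
have JE z x : cen z -> orth x -> J z x = - 2 *: phi z x.
  move=> cz ox; have [oW HW] := HJ _ _ cz ox; apply/eqP; rewrite -subr_eq0; apply/eqP; apply: ip_eq0.
  have oV : orth (- 2 *: phi z x) by move=> y cy; rewrite (ipZl ipL) phi_orth ?mulr0.
  have oWV := oB _ _ oW oV.
  by rewrite (ipBl ipL) HW // (phi_bracket cz) // (ipZl ipL) subrr.
have phZ z a x : phi z (a *: x) = a *: phi z x.
  by have := phi_linear z a x 0; have := phiB z 0 0; rewrite !subrr !addr0 => ->; rewrite addr0.
have oP z x : orth x -> orth (- 2 *: phi z x).
  by move=> ox w cw; rewrite (ipZl ipL) (phi_orth _ ox) ?mulr0.
move=> z z' cz cz' x ox; rewrite !(JE z' x) // !(JE z x) // !JE //; try exact: oP.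
rewrite !phZ -!scalerBr; set w := _ - _; suff -> : w = 0 by rewrite !scaler0.
have ow : orth w by apply: oB; apply: phi_orth; exact: phi_orth.
by apply: ip_eq0; rewrite {1}/w (ipBl ipL) phi_commute // subrr.
Qed.

End cyclic_algebra.

Lemma plot_curve (R : realType) n (M : manifoldType R n) (gamma : R^o -> M) (t : R^o) :
  smooth_curve gamma -> plot_at gamma t.
Proof.
move=> [cg sg]; split; first by apply: filterE => s; exact: cg.
move=> c ac dc; have oU : open [set t | dom c (gamma t)].
  by apply: open_comp; [move=> s _; exact: cg|exact: dom_open].
by have := sg c ac; move/(smooth_on_at _ oU); apply.
Qed.

Section isotropy.
Context {R : realType} {k n : nat} {G : lieGroupType R k} {N : lieGroupType R n} {g : riemannian N}.
Variables (act : G -> N -> N) (p : N).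
Hypothesis gl : left_invariant g.
Hypothesis act1 : forall x, act 1%g x = x.
Hypothesis act_smooth : smooth2 act.

Lemma plot_act_pt : plot_at (fun z => act (lpt G z) p) (le0 G).
Proof. by apply: plot_act => //; [exact: plot_pt cod1|exact: plot_at_cst]. Qed.

Lemma Kf_act X : Kf act p X (le0 N) = evel (fun z => p^-1 * act (lpt G z) p)%g (le0 G) X.
Proof. by rewrite KfE; apply: evel_ext; apply: filterE => z; rewrite /kap /base pt1 mulg1. Qed.

Lemma Kf_isotropy X : lie_algebra_of (isotropy act p) X -> Kf act p X (le0 N) = 0.
Proof.
move=> [theta [st hom v0 iso]].
have t0 : theta 0 = 1%g.
  by have := hom 0 0; rewrite addr0 -{1}[theta 0]mulg1 => /mulgI <-.
have pt0 := plot_curve (0 : R^o) st.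
have d0 : dom (lchart G) (theta 0) by rewrite t0; exact: dom1.
have s0 : smooth_at (fun t : R^o => lco G (theta t)) 0 by exact: plot_co.
have E0 : lco G (theta 0) = le0 G by rewrite t0.
have <- : 'D_(1 : R^o) (fun t : R^o => lco G (theta t)) 0 = X by rewrite -v0 /velocity t0.
have pf : plot_at (fun z => p^-1 * act (lpt G z) p)%g (lco G (theta 0)).
  by rewrite E0; apply: plot_mul; [exact: plot_at_cst|exact: plot_act_pt].
have f1 : (p^-1 * act (lpt G (lco G (theta 0))) p = 1)%g by rewrite E0 pt1 act1 mulVg.
have := evel_comp (1 : R^o) s0 pf f1; rewrite E0 Kf_act => <-.
apply: etrans (evel_cst (1%g : N) (0 : R^o) 1); apply: evel_ext.
have nd := dom_near (plot_at_cont pt0) d0.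
by apply: filterS nd => t dt; rewrite coordK // iso mulVg.
Qed.

Lemma induced_innerE X Y :
  induced_inner g act p X Y = inner g 1%g (Kf act p X (le0 N)) (Kf act p Y (le0 N)).
Proof.
rewrite !Kf_act; have := inner_vel gl X Y plot_act_pt.
by rewrite pt1 act1 => <-; rewrite /induced_inner /tangent_map /vel pt1 act1.
Qed.

End isotropy.

Lemma cyclic_sum (R : realType) (a b c p q r A B C : R) : A = a + p + q -> B = b + q + r -> C = c + r + p ->
  A + B + C = 0 -> a + b + c + 2 * (p + q + r) = 0.
Proof. by move=> -> -> -> H; lra. Qed.

Lemma cyclic_necessary (R : realType) n (N : lieGroupType R n) (g : riemannian N) :
  nilpotent_group N -> left_invariant g -> cyclic_manifold g -> at_most_two_step N /\ J_abelian g.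
Proof.
move=> nN gl [k [G [act [p [h [m [[_ a1 aM aS aT _ aI] [hE hm dhm _] cycl]]]]]]].
pose K X := Kf act p X (le0 N); pose ip := inner g (1%g : N); pose br := lie_bracket N.
have Kl : linear K by apply: Kf_linear => //; exact: cod1.
have Kh X : X \in h -> K X = 0.
  by move=> Xh; apply: Kf_isotropy => //; rewrite -hE.
have Km X : K (daddv_pi m h X) = K X.
  have mh : (m :&: h = 0)%VS by rewrite capvC; exact/directv_addP.
  have := daddv_pi_add (U := m) (V := h) mh (w := X); rewrite addvC hm memvf => /(_ isT) E.
  have := Kl 1 (daddv_pi m h X) (daddv_pi h m X); rewrite !scale1r E => ->.
  by rewrite (Kh (daddv_pi h m X)) ?addr0 // memv_pi.
have sel x : exists X, X \in m /\ K X = x.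
  have [X EX] := transitive_surjective p a1 aM aS aT x.
  by exists (daddv_pi m h X); split; [exact: memv_pi|rewrite Km].
have [s sP] := choice sel.
pose phi x y := Sf act p (s x) y (le0 N).
have ipC u v : ip u v = ip v u by exact: innerC.
have ipL a u v w : ip (a *: u + v) w = a * ip u w + ip v w by exact: innerDZl.
have ip0 u : ip u u = 0 -> u = 0 by exact: inner_eq0.
have brl y : linear (br^~ y) by move=> a x x'; exact: bracket_linear_l.
have brC x y : br x y = - br y x by exact: bracketC.
have jac x y z : br x (br y z) = br (br x y) z + br y (br x z) by exact: bracket_jacobi.
have nil : exists K, forall x, killed (br := br) K x.
  have [j HK] := nilpotent_killed nN; exists j => x; have {HK} := HK x.
  elim: j x => [|j IH] x //= H y; exact: IH.
have phl x : linear (phi x) by apply: Sf_linear_r => //; exact: cod1.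
have phs x y z : ip (phi x y) z = - ip y (phi x z) by apply: Sf_skew => //; exact: cod1.
have phd x y z : phi x (br y z) = br (phi x y) z + br y (phi x z).
  by apply: isometric_derivation => //; exact: cod1.
(* Skewness turns [- <S_y x, z>] into [<S_y z, x>], so that each such term occurs twice in the
   cyclic sum, whence the factor 2. *)
have brK x y z : induced_inner g act p (bracket_proj G h m (s x) (s y)) (s z) =
    ip (br x y) z + ip (phi x y) z + ip (phi y z) x.
  have Ez : K (s z) = z by have [] := sP z.
  have Ex : K (s x) = x by have [] := sP x.
  have Ey : K (s y) = y by have [] := sP y.
  have E : K (bracket_proj G h m (s x) (s y)) = br x y + phi x y - phi y x.
    have H0 : K (lie_bracket G (s x) (s y)) = br (K (s x)) (K (s y)) +
        Sf act p (s x) (K (s y)) (le0 N) - Sf act p (s y) (K (s x)) (le0 N).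
      by exact: Kf_bracket.
    apply: etrans (Km _) _; apply: etrans H0 _.
    exact: (f_equal2 (fun u v => br u v + Sf act p (s x) v (le0 N) - Sf act p (s y) u (le0 N)) Ex Ey).
  have H1 : induced_inner g act p (bracket_proj G h m (s x) (s y)) (s z) =
      ip (K (bracket_proj G h m (s x) (s y))) (K (s z)) by exact: induced_innerE.
  apply: etrans H1 _; apply: etrans (f_equal2 ip E Ez) _.
  exact: (ip_skew_sum ipC ipL (br x y) (phi x y) (phs y x z)).
have cyc x y z : ip (br x y) z + ip (br y z) x + ip (br z x) y +
  2 * (ip (phi x y) z + ip (phi y z) x + ip (phi z x) y) = 0.
  have [mx _] := sP x; have [my _] := sP y; have [mz _] := sP z.
  exact: (cyclic_sum (brK x y z) (brK y z x) (brK z x y) (cycl _ _ _ mx my mz)).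
split; first by move=> X Y Z; exact: (two_step ipC ipL ip0 brl brC jac nil phl phs phd cyc).
have HJ Z X : lie_center N Z -> center_orth g X -> center_orth g (J_map g Z X) /\
    forall Y, center_orth g Y -> ip (J_map g Z X) Y = ip (br X Y) Z.
  move=> cZ oX; have [W HW] := J_exists ipC ipL brC phl phs phd cyc cZ oX.
  exact: (@getPex _ [set W | center_orth g W /\ forall Y, center_orth g Y ->
    inner g 1%g W Y = inner g 1%g (lie_bracket N X Y) Z] (ex_intro _ W HW)).
exact: (J_commute ipC ipL ip0 brl brC jac nil phl phs phd cyc HJ).
Qed.

(** * The exponential map of a two-step nilpotent group *)

Lemma cross_cancel (R : realType) (a b c d p q : R) : a + c = p -> b + d = q -> c - d = p - q -> a = b.
Proof. by move=> h1 h2 h3; lra. Qed.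

Section primitive.
Context {R : realType} {n m : nat} (N : lieGroupType R n).
Local Notation e0 := (le0 N).
Local Notation c := (lchart N).
Variable A : 'rV[R]_n -> 'rV[R]_n -> 'rV[R]_m.
Hypothesis sA : \forall u \near e0, forall Y, smooth_at (A Y) u.
Hypothesis lA : \forall u \near e0, linear (A^~ u).
Hypothesis cA : \forall u \near e0, forall X Y,
  lder N X (A Y) u - lder N Y (A X) u = A (lie_bracket N X Y) u.

#[local] Transparent lder.
Lemma lder_idE Y : lder N Y id = lfield N Y.
Proof. by apply/funext => u; rewrite /lder derive_id. Qed.
#[local] Opaque lder.

Lemma lder_lfield X Y u : cod c u ->
  lder N X (lfield N Y) u - lder N Y (lfield N X) u = lfield N (lie_bracket N X Y) u.
Proof.
move=> cu; have H : lder N X (lder N Y id) u - lder N Y (lder N X id) u = lder N (lie_bracket N X Y) id u.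
  by apply: lder_comm => //; exact: smooth_at_id.
by rewrite !lder_idE in H.
Qed.

Let M u : 'M[R]_(n, m) := \matrix_(i, j) A (delta_mx ord0 i) u ord0 j.
Let Q u : 'M[R]_(n, m) := invmx (lmat N u) *m M u.
Let w j u : 'rV[R]_n := (col j (Q u))^T.

Let ME : \forall u \near e0, forall v, v *m M u = A v u.
Proof.
apply: filterS lA => u lu v; have E : A v u = \sum_i A (v ord0 i *: delta_mx ord0 i) u.
  by rewrite -[in LHS](sum_delta v); exact: (linear_sum (mklin lu)).
rewrite E.
apply/rowP => j; rewrite !mxE summxE; apply: eq_bigr => i _.
rewrite mxE; have -> : A (v ord0 i *: delta_mx ord0 i) u = v ord0 i *: A (delta_mx ord0 i) u.
  exact: (linearZ_LR (mklin lu)).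
by rewrite mxE.
Qed.

Let smooth_w j : smooth_at (w j) e0.
Proof.
apply/smooth_at_rowP => i.
apply: (@smooth_at_ext _ _ _ (fun u => \sum_k ((invmx (lmat N u) i k : R^o) * (M u k j : R^o) : R^o))).
  by apply: filterE => u; rewrite !mxE.
apply: smooth_at_sum => k; apply: smooth_atM.
  have u1 : lmat N e0 \in unitmx by rewrite lmat1 unitmx1.
  by have [_] := smooth_at_invmx (@smooth_lmat _ _ N) u1.
apply: (@smooth_at_ext _ _ _ (fun u => A (delta_mx ord0 k) u ord0 j : R^o)).
  by apply: filterE => u; rewrite mxE.
exact: ((smooth_at_rowP _ _).1 (nbhs_singleton sA _)).
Qed.

Let dot_w j u v : dot (w j u) v = (v *m Q u) ord0 j.
Proof. by rewrite dotE mxE; apply: eq_bigr => i _; rewrite !mxE mulrC. Qed.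

Let w_lfield : \forall u \near e0, forall j Y, dot (w j u) (lfield N Y u) = A Y u ord0 j.
Proof.
apply: filterS3 (cod_near1 (N := N)) (lmat_unit N) ME => u cu uu mu j Y.
by rewrite dot_w -lmatE // /Q mulmxA mulmxK ?mu.
Qed.

Let w_closed j : \forall u \near e0, forall V W, dot ('D_W (w j) u) V = dot ('D_V (w j) u) W.
Proof.
apply: filterS3 (filterI (cod_near1 (N := N)) (lmat_unit N)) (filterI (smooth_at_near (smooth_w j)) cA)
  (filterI (near_near w_lfield) sA) => u [cu uu] [su clu] [wl sAu] V W.
have D X Y : dot (lder N X (w j) u) (lfield N Y u) + dot (w j u) (lder N X (lfield N Y) u) =
    (lder N X (A Y) u) ord0 j.
  have [_ e1] := is_derive_dot (lfield N X u) su (smooth_lfield Y cu).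
  apply: etrans (esym e1) _.
  have e2 : lder N X (fun v => mklin (@coord_is_linear R m j) (A Y v)) u =
      mklin (@coord_is_linear R m j) (lder N X (A Y) u).
    by apply: lder_lin; exact: sAu.
  apply: etrans e2; apply: near_eq_derive.
  by apply: filterS wl => v h; exact: h.
have K X Y : dot (lder N X (w j) u) (lfield N Y u) = dot (lder N Y (w j) u) (lfield N X u).
  have h : dot (w j u) (lder N X (lfield N Y) u) - dot (w j u) (lder N Y (lfield N X) u) =
      (lder N X (A Y) u) ord0 j - (lder N Y (A X) u) ord0 j.
    have -> : (lder N X (A Y) u) ord0 j - (lder N Y (A X) u) ord0 j = (A (lie_bracket N X Y) u) ord0 j.
      by rewrite -clu !mxE.
    by rewrite -(nbhs_singleton wl) -lder_lfield // -[in LHS]mulN1r -dotZr scaleN1r -dotDr.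
  exact: (cross_cancel (D X Y) (D Y X) h).
have LV : forall Z, Z = lfield N (Z *m invmx (lmat N u)) u by move=> Z; rewrite -lmatE // mulmxKV.
rewrite (LV V) (LV W); exact: K.
Qed.

(** [A Y u] is the value on the left-invariant field [Y] of a vector-valued one-form, and [cA] is
    its closedness in the left-invariant frame. [w j] is its [j]-th component in coordinates, to
    which the Poincare lemma applies. *)
Theorem lder_primitive : exists F : 'rV[R]_n -> 'rV[R]_m, [/\ F e0 = 0, smooth_at F e0 &
  \forall u \near e0, forall Y, lder N Y F u = A Y u].
Proof.
have [F HF] := choice (fun j => poincare (smooth_w j) (w_closed j)).
exists (fun u => \row_j F j u).
have sF : smooth_at (fun u => \row_j F j u : 'rV[R]_m) e0.
  apply/smooth_at_rowP => j; have [_ sFj _] := HF j.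
  by apply: smooth_at_ext sFj; apply: filterE => u; rewrite mxE.
split => //; first by apply/rowP => j; rewrite !mxE; have [] := HF j.
have DF : \forall u \near e0, forall j, forall v, is_derive u v (F j) (dot (w j u) v).
  apply: (@filter_forall _ _ (fun j u => forall v, is_derive u v (F j) (dot (w j u) v)) (nbhs e0)).
  by move=> j; have [] := HF j.
apply: filterS3 DF w_lfield (smooth_at_near sF) => u dF wl sFu Y; apply/rowP => j.
have e2 : lder N Y (fun v => mklin (@coord_is_linear R m j) (\row_j F j v)) u =
    mklin (@coord_is_linear R m j) (lder N Y (fun v => \row_j F j v) u).
  by apply: lder_lin.
apply: etrans (esym e2) _; rewrite -wl; have [_ <-] := dF j (lfield N Y u).
by apply: near_eq_derive; apply: filterE => v /=; rewrite mxE.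
Qed.

End primitive.

Lemma near_pairP (R : realType) (V W : normedModType R) (P : V * W -> Prop) a b :
  (\forall z \near (a, b), P z) <-> exists2 r : R, 0 < r &
    forall v w, `|v - a| < r -> `|w - b| < r -> P (v, w).
Proof.
split=> [[[A B] /= [/nbhs_normP[r /= r0 HA] /nbhs_normP[s /= s0 HB]] H]|[r r0 H]].
  exists (Num.min r s); first by rewrite lt_min r0.
  move=> v w; rewrite !lt_min => /andP[va _] /andP[_ wb]; apply: H; split => /=.
    by apply: HA; rewrite /= distrC.
  by apply: HB; rewrite /= distrC.
exists ([set v | `|v - a| < r], [set w | `|w - b| < r]); last by move=> [v w] [/= va wb]; exact: H.
by split; apply/nbhs_normP; exists r => // v /=; rewrite distrC.
Qed.

Section local_exp.
Context {R : realType} {n : nat} (N : lieGroupType R n).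
Hypothesis N2 : at_most_two_step N.
Local Notation e0 := (le0 N).
Local Notation c := (lchart N).
Local Notation co := (lco N).
Local Notation pt := (lpt N).
Local Notation br := (lie_bracket N).
Implicit Types (X Y Z u v w : 'rV[R]_n).

Lemma center_linear a u v : lie_center N u -> lie_center N v -> lie_center N (a *: u + v).
Proof. by move=> cu cv X; rewrite bracket_linear_l cu cv scaler0 addr0. Qed.

(** The quotient by the centre, realised inside the algebra as the projection along the centre onto
    a complement. *)
Lemma center_quotient : exists q : 'rV[R]_n -> 'rV[R]_n, [/\ linear q,
  forall X Y, (br (q X) Y) = (br X Y) & forall X Y, q (br X Y) = 0].
Proof.
have [U [cU Uc]] := span_exists (lie_center N).
have c0 : lie_center N 0 by move=> X; exact: bracket0l.
have {}Uc u : u \in U -> lie_center N u := Uc (lie_center N) c0 center_linear (fun v h => h) u.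
exists (fun X => X - projv U X); split.
- by move=> a X Y; rewrite linearP scalerBr opprD addrACA.
- by move=> X Y; rewrite bracketDl bracketNl (Uc (projv U X)) ?memv_proj // subr0.
- move=> X Y; rewrite projv_id ?subrr //; apply: cU => Z.
  by rewrite bracketC N2 oppr0.
Qed.

Lemma lder0_derive (f : 'rV[R]_n -> 'rV[R]_n) u v : cod c u -> lmat N u \in unitmx ->
  (forall Y, lder N Y f u = 0) -> 'D_v f u = 0.
Proof.
move=> cu uu H; have -> : v = lfield N (v *m invmx (lmat N u)) u by rewrite -lmatE // mulmxKV.
exact: H.
Qed.

Lemma is_derive_lder0 (f : 'rV[R]_n -> 'rV[R]_n) u : cod c u -> lmat N u \in unitmx -> smooth_at f u ->
  (forall Y, lder N Y f u = 0) -> forall v, is_derive u v f 0.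
Proof.
move=> cu uu sf H v; have d := smooth_at_derivable v sf.
by rewrite -(lder0_derive v cu uu H); exact: DeriveDef.
Qed.

Lemma lder_cst Y (a u : 'rV[R]_n) : lder N Y (fun=> a : 'rV[R]_n) u = 0.
Proof. exact: derive_cst. Qed.

Lemma half_linear Y : linear (fun X => 2^-1 *: (br X Y)).
Proof. by move=> a X X'; rewrite bracket_linear_l scalerDr !scalerA mulrC. Qed.

Lemma star_linear X : linear (fun Z => Z + 2^-1 *: br X Z).
Proof.
move=> a Z Z'; have -> : br X (a *: Z + Z') = a *: br X Z + br X Z' by exact: bracket_linear_r.
by move: (br X Z) (br X Z') => p q; apply/rowP => i; rewrite !mxE; ring.
Qed.

(** The equation has [L] on both sides, but the bracket only sees [L] modulo the centre. There it
    reads [D_Y F = q Y], which is closed because [q] kills brackets; with [F] known, [Y + [F, Y] /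
    2] is closed since its derivatives antisymmetrise to [[X, Y]]. *)
Lemma log_exists : exists L : 'rV[R]_n -> 'rV[R]_n, [/\ L e0 = 0, smooth_at L e0 &
  \forall u \near e0, forall Y, lder N Y L u = Y + 2^-1 *: (br (L u) Y)].
Proof.
have [q [ql qb bq]] := center_quotient.
have [F [F0 sF DF]] : exists F : 'rV[R]_n -> 'rV[R]_n, [/\ F e0 = 0, smooth_at F e0 &
    \forall u \near e0, forall Y, lder N Y F u = q Y].
  apply: (@lder_primitive _ _ _ N (fun Y _ => q Y)).
  - by apply: filterE => u Y; exact: smooth_at_cst.
  - by apply: filterE => u a X Y; exact: ql.
  - by apply: filterE => u X Y; rewrite !lder_cst bq subrr.
have DA X Y u : smooth_at F u -> (forall Y, lder N Y F u = q Y) ->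
    lder N X (fun u => Y + 2^-1 *: (br (F u) Y)) u = 2^-1 *: (br X Y).
  move=> sFu dF.
  have s1 : smooth_at (fun u => mklin (half_linear Y) (F u)) u by exact: smooth_at_lin.
  have -> : lder N X (fun u => Y + 2^-1 *: (br (F u) Y)) u =
      lder N X (fun=> Y) u + lder N X (fun u => mklin (half_linear Y) (F u)) u.
    by apply: lderD => //; exact: smooth_at_cst.
  have -> : lder N X (fun u => mklin (half_linear Y) (F u)) u = mklin (half_linear Y) (lder N X F u).
    exact: lder_lin.
  by rewrite lder_cst add0r dF /= qb.
have [L [L0 sL DL]] : exists L : 'rV[R]_n -> 'rV[R]_n, [/\ L e0 = 0, smooth_at L e0 &
    \forall u \near e0, forall Y, lder N Y L u = Y + 2^-1 *: (br (F u) Y)].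
  apply: (@lder_primitive _ _ _ N (fun Y u => Y + 2^-1 *: (br (F u) Y))).
  - apply: filterS (smooth_at_near sF) => u sFu Y; apply: smooth_atD; first exact: smooth_at_cst.
    exact: (smooth_at_lin (mklin (half_linear Y)) sFu).
  - by apply: filterE => u; exact: star_linear.
  - apply: filterS2 (smooth_at_near sF) DF => u sFu dF X Y; rewrite !DA // N2 scaler0 addr0.
    by rewrite (bracketC Y) scalerN opprK -scalerDl -[2^-1]mul1r -splitr scale1r.
exists L; split; [exact: L0|exact: sL|].
have qF : \forall u \near e0, q (L u) - F u = 0.
  have : \forall u \near e0, q (L u) - F u = q (L e0) - F e0.
    apply: (zero_derive_near (f := fun u => q (L u) - F u)).
    apply: filterS3 (filterI (smooth_at_near sF) DF) (filterI (smooth_at_near sL) DL)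
      (filterI (cod_near1 (N := N)) (lmat_unit N)) => u [sFu dF] [sLu dL] [cu uu].
    have s1 : smooth_at (fun u => mklin ql (L u)) u by exact: smooth_at_lin.
    apply: is_derive_lder0 => //; first exact: smooth_atB.
    move=> Y; have -> : lder N Y (fun u => q (L u) - F u) u = lder N Y (fun u => mklin ql (L u)) u - lder N Y F u.
      exact: lderB.
    have -> : lder N Y (fun u => mklin ql (L u)) u = mklin ql (lder N Y L u) by exact: lder_lin.
    have E : q (Y + 2^-1 *: (br (F u) Y)) = q Y.
      have := ql 2^-1 (br (F u) Y) Y; rewrite bq scaler0 add0r addrC => <-.
      by rewrite addrC.
    by rewrite dL dF /= E subrr.
  have q0 : q 0 = 0 by have := linear0 (mklin ql).
  by rewrite L0 F0 q0 subr0.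
apply: filterS2 DL qF => u dL /eqP; rewrite subr_eq0 => /eqP E Y.
by rewrite dL -E qb.
Qed.

(* The Baker-Campbell-Hausdorff product of a two-step nilpotent Lie algebra. *)
Definition star X Y := X + Y + 2^-1 *: (br X Y).

Lemma lder_starr X Y (L : 'rV[R]_n -> 'rV[R]_n) u : smooth_at L u -> lder N Y L u = Y + 2^-1 *: (br (L u) Y) ->
  lder N Y (fun v => star X (L v)) u = Y + 2^-1 *: (br (star X (L u)) Y).
Proof.
move=> sL dL; have l2 := star_linear X.
have s1 : smooth_at (fun v => mklin l2 (L v)) u by exact: smooth_at_lin.
have -> : lder N Y (fun v => star X (L v)) u = lder N Y (fun v => X + mklin l2 (L v)) u.
  by apply: lder_ext; apply: filterE => v; exact: esym (addrA _ _ _).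
have -> : lder N Y (fun v => X + mklin l2 (L v)) u = lder N Y (fun=> X) u + lder N Y (fun v => mklin l2 (L v)) u.
  by apply: lderD => //; exact: smooth_at_cst.
have -> : lder N Y (fun u => mklin l2 (L u)) u = mklin l2 (lder N Y L u) by exact: lder_lin.
rewrite lder_cst add0r dL /= bracketDr bracketZr N2 scaler0 addr0 /star !bracketDl bracketZl.
have -> : (br (br X (L u)) Y) = 0 by rewrite bracketC N2 oppr0.
by move: (br (L u) Y) (br X Y) => p r; rewrite scaler0 addr0 scalerDr [_ *: r + _]addrC addrA.
Qed.

Lemma bracket_half_sub (a b Y : 'rV[R]_n) :
  Y + 2^-1 *: br a Y - (Y + 2^-1 *: br b Y) = 2^-1 *: br (a - b) Y.
Proof.
have -> : br (a - b) Y = br a Y - br b Y by rewrite bracketDl bracketNl.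
by move: (br a Y) (br b Y) => p r; rewrite opprD addrACA subrr add0r scalerBr.
Qed.

Lemma star0r X : star X 0 = X.
Proof. by rewrite /star bracket0r scaler0 !addr0. Qed.

(** As functions of the second factor, [L (w v)] and [star (L w) (L v)] solve the same equation with
    the same initial value. Their difference satisfies [D_Y H = [H, Y] / 2]; it vanishes first
    modulo the centre, where the right side disappears, and then altogether. *)
Lemma log_mul (L : 'rV[R]_n -> 'rV[R]_n) : L e0 = 0 -> smooth_at L e0 ->
  (\forall u \near e0, forall Y, lder N Y L u = Y + 2^-1 *: br (L u) Y) ->
  \forall z \near ((e0, e0) : 'rV[R]_n * 'rV[R]_n), [/\ cod c z.1, cod c z.2, dom c (pt z.1 * pt z.2)%g
    & L (mu N z) = star (L z.1) (L z.2)].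
Proof.
move=> L0 sL DL; have [q [ql qb bq]] := center_quotient.
pose admissible u := [/\ cod c u, lmat N u \in unitmx, smooth_at L u & forall Y, lder N Y L u = Y + 2^-1 *: br (L u) Y].
have ng : \forall u \near e0, admissible u.
  by apply: filterS2 (filterI (cod_near1 (N := N)) (lmat_unit N)) (filterI (smooth_at_near sL) DL) => u [? ?] [? ?].
have sm := smooth_mu0 (cod1 (N := N)).
have n1 : \forall z \near ((e0, e0) : 'rV[R]_n * 'rV[R]_n), admissible z.1.
  exact: (near_comp (smooth_at_cont (smooth_at_fst ((e0, e0) : 'rV[R]_n * 'rV[R]_n))) ng).
have n2 : \forall z \near ((e0, e0) : 'rV[R]_n * 'rV[R]_n), admissible z.2.
  exact: (near_comp (smooth_at_cont (smooth_at_snd ((e0, e0) : 'rV[R]_n * 'rV[R]_n))) ng).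
have n3 : \forall z \near ((e0, e0) : 'rV[R]_n * 'rV[R]_n), admissible (mu N z).
  have ng' : \forall u \near mu N (e0, e0), admissible u by rewrite mu0 //; exact: cod1.
  exact: (near_comp (smooth_at_cont sm) ng').
have n4 : \forall z \near ((e0, e0) : 'rV[R]_n * 'rV[R]_n), dom c (pt z.1 * pt z.2)%g.
  have pm : plot_at (fun z : 'rV[R]_n * 'rV[R]_n => pt z.1 * pt z.2)%g (e0, e0).
    by apply: plot_mul; apply: plot_pt_comp; [exact: smooth_at_fst|exact: cod1|exact: smooth_at_snd|exact: cod1].
  by apply: (dom_near (plot_at_cont pm)); rewrite /= pt1 mulg1; exact: dom1.
have nall : \forall z \near ((e0, e0) : 'rV[R]_n * 'rV[R]_n),
    (admissible z.1 /\ admissible z.2) /\ (admissible (mu N z) /\ dom c (pt z.1 * pt z.2)%g).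
  by apply: filterS2 (filterI n1 n2) (filterI n3 n4) => z h1 h2; split; [exact: h1|exact: h2].
apply/near_pairP; move: nall => /near_pairP[r r0 Hr].
exists r => // w v bw bv.
have {}Hr v' : `|v' - e0| < r -> [/\ admissible w, admissible v', admissible (mu N (w, v')) & dom c (pt w * pt v')%g].
  by move=> bv'; have [[h1 h2] [h3 h4]] := Hr w v' bw bv'; exact: (And4 h1 h2 h3 h4).
have r00 : `|e0 - e0| < r by rewrite subrr normr0.
have [[cw _ sLw dLw] [cv _ _ _] _ dwv] := Hr _ bv; split => //.
pose H v' := L (mu N (w, v')) - star (L w) (L v').
have E0 : H e0 = 0 by rewrite /H mu0 // L0 star0r subrr.
have HH v' : `|v' - e0| < r -> smooth_at H v' /\ forall Y, lder N Y H v' = 2^-1 *: br (H v') Y.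
  move=> /Hr[_ [cv' uv' sLv dLv] [cm um sLm dLm] dm].
  have s1 : smooth_at (fun v => mu N (w, v)) v' by apply: smooth_at_p2; exact: smooth_mu.
  have s2 : smooth_at (fun v => L (mu N (w, v))) v' by exact: (smooth_at_comp s1 sLm).
  have s3 : smooth_at (fun v => star (L w) (L v)) v'.
    apply: (@smooth_at_ext _ _ _ (fun v => L w + mklin (star_linear (L w)) (L v))).
      by apply: filterE => u; exact: addrA.
    by apply: smooth_atD; [exact: smooth_at_cst|exact: smooth_at_lin].
  split; first exact: smooth_atB.
  move=> Y; have -> : lder N Y H v' = lder N Y (fun v => L (mu N (w, v))) v' - lder N Y (fun v => star (L w) (L v)) v'.
    exact: lderB.
  have -> : lder N Y (fun v => L (mu N (w, v))) v' = Y + 2^-1 *: br (L (mu N (w, v'))) Y.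
    by apply: etrans (dLm Y); apply: esym; exact: lder_mu_aux.
  have -> : lder N Y (fun v => star (L w) (L v)) v' = Y + 2^-1 *: br (star (L w) (L v')) Y.
    by apply: lder_starr => //; exact: dLv.
  exact: bracket_half_sub.
have qH v' : `|v' - e0| < r -> q (H v') = 0.
  move=> rv'; have q0 : q 0 = 0 by have := linear0 (mklin ql).
  rewrite -[RHS]q0 -E0; apply: (zero_derive_const (f := fun v => q (H v))) rv' => y by_ v1.
  have [sH dH] := HH y by_; have [_ [cy uy _ _] _ _] := Hr y by_.
  have s1 : smooth_at (fun u => mklin ql (H u)) y by exact: smooth_at_lin.
  apply: is_derive_lder0 => // Y.
  have E : lder N Y (fun u => mklin ql (H u)) y = mklin ql (lder N Y H y) by exact: lder_lin.
  apply: etrans E _; rewrite dH /=.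
  by have := ql 2^-1 (br (H y) Y) 0; rewrite bq q0 !addr0 scaler0.
have : H v = H e0; last by rewrite E0 => /eqP; rewrite subr_eq0 => /eqP.
apply: (zero_derive_const (f := H)) bv => y by_ v1.
have [sH dH] := HH y by_; have [_ [cy uy _ _] _ _] := Hr y by_.
apply: is_derive_lder0 => // Y; rewrite dH -qb qH // bracket0l scaler0 //.
Qed.

End local_exp.

Section exponential.
Context {R : realType} {n : nat} (N : lieGroupType R n).
Local Notation e0 := (le0 N).
Local Notation c := (lchart N).
Local Notation co := (lco N).
Local Notation pt := (lpt N).
Local Notation br := (lie_bracket N).
Local Notation star := (star N).
Implicit Types (X Y Z u v w : 'rV[R]_n).

Record local_exp (e : 'rV[R]_n -> N) (L : N -> 'rV[R]_n) (r : R) : Prop := LocalExp {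
  lexp_r : 0 < r;
  lexp_plot : forall X, `|X| < r -> plot_at e X;
  lexp_hom : forall X Y, `|X| < r -> `|Y| < r -> e (star X Y) = (e X * e Y)%g;
  lexp_evel : forall X, evel e 0 X = X;
  lexp_K : forall X, `|X| < r -> L (e X) = X;
  llog_K : \forall x \near (1%g : N), e (L x) = x /\ `|L x| < r;
  llog_1 : L 1%g = 0;
  llog_plot : forall (V : normedModType R) (f : V -> N) x, plot_at f x -> f x = 1%g ->
    smooth_at (fun y => L (f y)) x
}.

Hypothesis N2 : at_most_two_step N.

(** The inverse function theorem for the logarithm, whose Jacobian at the identity is the identity
    matrix. *)
Lemma local_exp_exists : exists e L r, local_exp e L r.
Proof.
have [La [La0 sLa dLa]] := log_exists N2.
have j1 : jac La e0 = 1%:M.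
  apply: eq_mx_row => v; rewrite -jacE // mulmx1 -lder_e0 (nbhs_singleton dLa) La0 bracket0l.
  by rewrite scaler0 addr0.
have u1 : jac La e0 \in unitmx by rewrite j1 unitmx1.
have [h [h0 sh hK Kh]] := inverse_function sLa u1.
rewrite La0 in h0 sh hK.
have ch : \forall X \near (0 : 'rV[R]_n), cod c (h X).
  have n1 : \forall u \near h 0, cod c u by rewrite h0; exact: cod_near1.
  exact: (near_comp (smooth_at_cont sh) n1).
pose e X := pt (h X); pose L x := La (co x).
have nX : \forall X \near (0 : 'rV[R]_n), plot_at e X /\ L (e X) = X.
  apply: filterS3 ch (smooth_at_near sh) hK => X cX sX KX; split; first exact: plot_pt_comp.
  by rewrite /L /e pointK.
have nXY : \forall z \near ((0, 0) : 'rV[R]_n * 'rV[R]_n), e (star z.1 z.2) = (e z.1 * e z.2)%g.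
  pose hh (z : 'rV[R]_n * 'rV[R]_n) := (h z.1, h z.2).
  have sfst : smooth_at fst ((0, 0) : 'rV[R]_n * 'rV[R]_n) by exact: smooth_at_fst.
  have ssnd : smooth_at snd ((0, 0) : 'rV[R]_n * 'rV[R]_n) by exact: smooth_at_snd.
  have shh : smooth_at hh (0, 0).
    by apply: smooth_at_pair; [exact: (smooth_at_comp sfst sh)|exact: (smooth_at_comp ssnd sh)].
  have hh0 : hh (0, 0) = (e0, e0) by rewrite /hh /= h0.
  have m0 : mu N (e0, e0) = e0 by rewrite mu0 //; exact: cod1.
  have n1 : \forall z \near ((0, 0) : 'rV[R]_n * 'rV[R]_n), [/\ cod c (hh z).1, cod c (hh z).2,
      dom c (pt (hh z).1 * pt (hh z).2)%g & La (mu N (hh z)) = star (La (hh z).1) (La (hh z).2)].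
    have H := log_mul N2 La0 sLa dLa; rewrite -hh0 in H.
    exact: (near_comp (smooth_at_cont shh) H).
  have n2 : \forall z \near ((0, 0) : 'rV[R]_n * 'rV[R]_n), h (La (mu N (hh z))) = mu N (hh z).
    have sm : smooth_at (mu N) (hh (0, 0)) by rewrite hh0; apply: smooth_mu0; exact: cod1.
    have smh : smooth_at (fun z => mu N (hh z)) (0, 0) by exact: (smooth_at_comp shh sm).
    have H : \forall u \near mu N (hh (0, 0)), h (La u) = u by rewrite hh0 m0.
    exact: (near_comp (smooth_at_cont smh) H).
  have n3 : \forall z \near ((0, 0) : 'rV[R]_n * 'rV[R]_n), La (h z.1) = z.1.
    exact: (near_comp (smooth_at_cont sfst) hK).
  have n4 : \forall z \near ((0, 0) : 'rV[R]_n * 'rV[R]_n), La (h z.2) = z.2.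
    exact: (near_comp (smooth_at_cont ssnd) hK).
  apply: filterS3 n1 (n2) (filterI n3 n4) => z [c1 c2 d E] E2 [E3 E4].
  have E5 : h (star z.1 z.2) = mu N (hh z) by rewrite -E2 E /= E3 E4.
  by rewrite /e E5 /mu coordK.
move: nX => /nbhs_normP[r1 /= r10 H1]; move: nXY => /near_pairP[r2 r20 H2].
have nr X : `|X| < Num.min r1 r2 -> `|X| < r1 /\ `|X - 0| < r2 by rewrite lt_min subr0 => /andP.
exists e, L, (Num.min r1 r2); split.
- by rewrite lt_min r10.
- by move=> X /nr[h1 _]; have [] : plot_at e X /\ L (e X) = X by apply: H1; rewrite /= sub0r normrN.
- by move=> X Y /nr[_ hX] /nr[_ hY]; exact: (H2 X Y).
- move=> X; have pp : plot_at pt (h 0) by rewrite h0; exact: plot_pt cod1.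
  have p1 : pt (h 0) = 1%g by rewrite h0 pt1.
  apply: etrans (evel_comp X sh pp p1) _; rewrite h0 evel_pt.
  have sLh : smooth_at La (h 0) by rewrite h0.
  have E : 'D_('D_X h 0) La e0 = 'D_X h 0 by rewrite jacE // j1 mulmx1.
  rewrite -[LHS]E -h0; apply: etrans (esym (smooth_at_chainE X sh sLh)) _.
  apply: etrans (near_eq_derive X hK) _; exact: derive_id.
- by move=> X /nr[h1 _]; have [] : plot_at e X /\ L (e X) = X by apply: H1; rewrite /= sub0r normrN.
- have cL : {for (1%g : N), continuous co} by exact: coord_continuous dom1.
  have n1 : \forall x \near (1%g : N), h (La (co x)) = co x by exact: (cL _ Kh).
  have n2 : \forall x \near (1%g : N), dom c x.
    by apply: open_nbhs_nbhs; split; [exact: dom_open|exact: dom1].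
  have r0 : 0 < Num.min r1 r2 by rewrite lt_min r10.
  have nL : \forall u \near e0, `|La u| < Num.min r1 r2.
    have H : \forall X \near La e0, `|X| < Num.min r1 r2.
      by rewrite La0; apply/nbhs_normP; exists (Num.min r1 r2) => // X; rewrite /= sub0r normrN.
    exact: (near_comp (smooth_at_cont sLa) H).
  have n3 : \forall x \near (1%g : N), `|La (co x)| < Num.min r1 r2 by exact: (cL _ nL).
  by apply: filterS3 n1 n2 n3 => x E d b; split => //; rewrite /e E coordK.
- exact: La0.
- move=> V f x pf f1; have s1 := smooth1 pf f1.
  have sL : smooth_at La (co (f x)) by rewrite f1.
  exact: (smooth_at_comp s1 sL).
Qed.

Lemma bracket_self X : br X X = 0.
Proof.
have : br X X = - br X X by exact: bracketC.
by move: (br X X) => b /rowP E; apply/rowP => i; have := E i; rewrite !mxE; lra.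
Qed.

Lemma expr2_range (a : R) : exists k, a < 2 ^+ k.
Proof.
exists (Num.bound `|a|); apply: le_lt_trans (ler_norm _) _.
apply: lt_trans (archi_boundP _) _; first exact: normr_ge0.
by rewrite -natrX ltr_nat ltn_expl.
Qed.

Lemma plot_iter (V : normedModType R) (f : V -> N) x k : plot_at f x ->
  plot_at (fun y => iter k (fun a : N => a * a)%g (f y)) x.
Proof. by move=> pf; elim: k => [//|k IH] /=; apply: plot_mul; exact: IH. Qed.

(** * The global exponential map *)

Section global.
Variables (e : 'rV[R]_n -> N) (L : N -> 'rV[R]_n) (r : R).
Hypothesis le : local_exp e L r.

Let r0 := lexp_r le.

(* [exp X = (exp (2^-k X))^(2^k)] extends the local exponential to the whole Lie algebra. *)
Definition dbl k X : N := iter k (fun x : N => x * x)%g (e (2^-1 ^+ k *: X)).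

Lemma star_half X : star (2^-1 *: X) (2^-1 *: X) = X.
Proof.
by rewrite /star bracket_self scaler0 addr0 -scalerDl -[2^-1]mul1r -splitr scale1r.
Qed.

Lemma norm_half X t : `|X| < 2 * t -> `|2^-1 *: X| < t.
Proof. by rewrite normrZ gtr0_norm ?invr_gt0 // -ltr_pdivlMl ?invr_gt0 // invrK. Qed.

Lemma dblS k X : `|X| < 2 ^+ k * r -> dbl k.+1 X = dbl k X.
Proof.
move=> hX; rewrite /dbl iterSr; congr (iter k _ _).
have sm : `|2^-1 ^+ k *: X| < r.
  by rewrite normrZ ger0_norm ?exprn_ge0 ?invr_ge0 // exprVn -ltr_pdivlMl ?invr_gt0 ?exprn_gt0 // invrK.
have sm2 : `|2^-1 ^+ k.+1 *: X| < r.
  rewrite exprS -scalerA; apply: norm_half; apply: lt_trans sm _.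
  by rewrite ltr_pMl // ltr1n.
by rewrite -(lexp_hom le sm2 sm2) exprS -scalerA star_half.
Qed.

Lemma dbl_stable k l X : (k <= l)%N -> `|X| < 2 ^+ k * r -> dbl l X = dbl k X.
Proof.
move=> kl hX; rewrite -(subnK kl); elim: (l - k)%N => [//|j IH].
rewrite addSn dblS // (lt_le_trans hX) // ler_pM2r //.
by rewrite ler_eXn2l ?ltr1n // leq_addl.
Qed.

Lemma dbl_range X : exists k, `|X| < 2 ^+ k * r.
Proof.
by have [k hk] := expr2_range (`|X| / r); exists k; rewrite -ltr_pdivrMr.
Qed.

Definition gexp X := dbl (projT1 (cid (dbl_range X))) X.

Lemma gexpE k X : `|X| < 2 ^+ k * r -> gexp X = dbl k X.
Proof.
rewrite /gexp; case: (cid _) => l /= hl hk.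
by have [kl|/ltnW lk] := leqP k l; [exact: dbl_stable|exact: esym (dbl_stable _ _)].
Qed.

Lemma gexp_local X : `|X| < r -> gexp X = e X.
Proof. by move=> hX; rewrite (@gexpE 0%N) ?expr0 ?mul1r // /dbl expr0 scale1r. Qed.

Lemma gexp_half X : gexp X = (gexp (2^-1 *: X) * gexp (2^-1 *: X))%g.
Proof.
have [k hk] := dbl_range X.
have h2 : `|2^-1 *: X| < 2 ^+ k * r.
  by apply: norm_half; apply: lt_le_trans hk _; rewrite ler_peMl ?mulr_ge0 ?exprn_ge0 ?ltW // ?ltr1n // ler1n.
have h1 : `|X| < 2 ^+ k.+1 * r by apply: lt_le_trans hk _; rewrite exprS -mulrA ler_peMl ?mulr_ge0 ?exprn_ge0 ?ltW // ltr1n.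
by rewrite (gexpE h1) (gexpE h2) /dbl iterS exprSr -scalerA.
Qed.

Lemma plot_gexp X : plot_at gexp X.
Proof.
have [k hk] := dbl_range X.
apply: (@plot_at_ext _ _ _ _ (dbl k)).
  have H : \forall Y \near X, `|Y| < 2 ^+ k * r.
    have oB : open [set x : 'rV[R]_n | `|x - 0| < 2 ^+ k * r] by exact: open_norm_lt.
    by apply: filterS (open_nbhs_nbhs (conj oB _)) => [Y|] /=; rewrite subr0.
  by apply: filterS H => Y hY; rewrite (gexpE hY).
rewrite /dbl; have s : smooth_at (fun Y : 'rV[R]_n => 2^-1 ^+ k *: Y) X.
  have l : linear (fun Y : 'rV[R]_n => 2^-1 ^+ k *: Y) by move=> a Y Z; rewrite scalerDr !scalerA mulrC.
  by apply: (smooth_at_lin (mklin l)); exact: smooth_at_id.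
have pe : plot_at (fun Y => e (2^-1 ^+ k *: Y)) X.
  apply: (plot_at_comp s); apply: lexp_plot le _ _.
  by rewrite normrZ ger0_norm ?exprn_ge0 ?invr_ge0 // exprVn -ltr_pdivlMl ?invr_gt0 ?exprn_gt0 // invrK.
exact: plot_iter.
Qed.

Lemma star_range : exists2 t, 0 < t <= r & forall X Y, `|X| < t -> `|Y| < t -> `|star X Y| < r.
Proof.
have H : \forall z \near ((0, 0) : 'rV[R]_n * 'rV[R]_n), `|star z.1 z.2| < r.
  have s : smooth_at (fun z : 'rV[R]_n * 'rV[R]_n => star z.1 z.2) (0, 0).
    have bl Y : linear (br^~ Y) by move=> a X X'; exact: bracket_linear_l.
    have b2 X : linear (br X) by move=> a Y Y'; exact: bracket_linear_r.
    have sfst : smooth_at fst ((0, 0) : 'rV[R]_n * 'rV[R]_n) by exact: smooth_at_fst.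
    have ssnd : smooth_at snd ((0, 0) : 'rV[R]_n * 'rV[R]_n) by exact: smooth_at_snd.
    apply: smooth_atD; first exact: smooth_atD.
    by apply: smooth_atZ; [exact: smooth_at_cst|exact: (smooth_at_bilin bl b2)].
  have H : \forall X \near star (0 : 'rV[R]_n) 0, `|X| < r.
    by rewrite star0r; apply/nbhs_normP; exists r => // X; rewrite /= sub0r normrN.
  exact: (near_comp (smooth_at_cont s) H).
move: H => /near_pairP[t t0 H]; exists (Num.min t r); first by rewrite lt_min t0 r0 ge_min lexx orbT.
by move=> X Y; rewrite !lt_min => /andP[Xt _] /andP[Yt _]; apply: (H X Y); rewrite subr0.
Qed.

Lemma gexp_comm X Y : br X Y = 0 -> gexp (X + Y) = (gexp X * gexp Y)%g.
Proof.
have [t /andP[t0 tr] Ht] := star_range.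
suff H k : forall X Y, `|X| < 2 ^+ k * t -> `|Y| < 2 ^+ k * t -> br X Y = 0 -> gexp (X + Y) = (gexp X * gexp Y)%g.
  have [k hk] : exists k, (`|X| < 2 ^+ k * t) /\ (`|Y| < 2 ^+ k * t).
    have [k hk] := expr2_range ((`|X| + `|Y|) / t); exists k.
    have h : `|X| + `|Y| < 2 ^+ k * t by rewrite -ltr_pdivrMr.
    by split; apply: le_lt_trans h; rewrite ?lerDl ?lerDr.
  by move=> b0; apply: (H k) => //; case: hk.
elim: k => [|k IH] {}X {}Y.
  rewrite expr0 mul1r => hX hY b0.
  have sE : star X Y = X + Y by rewrite /star b0 scaler0 addr0.
  have := Ht X Y hX hY; rewrite sE => hXY.
  by rewrite !gexp_local ?(lt_le_trans hX) ?(lt_le_trans hY) // -sE (lexp_hom le) ?(lt_le_trans hX) ?(lt_le_trans hY).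
rewrite exprS -!mulrA => /norm_half hX /norm_half hY b0.
have b1 : br (2^-1 *: X) (2^-1 *: Y) = 0 by rewrite bracketZl bracketZr b0 !scaler0.
have b2 : br (2^-1 *: Y) (2^-1 *: X) = 0 by rewrite bracketC b1 oppr0.
have C : (gexp (2^-1 *: Y) * gexp (2^-1 *: X) = gexp (2^-1 *: X) * gexp (2^-1 *: Y))%g.
  by rewrite -!IH // addrC.
rewrite [LHS]gexp_half scalerDr IH // [gexp X]gexp_half [gexp Y]gexp_half.
by rewrite -!mulgA; congr (_ * _)%g; rewrite !mulgA C.
Qed.

(** The range of validity doubles at each step. With [x], [y] the halves of [X], [Y] and [z = exp
    ([x, y] / 2)] central, [exp x exp y = exp y exp x z^2]; hence
    [(exp x exp y z)^2 = (exp x)^2 (exp y)^2], and the left side is [exp (star X Y)]. *)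
Lemma gexp_star X Y : gexp (star X Y) = (gexp X * gexp Y)%g.
Proof.
have [t /andP[t0 tr] Ht] := star_range.
suff H k : forall X Y, `|X| < 2 ^+ k * t -> `|Y| < 2 ^+ k * t -> gexp (star X Y) = (gexp X * gexp Y)%g.
  have [k hk] : exists k, (`|X| < 2 ^+ k * t) /\ (`|Y| < 2 ^+ k * t).
    have [k hk] := expr2_range ((`|X| + `|Y|) / t); exists k.
    have h : `|X| + `|Y| < 2 ^+ k * t by rewrite -ltr_pdivrMr.
    by split; apply: le_lt_trans h; rewrite ?lerDl ?lerDr.
  by apply: (H k); case: hk.
elim: k => [|k IH] {}X {}Y.
  rewrite expr0 mul1r => hX hY; have hXY := Ht X Y hX hY.
  by rewrite !gexp_local ?(lt_le_trans hX) ?(lt_le_trans hY) // (lexp_hom le) ?(lt_le_trans hX) ?(lt_le_trans hY).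
rewrite exprS -!mulrA => /norm_half hX /norm_half hY.
pose x := 2^-1 *: X; pose y := 2^-1 *: Y; pose w := br x y.
have cw Z : br Z w = 0 by exact: N2.
have cw' a Z : br Z (a *: w) = 0 by rewrite bracketZr cw scaler0.
have cw'' a Z : br (a *: w) Z = 0 by rewrite bracketC cw' oppr0.
pose z := gexp (2^-1 *: w).
have zC V : (gexp V * z = z * gexp V)%g by rewrite -!gexp_comm // addrC.
have E1 : 2^-1 *: star X Y = star x y + 2^-1 *: w.
  have H (b : 'rV[R]_n) : 2^-1 *: (X + Y + 2^-1 *: (4 *: b)) = x + y + 2^-1 *: b + 2^-1 *: b.
    by apply/rowP => i; rewrite !mxE; field.
  have E : br X Y = 4 *: w.
    rewrite /w /x /y bracketZl bracketZr; move: (br X Y) => b.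
    by apply/rowP => i; rewrite !mxE; field.
  by rewrite /star E; exact: H.
have E2 : star x y = star y x + w.
  have H (b : 'rV[R]_n) : x + y + 2^-1 *: b = y + x + 2^-1 *: (- b) + b.
    by apply/rowP => i; rewrite !mxE; field.
  by rewrite /star (bracketC y x); exact: H.
have ab : (gexp x * gexp y = gexp y * gexp x * (z * z))%g.
  by rewrite -IH // E2 gexp_comm // IH // [gexp w]gexp_half.
rewrite gexp_half E1 gexp_comm // IH // -/z [gexp X]gexp_half [gexp Y]gexp_half -/x -/y.
have -> : (gexp x * gexp x * (gexp y * gexp y) = gexp x * (gexp x * gexp y) * gexp y)%g by rewrite !mulgA.
rewrite {3}ab -!mulgA; congr (_ * (_ * _))%g; by rewrite mulgA -zC -mulgA (zC y).
Qed.

Lemma gexp0 : gexp 0 = 1%g.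
Proof. by have := gexp_comm (bracket_self 0); rewrite addr0 -{1}[gexp 0]mulg1 => /mulgI. Qed.

Lemma gexpN X : gexp (- X) = (gexp X)^-1%g.
Proof.
have := @gexp_comm X (- X); rewrite subrr gexp0 bracketNr bracket_self oppr0 => /(_ erefl) E.
by rewrite -[LHS]mul1g -(mulVg (gexp X)) -mulgA -E mulg1.
Qed.

Lemma gexp_inj_near X Y : `|X| < r -> `|Y| < r -> gexp X = gexp Y -> X = Y.
Proof. by move=> hX hY; rewrite !gexp_local // => E; rewrite -(lexp_K le hX) E (lexp_K le). Qed.

Lemma glog_near : \forall x \near (1%g : N), gexp (L x) = x.
Proof. by apply: filterS (llog_K le) => x [E hx]; rewrite gexp_local. Qed.

Lemma evel_gexp X : evel gexp 0 X = X.
Proof.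
rewrite -[RHS](lexp_evel le); apply: evel_ext.
have H : \forall Y \near (0 : 'rV[R]_n), `|Y| < r.
  by apply/nbhs_normP; exists r => // Y; rewrite /= sub0r normrN.
by apply: filterS H => Y hY; rewrite gexp_local.
Qed.

Hypothesis N_connected : connected [set: N].

(** The image is a subgroup containing a neighbourhood of [1], hence open and closed. *)
Lemma gexp_surj x : exists X, gexp X = x.
Proof.
pose S : set N := [set x | exists X, gexp X = x].
have SM a b : S a -> S b -> S (a * b)%g.
  by move=> [X <-] [Y <-]; exists (star X Y); exact: gexp_star.
have SV a : S a -> S a^-1%g by move=> [X <-]; exists (- X); exact: gexpN.
have cmul (a : N) : continuous (fun x : N => a * x)%g.
  move=> y; apply: (@continuous_comp _ _ _ (fun y : N => (a, y)) (fun q : N * N => q.1 * q.2)%g).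
    by apply: cvg_pair; [exact: cvg_cst|exact: cvg_id].
  exact: (@lie_mul_smooth _ _ N).1.
have n1 a : \forall y \near a, exists2 s, S s & y = (a * s)%g.
  have H : \forall y \near (a^-1 * a)%g, S y.
    by rewrite mulVg; apply: filterS glog_near => y E; exists (L y).
  have H' : \forall y \near a, S (a^-1 * y)%g by exact: (cmul a^-1%g a _ H).
  by apply: filterS H' => y Sy; exists (a^-1 * y)%g; rewrite ?mulVKg.
have oS : open S.
  by rewrite openE => a Sa; rewrite /interior; apply: filterS (n1 a) => y [s Ss ->]; exact: SM.
have cS : closed S.
  rewrite -[S]setCK; apply: open_closedC; rewrite openE => a nSa; rewrite /interior.
  apply: filterS (n1 a) => y [s Ss ->] Sy; apply: nSa.
  by rewrite -[a](mulgK s); apply: SM => //; exact: SV.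
have S1 : S 1%g by exists 0; exact: gexp0.
have /seteqP[_] : S = [set: N].
  apply: N_connected; [by exists 1%g|by exists S; rewrite ?setTI|by exists S; rewrite ?setTI].
by apply.
Qed.

(* [gexp K = 1] forces [gexp (s [Y, K]) = 1] for all real [s], whereas [gexp] is injective near [0]. *)
Lemma gexp_kernel K : gexp K = 1%g -> lie_center N K.
Proof.
move=> E Y.
have H Z : gexp (br Z K) = 1%g.
  have E1 : (gexp Z * gexp K)%g = (gexp K * gexp Z)%g by rewrite E mulg1 mul1g.
  rewrite -!gexp_star in E1.
  have E2 : star Z K = star K Z + br Z K.
    have H (b : 'rV[R]_n) : Z + K + 2^-1 *: b = K + Z + 2^-1 *: (- b) + b.
      by apply/rowP => i; rewrite !mxE; field.
    by rewrite /star (bracketC K Z); exact: H.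
  rewrite E2 gexp_comm in E1; last exact: N2.
  by rewrite -[gexp (star K Z)]mulg1 in E1 *; move: E1; rewrite -mulgA mul1g => /mulgI.
have [k hk] := dbl_range (br Y K).
suff : 2^-1 ^+ k *: br Y K = 0.
  move/eqP; rewrite scaler_eq0 expf_eq0 invr_eq0 pnatr_eq0 andbF /= => /eqP b0.
  by rewrite bracketC b0 oppr0.
apply: gexp_inj_near; last by rewrite gexp0 -bracketZl H.
  by rewrite normrZ ger0_norm ?exprn_ge0 ?invr_ge0 // exprVn -ltr_pdivlMl ?invr_gt0 ?exprn_gt0 // invrK.
by rewrite normr0.
Qed.

End global.

End exponential.

(** * Commuting skew endomorphisms *)

Section rotations.
Context {R : realType} {n : nat} {I : finType}.
Implicit Types (A : I -> 'M[R]_n) (x y u v : 'rV[R]_n).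

(** Multiplication by [Q i *m Q i] on the right isolates the [i]-th term of [A k], up to sign. *)
Lemma rotation_sum_kill A d (Q : 'I_d -> 'M[R]_n) (co : I -> 'rV[R]_d) x :
  (forall i j, i != j -> Q i *m Q j = 0) -> (forall i, Q i *m Q i *m Q i = - Q i) ->
  (forall i, exists k, co k ord0 i != 0) -> (forall k, A k = \sum_i co k ord0 i *: Q i) ->
  (forall k, x *m A k = 0) -> forall i, x *m Q i = 0.
Proof.
move=> QQ Q3 cQ AE xA i; have [k ki] := cQ i.
have : x *m A k *m (Q i *m Q i) = 0 by rewrite xA mul0mx.
rewrite AE mulmx_sumr mulmx_suml (bigD1 i) //= big1 ?addr0; last first.
  by move=> j ji; rewrite -scalemxAr -scalemxAl -!mulmxA [Q j *m _]mulmxA QQ // mul0mx mulmx0 scaler0.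
rewrite -scalemxAr -scalemxAl -mulmxA [Q i *m _]mulmxA Q3 mulmxN scalerN => /eqP.
by rewrite oppr_eq0 scaler_eq0 (negbTE ki) => /eqP.
Qed.

(** A symmetric matrix whose kernel is the common kernel of the [A k]; its rank is the induction
    parameter, and its row space the complement on which the rotations live. *)
Let S A := \sum_k A k *m (A k)^T.

Let S_kill A x : x *m S A = 0 <-> forall k, x *m A k = 0.
Proof.
split=> [xS k|xA]; last by rewrite mulmx_sumr big1 // => k _; rewrite mulmxA xA mul0mx.
have : dot (x *m S A) x = 0 by rewrite xS dot0l.
have -> : dot (x *m S A) x = \sum_k dot (x *m A k) (x *m A k).
  rewrite mulmx_sumr dot_suml; apply: eq_bigr => l _.
  by rewrite mulmxA dot_mx trmxK.
move/eqP; rewrite psumr_eq0 => [/allP h|l _]; last exact: dot_ge0.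
by apply: dot_eq0; apply/eqP; exact: (h k (mem_index_enum k)).
Qed.

Let S_sym A : (S A)^T = S A.
Proof. by rewrite /S linear_sum; apply: eq_bigr => k _; rewrite /= trmx_mul trmxK. Qed.

(** The family is restricted to the row space of [S A], where no common kernel remains, and a
    complex eigenvector is split into [u] and [v]. Skewness makes the eigenvalues imaginary and,
    where they are nonzero, forces [u] and [v] to be orthogonal and of equal length. *)
Lemma common_rotation A : (forall k, (A k)^T = - A k) -> (forall k l, A k *m A l = A l *m A k) ->
  S A != 0 -> exists u v (be : I -> R), [/\ dot u u = 1, dot v v = 1, dot u v = 0,
    forall k, u *m A k = - (be k *: v) /\ v *m A k = be k *: u & exists k, be k != 0].
Proof.
move=> sk cm S0; pose r := \rank (S A); pose M := row_base (S A).
have cS l : S A *m A l = A l *m S A.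
  rewrite /S mulmx_suml mulmx_sumr; apply: eq_bigr => k _.
  have E : A k *m A k *m A l = A l *m (A k *m A k) by rewrite -mulmxA (cm k l) mulmxA (cm k l) -mulmxA.
  by rewrite sk mulmxN mulNmx mulmxN E.
have MS : (M :=: S A)%MS by exact: eq_row_base.
have invM k : (M *m A k <= M)%MS.
  apply: (submx_trans (submxMr _ _)); first by rewrite MS; exact: submx_refl.
  by rewrite MS cS submxMl.
pose A' k := M *m A k *m pinvmx M.
have A'E k : A' k *m M = M *m A k by exact: mulmxKpV.
have fM : row_free M by exact: row_base_free.
have cA' k l : A' k *m A' l = A' l *m A' k.
  have E a b : A' a *m A' b *m M = M *m (A a *m A b).
    by rewrite -(mulmxA (A' a)) A'E (mulmxA (A' a)) A'E -mulmxA.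
  by apply: (row_free_inj fM); apply: etrans (E k l) _; rewrite cm -E.
have r0 : (0 < r)%N by rewrite lt0n mxrank_eq0.
have [c1 [c2 [nz HA]]] := real_eigenpair r0 cA'.
pose u := c1 *m M; pose v := c2 *m M.
have M0 c : c *m M = 0 -> c = 0 by move=> E; apply: (row_free_inj fM); rewrite mul0mx.
have /choice[al] : forall k, exists p : R * R, u *m A k = p.1 *: u - p.2 *: v /\ v *m A k = p.2 *: u + p.1 *: v.
  move=> k; have [a [b [E1 E2]]] := HA k; exists (a, b).
  have F c : c *m M *m A k = c *m A' k *m M by rewrite -(mulmxA c) -A'E mulmxA.
  rewrite /u /v !F E1 E2 /=.
  by rewrite mulmxBl mulmxDl -!scalemxAl.
pose be k := (al k).2; move=> HA'.
have skdot k : [/\ (al k).1 = 0, be k * dot u v = 0 & be k * (dot u u - dot v v) = 0].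
  have [E1 E2] := HA' k; rewrite -/(be k) in E1 E2.
  have h1 := skew_dot0 u (sk k); have h2 := skew_dot0 v (sk k); have h3 := dot_skew u v (sk k).
  rewrite E1 dotDl dotNl !dotZl (dotC v u) in h1; rewrite E2 dotDl !dotZl in h2.
  rewrite E1 E2 dotDl dotNl dotDr !dotZl !dotZr in h3.
  have a0 : (al k).1 * (dot u u + dot v v) = 0 by lra.
  have : dot u u + dot v v != 0.
    apply/negP => /eqP s0; apply: nz; have p1 := dot_ge0 u; have p2 := dot_ge0 v.
    by split; apply: M0; apply: dot_eq0; rewrite -?/u -?/v; lra.
  move=> /negbTE nz'; move/eqP: a0; rewrite mulf_eq0 nz' orbF => /eqP a0.
  by split=> //; rewrite a0 !mul0r in h1 h3; lra.
have HB k : u *m A k = - (be k *: v) /\ v *m A k = be k *: u.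
  by have [E1 E2] := HA' k; have [a0 _ _] := skdot k; rewrite E1 E2 a0 !scale0r add0r addr0.
have [k bk] : exists k, be k != 0.
  apply: contrapT => nb; apply: nz.
  have b0 k : be k = 0 by apply/eqP; apply: contrapT => /negP h; apply: nb; exists k.
  have kill x : (x <= S A)%MS -> (forall k, x *m A k = 0) -> x = 0.
    move=> /submxP[y E] /S_kill xS; apply: dot_eq0.
    by rewrite {1}E dot_mx S_sym xS dotC dot0l.
  split; apply: M0; apply: kill; rewrite -?MS ?submxMl // => k; have [E1 E2] := HB k.
    by rewrite -/u E1 b0 scale0r oppr0.
  by rewrite -/v E2 b0 scale0r.
have [_ /eqP + /eqP] := skdot k; rewrite !mulf_eq0 (negbTE bk) /= => /eqP uv; rewrite subr_eq0 => /eqP uuvv.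
have u0 : 0 < dot u u.
  rewrite lt_neqAle dot_ge0 andbT; apply/negP => /eqP h; apply: nz.
  by split; apply: M0; apply: dot_eq0; rewrite -/u -?/v -?uuvv -h.
pose s := (Num.sqrt (dot u u))^-1.
have s2 : s * s * dot u u = 1.
  by rewrite -expr2 exprVn sqr_sqrtr ?ltW // mulVf // gt_eqF.
exists (s *: u), (s *: v), be; split; last by exists k.
- by rewrite dotZl dotZr mulrA.
- by rewrite dotZl dotZr mulrA -uuvv.
- by rewrite dotZl dotZr uv !mulr0.
- move=> l; have [E1 E2] := HB l.
  by rewrite -!scalemxAl E1 E2 scalerN !scalerA mulrC.
Qed.

(** Induction on [\rank (S A)]: subtract from each [A k] its action on the plane of [u] and [v]. The
    remainder kills this plane, so the rank drops, and the quarter turns found for it annihilate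
    [Q0]. *)
Theorem rotation_decomposition A : (forall k, (A k)^T = - A k) -> (forall k l, A k *m A l = A l *m A k) ->
  exists d (Q : 'I_d -> 'M[R]_n) (co : I -> 'rV[R]_d),
  [/\ forall i, (Q i)^T = - Q i, forall i j, i != j -> Q i *m Q j = 0,
      forall i, Q i *m Q i *m Q i = - Q i /\ Q i != 0, forall i, exists k, co k ord0 i != 0
    & forall k, A k = \sum_i co k ord0 i *: Q i].
Proof.
have [m] := ubnP (\rank (S A)); elim: m A => // m IH A Sm sk cm.
have [S0|S0] := eqVneq (S A) 0.
  have A0 k : A k = 0 by apply: eq_mx_row => x; rewrite mulmx0; apply: (S_kill A x).1; rewrite S0 mulmx0.
  exists 0%N, (fun=> 0), (fun=> 0); split; try by case.
  by move=> k; rewrite A0 big_ord0.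
have [u [v [be [uu vv uv HB [k0 bk0]]]]] := common_rotation sk cm S0.
(* The quarter turn of the plane spanned by [u] and [v], zero on its orthogonal complement. *)
pose Q0 := v^T *m u - u^T *m v.
have Q0E x : x *m Q0 = dot x v *: u - dot x u *: v.
  rewrite /Q0 mulmxBr !mulmxA; congr (_ - _).
    by rewrite [x *m v^T]mx11_scalar mul_scalar_mx.
  by rewrite [x *m u^T]mx11_scalar mul_scalar_mx.
have vu : dot v u = 0 by rewrite dotC.
have uQ0 : u *m Q0 = - v by rewrite Q0E uv uu scale0r sub0r scale1r.
have vQ0 : v *m Q0 = u by rewrite Q0E vv vu scale0r subr0 scale1r.
have Q0T : Q0^T = - Q0 by rewrite /Q0 linearB /= !trmx_mul !trmxK opprB.
have Q03 : Q0 *m Q0 *m Q0 = - Q0.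
  apply: eq_mx_row => x; rewrite !mulmxA mulmxN (Q0E x) !mulmxBl -!scalemxAl uQ0 vQ0 mulNmx vQ0 uQ0.
  by rewrite !scalerN opprB opprK addrC.
have Q00 : Q0 != 0.
  apply/eqP => E; have := uQ0; rewrite E mulmx0 => /esym/eqP; rewrite oppr_eq0 => /eqP v0.
  by have := vv; rewrite v0 dot0l => /eqP; rewrite eq_sym oner_eq0.
have cQ k : A k *m Q0 = Q0 *m A k.
  apply: eq_mx_row => x; have [E1 E2] := HB k; rewrite !mulmxA !Q0E !dot_skew // E1 E2.
  have h : dot x (- (be k *: v)) = - (be k * dot x v) by rewrite -scaleN1r !dotZr mulN1r.
  rewrite mulmxBl -!scalemxAl E1 E2 h dotZr.
  by apply/rowP => i; rewrite !mxE; ring.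
pose A1 k := A k - be k *: Q0.
have sk1 k : (A1 k)^T = - A1 k.
  by rewrite /A1 linearB linearZ /= sk Q0T scalerN opprB opprK addrC.
have cm1 k l : A1 k *m A1 l = A1 l *m A1 k.
  rewrite /A1 !mulmxBl !mulmxBr -!scalemxAl -!scalemxAr cm !cQ.
  move: (Q0 *m A k) (Q0 *m A l) (A l *m A k) (Q0 *m Q0) => *; apply/matrixP => i j; rewrite !mxE; ring.
have uA1 k : u *m A1 k = 0.
  by rewrite mulmxBr -scalemxAr uQ0 (HB k).1 scalerN opprK addNr.
have vA1 k : v *m A1 k = 0 by rewrite mulmxBr -scalemxAr vQ0 (HB k).2 subrr.
have rS : (\rank (S A1) < m)%N.
  have lt : (kermx (S A) < kermx (S A1))%MS.
    rewrite ltmxE; apply/andP; split.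
      apply/rV_subP => x /sub_kermxP/S_kill xA; apply/sub_kermxP/S_kill => k.
      have ux : dot x v = 0 /\ dot x u = 0.
        have [E1 E2] := HB k0.
        have h1 := dot_skew x v (sk k0); have h2 := dot_skew x u (sk k0).
        rewrite xA dot0l E2 dotZr in h1; rewrite xA dot0l E1 dotNr dotZr in h2.
        have b0 : (be k0 == 0) = false by exact: negbTE.
        split; apply/eqP; [move/eqP: h2|move/eqP: h1].
          by rewrite opprK eq_sym mulf_eq0 b0.
        by rewrite eq_sym oppr_eq0 mulf_eq0 b0.
      by rewrite mulmxBr xA -scalemxAr Q0E ux.1 ux.2 !scale0r subrr scaler0 subr0.
    apply/negP => h; have : (u <= kermx (S A))%MS.
      by apply: submx_trans h; apply/sub_kermxP/S_kill.
    move=> /sub_kermxP/S_kill/(_ k0); rewrite (HB k0).1 => /eqP; rewrite oppr_eq0 scaler_eq0 (negbTE bk0) /= => /eqP v0.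
    by have := vv; rewrite v0 dot0l => /eqP; rewrite eq_sym oner_eq0.
  have := rank_ltmx lt; rewrite !mxrank_ker => h.
  rewrite -ltnS; apply: leq_trans Sm; rewrite ltnS.
  have r1 := rank_leq_row (S A); have r2 := rank_leq_row (S A1); lia.
have [d [Q [co [QT QQ Q3 Qc QA]]]] := IH A1 rS sk1 cm1.
have Q3' i : Q i *m Q i *m Q i = - Q i by have [] := Q3 i.
have uQ := rotation_sum_kill QQ Q3' Qc QA uA1; have vQ := rotation_sum_kill QQ Q3' Qc QA vA1.
have Q0Q i : Q0 *m Q i = 0 by apply: eq_mx_row => x; rewrite mulmxA Q0E mulmxBl -!scalemxAl uQ vQ !scaler0 subrr mulmx0.
have QQ0 i : Q i *m Q0 = 0.
  by rewrite -[LHS]trmxK trmx_mul Q0T QT mulmxN mulNmx opprK Q0Q trmx0.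
pose Q' (i : 'I_d.+1) := if unlift ord0 i is Some j then Q j else Q0.
pose co' k : 'rV[R]_d.+1 := \row_i if unlift ord0 i is Some j then co k ord0 j else be k.
exists d.+1, Q', co'; split.
- by move=> i; rewrite /Q'; case: (unlift ord0 i).
- move=> i j; rewrite /Q'; case: (unliftP ord0 i) => [i' ->|->]; case: (unliftP ord0 j) => [j' ->|->] //.
    by move=> ij; apply: QQ; apply: contra ij => /eqP ->.
- by move=> i; rewrite /Q'; case: (unlift ord0 i).
- move=> i; case: (unliftP ord0 i) => [j ->|->].
    by have [k hk] := Qc j; exists k; rewrite mxE liftK.
  by exists k0; rewrite mxE unlift_none.
- move=> k; rewrite big_ord_recl mxE /Q' unlift_none.
  under eq_bigr => i _ do rewrite mxE liftK.
  by rewrite -QA /A1 addrC subrK.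
Qed.

End rotations.

Section rotation_data.
Context {R : realType} {n : nat} {N : lieGroupType R n} (g : riemannian N).
Local Notation br := (lie_bracket N).
Local Notation ip := (inner g (1%g : N)).
Implicit Types (x y z u v w : 'rV[R]_n).

(* The [Q i] are quarter turns on the common eigenspaces of the [J_z], and [J_z] is the sum of the
   [co z ord0 i *: Q i]. *)
Record rotation_data d (Q : 'I_d -> 'M[R]_n) (co : 'rV[R]_n -> 'rV[R]_d) : Prop := RotationData {
  rot_skew : forall i x y, ip (x *m Q i) y = - ip x (y *m Q i);
  rot_orth : forall i j, i != j -> Q i *m Q j = 0;
  rot_cube : forall i, Q i *m Q i *m Q i = - Q i;
  rot_neq0 : forall i, Q i != 0;
  rot_cen : forall z i, lie_center N z -> z *m Q i = 0;
  co_linear : linear co;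
  rot_bracket : forall x y z, ip (br x y) z = \sum_i co z ord0 i * ip (x *m Q i) y;
  co_rot : forall x i, co (x *m Q i) = 0
}.

Lemma J_mapE Z X W : center_orth g W ->
  (forall Y, center_orth g Y -> ip W Y = ip (br X Y) Z) -> J_map g Z X = W.
Proof.
move=> oW HW; have [oV HV] : center_orth g (J_map g Z X) /\
    forall Y, center_orth g Y -> ip (J_map g Z X) Y = ip (br X Y) Z.
  by exact: (@getPex _ [set W | center_orth g W /\ forall Y, center_orth g Y ->
    inner g 1%g W Y = inner g 1%g (lie_bracket N X Y) Z] (ex_intro _ W (conj oW HW))).
have ipL := innerDZl g (1%g : N).
have oVW : center_orth g (J_map g Z X - W).
  by move=> c cc; rewrite (ipBl ipL) oV // oW // subr0.
apply/eqP; rewrite -subr_eq0; apply/eqP; apply: (@inner_eq0 _ _ _ g 1%g).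
by rewrite (ipBl ipL) HV // HW // subrr.
Qed.

(** The bracket paired with any [w], central or not, is a skew form; its endomorphism [bop w] is [J]
    of the central component of [w], extended by zero to the centre. Hence all [bop w] commute, and
    the decomposition is applied to those of an orthonormal frame. *)
Lemma rotation_data_exists : at_most_two_step N -> J_abelian g ->
  exists d (Q : 'I_d -> 'M[R]_n) co, rotation_data Q co.
Proof.
move=> N2 Jab.
have ipC u v : ip u v = ip v u by exact: innerC.
have ipL a u v w : ip (a *: u + v) w = a * ip u w + ip v w by exact: innerDZl.
have ip0 u : ip u u = 0 -> u = 0 by exact: inner_eq0.
have [P uP EP] := orthonormal_frame (gram_sym g 1%g) (gram_posdef g 1%g).
pose K := invmx P; have uK : K \in unitmx by rewrite unitmx_inv.
have GE : gram g 1%g = K *m K^T.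
  rewrite -[LHS](mulKmx uP) -[X in _ *m X](mulmxK (_ : P^T \in unitmx)) ?unitmx_tr //.
  by rewrite EP mul1mx trmx_inv.
have ipE u v : ip u v = dot (u *m K) (v *m K) by rewrite inner_dot GE mulmxA dot_mx trmxK.
have PK : P *m K = 1%:M by exact: mulmxV.
have KP : K *m P = 1%:M by exact: mulVmx.
have brZ a x y : br x (a *: y) = a *: br x y by exact: bracketZr.
have b2 x : linear (br x) by move=> a y y'; exact: bracket_linear_r.
have b1 y : linear (br^~ y) by move=> a x x'; exact: bracket_linear_l.
pose B w : 'M[R]_n := \matrix_(i, j) ip (br (delta_mx ord0 i *m P) (delta_mx ord0 j *m P)) w.
have bsuml (F : 'I_n -> 'rV[R]_n) y : br (\sum_i F i) y = \sum_i br (F i) y.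
  exact: (linear_sum (mklin (b1 y))).
have bsumr (F : 'I_n -> 'rV[R]_n) x : br x (\sum_i F i) = \sum_i br x (F i).
  exact: (linear_sum (mklin (b2 x))).
have BE x y w : dot (x *m B w) y = ip (br (x *m P) (y *m P)) w.
  rewrite -{2}(sum_delta x) -{2}(sum_delta y) !mulmx_suml bsuml (ip_suml ipL) dotE.
  under eq_bigr => j _ do rewrite mxE mulr_suml.
  rewrite exchange_big; apply: eq_bigr => i _ /=.
  rewrite bsumr (ip_suml ipL); apply: eq_bigr => j _.
  have -> : br ((x ord0 i *: delta_mx ord0 i) *m P) ((y ord0 j *: delta_mx ord0 j) *m P) =
      (x ord0 i * y ord0 j) *: br (delta_mx ord0 i *m P) (delta_mx ord0 j *m P).
    by rewrite -!scalemxAl brZ bracketZl scalerA mulrC.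
  by rewrite (ipZl ipL) mxE mulrAC.
pose bop w x := x *m K *m B w *m P.
have bopE x y w : ip (bop w x) y = ip (br x y) w.
  by rewrite ipE /bop -mulmxA PK mulmx1 BE -!mulmxA KP !mulmx1.
have ip_sub0 b u v : ip (u - v) b = 0 -> ip b u = ip b v.
  by rewrite (ipBl ipL) (ipC u) (ipC v) => /eqP; rewrite subr_eq0 => /eqP.
have cen0 : lie_center N 0 by move=> x; exact: bracket0l.
have split_cen x : exists2 z, lie_center N z & center_orth g (x - z).
  exact: (orth_projection ipC ipL ip0 cen0 (@center_linear _ _ N)).
have brcen x y : lie_center N (br x y).
  by move=> w; rewrite bracketC N2 oppr0.
have oB w x : center_orth g (bop w x).
  move=> z cz; rewrite bopE; have -> : br x z = 0 by rewrite bracketC cz oppr0.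
  exact: (ip0l ipL).
have bop_eq w x v : (forall y, ip v y = ip (br x y) w) -> bop w x = v.
  move=> H; apply/eqP; rewrite -subr_eq0; apply/eqP; apply: ip0.
  by rewrite (ipBl ipL) bopE H subrr.
have bopJ w z x c : lie_center N z -> center_orth g (w - z) -> lie_center N c -> center_orth g (x - c) ->
    bop w x = J_map g z (x - c).
  move=> cz oz cc oc; apply: esym; apply: J_mapE; first exact: oB.
  move=> y oy; rewrite bopE.
  have -> : br (x - c) y = br x y by rewrite bracketDl bracketNl cc subr0.
  exact: (ip_sub0 _ _ _ (oz _ (brcen x y))).
have bopC w w' x : bop w (bop w' x) = bop w' (bop w x).
  have [z cz oz] := split_cen w; have [z' cz' oz'] := split_cen w'; have [c cc oc] := split_cen x.
  have o0 v y : center_orth g (bop v y - 0) by rewrite subr0.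
  rewrite (bopJ w' z' x c) // (bopJ w z x c) //.
  have J0 v y : center_orth g (J_map g v y) -> center_orth g (J_map g v y - 0) by rewrite subr0.
  have oJ1 : center_orth g (J_map g z' (x - c)) by rewrite -(bopJ w' z' x c).
  have oJ2 : center_orth g (J_map g z (x - c)) by rewrite -(bopJ w z x c).
  rewrite (bopJ w z _ 0) ?subr0 // (bopJ w' z' _ 0) ?subr0 //.
  by apply/eqP; rewrite -subr_eq0; apply/eqP; exact: Jab.
pose A (k : 'I_n) := B (delta_mx ord0 k *m P).
have Bsk w : (B w)^T = - B w.
  apply/matrixP => i j; rewrite !mxE; have -> : br (delta_mx ord0 j *m P) (delta_mx ord0 i *m P) = - br (delta_mx ord0 i *m P) (delta_mx ord0 j *m P).
    exact: bracketC.
  exact: (ipNl ipL).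
have Bcm w w' : B w *m B w' = B w' *m B w.
  apply: eq_mx_row => x; have := bopC w' w (x *m P); rewrite /bop.
  rewrite -!(mulmxA _ P K) PK !mulmx1 => /(can_inj (mulmxK uP)).
  by rewrite -!mulmxA.
have Blin w : B w = \sum_k (w *m K) ord0 k *: A k.
  apply: eq_mx_row => x; apply: dot_inj => y; rewrite BE mulmx_sumr dot_suml.
  have {1}-> : w = \sum_k (w *m K) ord0 k *: (delta_mx ord0 k *m P).
    rewrite -[LHS](mulmxKV uP) -{1}[w *m K](sum_delta (w *m K)) mulmx_suml.
    by apply: eq_bigr => k _; rewrite scalemxAl.
  rewrite ipC (ip_suml ipL); apply: eq_bigr => k _.
  by rewrite (ipZl ipL) ipC -scalemxAr dotZl BE.
have [d [Q [co [QT QQ Q3 Qc QA]]]] := rotation_decomposition (fun k => Bsk _) (fun k l => Bcm _ _) (A := A).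
have Q3' i : Q i *m Q i *m Q i = - Q i by have [] := Q3 i.
pose Q' i := K *m Q i *m P; pose co' w := \sum_k (w *m K) ord0 k *: co k.
have xQ x i : x *m Q' i *m K = x *m K *m Q i by rewrite /Q' !mulmxA -[_ *m P *m K]mulmxA PK mulmx1.
have BQ w : B w = \sum_i co' w ord0 i *: Q i.
  rewrite Blin; under eq_bigr => k _ do rewrite QA scaler_sumr.
  rewrite exchange_big; apply: eq_bigr => i _ /=.
  rewrite /co' summxE scaler_suml; apply: eq_bigr => k _.
  by rewrite scalerA; congr (_ *: _); rewrite [RHS]mxE.
have conjM (M M' : 'M[R]_n) : (K *m M *m P) *m (K *m M' *m P) = K *m (M *m M') *m P.
  by rewrite !mulmxA -[K *m M *m P *m K]mulmxA PK mulmx1.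
have rsk i x y : ip (x *m Q' i) y = - ip x (y *m Q' i).
  by rewrite !ipE !xQ dot_skew.
have rcen z i : lie_center N z -> z *m Q' i = 0.
  move=> cz; apply: (can_inj (mulmxK uK)); rewrite xQ mul0mx.
  apply: (rotation_sum_kill QQ Q3' Qc QA) => k; apply: dot_inj => y.
  by rewrite BE -mulmxA KP mulmx1 cz dot0l (ip0l ipL).
exists d, Q', co'; split => //.
- by move=> i j ij; rewrite /Q' conjM QQ // mulmx0 mul0mx.
- by move=> i; rewrite /Q' !conjM Q3' mulmxN mulNmx.
- move=> i; have [_ nz] := Q3 i; apply: contra nz => /eqP E.
  have := congr1 (fun M => P *m M *m K) E; rewrite /Q' mulmx0 mul0mx !mulmxA PK mul1mx -mulmxA PK mulmx1.
  by move=> ->.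
- move=> a u v; rewrite /co' scaler_sumr -big_split; apply: eq_bigr => k _ /=.
  by rewrite mulmxDl -scalemxAl !mxE scalerDl scalerA.
- move=> x y w; rewrite -bopE ipE /bop -mulmxA PK mulmx1 BQ mulmx_sumr dot_suml.
  by apply: eq_bigr => i _; rewrite -scalemxAr dotZl ipE xQ.
(* [w] is orthogonal to the centre, hence to all brackets, so the sum of the [co' w ord0 j *: Q j]
   vanishes; multiplication by [Q j *m Q j] extracts each coefficient. *)
- move=> x i; set w := x *m Q' i.
  have ow : center_orth g w by move=> z cz; rewrite rsk rcen // (ip0r ipC ipL) oppr0.
  have B0 : \sum_j co' w ord0 j *: Q j = 0.
    rewrite -BQ; apply: eq_mx_row => y; rewrite mulmx0; apply: dot_inj => y'.
    by rewrite BE dot0l; apply: etrans (ipC _ _) _; exact: (ow _ (brcen _ _)).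
  apply/rowP => j; rewrite [RHS]mxE; have [_ nz] := Q3 j.
  have : (\sum_j co' w ord0 j *: Q j) *m (Q j *m Q j) = 0 by rewrite B0 mul0mx.
  rewrite mulmx_suml (bigD1 j) //= big1 ?addr0; last first.
    by move=> l lj; rewrite -scalemxAl mulmxA QQ // mul0mx scaler0.
  rewrite -scalemxAl mulmxA Q3' scalerN => /eqP.
  by rewrite oppr_eq0 scaler_eq0 (negbTE nz) orbF => /eqP.
Qed.

End rotation_data.

(** * Semidirect products with a torus *)

Section torus.
Context {R : realType} {d : nat}.
Local Notation W := ('rV[R]_d * 'rV[R]_d)%type.
Implicit Types (t s : W) (u : 'rV[R]_d).

(** A torus element is a pair of rows, the cosines and the sines of its angles. Inside a vector
    space it inherits a topology, and no quotient of the angles is formed. *)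
Definition on_torus t := forall i, t.1 ord0 i ^+ 2 + t.2 ord0 i ^+ 2 = 1.

Definition tmul t s : W := (\row_i (t.1 ord0 i * s.1 ord0 i - t.2 ord0 i * s.2 ord0 i),
  \row_i (t.2 ord0 i * s.1 ord0 i + t.1 ord0 i * s.2 ord0 i)).

Definition tone : W := (const_mx 1, 0).
Definition tinv t : W := (t.1, - t.2).

Lemma pair_rowP t s : (forall i, t.1 ord0 i = s.1 ord0 i) -> (forall i, t.2 ord0 i = s.2 ord0 i) -> t = s.
Proof. by case: t s => [a b] [a' b'] /= h1 h2; congr pair; apply/rowP. Qed.

Lemma tmulA : associative tmul.
Proof. by move=> t s r; apply: pair_rowP => i; rewrite !mxE; ring. Qed.

Lemma tmul1 t : tmul tone t = t.
Proof. by apply: pair_rowP => i; rewrite !mxE; ring. Qed.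

Lemma tmulr1 t : tmul t tone = t.
Proof. by apply: pair_rowP => i; rewrite !mxE; ring. Qed.

Lemma tmulV t : on_torus t -> tmul t (tinv t) = tone.
Proof. by move=> ht; apply: pair_rowP => i; rewrite !mxE; [rewrite -(ht i)|]; ring. Qed.

Lemma tmulVt t : on_torus t -> tmul (tinv t) t = tone.
Proof. by move=> ht; apply: pair_rowP => i; rewrite !mxE; [rewrite -(ht i)|]; ring. Qed.

Lemma on_torusM t s : on_torus t -> on_torus s -> on_torus (tmul t s).
Proof.
move=> ht hs i; rewrite !mxE -[RHS]mulr1 -{1}(ht i) -(hs i).
by move: (t.1 _ _) (t.2 _ _) (s.1 _ _) (s.2 _ _) => *; ring.
Qed.

Lemma on_torusV t : on_torus t -> on_torus (tinv t).
Proof. by move=> ht i; rewrite !mxE sqrrN ht. Qed.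

Lemma on_torus1 : on_torus tone.
Proof. by move=> i; rewrite !mxE expr1n expr0n addr0. Qed.

(* Stereographic parametrisation of the circles, [tan (theta / 2)] being the parameter. *)
Definition cay u : W := (\row_i ((1 - u ord0 i ^+ 2) / (1 + u ord0 i ^+ 2)), \row_i (2 * u ord0 i / (1 + u ord0 i ^+ 2))).
Definition ucoord t : 'rV[R]_d := \row_i (t.2 ord0 i / (1 + t.1 ord0 i)).

Lemma cay_den (a : R) : 1 + a ^+ 2 != 0.
Proof. by rewrite gt_eqF // ltr_pwDl // sqr_ge0. Qed.

Lemma cay_torus u : on_torus (cay u).
Proof. by move=> i; rewrite !mxE; have := cay_den (u ord0 i); move: (u _ _) => a h; field. Qed.

Lemma cay_dom u i : 1 + (cay u).1 ord0 i != 0.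
Proof.
rewrite mxE; have h := cay_den (u ord0 i); move: (u _ _) h => a h.
have -> : 1 + (1 - a ^+ 2) / (1 + a ^+ 2) = 2 / (1 + a ^+ 2) by field.
by rewrite mulf_neq0 ?invr_eq0 ?pnatr_eq0.
Qed.

Lemma ucoordK t : on_torus t -> (forall i, 1 + t.1 ord0 i != 0) -> cay (ucoord t) = t.
Proof.
move=> ht dt; apply: pair_rowP => i; rewrite !mxE; have := ht i; have := dt i;
  move: (t.1 _ _) (t.2 _ _) => a b h E; have E' : b ^+ 2 = 1 - a ^+ 2 by rewrite -E addrC addKr.
- have D : 1 + (b / (1 + a)) ^+ 2 = 2 / (1 + a) by rewrite expr_div_n E'; field.
  have D' : 1 - (b / (1 + a)) ^+ 2 = 2 * a / (1 + a) by rewrite expr_div_n E'; field.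
  by rewrite D D'; field; rewrite h.
- have D : 1 + (b / (1 + a)) ^+ 2 = 2 / (1 + a) by rewrite expr_div_n E'; field.
  by rewrite D; field; rewrite h.
Qed.

Lemma cayK u : ucoord (cay u) = u.
Proof.
apply/rowP => i; have h2 := cay_dom u i; rewrite !mxE in h2 *.
have := cay_den (u ord0 i); move: (u _ _) h2 => a h2 h.
have -> : 1 + (1 - a ^+ 2) / (1 + a ^+ 2) = 2 / (1 + a ^+ 2) by field.
by field; rewrite h.
Qed.

Context {V : normedModType R}.
Implicit Types (f h : V -> W) (x : V).

Lemma smooth_at_coor1 f x i : smooth_at f x -> smooth_at (fun y => (f y).1 ord0 i : R^o) x.
Proof.
move=> sf; have l : linear (fun w : W => w.1 ord0 i : R^o) by move=> a w w'; rewrite !mxE.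
exact: (smooth_at_lin (mklin l) sf).
Qed.

Lemma smooth_at_coor2 f x i : smooth_at f x -> smooth_at (fun y => (f y).2 ord0 i : R^o) x.
Proof.
move=> sf; have l : linear (fun w : W => w.2 ord0 i : R^o) by move=> a w w'; rewrite !mxE.
exact: (smooth_at_lin (mklin l) sf).
Qed.

Lemma smooth_at_row m (f : 'I_m -> V -> R^o) x : (forall i, smooth_at (f i) x) -> smooth_at (fun y => \row_i f i y) x.
Proof.
move=> sf; apply/smooth_at_rowP => i; apply: smooth_at_ext (sf i).
by apply: filterE => y; rewrite mxE.
Qed.

Lemma smooth_tmul f h x : smooth_at f x -> smooth_at h x -> smooth_at (fun y => tmul (f y) (h y)) x.
Proof.
move=> sf sh; apply: smooth_at_pair; apply: smooth_at_row => i.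
  by apply: smooth_atB; apply: smooth_atM; try exact: smooth_at_coor1; exact: smooth_at_coor2.
by apply: smooth_atD; apply: smooth_atM; try exact: smooth_at_coor1; exact: smooth_at_coor2.
Qed.

Lemma smooth_tinv f x : smooth_at f x -> smooth_at (fun y => tinv (f y)) x.
Proof.
move=> sf; have l : linear tinv by move=> a w w'; rewrite /tinv; congr pair; rewrite /= opprD scalerN.
exact: (smooth_at_lin (mklin l) sf).
Qed.

Lemma smooth_cay (f : V -> 'rV[R]_d) x : smooth_at f x -> smooth_at (fun y => cay (f y)) x.
Proof.
move=> sf; have si i : smooth_at (fun y => f y ord0 i : R^o) x by apply: (smooth_at_rowP _ _).1.
have sq i : smooth_at (fun y => f y ord0 i ^+ 2 : R^o) x by apply: smooth_atM.
have sd i : smooth_at (fun y => 1 + f y ord0 i ^+ 2 : R^o) x by apply: smooth_atD => //; exact: smooth_at_cst.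
have sv i : smooth_at (fun y => (1 + f y ord0 i ^+ 2)^-1 : R^o) x by apply: smooth_at_inv => //; exact: cay_den.
apply: smooth_at_pair; apply: smooth_at_row => i; apply: smooth_atM => //.
  by apply: smooth_atB => //; exact: smooth_at_cst.
by apply: smooth_atM => //; exact: smooth_at_cst.
Qed.

Lemma smooth_ucoord f x : smooth_at f x -> (forall i, 1 + (f x).1 ord0 i != 0) -> smooth_at (fun y => ucoord (f y)) x.
Proof.
move=> sf dx; apply: smooth_at_row => i; apply: smooth_atM; first exact: smooth_at_coor2.
by apply: smooth_at_inv => //; apply: smooth_atD; [exact: smooth_at_cst|exact: smooth_at_coor1].
Qed.

Lemma smooth_at_row_mx n (f : V -> 'rV[R]_n) (h : V -> 'rV[R]_d) x :
  smooth_at f x -> smooth_at h x -> smooth_at (fun y => row_mx (f y) (h y)) x.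
Proof.
move=> sf sh; apply/smooth_at_rowP => j; case: (split_ordP j) => k ->.
  by apply: smooth_at_ext ((smooth_at_rowP _ _).1 sf k); apply: filterE => y; rewrite row_mxEl.
by apply: smooth_at_ext ((smooth_at_rowP _ _).1 sh k); apply: filterE => y; rewrite row_mxEr.
Qed.

Lemma smooth_at_lsubmx n (f : V -> 'rV[R]_(n + d)) x : smooth_at f x -> smooth_at (fun y => lsubmx (f y)) x.
Proof.
move=> sf; have l : linear (fun w : 'rV[R]_(n + d) => lsubmx w) by move=> a w w'; rewrite linearP.
exact: (smooth_at_lin (mklin l) sf).
Qed.

Lemma smooth_at_rsubmx n (f : V -> 'rV[R]_(n + d)) x : smooth_at f x -> smooth_at (fun y => rsubmx (f y)) x.
Proof.
move=> sf; have l : linear (fun w : 'rV[R]_(n + d) => rsubmx w) by move=> a w w'; rewrite linearP.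
exact: (smooth_at_lin (mklin l) sf).
Qed.

Lemma ucoord_dom_near (X : topologicalType) (f : X -> W) (x : X) : {for x, continuous f} ->
  (forall i, 1 + (f x).1 ord0 i != 0) -> \forall y \near x, forall i, 1 + (f y).1 ord0 i != 0.
Proof.
move=> cf dx; apply: (@filter_forall _ _ (fun i y => 1 + (f y).1 ord0 i != 0) (nbhs x)) => i.
have c1 : {for f x, continuous (fun w : W => 1 + w.1 ord0 i : R^o)}.
  apply: smooth_at_cont; have l : linear (fun w : W => w.1 ord0 i : R^o) by move=> a w w'; rewrite !mxE.
  apply: smooth_atD; first exact: smooth_at_cst.
  exact: (smooth_at_lin (mklin l) (smooth_at_id (f x))).
have n1 : \forall w \near f x, 1 + (w : W).1 ord0 i != 0.
  have H : \forall a \near (1 + (f x).1 ord0 i : R^o), a != 0.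
    by apply: open_nbhs_nbhs; split => //; exact: open_neq.
  exact: (c1 _ H).
exact: (cf _ n1).
Qed.

End torus.

Section continuity.

Lemma initial_continuous_at {X : topologicalType} {Y : choiceType} {Z : topologicalType}
  (w : Y -> Z) (f : X -> initial_topology w) (x : X) :
  {for x, continuous (w \o f)} -> {for x, continuous f}.
Proof.
move=> cf U [?/= [[B oB <-]] /= Bx /filterS]; apply; apply: cf.
exact: open_nbhs_nbhs.
Qed.

Lemma continuous_at_pair (X Y Z : topologicalType) (f : X -> Y) (h : X -> Z) (x : X) :
  {for x, continuous f} -> {for x, continuous h} -> {for x, continuous (fun y => (f y, h y))}.
Proof.
move=> cf ch U [[B C] /= [nB nC] H].
have nf : \forall y \near x, B (f y) by exact: (cf _ nB).
have nh : \forall y \near x, C (h y) by exact: (ch _ nC).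
have : \forall y \near x, U (f y, h y) by apply: filterS2 nf nh => y By Cy; exact: H.
by [].
Qed.

Lemma cluster_continuous (X Y : topologicalType) (f : X -> Y) (x y : X) : continuous f ->
  cluster (nbhs x) y -> cluster (nbhs (f x)) (f y).
Proof.
move=> cf cl A B nA nB; have [z [Az Bz]] := cl _ _ (cf x _ nA) (cf y _ nB).
by exists (f z).
Qed.

Lemma row_dense (R : realType) d : exists D : nat -> 'rV[R]_d,
  forall (x : 'rV[R]_d) (e : R), 0 < e -> exists k, `|D k - x| < e.
Proof.
exists (fun k => if unpickle k is Some q then \row_i ratr ((q : {ffun 'I_d -> rat}) i) else 0) => x e e0.
pose C := \sum_(i < d) `|delta_mx ord0 i : 'rV[R]_d| + 1.
have C0 : 0 < C by rewrite ltr_pwDr // sumr_ge0.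
have [q Hq] := choice (fun i : 'I_d => rat_in_itvoo (ltr_pwDr (divr_gt0 e0 C0) (lexx (x ord0 i)))).
exists (pickle [ffun i => q i]); rewrite pickleK.
set y := \row_i _; rewrite -[y - x](sum_delta); apply: le_lt_trans (ler_norm_sum _ _ _) _.
have h i : `|(y - x) ord0 i *: (delta_mx ord0 i : 'rV[R]_d)| <= e / C * `|delta_mx ord0 i : 'rV[R]_d|.
  rewrite normrZ ler_wpM2r //; have := Hq i; rewrite in_itv /= => /andP[h1 h2].
  by rewrite !mxE ffunE ger0_norm; lra.
apply: le_lt_trans (ler_sum _ (fun i _ => h i)) _.
by rewrite -mulr_sumr mulrAC ltr_pdivrMr // ltr_pM2l // /C ltrDl.
Qed.

End continuity.

(** The interface between the rotations and the semidirect product. [tact] is total in [t], so its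
    laws are restricted to the torus, and joint smoothness is stated on plots with values in it. *)
Record torus_action (R : realType) (n d : nat) (N : lieGroupType R n) := TorusAction {
  tact : ('rV[R]_d * 'rV[R]_d) -> N -> N;
  tactM : forall t x y, on_torus t -> tact t (x * y)%g = (tact t x * tact t y)%g;
  tact_comp : forall t s x, on_torus t -> on_torus s -> tact (tmul t s) x = tact t (tact s x);
  tact1 : forall x, tact tone x = x;
  tact_plot : forall (V : normedModType R) (t : V -> 'rV[R]_d * 'rV[R]_d) (f : V -> N) x, smooth_at t x ->
    (\forall y \near x, on_torus (t y)) -> plot_at f x -> plot_at (fun y => tact (t y) (f y)) x
}.

(** [A] is a parameter of the type, though absent from the underlying pair, so that the group law
    can be attached to the type. *)
Record semidirect (R : realType) (n d : nat) (N : lieGroupType R n) (A : torus_action d N) := Semidirect {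
  sval2 : N * ('rV[R]_d * 'rV[R]_d);
  sval2_torus : on_torus sval2.2
}.

Section semidirect.
Context {R : realType} {n d : nat} {N : lieGroupType R n} (A : torus_action d N).
Local Notation W := ('rV[R]_d * 'rV[R]_d)%type.
Local Notation G := (semidirect A).
Local Notation al := (tact A).

HB.instance Definition _ := gen_eqMixin G.
HB.instance Definition _ := gen_choiceMixin G.
HB.instance Definition _ := Topological.copy G (initial_topology (@sval2 _ _ _ _ A)).

Lemma sval2_inj : injective (@sval2 _ _ _ _ A).
Proof. by case=> x hx [y hy] /= E; case: _ / E hy => hy; congr Semidirect; exact: Prop_irrelevance. Qed.

Lemma sval2_continuous : continuous (@sval2 _ _ _ _ A).
Proof. exact: initial_continuous. Qed.

Lemma sN_continuous : continuous (fun x : G => (sval2 x).1).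
Proof. by move=> x; apply: (@continuous_comp _ _ _ (@sval2 _ _ _ _ A) fst); [exact: sval2_continuous|exact: cvg_fst]. Qed.

Lemma sW_continuous : continuous (fun x : G => (sval2 x).2 : W).
Proof. by move=> x; apply: (@continuous_comp _ _ _ (@sval2 _ _ _ _ A) snd); [exact: sval2_continuous|exact: cvg_snd]. Qed.

Lemma into_semidirect (X : topologicalType) (f : X -> G) x :
  {for x, continuous (fun y => (sval2 (f y)).1)} -> {for x, continuous (fun y => (sval2 (f y)).2 : W)} ->
  {for x, continuous f}.
Proof.
move=> c1 c2; apply: (initial_continuous_at (w := @sval2 _ _ _ _ A)).
have E : (fun y => ((sval2 (f y)).1, (sval2 (f y)).2)) = @sval2 _ _ _ _ A \o f.
  by apply/funext => y /=; case: (sval2 (f y)).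
have H : {for x, continuous (fun y => ((sval2 (f y)).1, (sval2 (f y)).2))}.
  exact: (continuous_at_pair c1 c2).
by rewrite E in H.
Qed.

Section chart.
Variables (c : chart R n N) (b : W).
Hypothesis hb : on_torus b.

(** [cay] misses the elements with some cosine equal to [-1]. Translation by [b] moves this gap; the
    chart used at an element takes for [b] its torus component. *)
Definition sdom : set G := [set x | dom c (sval2 x).1 /\ forall i, 1 + (tmul (sval2 x).2 (tinv b)).1 ord0 i != 0].
Definition scod : set 'rV[R]_(n + d) := [set y | cod c (lsubmx y)].
Definition scoord (x : G) : 'rV[R]_(n + d) := row_mx (coord c (sval2 x).1) (ucoord (tmul (sval2 x).2 (tinv b))).
Definition spoint (y : 'rV[R]_(n + d)) : G :=
  Semidirect A (sval2 := (point c (lsubmx y), tmul (cay (rsubmx y)) b)) (on_torusM (@cay_torus _ _ _) hb).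

Lemma tdiv_continuous (x : G) : {for x, continuous (fun y : G => tmul (sval2 y).2 (tinv b))}.
Proof.
apply: (@continuous_comp _ _ _ (fun y : G => (sval2 y).2) (fun t => tmul t (tinv b))); first exact: sW_continuous.
by apply: smooth_at_cont; apply: smooth_tmul; [exact: smooth_at_id|exact: smooth_at_cst].
Qed.

Lemma sdom_open : open sdom.
Proof.
rewrite openE => x [dx ux]; rewrite /interior.
have n1 : \forall y \near x, dom c (sval2 y).1.
  have H : \forall z \near (sval2 x).1, dom c z := open_nbhs_nbhs (conj (dom_open c) dx).
  exact: (@sN_continuous x _ H).
have n2 := ucoord_dom_near (@tdiv_continuous x) ux.
exact: filterS2 n1 n2.
Qed.

Lemma scod_open : open scod.
Proof.
rewrite openE => y cy; rewrite /interior.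
have s := smooth_at_cont (smooth_at_lsubmx (n := n) (d := d) (smooth_at_id y)).
exact: (near_comp s (cod_near cy)).
Qed.

Lemma scoord_cod x : sdom x -> scod (scoord x).
Proof. by move=> [dx _]; rewrite /scod /scoord /= row_mxKl; exact: coord_cod. Qed.

Lemma tdivK t : tmul (tmul t b) (tinv b) = t.
Proof. by rewrite -tmulA tmulV // tmulr1. Qed.

Lemma tdivVK t : tmul (tmul t (tinv b)) b = t.
Proof. by rewrite -tmulA tmulVt // tmulr1. Qed.

Lemma spoint_dom y : scod y -> sdom (spoint y).
Proof.
move=> cy; split; first exact: point_dom.
have E : tmul (sval2 (spoint y)).2 (tinv b) = cay (rsubmx y) by exact: tdivK.
by move=> i; rewrite E; exact: cay_dom.
Qed.

Lemma scoordK x : sdom x -> spoint (scoord x) = x.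
Proof.
move=> [dx ux]; apply: sval2_inj; rewrite /= row_mxKl row_mxKr coordK //.
rewrite ucoordK ?tdivVK //; first by case: (sval2 x).
by apply: on_torusM; [exact: sval2_torus|exact: on_torusV].
Qed.

Lemma spointK y : scod y -> scoord (spoint y) = y.
Proof. by move=> cy; rewrite /scoord /= pointK // tdivK cayK hsubmxK. Qed.

Lemma smooth_spoint2 (V : normedModType R) (f : V -> 'rV[R]_(n + d)) x : smooth_at f x ->
  smooth_at (fun y => tmul (cay (rsubmx (f y))) b) x.
Proof.
move=> sf; apply: smooth_tmul; last exact: smooth_at_cst.
by apply: smooth_cay; exact: smooth_at_rsubmx.
Qed.

Lemma scoord_continuous x : sdom x -> {for x, continuous scoord}.
Proof.
move=> [dx ux].
have c1 : {for x, continuous (fun y : G => coord c (sval2 y).1)}.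
  by apply: (@continuous_comp _ _ _ (fun y : G => (sval2 y).1) (coord c)); [exact: sN_continuous|exact: coord_continuous].
have c2 : {for x, continuous (fun y : G => ucoord (tmul (sval2 y).2 (tinv b)))}.
  apply: (@continuous_comp _ _ _ (fun y : G => tmul (sval2 y).2 (tinv b)) ucoord); first exact: tdiv_continuous.
  by apply: smooth_at_cont; exact: (smooth_ucoord (smooth_at_id _)).
apply: (@continuous_comp _ _ _ (fun y : G => (coord c (sval2 y).1, ucoord (tmul (sval2 y).2 (tinv b))))
  (fun z : 'rV[R]_n * 'rV[R]_d => row_mx z.1 z.2)); first exact: (continuous_at_pair c1 c2).
apply: smooth_at_cont; apply: smooth_at_row_mx; [exact: smooth_at_fst|exact: smooth_at_snd].
Qed.

Lemma spoint_continuous y : scod y -> {for y, continuous spoint}.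
Proof.
move=> cy; apply: into_semidirect => /=.
  apply: (@continuous_comp _ _ _ (fun y : 'rV[R]_(n + d) => lsubmx y) (point c)); last exact: point_continuous.
  exact: smooth_at_cont (smooth_at_lsubmx (smooth_at_id y)).
exact: smooth_at_cont (smooth_spoint2 (smooth_at_id y)).
Qed.

Definition schart : chart R (n + d) G :=
  Chart sdom_open scod_open scoord_cod spoint_dom scoordK spointK scoord_continuous spoint_continuous.

End chart.

Definition satlas : set (chart R (n + d) G) := [set e | exists c b (hb : on_torus b), atlas c /\ e = schart c hb].
Definition schart_at (x : G) : chart R (n + d) G := schart (chart_at (sval2 x).1) (sval2_torus x).

Lemma schart_at_atlas x : satlas (schart_at x).
Proof. by exists (chart_at (sval2 x).1), (sval2 x).2, (sval2_torus x); split => //; exact: chart_at_atlas. Qed.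

Lemma schart_at_dom x : dom (schart_at x) x.
Proof.
split; first exact: chart_at_dom.
by move=> i; rewrite tmulV ?mxE; [rewrite gt_eqF // addr_gt0|exact: sval2_torus].
Qed.

Lemma satlas_compatible e f : satlas e -> satlas f ->
  smooth_on [set x | cod e x /\ dom f (point e x)] (coord f \o point e).
Proof.
move=> [c [b [hb [ac ->]]]] [c' [b' [hb' [ac' ->]]]].
have oU : open [set x | cod (schart c hb) x /\ dom (schart c' hb') (point (schart c hb) x)] by exact: transition_open.
apply/(smooth_on_at _ oU) => y [cy [dy uy]] /=.
apply: (@smooth_at_row_mx R d _ n (fun y => coord c' (point c (lsubmx y)))
  (fun y => ucoord (tmul (tmul (cay (rsubmx y)) b) (tinv b')))).
  exact: (smooth_at_comp (smooth_at_lsubmx (smooth_at_id y)) (transition_smooth ac ac' cy dy)).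
apply: smooth_ucoord; last exact: uy.
by apply: smooth_tmul; [exact: smooth_spoint2 (smooth_at_id y)|exact: smooth_at_cst].
Qed.

Lemma semidirect_hausdorff : hausdorff_space G.
Proof.
move=> x y cl; apply: sval2_inj; apply: injective_projections.
  by apply: (@manifold_hausdorff _ _ N); exact: (cluster_continuous sN_continuous cl).
by apply: norm_hausdorff; exact: (cluster_continuous sW_continuous cl).
Qed.

Lemma semidirect_second_countable : @second_countable G.
Proof.
have [B cB [oB bB]] := @manifold_second_countable _ _ N.
have [D HD] := row_dense R d.
(* Boxes from the basis of [N], a dense sequence of centres and the radii [1 / (k + 1)]. *)
pose U (p : set N * (nat * nat * nat)) : set G := [set x | [/\ p.1 (sval2 x).1,
  `|D p.2.1.1 - (sval2 x).2.1| < (p.2.2.+1%:R)^-1 & `|D p.2.1.2 - (sval2 x).2.2| < (p.2.2.+1%:R)^-1]].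
have oU p : B p.1 -> open (U p).
  move=> Bp; rewrite openE => x [x1 x2 x3]; rewrite /interior.
  have n1 : \forall y \near x, p.1 (sval2 y).1.
    have H : \forall z \near (sval2 x).1, p.1 z := open_nbhs_nbhs (conj (oB _ Bp) x1).
    exact: (@sN_continuous x _ H).
  have nW (q : W -> 'rV[R]_d) k (r : R) : continuous q -> `|D k - q (sval2 x).2| < r -> \forall y \near x, `|D k - q (sval2 y).2| < r.
    move=> cq h; have H : \forall v \near q (sval2 x).2, `|D k - v| < r.
      have := open_nbhs_nbhs (conj (@open_norm_lt _ _ (D k) r) (_ : `|q (sval2 x).2 - D k| < r)); rewrite distrC => /(_ h).
      by apply: filterS => v /=; rewrite distrC.
    have H' : \forall w \near (sval2 x).2, `|D k - q w| < r by exact: (cq _ _ H).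
    exact: (@sW_continuous x _ H').
  by apply: filterS3 n1 (nW fst _ _ _ x2) (nW snd _ _ _ x3) => [y||] //; move=> z; [exact: cvg_fst|exact: cvg_snd].
exists (U @` [set p | B p.1]).
  apply: sub_countable (card_image_le _ _) _.
  have -> : [set p : set N * (nat * nat * nat) | B p.1] = B `*` setT by apply/seteqP; split => p //= [].
  by apply: countableX => //; exact: countableP.
split; first by move=> _ [p Bp <-]; exact: oU.
move=> x Q [Q1 /= [[Q2 oQ2 <-] /= Q2x] Q1Q].
have [[A1 A2] /= [nA1 nA2] HA] : nbhs (sval2 x) Q2 by exact: open_nbhs_nbhs.
have [B1 [BB1 B1x] B1A] := bB _ _ nA1.
have /near_pairP[r r0 Hr] : \forall w \near (((sval2 x).2.1, (sval2 x).2.2) : W), A2 w.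
  by have -> : ((sval2 x).2.1, (sval2 x).2.2) = (sval2 x).2 by case: (sval2 x).2.
have [k hk] : exists k : nat, (k.+1%:R)^-1 < r / 2.
  exists (Num.bound (r / 2)^-1); rewrite -[ltRHS]invrK ltf_pV2 ?posrE ?invr_gt0 ?divr_gt0 // ?ltr0n //.
  apply: lt_trans (archi_boundP _) _; first by rewrite invr_ge0 divr_ge0 ?ltW.
  by rewrite ltr_nat.
have k0 : 0 < (k.+1%:R : R)^-1 by rewrite invr_gt0 ltr0n.
have h2 : (k.+1%:R : R)^-1 + (k.+1%:R)^-1 < r by move: hk; move: (_^-1) => e; lra.
have [i hi] := HD (sval2 x).2.1 _ k0; have [j hj] := HD (sval2 x).2.2 _ k0.
exists (U (B1, ((i, j), k))); first by split; [exists (B1, ((i, j), k))|split].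
move=> y [/= y1 y2 y3]; apply: Q1Q => /=; apply: HA; split => /=; first exact: B1A.
have -> : (sval2 y).2 = ((sval2 y).2.1, (sval2 y).2.2) by case: (sval2 y).2.
apply: Hr.
  apply: le_lt_trans (ler_distD (D i) _ _) _; rewrite (distrC _ (D i)).
  exact: lt_trans (ltrD y2 hi) h2.
apply: le_lt_trans (ler_distD (D j) _ _) _; rewrite (distrC _ (D j)).
exact: lt_trans (ltrD y3 hj) h2.
Qed.

HB.instance Definition _ := Topological_isManifold.Build R (n + d)%N G
  schart_at_atlas schart_at_dom satlas_compatible semidirect_hausdorff semidirect_second_countable.

End semidirect.

Section semidirect_group.
Context {R : realType} {n d : nat} {N : lieGroupType R n} (A : torus_action d N).
Local Notation W := ('rV[R]_d * 'rV[R]_d)%type.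
Local Notation G := (semidirect A).
Local Notation al := (tact A).

(** Reduces each smoothness check on the semidirect product to one in [N] and one in the vector
    space containing the torus. *)
Lemma plot_semidirect (V : normedModType R) (f : V -> G) x :
  plot_at f x <-> plot_at (fun y => (sval2 (f y)).1) x /\ smooth_at (fun y => (sval2 (f y)).2 : W) x.
Proof.
split=> [pf|[pN sW]].
  pose c := chart_at (f x).
  have dc : dom c (f x) by exact: chart_at_dom.
  have nd := dom_near (plot_at_cont pf) dc.
  have sc : smooth_at (fun y => coord c (f y)) x by apply: plot_at_coord => //; exact: chart_at_atlas.
  have nE : \forall y \near x, point c (coord c (f y)) = f y by apply: filterS nd => y dy; exact: coordK.
  split.
    pose c0 := chart_at (sval2 (f x)).1.
    apply: (@plot_at_ext _ _ _ _ (fun y => point c0 (lsubmx (coord c (f y))))).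
      by apply: filterS nE => y E; rewrite -[in RHS]E.
    apply: (plot_at_comp (smooth_at_lsubmx sc)); apply: plot_at_point; first exact: chart_at_atlas.
    exact: (scoord_cod dc).
  apply: (@smooth_at_ext _ _ _ (fun y => tmul (cay (rsubmx (coord c (f y)))) (sval2 (f x)).2 : W)).
    by apply: filterS nE => y E; rewrite -[in RHS]E.
  exact: smooth_spoint2.
have ca : atlas (chart_at (f x)) by exact: chart_at_atlas.
apply: (plot_atI ca (chart_at_dom _)).
  apply: filterS2 (plot_at_near pN) (smooth_at_near sW) => y py sy.
  by apply: into_semidirect; [exact: plot_at_cont|exact: smooth_at_cont].
apply: (@smooth_at_row_mx R d V n (fun y => coord (chart_at (sval2 (f x)).1) (sval2 (f y)).1)
  (fun y => ucoord (tmul (sval2 (f y)).2 (tinv (sval2 (f x)).2)))).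
  by apply: plot_at_coord => //; [exact: chart_at_atlas|exact: chart_at_dom].
apply: smooth_ucoord; first by apply: smooth_tmul => //; exact: smooth_at_cst.
by have [_ h] := schart_at_dom (f x).
Qed.

Lemma tact_1 t : on_torus t -> al t 1%g = 1%g.
Proof. by move=> ht; have := tactM A 1%g 1%g ht; rewrite mulg1 -{1}[al t 1%g]mulg1 => /mulgI <-. Qed.

Lemma tactV t x : on_torus t -> al t x^-1%g = (al t x)^-1%g.
Proof.
move=> ht; have := tactM A x^-1%g x ht; rewrite mulVg tact_1 // => E.
by rewrite -[RHS]mul1g E mulgK.
Qed.

Lemma tactK t x : on_torus t -> al t (al (tinv t) x) = x.
Proof. by move=> ht; rewrite -tact_comp ?tmulV ?tact1 //; exact: on_torusV. Qed.

Definition smul (x y : G) : G := Semidirect A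
  (sval2 := ((sval2 x).1 * al (sval2 x).2 (sval2 y).1, tmul (sval2 x).2 (sval2 y).2)%g)
  (on_torusM (sval2_torus x) (sval2_torus y)).
Definition sone : G := Semidirect A (sval2 := (1%g, tone)) on_torus1.
Definition sinv (x : G) : G := Semidirect A (sval2 := (al (tinv (sval2 x).2) (sval2 x).1^-1, tinv (sval2 x).2)%g)
  (on_torusV (sval2_torus x)).

Lemma sval2_eq (x y : G) : (sval2 x).1 = (sval2 y).1 -> (sval2 x).2 = (sval2 y).2 -> x = y.
Proof. by move=> h1 h2; apply: sval2_inj; exact: injective_projections. Qed.

Lemma smulA : associative smul.
Proof.
move=> x y z; have hx := sval2_torus x; have hy := sval2_torus y.
apply: sval2_eq; rewrite /= ?tmulA // tactM // tact_comp // mulgA //.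
Qed.

Lemma smul1 : left_id sone smul.
Proof. by move=> x; apply: sval2_eq; rewrite /= ?tmul1 // tact1 mul1g. Qed.

Lemma smulr1 : right_id sone smul.
Proof. by move=> x; apply: sval2_eq; rewrite /= ?tmulr1 // tact_1 ?mulg1 //; exact: sval2_torus. Qed.

Lemma smulV : left_inverse sone sinv smul.
Proof.
move=> x; have hx := sval2_torus x; have hv := on_torusV hx.
by apply: sval2_eq; rewrite /= ?tmulVt // -tactM // mulVg tact_1.
Qed.

Lemma smulrV : right_inverse sone sinv smul.
Proof.
by move=> x; have hx := sval2_torus x; apply: sval2_eq; rewrite /= ?tmulV // tactK // mulgV.
Qed.

HB.instance Definition _ := isGroup.Build G smulA smul1 smulr1 smulV smulrV.

Lemma plot_tact_near (V : normedModType R) (f : V -> G) (h : V -> N) x : plot_at f x -> plot_at h x ->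
  plot_at (fun y => al (sval2 (f y)).2 (h y)) x.
Proof.
move=> /plot_semidirect[_ sW] ph; apply: (tact_plot A sW) => //.
by apply: filterE => y; exact: sval2_torus.
Qed.

Lemma smul_smooth : smooth2 (fun x y : G => (x * y)%g).
Proof.
apply: plots_smooth2 => c e z ac ae cz ez.
have p1 : plot_at (fun y : 'rV[R]_(n + d) * 'rV[R]_(n + d) => point c y.1) z.
  by apply: (plot_at_comp (smooth_at_fst z)); exact: plot_at_point.
have p2 : plot_at (fun y : 'rV[R]_(n + d) * 'rV[R]_(n + d) => point e y.2) z.
  by apply: (plot_at_comp (smooth_at_snd z)); exact: plot_at_point.
have [q1 s1] := (plot_semidirect _ _).1 p1; have [q2 s2] := (plot_semidirect _ _).1 p2.
apply/plot_semidirect; split; last exact: smooth_tmul.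
by apply: plot_mul => //; exact: plot_tact_near.
Qed.

Lemma sinv_smooth : smooth (fun x : G => (x^-1)%g).
Proof.
apply: plots_smooth => c z ac cz.
have p1 : plot_at (point c) z by exact: plot_at_point.
have [q1 s1] := (plot_semidirect _ _).1 p1.
apply/plot_semidirect; split; last exact: smooth_tinv.
apply: (tact_plot A (smooth_tinv s1)); last exact: plot_inv.
by apply: filterE => y; apply: on_torusV; exact: sval2_torus.
Qed.

HB.instance Definition _ := isLieGroup.Build R (n + d)%N G smul_smooth sinv_smooth.

Definition sact (x : G) (y : N) : N := ((sval2 x).1 * al (sval2 x).2 y)%g.

Lemma sact_1 y : sact 1%g y = y.
Proof. by rewrite /sact /= tact1 mul1g. Qed.

Lemma sact_M a b y : sact (a * b)%g y = sact a (sact b y).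
Proof.
have ha := sval2_torus a; have hb := sval2_torus b.
by rewrite /sact /= tactM // tact_comp // mulgA.
Qed.

Lemma plot_sact (V : normedModType R) (f : V -> G) (h : V -> N) x : plot_at f x -> plot_at h x ->
  plot_at (fun y => sact (f y) (h y)) x.
Proof.
move=> pf ph; have [q1 s1] := (plot_semidirect _ _).1 pf.
by apply: plot_mul => //; exact: plot_tact_near.
Qed.

Lemma sact_smooth : smooth2 sact.
Proof.
apply: plots_smooth2 => c e z ac ae cz ez; apply: plot_sact.
  by apply: (plot_at_comp (smooth_at_fst z)); exact: plot_at_point.
by apply: (plot_at_comp (smooth_at_snd z)); exact: plot_at_point.
Qed.

Lemma sact_transitive x y : exists a, sact a x = y.
Proof.
exists (Semidirect A (sval2 := (y * x^-1, tone)%g) on_torus1).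
by rewrite /sact /= tact1 mulgVK.
Qed.

Lemma tinv1 : tinv tone = tone :> W.
Proof. by apply: pair_rowP => i; rewrite !mxE ?oppr0. Qed.

Lemma cay0 : cay 0 = tone :> W.
Proof. by apply: pair_rowP => i; rewrite !mxE expr0n /= ?mulr0 ?mul0r ?subr0 ?addr0 ?divr1. Qed.

Lemma ucoord1 : ucoord tone = 0 :> 'rV[R]_d.
Proof. by apply/rowP => i; rewrite !mxE mul0r. Qed.

Lemma lpt_semidirect z : sval2 (lpt (G : lieGroupType R (n + d)) z) = (lpt N (lsubmx z), cay (rsubmx z)).
Proof. by rewrite /= tmulr1. Qed.

Lemma lco_semidirect x : lco (G : lieGroupType R (n + d)) x = row_mx (lco N (sval2 x).1) (ucoord (sval2 x).2).
Proof. by rewrite -[in RHS](tmulr1 (sval2 x).2) -tinv1. Qed.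

Lemma le0_semidirect : le0 (G : lieGroupType R (n + d)) = row_mx (le0 N) 0.
Proof. by rewrite lco_semidirect /= ucoord1. Qed.

End semidirect_group.

(** * The homogeneous presentations *)

Lemma ip_inj (R : realType) n (ip : 'rV[R]_n -> 'rV[R]_n -> R) :
  (forall a u v w, ip (a *: u + v) w = a * ip u w + ip v w) -> (forall u, ip u u = 0 -> u = 0) ->
  forall u v, (forall w, ip u w = ip v w) -> u = v.
Proof.
move=> ipL ip0 u v E; apply/eqP; rewrite -subr_eq0; apply/eqP; apply: ip0.
by rewrite (ipBl ipL) E subrr.
Qed.

Section tau.
Context {R : realType} {n d : nat} {N : lieGroupType R n} {g : riemannian N}.
Variables (Q : 'I_d -> 'M[R]_n) (co : 'rV[R]_n -> 'rV[R]_d).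
Hypothesis rd : rotation_data g Q co.
Hypothesis N2 : at_most_two_step N.
Local Notation W := ('rV[R]_d * 'rV[R]_d)%type.
Local Notation br := (lie_bracket N).
Local Notation ip := (inner g (1%g : N)).
Implicit Types (t s : W).

(** As the cube of [Q i] is [- Q i], the exponential of [theta Q i] is [1 + sin theta Q i + (1 - cos
    theta) Q i ^ 2]. [rot t i] is this minus the identity, and [tau t] is the product of the
    exponentials since distinct [Q i] annihilate each other. *)
Definition rot t i : 'M[R]_n := (1 - t.1 ord0 i) *: (Q i *m Q i) + t.2 ord0 i *: Q i.
Definition tau t : 'M[R]_n := 1%:M + \sum_i rot t i.

Let ipC u v : ip u v = ip v u. Proof. exact: innerC. Qed.
Let ipL a u v w : ip (a *: u + v) w = a * ip u w + ip v w. Proof. exact: innerDZl. Qed.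
Let ip0 u : ip u u = 0 -> u = 0. Proof. exact: inner_eq0. Qed.

Lemma rot_rot0 t s i j : i != j -> rot t i *m rot s j = 0.
Proof.
move=> ij; have QQ := rot_orth rd ij.
rewrite /rot mulmxDl !mulmxDr -!scalemxAl -!scalemxAr !mulmxA -(mulmxA _ (Q i) (Q j)) QQ.
by rewrite !(mulmx0, mul0mx, scaler0, addr0).
Qed.

Lemma rotM t s i : rot t i + rot s i + rot t i *m rot s i = rot (tmul t s) i.
Proof.
have Q3 := rot_cube rd i; rewrite /rot mulmxDl !mulmxDr -!scalemxAl -!scalemxAr !mulmxA Q3 !mulNmx.
rewrite !mxE; move: (Q i *m Q i) (Q i) => A B; apply/matrixP => k l; rewrite !mxE.
by move: (t.1 _ _) (t.2 _ _) (s.1 _ _) (s.2 _ _) (A k l) (B k l) => *; ring.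
Qed.

Lemma tauM t s : tau (tmul t s) = tau t *m tau s.
Proof.
have H1 : \sum_i rot (tmul t s) i = \sum_i rot t i + \sum_i rot s i + \sum_i rot t i *m rot s i.
  by rewrite -!big_split; apply: eq_bigr => i _; exact: esym (rotM t s i).
have H2 : (\sum_i rot t i) *m (\sum_i rot s i) = \sum_i rot t i *m rot s i.
  rewrite mulmx_suml; apply: eq_bigr => i _; rewrite mulmx_sumr (bigD1 i) //= big1 ?addr0 // => j ji.
  by rewrite rot_rot0 // eq_sym.
rewrite /tau mulmxDl mul1mx mulmxDr mulmx1 H1 H2.
by move: (\sum_i _) (\sum_i _) (\sum_i _) => a b c; apply/matrixP => i j; rewrite !mxE; ring.
Qed.

Lemma tau1 : tau tone = 1%:M.
Proof. by rewrite /tau big1 ?addr0 // => i _; rewrite /rot !mxE subrr !scale0r addr0. Qed.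

Lemma tauK t : on_torus t -> tau t *m tau (tinv t) = 1%:M.
Proof. by move=> ht; rewrite -tauM tmulV // tau1. Qed.

Lemma tau_rot t i : tau t *m Q i = Q i *m tau t.
Proof.
rewrite /tau mulmxDl mulmxDr mul1mx mulmx1; congr (_ + _); rewrite mulmx_suml mulmx_sumr.
apply: eq_bigr => j _; rewrite /rot mulmxDl mulmxDr -!scalemxAl -!scalemxAr mulmxA.
have [->//|ij] := eqVneq i j; have Q1 := rot_orth rd ij; have Q2 := rot_orth rd (_ : j != i); rewrite eq_sym in Q2.
by rewrite -mulmxA Q2 // Q1 !(mulmx0, mulmxA, Q1, mul0mx, scaler0).
Qed.

Lemma tau_adj t (x y : 'rV[R]_n) : ip (x *m tau t) y = ip x (y *m tau (tinv t)).
Proof.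
rewrite /tau !mulmxDr !mulmx1 (ipDl ipL) (ipDr ipC ipL); congr (_ + _).
rewrite !mulmx_sumr (ip_suml ipL) [RHS]ipC (ip_suml ipL); apply: eq_bigr => i _.
rewrite [RHS]ipC /rot !mulmxDr -!scalemxAr (ipDl ipL) (ipDr ipC ipL) !(ipZl ipL) !(ipZr ipC ipL) !mulmxA.
by rewrite !(rot_skew rd) opprK mxE mulrN mulNr.
Qed.

Lemma tau_orth t (x y : 'rV[R]_n) : on_torus t -> ip (x *m tau t) (y *m tau t) = ip x y.
Proof. by move=> ht; rewrite tau_adj -mulmxA tauK // mulmx1. Qed.

(** [tau t] is orthogonal and commutes with every [Q i], so it preserves the forms that determine
    the bracket. As brackets are central and [tau t] fixes the centre, [tau t] is an
    automorphism. *)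
Lemma tau_bracket t (x y : 'rV[R]_n) : on_torus t -> br (x *m tau t) (y *m tau t) = br x y.
Proof.
move=> ht; apply: (ip_inj ipL ip0) => z.
apply: etrans (rot_bracket rd _ _ _) _; apply: etrans (esym (rot_bracket rd _ _ _)).
by apply: eq_bigr => i _; rewrite -mulmxA tau_rot mulmxA tau_orth.
Qed.

Lemma tau_center t (z : 'rV[R]_n) : lie_center N z -> z *m tau t = z.
Proof.
move=> cz; rewrite /tau mulmxDr mulmx1 mulmx_sumr big1 ?addr0 // => i _.
by rewrite /rot mulmxDr -!scalemxAr mulmxA (rot_cen rd i cz) mul0mx !scaler0 addr0.
Qed.

Lemma tau_star t (x y : 'rV[R]_n) : on_torus t -> star N (x *m tau t) (y *m tau t) = star N x y *m tau t.
Proof.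
move=> ht; have cb : lie_center N (br x y) by move=> w; rewrite bracketC N2 oppr0.
rewrite /star; have -> := tau_bracket x y ht.
rewrite -{1}(tau_center t cb); move: (br x y) => b.
by rewrite !mulmxDl -scalemxAl.
Qed.

Lemma co_tau t (x : 'rV[R]_n) : co (x *m tau t) = co x.
Proof.
have cl := co_linear rd; have l0 := linear0 (mklin cl); have lD := linearD (mklin cl); have lZ := linearZ_LR (mklin cl).
rewrite /= in l0 lD lZ.
rewrite /tau mulmxDr mulmx1 lD -[RHS]addr0; congr (_ + _); rewrite mulmx_sumr.
have -> : co (\sum_i x *m rot t i) = \sum_i co (x *m rot t i) by exact: (linear_sum (mklin cl)).
by rewrite big1 // => i _; rewrite /rot mulmxDr -!scalemxAr lD !lZ mulmxA !(co_rot rd) !scaler0 addr0.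
Qed.

(** Faithfulness, for the action to be effective. Multiplication by [Q i *m Q i] isolates the
    relation [H]; combined with its product by [Q i] it gives [((1 - cos)^2 + sin^2) Q i = 0]. *)
Lemma tau_eq1 t : on_torus t -> tau t = 1%:M -> t = tone.
Proof.
move=> ht E.
have H i : (1 - t.1 ord0 i) *: (Q i *m Q i) + t.2 ord0 i *: Q i = 0.
  have E0 : \sum_i rot t i = 0 by have := E; rewrite /tau -[RHS]addr0 => /addrI.
  have E1 : (\sum_j rot t j) *m (Q i *m Q i) = - rot t i.
    rewrite mulmx_suml (bigD1 i) //= big1 ?addr0; last first.
      move=> j ji; have QQ := rot_orth rd ji; rewrite /rot mulmxDl -!scalemxAl !mulmxA -(mulmxA _ (Q j) (Q i)) QQ.
      by rewrite !(mulmx0, mul0mx, scaler0, addr0).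
    have Q3 := rot_cube rd i; rewrite /rot mulmxDl -!scalemxAl !mulmxA Q3 mulNmx.
    by rewrite !scalerN opprD.
  by have := E1; rewrite E0 mul0mx => /esym/eqP; rewrite oppr_eq0 => /eqP.
have H2 i : (1 - t.1 ord0 i) *: Q i = t.2 ord0 i *: (Q i *m Q i).
  have := congr1 (mulmx^~ (Q i)) (H i); rewrite mulmxDl mul0mx -!scalemxAl (rot_cube rd) scalerN => /eqP.
  by rewrite addrC subr_eq0 => /eqP.
have H3 i : ((1 - t.1 ord0 i) ^+ 2 + t.2 ord0 i ^+ 2) = 0.
  have : ((1 - t.1 ord0 i) ^+ 2 + t.2 ord0 i ^+ 2) *: Q i = 0.
    rewrite scalerDl !expr2 -!scalerA H2 !scalerA [t.2 _ _ * (_ : R)]mulrC.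
    have := congr1 ( *:%R (t.2 ord0 i)) (H i); rewrite scalerDr scaler0 !scalerA => h.
    by rewrite [(1 - _) * _]mulrC h.
  by move/eqP; rewrite scaler_eq0 (negbTE (rot_neq0 rd i)) orbF => /eqP.
apply: pair_rowP => i; rewrite !mxE; have := H3 i => /eqP; rewrite paddr_eq0 ?sqr_ge0 // !sqrf_eq0.
  by rewrite subr_eq0 => /andP[/eqP <-].
by move=> /andP[_ /eqP].
Qed.

Lemma smooth_tau (V : normedModType R) (f : V -> 'rV[R]_n) (t : V -> W) v : smooth_at f v -> smooth_at t v ->
  smooth_at (fun y => f y *m tau (t y)) v.
Proof.
move=> sf st; apply: (@smooth_at_ext _ _ _ (fun y => f y + \sum_i
  ((1 - (t y).1 ord0 i) *: (f y *m (Q i *m Q i)) + (t y).2 ord0 i *: (f y *m Q i)))).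
  apply: filterE => y; rewrite /tau mulmxDr mulmx1 mulmx_sumr; congr (_ + _).
  by apply: eq_bigr => i _; rewrite /rot mulmxDr -!scalemxAr.
have l (M : 'M[R]_n) : linear (fun x : 'rV[R]_n => x *m M) by move=> a u u'; rewrite mulmxDl -scalemxAl.
apply: smooth_atD => //; apply: smooth_at_sum => i; apply: smooth_atD.
  apply: (@smooth_atZ _ _ _ (fun y => 1 - (t y).1 ord0 i : R^o)).
    by apply: smooth_atB; [exact: smooth_at_cst|exact: smooth_at_coor1].
  exact: (smooth_at_lin (mklin (l _)) sf).
apply: (@smooth_atZ _ _ _ (fun y => (t y).2 ord0 i : R^o)); first exact: smooth_at_coor2.
exact: (smooth_at_lin (mklin (l _)) sf).
Qed.

Section alpha.
Variables (e : 'rV[R]_n -> N) (L : N -> 'rV[R]_n) (r : R).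
Hypothesis le : local_exp e L r.
Hypothesis N_connected : connected [set: N].
Local Notation E := (gexp le).

Definition alpha t (x : N) : N := E (projT1 (cid (gexp_surj N2 le N_connected x)) *m tau t).

(** [alpha] chooses a logarithm. Two logarithms of one element differ by an element of the kernel of
    [E], which is central by [gexp_kernel] and so fixed by [tau t]: the choice does not matter. *)
Lemma alpha_gexp t X : on_torus t -> alpha t (E X) = E (X *m tau t).
Proof.
move=> ht; rewrite /alpha; case: (cid _) => Y /= EY.
pose K := star N Y (- X).
have EK : E K = 1%g by rewrite (gexp_star N2) gexpN // EY mulgV.
have cK : lie_center N K := gexp_kernel N2 EK.
have YX : br Y X = 0.
  have := cK X; rewrite /K /star !bracketDl bracketNl (bracket_self N X) bracketZl bracketNr bracketNl.
  have -> : br (br Y X) X = 0 by rewrite bracketC N2 oppr0.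
  by rewrite oppr0 scaler0 !addr0.
have KE : K = Y - X by rewrite /K /star bracketNr YX oppr0 scaler0 addr0.
have -> : Y = X + K by rewrite KE addrC subrK.
have b0 : br (X *m tau t) K = 0 by rewrite bracketC cK oppr0.
have -> : (X + K) *m tau t = X *m tau t + K by rewrite mulmxDl (tau_center t cK).
by rewrite (gexp_comm le b0) EK mulg1.
Qed.

Lemma gexp_sur x : exists X, E X = x. Proof. exact: gexp_surj. Qed.

Lemma alphaM t x y : on_torus t -> alpha t (x * y)%g = (alpha t x * alpha t y)%g.
Proof.
move=> ht; have [X <-] := gexp_sur x; have [Y <-] := gexp_sur y.
by rewrite -(gexp_star N2) !alpha_gexp // -(gexp_star N2) tau_star.
Qed.

Lemma alpha_comp t s x : on_torus t -> on_torus s -> alpha (tmul t s) x = alpha t (alpha s x).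
Proof.
move=> ht hs; have [X <-] := gexp_sur x.
rewrite !alpha_gexp //; last exact: on_torusM.
rewrite -mulmxA -tauM; congr (E (X *m tau _)).
(* Matrices acting on rows compose in the opposite order, and the torus is commutative. *)
by apply: pair_rowP => i; rewrite !mxE; ring.
Qed.

Lemma alpha1 x : alpha tone x = x.
Proof. by have [X <-] := gexp_sur x; rewrite alpha_gexp ?tau1 ?mulmx1 //; exact: on_torus1. Qed.

Lemma glog_plot (V : normedModType R) (f : V -> N) v : plot_at f v -> f v = 1%g ->
  smooth_at (fun y => L (f y)) v /\ \forall y \near v, E (L (f y)) = f y.
Proof.
move=> pf f1; split; first exact: (llog_plot le).
have H : \forall x \near f v, E (L x) = x by rewrite f1; exact: glog_near.
exact: (plot_at_cont pf H).
Qed.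

Lemma alpha_plot (V : normedModType R) (t : V -> W) (f : V -> N) v : smooth_at t v ->
  (\forall y \near v, on_torus (t y)) -> plot_at f v -> plot_at (fun y => alpha (t y) (f y)) v.
Proof.
(* The logarithm [L] is smooth only near [1], hence the translation by [f v]. *)
move=> st ht pf; pose h y := ((f v)^-1 * f y)%g.
have ph : plot_at h v by apply: plot_mul => //; exact: plot_at_cst.
have h1 : h v = 1%g by rewrite /h mulVg.
have [sL nL] := glog_plot ph h1; have [X0 EX0] := gexp_sur (f v).
apply: (@plot_at_ext _ _ _ _ (fun y => E (X0 *m tau (t y)) * E (L (h y) *m tau (t y)))%g).
  apply: filterS2 ht nL => y hy Eh; rewrite -!alpha_gexp // -alphaM // Eh EX0 /h.
  by rewrite mulVKg.
apply: plot_mul.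
  have s : smooth_at (fun y => X0 *m tau (t y)) v by apply: smooth_tau => //; exact: smooth_at_cst.
  exact: (plot_at_comp s (plot_gexp le _)).
have s : smooth_at (fun y => L (h y) *m tau (t y)) v by exact: smooth_tau.
exact: (plot_at_comp s (plot_gexp le _)).
Qed.

Lemma evel_alpha (V : normedModType R) t (f : V -> N) v w : on_torus t -> plot_at f v -> f v = 1%g ->
  evel (fun y => alpha t (f y)) v w = evel f v w *m tau t.
Proof.
move=> ht pf f1; have [sL nL] := glog_plot pf f1.
have E0 : L (f v) = 0 by rewrite f1 (llog_1 le).
have l : linear (fun x : 'rV[R]_n => x *m tau t) by move=> a u u'; rewrite mulmxDl -scalemxAl.
have p0 u : u = 0 -> plot_at E u /\ E u = 1%g by move=> ->; split; [exact: plot_gexp|exact: gexp0].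
have D1 : evel f v w = 'D_w (fun y => L (f y)) v.
  have [p e1] := p0 _ E0; rewrite -[RHS](evel_gexp le) -E0 -(evel_comp w sL p e1).
  by apply: evel_ext; apply: filterS nL => y ->.
have sT : smooth_at (fun y => mklin l (L (f y))) v by exact: smooth_at_lin.
have ET : mklin l (L (f v)) = 0 by rewrite E0 linear0.
have [p e1] := p0 _ ET.
have -> : evel (fun y => alpha t (f y)) v w = evel (fun y => E (mklin l (L (f y)))) v w.
  by apply: evel_ext; apply: filterS nL => y {1}<-; rewrite alpha_gexp.
have cl : continuous (mklin l) by exact: fd_linear_continuous.
have [_ e2] := derivable_lin cl (smooth_at_derivable w sL).
by rewrite (evel_comp w sT p e1) ET evel_gexp e2 D1.
Qed.

Definition alpha_action : torus_action d N := TorusAction alphaM alpha_comp alpha1 alpha_plot.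

End alpha.

End tau.

(** Where all coefficients [a i] vanish, the Leibniz rule leaves only their derivatives. *)
Lemma derive_frame (R : realType) (V W : normedModType R) d (c : W) (a : 'I_d -> V -> R^o) (F : 'I_d -> V -> W) x v :
  (forall i, smooth_at (a i) x) -> (forall i, smooth_at (F i) x) -> (forall i, a i x = 0) ->
  'D_v (fun y => c + \sum_i (a i y : R) *: F i y) x = \sum_i ('D_v (a i) x : R) *: F i x.
Proof.
move=> sa sF a0.
have H i : is_derive x v (fun y => (a i y : R) *: F i y) (('D_v (a i) x : R) *: F i x).
  have := scaleo_is_derive (smooth_at_cont (sa i)) (smooth_at_derivable v (sa i)) (smooth_at_derivable v (sF i)).
  by rewrite a0 scale0r addr0.
have -> : (fun y => c + \sum_i (a i y : R) *: F i y) = cst c + \sum_i (fun y => (a i y : R) *: F i y).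
  by apply/funext => y; rewrite fctE fct_sumE.
have H1 := is_derive_sum H; have H2 := is_derive_cst c x v.
have H3 := is_deriveD H2 H1; rewrite add0r in H3.
by case: H3.
Qed.

Lemma derive_sin_scale (R : realType) (a : R) : 'D_(1 : R^o) (fun s : R^o => sin (a * s) : R^o) 0 = a.
Proof.
have h1 : is_derive (0 : R^o) (1 : R^o) (fun s : R^o => a * s : R^o) a.
  have := is_deriveZ a (is_derive_id (0 : R^o) (1 : R^o)); rewrite /GRing.scale /= mulr1.
  by [].
have h2 : is_derive (a * 0 : R^o) (1 : R^o) (@sin R : R^o -> R^o) (cos (a * 0)) by exact: is_derive_sin.
have [_ ->] := is_derive1_comp h2 h1.
by rewrite mulr0 cos0 mul1r.
Qed.

Lemma smooth_trig (R : realType) (a s : R^o) :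
  smooth_at (fun s : R^o => cos (a * s) : R^o) s /\ smooth_at (fun s : R^o => sin (a * s) : R^o) s.
Proof.
have sa : smooth_at (fun s : R^o => a * s : R^o) s by apply: smooth_atM; [exact: smooth_at_cst|exact: smooth_at_id].
by have [h1 h2] := smooth_at_cos_sin (a * s); split; [exact: (smooth_at_comp sa h1)|exact: (smooth_at_comp sa h2)].
Qed.

Lemma circle_angle (R : realType) (a b : R) : a ^+ 2 + b ^+ 2 = 1 -> exists t, cos t = a /\ sin t = b.
Proof.
move=> E; have ha : -1 <= a <= 1.
  by rewrite -ler_norml -(@ler_pXn2r _ 2) ?nnegrE // expr1n real_normK ?num_real // -E lerDl sqr_ge0.
have [b0|b0] := leP 0 b.
  exists (acos a); have [_ ->] := acos_def ha; rewrite sin_acos // -E addrAC subrr add0r sqrtr_sqr ger0_norm //.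
exists (- acos a); rewrite cosN sinN; have [_ ->] := acos_def ha; rewrite sin_acos // -E addrAC subrr add0r sqrtr_sqr ltr0_norm //.
by rewrite opprK.
Qed.

Lemma plot_smooth_curve (R : realType) n (M : manifoldType R n) (gamma : R^o -> M) :
  (forall t : R^o, plot_at gamma t) -> smooth_curve gamma.
Proof.
move=> pg; have cg : continuous gamma by move=> t; exact: plot_at_cont.
split=> // c ac; have oU : open [set t | dom c (gamma t)].
  by apply: open_comp; [move=> s _; exact: cg|exact: dom_open].
by apply/(smooth_on_at _ oU) => t dt; exact: plot_at_coord.
Qed.

Lemma ip_add_sub (R : realType) n (ip : 'rV[R]_n -> 'rV[R]_n -> R) :
  (forall a u v w, ip (a *: u + v) w = a * ip u w + ip v w) ->
  forall u s s' w a b, ip s w = a -> ip s' w = b -> ip (u + s - s') w = ip u w + a - b.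
Proof. by move=> ipL u s s' w a b <- <-; rewrite (ipBl ipL) (ipDl ipL). Qed.

(** * Geometry of the semidirect product *)

Section semidirect_geometry.
Context {R : realType} {n d : nat} {N : lieGroupType R n} {g : riemannian N}.
Variables (Q : 'I_d -> 'M[R]_n) (co : 'rV[R]_n -> 'rV[R]_d).
Hypothesis rd : rotation_data g Q co.
Hypothesis gl : left_invariant g.
Hypothesis N2 : at_most_two_step N.
Variables (e : 'rV[R]_n -> N) (L : N -> 'rV[R]_n) (r : R).
Hypothesis le : local_exp e L r.
Hypothesis N_connected : connected [set: N].
Variable A : torus_action d N.
Hypothesis evel_tact : forall (V : normedModType R) t (f : V -> N) v w, on_torus t -> plot_at f v ->
  f v = 1%g -> evel (fun y => tact A t (f y)) v w = evel f v w *m tau Q t.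
Local Notation W := ('rV[R]_d * 'rV[R]_d)%type.
Local Notation G := (semidirect A : lieGroupType R (n + d)).
Local Notation al := (tact A).
Local Notation br := (lie_bracket N).
Local Notation ip := (inner g (1%g : N)).
Local Notation act := (@sact R n d N A).

Let a1 : forall x, act 1%g x = x. Proof. exact: sact_1. Qed.
Let aM : forall a b x, act (a * b)%g x = act a (act b x). Proof. exact: sact_M. Qed.
Let aS : smooth2 act. Proof. exact: sact_smooth. Qed.

Lemma sact1E (x : G) : act x 1%g = (sval2 x).1.
Proof. by rewrite /sact tact_1 ?mulg1 //; exact: sval2_torus. Qed.

Lemma codl_semidirect : cod (lchart N) (lsubmx (le0 G)).
Proof. by rewrite le0_semidirect row_mxKl; exact: cod1. Qed.

Lemma Kf_semidirect v : Kf (act : G -> N -> N) 1%g v (le0 N) = lsubmx v.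
Proof.
have l : linear (fun w : 'rV[R]_(n + d) => lsubmx w) by move=> a w w'; rewrite linearP.
rewrite Kf_act -[RHS](evel_pt (N := N)).
have sl : smooth_at (fun w : 'rV[R]_(n + d) => lsubmx w) (le0 G) by exact: smooth_at_lsubmx (smooth_at_id _).
have E0 : lsubmx (le0 G) = le0 N by rewrite le0_semidirect row_mxKl.
have pp : plot_at (lpt N) (lsubmx (le0 G)) by apply: plot_pt; exact: codl_semidirect.
have p1 : lpt N (lsubmx (le0 G)) = 1%g by rewrite E0 pt1.
have := evel_comp v sl pp p1; rewrite E0.
have -> : 'D_v (fun w : 'rV[R]_(n + d) => lsubmx w) (le0 G) = lsubmx v.
  have cl : continuous (mklin l) by exact: fd_linear_continuous.
  by have [_ ->] := derivable_lin cl (smooth_at_derivable v (smooth_at_id (le0 G))); rewrite derive_id.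
move=> <-; apply: evel_ext; apply: filterE => z.
by rewrite sact1E lpt_semidirect /= invg1 mul1g.
Qed.

Lemma Af_semidirect Y z : Af (act : G -> N -> N) 1%g Y (z, le0 N) = Y *m tau Q (cay (rsubmx z)).
Proof.
rewrite AfE -[in RHS](evel_pt (N := N) Y).
rewrite -(evel_tact _ (cay_torus _) (plot_pt (cod1 : cod (lchart N) (le0 N))) (pt1 : lpt N (le0 N) = 1%g)).
apply: evel_ext; apply: filterE => v; rewrite /thet /base pt1 mulg1 !mul1g sact1E.
by rewrite /sact lpt_semidirect /= mulKg.
Qed.

(** With [u = tan (theta / 2)] one has [1 - cos theta = u sin theta] and
    [sin theta = u (1 + cos theta)]; factoring out [u] prepares [derive_frame] at [u = 0]. *)
Lemma tau_cay (Y : 'rV[R]_n) u : Y *m tau Q (cay u) = Y + \sum_i u ord0 i *: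
  ((cay u).2 ord0 i *: (Y *m (Q i *m Q i)) + (1 + (cay u).1 ord0 i) *: (Y *m Q i)).
Proof.
rewrite /tau mulmxDr mulmx1 mulmx_sumr; congr (_ + _); apply: eq_bigr => i _.
rewrite /rot mulmxDr -!scalemxAr scalerDr !scalerA; have h := cay_den (u ord0 i).
by congr (_ *: _ + _ *: _); rewrite !mxE; move: (u _ _) h => a h; field.
Qed.

(** The 2 is the derivative of the angle with respect to [tan (theta / 2)] at zero. *)
Lemma Sf_semidirect v Y :
  Sf (act : G -> N -> N) 1%g v Y (le0 N) = \sum_i (2 * rsubmx v ord0 i) *: (Y *m Q i).
Proof.
rewrite SfE; under eq_fun do rewrite Af_semidirect tau_cay.
have s0 : smooth_at (fun z : 'rV[R]_(n + d) => rsubmx z) (le0 G) by exact: smooth_at_rsubmx (smooth_at_id _).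
have E0 : rsubmx (le0 G) = 0 by rewrite le0_semidirect row_mxKr.
have sc := smooth_cay s0.
have sF i : smooth_at (fun z : 'rV[R]_(n + d) => (cay (rsubmx z)).2 ord0 i *: (Y *m (Q i *m Q i)) +
    (1 + (cay (rsubmx z)).1 ord0 i) *: (Y *m Q i)) (le0 G).
  apply: smooth_atD.
    by apply: (@smooth_atZ _ _ _ (fun z => (cay (rsubmx z)).2 ord0 i : R^o)); [exact: smooth_at_coor2|exact: smooth_at_cst].
  apply: (@smooth_atZ _ _ _ (fun z => 1 + (cay (rsubmx z)).1 ord0 i : R^o)); last exact: smooth_at_cst.
  by apply: smooth_atD; [exact: smooth_at_cst|exact: smooth_at_coor1].
have sa i : smooth_at (fun z : 'rV[R]_(n + d) => rsubmx z ord0 i : R^o) (le0 G) by apply: (smooth_at_rowP _ _).1.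
have a0 i : rsubmx (le0 G) ord0 i = 0 by rewrite E0 mxE.
apply: etrans (derive_frame Y v sa sF a0) _; apply: eq_bigr => i _.
have l : linear (fun z : 'rV[R]_(n + d) => rsubmx z ord0 i : R^o) by move=> a w w'; rewrite linearP !mxE.
have cl : continuous (mklin l) by exact: fd_linear_continuous.
have [_ dE] := derivable_lin cl (smooth_at_derivable v (smooth_at_id (le0 G))).
have -> : 'D_v (fun z : 'rV[R]_(n + d) => rsubmx z ord0 i : R^o) (le0 G) = rsubmx v ord0 i.
  by apply: etrans dE _; rewrite derive_id.
rewrite E0 cay0 /= !mxE scale0r add0r scalerA; congr (_ *: _); ring.
Qed.

Definition ver : {vspace 'rV[R]_(n + d)} := lker (linfun (@lsubmx R 1 n d)).

Lemma verE v : (v \in ver) = (lsubmx v == 0).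
Proof. by rewrite memv_ker lfunE. Qed.

Variable kap : R.

Lemma hor_linear : linear (fun v : 'rV[R]_(n + d) => rsubmx v - (kap / 2) *: co (lsubmx v)).
Proof.
move=> a v w; rewrite !linearP /= (co_linear rd).
move: (co _) (co _) (rsubmx v) (rsubmx w) => c c' u u'; apply/rowP => i; rewrite !mxE; ring.
Qed.

(** [kap / 2] cancels the 2 of [Sf_semidirect]: for an element of [hor] over [x], [S] is [kap] times
    the sum of the [co x ord0 i *: Q i], that is, [<S y, z> = kap <[y, z], x>]. *)
Definition hor : {vspace 'rV[R]_(n + d)} := lker (linfun (mklin hor_linear)).

Lemma horE v : (v \in hor) = (rsubmx v == (kap / 2) *: co (lsubmx v)).
Proof. by rewrite memv_ker lfunE /= subr_eq0. Qed.

Lemma ver_hor_full : (ver + hor)%VS = fullv.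
Proof.
apply/eqP; rewrite eqEsubv subvf /=; apply/subvP => v _.
pose w := row_mx (lsubmx v) ((kap / 2) *: co (lsubmx v)).
rewrite -(subrK w v) memv_add //; last by rewrite horE row_mxKl row_mxKr.
by rewrite verE linearB /= row_mxKl subrr.
Qed.

Lemma ver_hor_direct : directv (ver + hor).
Proof.
apply/directv_addP/eqP; rewrite -subv0; apply/subvP => v.
rewrite memv_cap verE horE memv0 => /andP[/eqP E0 /eqP E1].
have co0 : co 0 = 0 by exact: (linear0 (mklin (co_linear rd))).
by rewrite -(hsubmxK v) E1 E0 co0 scaler0 row_mx0.
Qed.

Lemma velocity_isotropy : [set X | X \in ver] = lie_algebra_of (isotropy (act : G -> N -> N) 1%g).
Proof.
apply/seteqP; split=> v; last first.
  move=> Hv; rewrite /= verE -Kf_semidirect; apply/eqP.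
  have := Kf_isotropy a1 aS Hv; exact.
rewrite /= verE => /eqP v0.
(* The angular velocity for which the coordinate [tan (theta / 2)] has velocity [rsubmx v]. *)
pose a i := 2 * rsubmx v ord0 i.
pose th (s : R^o) : W := (\row_i cos (a i * s), \row_i sin (a i * s)).
have ht s : on_torus (th s) by move=> i; rewrite !mxE cos2Dsin2.
pose theta (s : R^o) : G := Semidirect A (sval2 := (1%g, th s)) (ht s).
have sth s : smooth_at th s.
  by apply: smooth_at_pair; apply: smooth_at_row => i; have [] := smooth_trig (a i) s.
have pth s : plot_at theta s.
  by apply/plot_semidirect; split; [exact: plot_at_cst|exact: sth].
exists theta; split.
- by apply: plot_smooth_curve.
- move=> s t; apply: sval2_eq; rewrite /= ?tact_1 ?mulg1 //.
  by apply: pair_rowP => i; rewrite !mxE mulrDr ?cosD ?sinD //; ring.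
- have th0 : theta 0 = 1%g.
    by apply: sval2_eq => //=; apply: pair_rowP => i; rewrite !mxE mulr0 ?cos0 ?sin0.
  rewrite /velocity th0.
  (* In the chart the curve is [sin / (1 + cos)], written with the vanishing factor [sin] in front
     for [derive_frame]. *)
  have E : (coord (chart_at (1%g : G)) \o theta) = fun s : R^o => row_mx (le0 N) 0 + \sum_i (sin (a i * s)) *:
      ((1 + cos (a i * s))^-1 *: (row_mx 0 (delta_mx 0 i) : 'rV[R]_(n + d))).
    apply/funext => s; apply: etrans (lco_semidirect (theta s)) _.
    apply/rowP => j; rewrite [RHS]mxE summxE; case: (split_ordP j) => k ->; rewrite ?row_mxEl ?row_mxEr.
      by rewrite big1 ?addr0 // => i _; rewrite mxE mxE row_mxEl mxE !mulr0.
    rewrite (bigD1 k) //= big1 ?addr0; last first.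
      by move=> i ik; rewrite mxE mxE row_mxEr mxE eq_sym (negbTE ik) andbF !mulr0.
    by rewrite [X in _ = X + _]mxE add0r [RHS]mxE [X in _ = _ * X]mxE row_mxEr !mxE !eqxx mulr1.
  rewrite E.
  have sa i : smooth_at (fun s : R^o => sin (a i * s) : R^o) 0 by have [] := smooth_trig (a i) 0.
  have sF i : smooth_at (fun s : R^o => (1 + cos (a i * s))^-1 *: (row_mx 0 (delta_mx 0 i) : 'rV[R]_(n + d))) (0 : R^o).
    apply: (@smooth_atZ _ _ _ (fun s : R^o => (1 + cos (a i * s))^-1 : R^o)); last exact: smooth_at_cst.
    have [sc _] := smooth_trig (a i) (0 : R^o); apply: smooth_at_inv.
      by rewrite mulr0 cos0 gt_eqF.
    by apply: smooth_atD; first exact: smooth_at_cst.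
  have a0 i : sin (a i * 0) = 0 by rewrite mulr0 sin0.
  have DF := derive_frame (row_mx (le0 N) 0 : 'rV[R]_(n + d)) (1 : R^o) sa sF a0.
  apply: (etrans DF).
  apply/rowP => j; rewrite summxE -[v in RHS]hsubmxK v0; case: (split_ordP j) => k ->; rewrite ?row_mxEl ?row_mxEr.
    by rewrite big1 ?mxE // => i _; rewrite mxE mxE row_mxEl mxE !mulr0.
  rewrite (bigD1 k) //= big1 ?addr0; last first.
    by move=> i ik; rewrite mxE mxE row_mxEr mxE eq_sym (negbTE ik) andbF !mulr0.
  rewrite mxE mxE row_mxEr mxE !eqxx derive_sin_scale mulr1 mulr0 cos0 /a.
  by move: (rsubmx v ord0 k) => x; field.
- by move=> t; rewrite /isotropy /= sact1E.
Qed.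

(** An isotropy element acts by [tau t] on the part in [n] and trivially on the commutative torus
    part, and [co] is invariant under [tau t]. *)
Lemma Ad_hor (a : G) : act a 1%g = 1%g -> forall X, X \in hor -> Ad a X \in hor.
Proof.
rewrite sact1E => a1E X; rewrite !horE => /eqP EX.
pose t := (sval2 a).2; have ht : on_torus t by exact: sval2_torus.
pose F (y : 'rV[R]_(n + d)) : N := al t (lpt N (lsubmx y)).
have s0 : smooth_at (fun y : 'rV[R]_(n + d) => lsubmx y) (le0 G) by exact: smooth_at_lsubmx (smooth_at_id _).
have E0 : lsubmx (le0 G) = le0 N by rewrite le0_semidirect row_mxKl.
have pp : plot_at (lpt N) (lsubmx (le0 G)) by apply: plot_pt; exact: codl_semidirect.
have p1 : lpt N (lsubmx (le0 G)) = 1%g by rewrite E0 pt1.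
have pF : plot_at F (le0 G).
  apply: (tact_plot A); [exact: smooth_at_cst|by apply: filterE|exact: (plot_at_comp s0 pp)].
have E : (fun y => lco G (a * lpt G y * a^-1)%g) = (fun y => row_mx (lco N (F y)) (rsubmx y)).
  apply/funext => y; rewrite lco_semidirect.
  have aE : sval2 (a * lpt G y * a^-1)%g = ((sval2 a).1 * al t (sval2 (lpt G y)).1 *
      al (tmul t (sval2 (lpt G y)).2) (al (tinv t) (sval2 a).1^-1),
      tmul (tmul t (sval2 (lpt G y)).2) (tinv t))%g by [].
  rewrite aE a1E lpt_semidirect /= mul1g invg1 (tact_1 _ (on_torusV ht)).
  rewrite (tact_1 _ (on_torusM ht (cay_torus _))) mulg1; congr row_mx.
  rewrite -[RHS]cayK; congr ucoord; apply: pair_rowP => i; have := ht i; rewrite !mxE => ht'.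
    by rewrite -[RHS]mul1r -ht'; ring.
  by rewrite -[RHS]mul1r -ht'; ring.
have sE : smooth_at (fun y => row_mx (lco N (F y)) (rsubmx y)) (le0 G).
  apply: smooth_at_row_mx; last exact: smooth_at_rsubmx (smooth_at_id _).
  by apply: plot_co => //; rewrite /F p1 tact_1 //; exact: dom1.
have AE : Ad a X = 'D_X (fun y => row_mx (lco N (F y)) (rsubmx y)) (le0 G).
  by rewrite AdE /evel E.
have ll : linear (fun w : 'rV[R]_(n + d) => lsubmx w) by move=> b w w'; rewrite linearP.
have lr : linear (fun w : 'rV[R]_(n + d) => rsubmx w) by move=> b w w'; rewrite linearP.
have cl : continuous (mklin ll) by exact: fd_linear_continuous.
have cr : continuous (mklin lr) by exact: fd_linear_continuous.
have [_ dl] := derivable_lin cl (smooth_at_derivable X sE).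
have [_ dr] := derivable_lin cr (smooth_at_derivable X sE).
have [_ dl0] := derivable_lin cl (smooth_at_derivable X (smooth_at_id (le0 G))).
have [_ dr0] := derivable_lin cr (smooth_at_derivable X (smooth_at_id (le0 G))).
have Al : lsubmx (Ad a X) = lsubmx X *m tau Q t.
  rewrite AE; apply: etrans (esym dl) _; rewrite /=.
  under eq_fun do rewrite row_mxKl.
  have F1 : (fun y => lpt N (lsubmx y)) (le0 G) = 1%g := p1.
  have := evel_tact X ht (plot_at_comp s0 pp) F1; rewrite /evel -/F => ->.
  have := evel_comp X s0 pp p1; rewrite /evel => ->.
  rewrite E0 -[X in 'D_X _ _ ]/('D_X (fun y : 'rV[R]_(n + d) => lsubmx y) (le0 G)).
  by have := evel_pt (N := N); rewrite /evel => ->; congr (_ *m _); apply: etrans dl0 _; rewrite derive_id.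
have Ar : rsubmx (Ad a X) = rsubmx X.
  rewrite AE; apply: etrans (esym dr) _; rewrite /=.
  under eq_fun do rewrite row_mxKr.
  by apply: etrans dr0 _; rewrite derive_id.
by rewrite Al Ar (co_tau rd) EX.
Qed.

Lemma semidirect_reductive : reductive_decomposition (isotropy (act : G -> N -> N) 1%g) ver hor.
Proof.
by split; [exact: velocity_isotropy|exact: ver_hor_full|exact: ver_hor_direct|exact: Ad_hor].
Qed.

(** Each element is joined to [1] by scaling a logarithm and a choice of angles. *)
Lemma semidirect_connected : connected [set: G].
Proof.
pose th (a : 'rV[R]_d) (s : R^o) : W := (\row_i cos (a ord0 i * s), \row_i sin (a ord0 i * s)).
have ht a s : on_torus (th a s) by move=> i; rewrite !mxE cos2Dsin2.
pose path (Xa : 'rV[R]_n * 'rV[R]_d) (s : R^o) : G :=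
  Semidirect A (sval2 := (gexp le (s *: Xa.1), th Xa.2 s)) (ht Xa.2 s).
have pp Xa s : plot_at (path Xa) s.
  apply/plot_semidirect; split.
    have ss : smooth_at (fun s : R^o => s *: Xa.1 : 'rV[R]_n) s.
      by apply: (@smooth_atZ _ _ _ (fun s : R^o => s)); [exact: smooth_at_id|exact: smooth_at_cst].
    exact: (plot_at_comp ss (plot_gexp le _)).
  by apply: smooth_at_pair; apply: smooth_at_row => i; have [] := smooth_trig (Xa.2 ord0 i) s.
pose arc Xa : set G := path Xa @` `[0, 1].
have arc1 Xa : arc Xa (1%g : G).
  exists 0; first by rewrite /= in_itv /= lexx ler01.
  apply: sval2_eq; rewrite /= ?scale0r ?gexp0 //.
  by apply: pair_rowP => i; rewrite !mxE mulr0 ?cos0 ?sin0.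
have -> : [set: G] = \bigcup_(Xa in [set: 'rV[R]_n * 'rV[R]_d]) arc Xa.
  apply/esym; rewrite -subTset => x _.
  have [X EX] := gexp_surj N2 le N_connected (sval2 x).1.
  have /choice[a aE] i : exists t, cos t = (sval2 x).2.1 ord0 i /\ sin t = (sval2 x).2.2 ord0 i.
    by apply: circle_angle; exact: sval2_torus.
  exists (X, \row_i a i) => //; exists 1; first by rewrite /= in_itv /= lexx ler01.
  apply: sval2_eq; rewrite /= ?scale1r //.
  by apply: pair_rowP => i; rewrite !mxE mulr1; have [] := aE i.
apply: bigcup_connected; first by exists 1%g => Xa _; exact: arc1.
move=> Xa _; apply: connected_continuous_connected; first exact: segment_connected.
by apply: continuous_subspaceT => s; exact: plot_at_cont.
Qed.

(** Fixing [1] kills the component in [N]; then the differential at [1], which is [tau Q] of the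
    torus component, is the identity. *)
Lemma sact_effective (a : G) : (forall x, act a x = x) -> a = 1%g.
Proof.
move=> H; have a1E : (sval2 a).1 = 1%g by rewrite -sact1E H.
have ht := sval2_torus a.
apply: sval2_eq; first exact: a1E.
apply: (tau_eq1 rd ht); apply/row_matrixP => i; rewrite !rowE.
have e0c : cod (lchart N) (le0 N) := cod1.
have pp : plot_at (lpt N) (le0 N) := plot_pt e0c.
have p1 : lpt N (le0 N) = 1%g := pt1.
have := evel_tact (delta_mx 0 i) ht pp p1; rewrite evel_pt => <-.
rewrite mulmx1 -[RHS](evel_pt (N := N)); apply: evel_ext; apply: filterE => y.
by have := H (lpt N y); rewrite /sact a1E mul1g.
Qed.

(** Each [tact A t] is an automorphism, so after left translation to [1] the differential of [act a]
    is the same orthogonal map [tau Q t] at every point. *)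
Lemma sact_isometry (a : G) : isometry g (act a).
Proof.
have ht := sval2_torus a.
have sm : smooth (act a).
  by apply: plots_smooth => c x ac cx; apply: plot_sact; [exact: plot_at_cst|exact: plot_at_point].
split=> //.
  by exists (act a^-1%g) => x; rewrite -aM ?mulVg ?mulgV a1.
move=> p u v; pose c := chart_at p; pose x := coord c p; pose f := point c.
have cx : cod c x by apply: coord_cod; exact: chart_at_dom.
have pf : plot_at f x by apply: plot_at_point => //; exact: chart_at_atlas.
have fx : f x = p by apply: coordK; exact: chart_at_dom.
have oc : \forall y \near x, cod c y by exact: (open_nbhs_nbhs (conj (@cod_open _ _ _ c) cx)).
have vE w : vel f x w = w.
  rewrite /vel fx -[RHS](derive_id x w); apply: near_eq_derive.
  by apply: filterS oc => y cy; exact: pointK.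
have pF : plot_at (fun y => act a (f y)) x by apply: plot_sact => //; exact: plot_at_cst.
have TE w : tangent_map (act a) p w = vel (fun y => act a (f y)) x w.
  by have := tangent_map_vel w sm pf; rewrite fx vE.
have I1 := inner_vel gl u v pF; have I0 := inner_vel gl u v pf.
rewrite fx !vE in I0; rewrite fx in I1.
rewrite !TE I1 I0.
have eE w : evel (fun y => (act a p)^-1 * act a (f y))%g x w = evel (fun y => p^-1 * f y)%g x w *m tau Q (sval2 a).2.
  have ph : plot_at (fun y => p^-1 * f y)%g x by apply: plot_mul; [exact: plot_at_cst|exact: pf].
  have h1 : (p^-1 * f x)%g = 1%g by rewrite fx mulVg.
  rewrite -(evel_tact w ht ph h1); apply: evel_ext; apply: filterE => y.
  by rewrite /sact invgM -mulgA mulKg (tactM A _ _ ht) tactV.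
exact: etrans (f_equal2 ip (eE u) (eE v)) (tau_orth rd _ _ ht).
Qed.

Lemma semidirect_presentation : homogeneous_presentation g (act : G -> N -> N).
Proof.
split; [exact: semidirect_connected|exact: a1|exact: aM|exact: aS|exact: sact_transitive
  |exact: sact_effective|exact: sact_isometry].
Qed.

(** [Kf_bracket], with [S_X y] and [S_Y x] evaluated by the choice of [hor]; projection along [ver]
    does not change the component in [n]. *)
Lemma induced_bracket X Y Z : X \in hor -> Y \in hor ->
  let x := lsubmx X in let y := lsubmx Y in let z := lsubmx Z in
  induced_inner g (act : G -> N -> N) 1%g (bracket_proj G ver hor X Y) Z =
  ip (br x y) z + kap * ip (br y z) x - kap * ip (br x z) y.
Proof.
rewrite !horE => /eqP hX /eqP hY x y z.
have ipC u v : ip u v = ip v u by exact: innerC.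
have ipL a u v w : ip (a *: u + v) w = a * ip u w + ip v w by exact: innerDZl.
have PE v : lsubmx (daddv_pi hor ver v) = lsubmx v.
  have mh : (hor :&: ver = 0)%VS by rewrite capvC; exact/directv_addP/ver_hor_direct.
  have := daddv_pi_add (U := hor) (V := ver) mh (w := v).
  rewrite addvC ver_hor_full memvf => /(_ isT) Ev.
  have : daddv_pi ver hor v \in ver by exact: memv_pi.
  by rewrite verE => /eqP E0; rewrite -[in RHS]Ev linearD /= E0 addr0.
have SE v w : rsubmx v = (kap / 2) *: co (lsubmx v) ->
    ip (Sf (act : G -> N -> N) 1%g v w (le0 N)) z = kap * ip (br w z) (lsubmx v).
  move=> hv; rewrite Sf_semidirect (ip_suml ipL) (rot_bracket rd) big_distrr /=.
  apply: eq_bigr => i _; rewrite (ipZl ipL) hv mxE.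
  by move: (co _ _ _) (ip _ _) => b c; field.
have Kb : Kf (act : G -> N -> N) 1%g (lie_bracket G X Y) (le0 N) =
    br (Kf (act : G -> N -> N) 1%g X (le0 N)) (Kf (act : G -> N -> N) 1%g Y (le0 N))
    + Sf (act : G -> N -> N) 1%g X (Kf (act : G -> N -> N) 1%g Y (le0 N)) (le0 N)
    - Sf (act : G -> N -> N) 1%g Y (Kf (act : G -> N -> N) 1%g X (le0 N)) (le0 N).
  by exact: Kf_bracket.
rewrite !Kf_semidirect in Kb.
have IE U V : induced_inner g (act : G -> N -> N) 1%g U V =
    ip (Kf (act : G -> N -> N) 1%g U (le0 N)) (Kf (act : G -> N -> N) 1%g V (le0 N)) by exact: induced_innerE.
apply: etrans (IE _ _) _.
apply: etrans (f_equal2 ip (etrans (Kf_semidirect _) (etrans (PE _) Kb)) (Kf_semidirect Z)) _.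
exact: (ip_add_sub ipL _ (SE X y hX) (SE Y x hY)).
Qed.

End semidirect_geometry.

Lemma inner_bracketC (R : realType) n (N : lieGroupType R n) (g : riemannian N) x y z :
  inner g 1%g (lie_bracket N x y) z = - inner g 1%g (lie_bracket N y x) z.
Proof. by rewrite bracketC; apply: ipNl => a u v w; exact: innerDZl. Qed.

(** With [a], [b], [c] the cyclic permutations of [t x y z], the first summand is [a + k (b + c)]
    and the total is [(1 + 2 k) (a + b + c)]: hence [k = - 1 / 2]. *)
Lemma skew_cyclic (F : realFieldType) (T : Type) (t : T -> T -> T -> F) :
  (forall x y z, t x y z = - t y x z) -> forall x y z,
  t x y z + - 2^-1 * t y z x - - 2^-1 * t x z y + (t y z x + - 2^-1 * t z x y - - 2^-1 * t y x z)
  + (t z x y + - 2^-1 * t x y z - - 2^-1 * t z y x) = 0.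
Proof. by move=> s x y z; rewrite (s x z y) (s y x z) (s z y x); field. Qed.

(** Exchanging [y] and [z] sends [a], [b], [c] to [- c], [- b], [- a]; the sum is [(1 - k) (a - c)],
    hence [k = 1]. *)
Lemma skew_natural (F : realFieldType) (T : Type) (t : T -> T -> T -> F) :
  (forall x y z, t x y z = - t y x z) -> forall x y z,
  t x y z + 1 * t y z x - 1 * t x z y + (t x z y + 1 * t z y x - 1 * t x y z) = 0.
Proof. by move=> s x y z; rewrite (s z y x); ring. Qed.

(** [f] restricts to the identification of [m] with [n]. The constant is left free, as the two
    geometric conclusions take different values of it. *)
Lemma homogeneous_construction (R : realType) n (N : lieGroupType R n) (g : riemannian N) (kap : R) :
  connected [set: N] -> left_invariant g -> at_most_two_step N -> J_abelian g ->
  exists k (G : lieGroupType R k) (act : G -> N -> N) (h m : {vspace 'rV[R]_k}) (f : 'rV[R]_k -> 'rV[R]_n),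
  [/\ homogeneous_presentation g act, reductive_decomposition (isotropy act 1%g) h m
    & forall X Y Z, X \in m -> Y \in m ->
      let ip := inner g (1%g : N) in let br := lie_bracket N in
      induced_inner g act 1%g (bracket_proj G h m X Y) Z =
      ip (br (f X) (f Y)) (f Z) + kap * ip (br (f Y) (f Z)) (f X) - kap * ip (br (f X) (f Z)) (f Y)].
Proof.
move=> cN gl N2 Jab; have [d [Q [co rd]]] := rotation_data_exists N2 Jab.
have [e [L [r le]]] := local_exp_exists N2.
pose A := alpha_action rd N2 le cN.
have ev (V : normedModType R) t (f : V -> N) v w : on_torus t -> plot_at f v -> f v = 1%g ->
    evel (fun y => tact A t (f y)) v w = evel f v w *m tau Q t by move=> ht pf f1; exact: (evel_alpha rd N2 le cN w ht pf f1).
exists (n + d)%N, (semidirect A), (@sact R n d N A), (@ver R n d), (hor rd kap), (@lsubmx R 1 n d); split.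
- exact: (semidirect_presentation rd gl N2 le cN ev).
- exact: (semidirect_reductive rd ev).
- by move=> X Y Z Xm Ym; exact: (induced_bracket gl ev Z Xm Ym).
Qed.

Lemma cyclic_construction (R : realType) n (N : lieGroupType R n) (g : riemannian N) :
  connected [set: N] -> left_invariant g -> at_most_two_step N -> J_abelian g -> cyclic_manifold g.
Proof.
move=> cN gl N2 Jab; have [k [G [act [h [m [f [hp rdec H]]]]]]] := homogeneous_construction (- 2^-1) cN gl N2 Jab.
exists k, G, act, 1%g, h, m; split; [exact: hp|exact: rdec|move=> X Y Z hX hY hZ].
have E1 := H X Y Z hX hY; have E2 := H Y Z X hY hZ; have E3 := H Z X Y hZ hX.
apply: etrans (f_equal2 +%R (f_equal2 +%R E1 E2) E3) _.
exact: (skew_cyclic (inner_bracketC g)).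
Qed.

Lemma naturally_reductive_construction (R : realType) n (N : lieGroupType R n) (g : riemannian N) :
  connected [set: N] -> left_invariant g -> at_most_two_step N -> J_abelian g -> naturally_reductive g.
Proof.
move=> cN gl N2 Jab; have [k [G [act [h [m [f [hp rdec H]]]]]]] := homogeneous_construction 1 cN gl N2 Jab.
exists k, G, act, 1%g, h, m; split; [exact: hp|exact: rdec|move=> X Y Z hX hY hZ].
have E1 := H X Y Z hX hY; have E2 := H X Z Y hX hZ.
have E3 : induced_inner g act 1%g Y (bracket_proj G h m X Z) = induced_inner g act 1%g (bracket_proj G h m X Z) Y.
  by exact: innerC.
apply: etrans (f_equal2 +%R E1 (etrans E3 E2)) _.
exact: (skew_natural (inner_bracketC g)).
Qed.

Theorem theorem1p1 (R : realType) (n : nat) (N : lieGroupType R n)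
    (g : riemannian N)
    (N_connected : connected [set: N])
    (N_nilpotent : nilpotent_group N)
    (g_left_invariant : left_invariant g) :
  (cyclic_manifold g <-> at_most_two_step N /\ J_abelian g) /\
  (cyclic_manifold g -> naturally_reductive g).
Proof.
split; first split.
- exact: cyclic_necessary.
- by move=> [N2 Jab]; exact: cyclic_construction.
- move=> cyc; have [N2 Jab] := cyclic_necessary N_nilpotent g_left_invariant cyc.
  exact: naturally_reductive_construction.
Qed.
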